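(* Suppose $\theta_n\to\infty$ as $n\to\infty$. Let $R\in[-1,1]^{n\times\ell}$, with rows $\mathbf{R}_i$, have the stationary distribution of the opinion process $\{R^{(k)}:k\ge 0\}$ on $G_n$ defined in the context, and let $\mathbf{R}_{I_n}$ be a uniformly chosen row of $R$, where $I_n$ is uniform on $V_n$. Define the random variables $(\boldsymbol{\mathcal{R}}_\emptyset,\mathcal{J}_\emptyset)$ by $$P(\mathcal{J}_\emptyset=r)=\pi_r,\qquad 1\le r\le K,$$ $$P(\boldsymbol{\mathcal{R}}_\emptyset\in A\mid\mathcal{J}_\emptyset=r)=\mathbb{P}_n\left(\left.\sum_{t=0}^\infty(1-c-d)^t\mathbf{W}_i^{(t)}+\sum_{t=1}^\infty\sum_{s=1}^ta_{s,t}(M^s\bar W)_{J_i\bullet}\in A\,\right|\,J_i=r\right),\qquad A\subseteq[-1,1]^\ell\ \text{measurable}.$$ Then there exists a coupling $(\mathbf{R}_{I_n},J_{I_n},\boldsymbol{\mathcal{R}}_\emptyset,\mathcal{J}_\emptyset)$ such that for any bounded function $f:[-1,1]^\ell\to\mathbb{R}$ that is continuous with respect to $\|\cdot\|_1$, and any $1\le r\le K$, $$\mathbb{E}_n\left[\|\mathbf{R}_{I_n}-\boldsymbol{\mathcal{R}}_\emptyset\|_1\right]\xrightarrow{P}0\qquad\text{and}\qquad\frac1n\sum_{i=1}^nf(\mathbf{R}_i)\,1(J_i=r)\xrightarrow{P}E\left[f(\boldsymbol{\mathcal{R}}_\emptyset)\,1(\mathcal{J}_\emptyset=r)\right]$$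 as $n\to\infty$. Furthermore, for any arbitrary collection of vertices $\{i_1,\dots,i_m\}\subseteq V_n$ having community labels $\{r_1,\dots,r_m\}$, $m\ge 1$, and any bounded functions $f_1,\dots,f_m$ on $[-1,1]^\ell$ that are continuous with respect to $\|\cdot\|_1$, $$\mathbb{E}_n\left[\prod_{j=1}^mf_j(\mathbf{R}_{i_j})\right]\xrightarrow{P}\prod_{j=1}^mE[f_j(\boldsymbol{\mathcal{R}}_\emptyset)\mid\mathcal{J}_\emptyset=r_j],\qquad n\to\infty.$$
   Context: Parameters. Fix integers $K,\ell\ge 1$ (communities, topics), $c,d\in[0,1]$ with $0<c+d\le 1$ and $d>0$, a finite constant $H>0$, a nonnegative kernel $\kappa:\{1,\dots,K\}^2\to[0,\infty)$, distributions $F_r$ on $[-1,1]^\ell$ ($1\le r\le K$), distributions $G_{r,s}$ on $[0,H]$ ($1\le r,s\le K$), and a family of distributions $\nu(\mathbf{a})$, $\mathbf{a}\in\{1,\dots,K\}\times[-1,1]^\ell$. Let $\theta_n>0$ be a density parameter with $\limsup_{n\to\infty}\max_{1\le r,s\le K}\kappa(r,s)\theta_n/n\le 1$. All random objects live on one probability space $(\Omega,\mathcal{F},P)$. Random graph. For each $n$, $G_n=(V_n,E_n)$ is a directed random graph with $|V_n|=n$. Vertex $i$ has community label $J_i\in\{1,\dots,K\}$; $\mathscr{J}_n=\{J_i:i\in V_n\}$, $\mathbb{E}_n[\cdot]=E[\cdot\mid\mathscr{J}_n]$, and $\mathbb{P}_n$ is the corresponding conditional probability. Given $\mathscr{J}_n$,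 the edge $(i,j)$ (written $i\to j$: $j$ listens to $i$) is present with probability $p_{ij}^{(n)}=\frac{\kappa(J_i,J_j)\theta_n}{n}\wedge 1$, independently of everything else. Assume $\pi_r^{(n)}:=\frac1n\sum_{i=1}^n 1(J_i=r)\xrightarrow{P}\pi_r$ for every $r$, where $(\pi_1,\dots,\pi_K)$ is a probability vector with all $\pi_r>0$. Internal beliefs $\mathbf{Q}_i\in[-1,1]^\ell$ are sampled from $F_{J_i}$; the attribute of $i$ is $\mathbf{A}_i=(J_i,\mathbf{Q}_i)$. Unnormalized weights $\{B_{ij}\}$ are conditionally independent given the labels, with $B_{ij}\sim G_{J_i,J_j}$. Normalized weights: $$C_{ij}=\frac{B_{ij}1(j\to i)}{\sum_{l\in V_n}B_{il}1(l\to i)}\,1\Big(\sum_{l\in V_n}B_{il}1(l\to i)>0,\ i\ne j\Big).$$ Opinion process. $R^{(k)}\in[-1,1]^{n\times\ell}$ has $i$th row $\mathbf{R}_i^{(k)}$ and satisfies $$\mathbf{R}_i^{(k+1)}=c\sum_{j\in V_n}C_{ij}\mathbf{R}_j^{(k)}+\mathbf{W}_i^{(k+1)}+(1-c-d)\mathbf{R}_i^{(k)},\quad k\ge 0,$$ with external signals $\mathbf{W}_i^{(k)}=d\,\mathbf{Z}_i^{(k)}+c\,\mathbf{Q}_i1(d_i^-=0)\in[-1,1]^\ell$, where $d_i^-=\sum_{j\in V_n}1(j\to i)$. Given the graph and attributes, the media signals $\mathbf{Z}_i^{(k)}$ are independent over $i$ and $k$, independent of $R^{(0)}$, with $\{\mathbf{Z}_i^{(k)}:k\ge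 0\}$ i.i.d. with law $\nu(\mathbf{A}_i)$. Since $d>0$, for a fixed realization of the graph, weights and attributes the Markov chain $\{R^{(k)}\}$ converges weakly as $k\to\infty$ to its stationary distribution; $R$ denotes a matrix with that distribution. Dependence of the process and of $R$ on $n$ is suppressed in the notation. Constants. $\beta_{r,s}=E[B_{ij}\mid J_i=r,J_j=s]$. $M\in[0,1]^{K\times K}$ has entries $$m_{rs}=\frac{\pi_s\beta_{r,s}\kappa(s,r)}{\sum_{t=1}^K\pi_t\beta_{r,t}\kappa(t,r)}\,1\Big(\sum_{t=1}^K\pi_t\beta_{r,t}\kappa(t,r)>0\Big).$$ $\bar W\in[-1,1]^{K\times\ell}$ has $r$th row $E[\mathbf{W}_i^{(0)}\mid J_i=r]$. $a_{s,t}=\binom{t}{s}(1-c-d)^{t-s}c^s$ (with $0^0=1$), and $X_{j\bullet}$ denotes the $j$th row of a matrix $X$. $\|\cdot\|_1$ is the vector $\ell_1$ norm, and $\xrightarrow{P}$ denotes convergence in probability.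
   Formalization: In the definition of R_∅ and W̄, the n-dependent indicator 1(d_i^-=0) inside W_i^{(t)} is replaced by its limit as θ_n→∞, namely 1(Σ_s π_s κ(s,r)=0) for J_i=r, so that the limiting law does not depend on n. *)

(* Defs.v *)
From HB Require Import structures.
From mathcomp Require Import all_boot all_order all_algebra.
From mathcomp Require Import all_classical all_reals all_analysis.
From mathcomp Require Import ring.

Set Implicit Arguments.
Unset Strict Implicit.
Unset Printing Implicit Defensive.
Import Order.TTheory GRing.Theory Num.Theory.
Import numFieldTopology.Exports numFieldNormedType.Exports.

Local Open Scope classical_set_scope.
Local Open Scope ring_scope.

(* Elements of R^l are [l.-tuple R], with the product sigma-algebra of the
   Borel sets; an n x l matrix of opinions is the n-tuple of its rows. *)

Section Vectors.
Context {R : realType} {l : nat}.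
Implicit Types x y : l.-tuple R.

Definition dist1 x y : R := \sum_(k < l) `|tnth x k - tnth y k|.

Definition cube : set (l.-tuple R) := [set x | forall k, `|tnth x k| <= 1].

(* The values of [f] outside [cube] are irrelevant. *)
Definition bounded_continuous (f : l.-tuple R -> R) : Prop :=
  (exists C, forall x, cube x -> `|f x| <= C) /\
  (forall x, cube x -> forall eps, 0 < eps ->
     exists2 del, 0 < del &
       forall y, cube y -> dist1 x y < del -> `|f x - f y| < eps).

End Vectors.

Section Probability.
Context {d : measure_display} {T : measurableType d} {R : realType}.
Variable P : {measure set T -> \bar R}.

Definition Pr (A : set T) : R := fine (P A).

(* Conditioning on an event; [E_n] is this on the atoms of the labels. *)
Definition condE (D : set T) (X : T -> R) : R :=
  (\int[P]_(w in D) X w) / Pr D.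

Definition condPr (D A : set T) : R := Pr (A `&` D) / Pr D.

Definition cvg_in_prob (X : nat -> T -> R) (a : R) : Prop :=
  forall eps, 0 < eps ->
    (fun n => P [set w | eps <= `|X n w - a|]) @ \oo --> 0%E.

End Probability.

(* A realization of the labels, graph, internal beliefs and weights on n
   vertices; [edge e i j] means that j listens to i. *)
Record environment (R : realType) (K l n : nat) := Environment {
  label : 'I_n -> 'I_K;
  edge : 'I_n -> 'I_n -> bool;
  belief : 'I_n -> l.-tuple R;
  weight : 'I_n -> 'I_n -> R }.

Section OpinionProcess.
Context {R : realType} {K l n : nat}.
Variables (c d : R) (nu : 'I_K -> R.-pker (l.-tuple R) ~> (l.-tuple R)).
Variable e : environment R K l n.

Definition indegree (i : 'I_n) : nat := (\sum_(j < n) edge e j i)%N.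

Definition total_weight (i : 'I_n) : R :=
  \sum_(j < n) weight e i j * (edge e j i)%:R.

Definition norm_weight (i j : 'I_n) : R :=
  if (0 < total_weight i) && (i != j)
  then weight e i j * (edge e j i)%:R / total_weight i else 0.

Definition external_signal (z : n.-tuple (l.-tuple R)) (i : 'I_n) (k : 'I_l) :
    R :=
  d * tnth (tnth z i) k
  + c * tnth (belief e i) k * (indegree i == 0%N)%:R.

Definition opinion_step (z r : n.-tuple (l.-tuple R)) : n.-tuple (l.-tuple R) :=
  [tuple [tuple c * (\sum_(j < n) norm_weight i j * tnth (tnth r j) k)
                + external_signal z i k
                + (1 - c - d) * tnth (tnth r i) k | k < l] | i < n].

(* Joint law of the media signals received by the vertices in one step: they
   are independent with laws nu(A_i). *)
Definition media_law (zeta : probability (n.-tuple (l.-tuple R)) R) : Prop :=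
  forall A : 'I_n -> set (l.-tuple R), (forall i, measurable (A i)) ->
    Pr zeta [set z | forall i, A i (tnth z i)] =
    \prod_(i < n) Pr (nu (label e i) (belief e i)) (A i).

(* Invariance under the transition kernel of the Markov chain R^(k) in the
   fixed environment [e]. *)
Definition stationary_law (mu : probability (n.-tuple (l.-tuple R)) R) : Prop :=
  mu [set r | forall i, cube (tnth r i)] = 1%E /\
  exists2 zeta, media_law zeta &
    forall S, measurable S ->
      mu S = (\int[mu]_r zeta [set z | S (opinion_step z r)])%E.

End OpinionProcess.

Section Network.
Context {R : realType} {K l : nat} {dO : measure_display}.
Context {Omega : measurableType dO}.
Variables (kappa : 'I_K -> 'I_K -> R) (theta : nat -> R).
Variables (F : 'I_K -> probability (l.-tuple R) R).
Variables (G : 'I_K -> 'I_K -> probability R R).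
Variables (nu : 'I_K -> R.-pker (l.-tuple R) ~> (l.-tuple R)) (c d H : R).
Variable P : probability Omega R.
Variables (J : forall n, 'I_n -> Omega -> 'I_K).
Variables (E : forall n, 'I_n -> 'I_n -> {RV P >-> bool}).
Variables (Q : forall n, 'I_n -> {RV P >-> l.-tuple R}).
Variables (B : forall n, 'I_n -> 'I_n -> {RV P >-> R}).
Variable X : forall n, {RV P >-> n.-tuple (l.-tuple R)}.

Definition edge_prob (n : nat) (r s : 'I_K) : R :=
  Num.min (kappa r s * theta n / n%:R) 1.

Definition labels (n : nat) (w : Omega) : {ffun 'I_n -> 'I_K} :=
  [ffun i => J i w].

Definition label_atom (n : nat) (j : {ffun 'I_n -> 'I_K}) : set Omega :=
  [set w | labels n w = j].

Definition environment_at (n : nat) (w : Omega) : environment R K l n :=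
  Environment (fun i => J i w) (fun i k => E i k w) (fun i => Q i w)
    (fun i k => B i k w).

(* These events form a pi-system generating the sigma-algebra of the
   environment. *)
Definition environment_event (n : nat) (j : {ffun 'I_n -> 'I_K})
    (g : 'I_n -> 'I_n -> bool) (A : 'I_n -> set (l.-tuple R))
    (D : 'I_n -> 'I_n -> set R) : set Omega :=
  [set w | [/\ labels n w = j, forall i k, E i k w = g i k,
               forall i, A i (Q i w) & forall i k, D i k (B i k w)]].

(* Given the labels, the edges, beliefs and weights are all independent, with
   laws Bernoulli(p_ij), F_(J_i) and G_(J_i, J_j). *)
Definition network_model : Prop :=
  [/\ forall n (i : 'I_n) r, measurable [set w | J i w = r],
      forall n (i : 'I_n) w, cube (Q i w),
      forall n (i k : 'I_n) w, 0 <= B i k w <= H &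
      forall n j g A D, (forall i, measurable (A i)) ->
        (forall i k, measurable (D i k)) ->
        Pr P (@environment_event n j g A D) =
        Pr P (label_atom j)
        * (\prod_(i < n) \prod_(k < n)
             (if g i k then edge_prob n (j i) (j k)
              else 1 - edge_prob n (j i) (j k)))
        * (\prod_(i < n) Pr (F (j i)) (A i))
        * (\prod_(i < n) \prod_(k < n) Pr (G (j i) (j k)) (D i k))].

(* Conditionally on the environment, X_n has the stationary distribution of the
   opinion process in that environment. *)
Definition stationary_opinions : Prop :=
  forall n, (forall w i, cube (tnth (X n w) i)) /\
    exists mu : Omega -> probability (n.-tuple (l.-tuple R)) R,
      (forall w, stationary_law c d nu (environment_at n w) (mu w)) /\
      (forall j g A D S, (forall i, measurable (A i)) ->
        (forall i k, measurable (D i k)) -> measurable S ->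
        Pr P (@environment_event n j g A D `&` [set w | S (X n w)]) =
        \int[P]_(w in @environment_event n j g A D) Pr (mu w) S).

End Network.

Section MeanField.
Context {R : realType} {K l : nat} {dO : measure_display}.
Context {Omega : measurableType dO}.
Variables (kappa : 'I_K -> 'I_K -> R) (pi_ : 'I_K -> R).
Variables (F : 'I_K -> probability (l.-tuple R) R).
Variables (G : 'I_K -> 'I_K -> probability R R).
Variables (nu : 'I_K -> R.-pker (l.-tuple R) ~> (l.-tuple R)) (c d : R).
Variable P : probability Omega R.
Variables (J : Omega -> 'I_K) (Q : {RV P >-> l.-tuple R}).
Variable Z : nat -> {RV P >-> l.-tuple R}.

Definition mean_weight (r s : 'I_K) : R := \int[G r s]_x x.

Definition mean_matrix : 'M[R]_K :=
  \matrix_(r, s)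
    let S := \sum_t pi_ t * mean_weight r t * kappa t r in
    if 0 < S then pi_ s * mean_weight r s * kappa s r / S else 0.

(* Label, belief and media signals of a vertex: J ~ pi, and given J = r,
   Q ~ F_r; given (J, Q), the Z^(t) are i.i.d. with law nu(J, Q). *)
Definition typical_vertex : Prop :=
  [/\ forall r, measurable [set w | J w = r],
      forall w, cube (Q w),
      forall t w, cube (Z t w) &
      forall r A N (D : nat -> set (l.-tuple R)),
        measurable A -> (forall t, measurable (D t)) ->
        Pr P [set w | [/\ J w = r, A (Q w) &
                          forall t, (t < N)%N -> D t (Z t w)]] =
        pi_ r * \int[F r]_(q in A) \prod_(t < N) Pr (nu r q) (D t)].

(* The limiting variables do not depend on n, so the indicator 1(d_i^- = 0) in
   the external signal of a vertex with J_i = r enters through its limit as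
   theta_n -> oo, which is deterministic: see [no_inbound_limit]. *)
Definition no_inbound (r : 'I_K) : bool := \sum_s pi_ s * kappa s r == 0.

(* W_i^(t) for the limiting vertex. *)
Definition signal (t : nat) (w : Omega) (k : 'I_l) : R :=
  d * tnth (Z t w) k + c * tnth (Q w) k * (no_inbound (J w))%:R.

Definition mean_signal : 'M[R]_(K, l) :=
  \matrix_(r, k) condE P [set w | J w = r] (fun w => signal 0 w k).

Definition coef (s t : nat) : R :=
  'C(t, s)%:R * (1 - c - d) ^+ (t - s) * c ^+ s.

(* The term of index 0 of the second series is an empty sum. *)
Definition mean_field_opinion (w : Omega) : l.-tuple R :=
  [tuple limn (series (fun t => (1 - c - d) ^+ t * signal t w k))
         + limn (series (fun t => \sum_(1 <= s < t.+1)
              coef s t * (mean_matrix ^+ s *m mean_signal) (J w) k)) | k < l].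

End MeanField.

Lemma bernoulli_exp (R : realType) (p : R) (N : nat) :
  0 <= p <= 1 -> (1 - p) ^+ N * (1 + N%:R * p) <= 1.
Proof.
move=> /andP[p0 p1]; elim: N => [|N IH]; first by rewrite expr0 mul0r addr0 mulr1.
apply: le_trans IH; rewrite exprSr -mulrA ler_wpM2l ?exprn_ge0 ?subr_ge0//.
rewrite -natr1; have : 0 <= N%:R :> R by []. 
move: (N%:R : R) => x x0.
have -> : (1 - p) * (1 + (x + 1) * p) = 1 + x * p - (x + 1) * p ^+ 2 by ring.
by rewrite gerBl mulr_ge0 ?sqr_ge0// addr_ge0.
Qed.

(* For labels with frequencies converging to pi, the conditional probability
   that a vertex of community r has in-degree 0 converges to the indicator
   [no_inbound r]. *)
Lemma no_inbound_limit (R : realType) (K : nat) (kappa : 'I_K -> 'I_K -> R)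
    (pi_ : 'I_K -> R) (theta : nat -> R) (j : forall n, 'I_n -> 'I_K)
    (r : 'I_K) :
  (forall s t, 0 <= kappa s t) -> (forall s, 0 < pi_ s) ->
  theta @ \oo --> +oo ->
  (forall s, (fun n => (\sum_(i < n) (j n i == s)%:R) / n%:R) @ \oo --> pi_ s) ->
  (fun n => \prod_(i < n) (1 - edge_prob kappa theta n (j n i) r)) @ \oo
    --> ((no_inbound kappa pi_ r)%:R : R).
Proof.
move=> kappa0 pi0 thetay jpi; have /cvgryPgt tgt := thetay; rewrite /no_inbound.
have term0 s : 0 <= pi_ s * kappa s r by rewrite mulr_ge0// ltW.
case: (boolP (_ == 0)) => [/eqP /psumr_eq0P kr0|].
  apply: cvg_near_cst; apply: nearW => n; apply: big1 => i _.
  have /eqP := kr0 (fun s _ => term0 s) (j n i) isT.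
  rewrite mulf_eq0 gt_eqF//= => /eqP jr0.
  by rewrite /edge_prob jr0 !mul0r min_l// subr0.
rewrite psumr_neq0// => /hasP[s _ /=].
rewrite pmulr_rgt0// => ks0.
pose N n : nat := (\sum_(i < n) (j n i == s))%N.
pose p n := edge_prob kappa theta n s r.
have NE n : \sum_(i < n) (j n i == s)%:R = (N n)%:R :> R by rewrite natr_sum.
apply/cvgr0Pnorm_lt => eps eps0.
near=> n.
have n0 : (0 < n%:R :> R).
  rewrite ltr0n; near: n; exact: nbhs_infty_gt.
have th0 : 0 < theta n by near: n; exact: tgt.
have ep01 t : 0 <= edge_prob kappa theta n t r <= 1.
  by rewrite /edge_prob ge_min lexx orbT le_min ler01 !mulr_ge0 ?invr_ge0// ltW.
have p01 : 0 <= p n <= 1 by exact: ep01.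
rewrite ger0_norm; last first.
  by apply: prodr_ge0 => i _; rewrite subr_ge0; case/andP: (ep01 (j n i)).
apply: (@le_lt_trans _ _ ((1 - p n) ^+ N n)).
  rewrite /N -prodrXr.
  apply: ler_prod => i _; rewrite subr_ge0.
  case/andP: (ep01 (j n i)) => e0 e1; rewrite e1 /=.
  case: eqP => [->|_]; first by rewrite expr1.
  by rewrite expr0 gerBl.
have half : pi_ s / 2 <= (N n)%:R / n%:R.
  rewrite -NE; near: n.
  apply: (cvgr_ge (pi_ s)) => //.
  by rewrite ltr_pdivrMr// ltr_pMr// ltr1n.
have big : eps^-1 <= (N n)%:R * p n.
  have -> : (N n)%:R * p n = (N n)%:R / n%:R * Num.min (kappa s r * theta n) n%:R.
    rewrite -[RHS]mulrA; congr (_ * _).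
    by rewrite minr_pMr ?invr_ge0 ?ltW// mulVf ?gt_eqF// [in RHS]mulrC.
  apply: (@le_trans _ _ (pi_ s / 2 * (eps^-1 / (pi_ s / 2)))).
    by rewrite mulrC divfK// gt_eqF// divr_gt0.
  rewrite ler_pM// ?divr_ge0 ?invr_ge0 ?ltW//.
  rewrite lt_min; apply/andP; split.
    rewrite -ltr_pdivrMl//; near: n; exact: tgt.
  near: n; apply: nbhs_infty_gtr.
have := bernoulli_exp (N n) p01.
have q0 : 0 <= (1 - p n) ^+ N n by rewrite exprn_ge0// subr_ge0; case/andP: p01.
move: (_ ^+ _) q0 => q q0 qle.
have pos : 0 < 1 + (N n)%:R * p n.
  by rewrite (lt_le_trans _ (lerD (lexx 1) big))// addr_gt0// invr_gt0.
rewrite -(ltr_pM2r pos); apply: (le_lt_trans qle).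
rewrite -(@ltr_pM2l _ eps^-1) ?invr_gt0// mulr1 mulrA mulVf ?gt_eqF// mul1r.
by rewrite (le_lt_trans big)// ltrDr.
Unshelve. all: by end_near. Qed.

(* [Gam] is the law of a coupling ((R_(I_n), J_(I_n)), (R0, J0)) under P_n, on
   the event that the label vector is [j]; labels are coded as naturals. *)
Definition is_coupling (R : realType) (K l : nat)
    (dO : measure_display) (Omega : measurableType dO) (P : probability Omega R)
    (J : forall n, 'I_n -> Omega -> 'I_K)
    (X : forall n, {RV P >-> n.-tuple (l.-tuple R)})
    (d0 : measure_display) (Omega0 : measurableType d0)
    (P0 : probability Omega0 R)
    (R0 : Omega0 -> l.-tuple R) (J0 : Omega0 -> 'I_K)
    (n : nat) (j : {ffun 'I_n -> 'I_K})
    (Gam : probability ((l.-tuple R * nat) * (l.-tuple R * nat))%type R) :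
    Prop :=
  forall (A : set (l.-tuple R)) (r : 'I_K), measurable A ->
    Pr Gam [set x | A x.1.1 /\ x.1.2 = r :> nat] =
      n%:R^-1 * \sum_(i < n)
        condPr P (label_atom J j) [set w | A (tnth (X n w) i) /\ J n i w = r] /\
    Pr Gam [set x | A x.2.1 /\ x.2.2 = r :> nat] =
      Pr P0 [set w | A (R0 w) /\ J0 w = r].

(* Main.v *)
Require Import Defs.
From HB Require Import structures.
From mathcomp Require Import all_boot all_order all_algebra.
From mathcomp Require Import all_classical all_reals all_analysis.
From mathcomp Require Import measurable_realfun.
From mathcomp Require Import ring lra zify.
Set Implicit Arguments.
Unset Strict Implicit.
Unset Printing Implicit Defensive.
Import Order.TTheory GRing.Theory Num.Theory.
Import numFieldTopology.Exports numFieldNormedType.Exports.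
Local Open Scope classical_set_scope.
Local Open Scope ring_scope.

(** * Bounded measurable functions *)

Definition bm (R : realType) d (T : measurableType d) (f : T -> R) : Prop :=
  measurable_fun setT f /\ exists M, forall x, `|f x| <= M.

Section BoundedMeasurable.
Context {R : realType} {d : measure_display} {T : measurableType d}.
Implicit Types f g : T -> R.

Lemma bm_cst (a : R) : bm (fun _ : T => a).
Proof. by split; [exact: measurable_cst|exists `|a|]. Qed.

Lemma bmD f g : bm f -> bm g -> bm (fun x => f x + g x).
Proof.
move=> [mf [M fM]] [mg [N gN]]; split; first exact: measurable_funD.
by exists (M + N) => x; rewrite (le_trans (ler_normD _ _))// lerD.
Qed.

Lemma bmN f : bm f -> bm (fun x => - f x).
Proof.
move=> [mf [M fM]]; split; first exact: measurableT_comp.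
by exists M => x; rewrite normrN.
Qed.

Lemma bmB f g : bm f -> bm g -> bm (fun x => f x - g x).
Proof. by move=> bf bg; apply: bmD => //; exact: bmN. Qed.

Lemma bmM f g : bm f -> bm g -> bm (fun x => f x * g x).
Proof.
move=> [mf [M fM]] [mg [N gN]]; split; first exact: measurable_funM.
by exists (M * N) => x; rewrite normrM ler_pM.
Qed.

Lemma bmX f n : bm f -> bm (fun x => f x ^+ n).
Proof.
move=> bf; elim: n => [|n IH]; first exact: bm_cst.
rewrite (_ : (fun _ => _) = fun x => f x * f x ^+ n); first exact: bmM.
by apply/funext => x; rewrite exprS.
Qed.

Lemma bm_norm f : bm f -> bm (fun x => `|f x|).
Proof.
move=> [mf [M fM]]; split; first exact: measurableT_comp.
by exists M => x; rewrite normr_id.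
Qed.

Lemma bm_sum I (s : seq I) (p : pred I) (F : I -> T -> R) :
  (forall i, p i -> bm (F i)) -> bm (fun x => \sum_(i <- s | p i) F i x).
Proof.
move=> bF; elim: s => [|i s IH].
  rewrite (_ : (fun _ => _) = fun=> 0); first exact: bm_cst.
  by apply/funext => x; rewrite big_nil.
rewrite (_ : (fun _ => _) = fun x =>
    if p i then F i x + \sum_(j <- s | p j) F j x
    else \sum_(j <- s | p j) F j x); last first.
  by apply/funext => x; rewrite big_cons.
case pi: (p i) => //.
by apply: bmD => //; exact: bF.
Qed.

Lemma bm_prod I (s : seq I) (p : pred I) (F : I -> T -> R) :
  (forall i, p i -> bm (F i)) -> bm (fun x => \prod_(i <- s | p i) F i x).
Proof.
move=> bF; elim: s => [|i s IH].
  rewrite (_ : (fun _ => _) = fun=> 1); first exact: bm_cst.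
  by apply/funext => x; rewrite big_nil.
rewrite (_ : (fun _ => _) = fun x =>
    if p i then F i x * \prod_(j <- s | p j) F j x
    else \prod_(j <- s | p j) F j x); last first.
  by apply/funext => x; rewrite big_cons.
case pi: (p i) => //.
by apply: bmM => //; exact: bF.
Qed.

Lemma bm_indic (A : set T) : measurable A -> bm (\1_A : T -> R).
Proof.
move=> mA; split; first exact: measurable_indic.
by exists 1 => x; rewrite indicE; case: (_ \in _); rewrite ?normr1 ?normr0.
Qed.

Lemma bm_comp d' (T' : measurableType d') (g : T' -> T) f :
  bm f -> measurable_fun setT g -> bm (fun x => f (g x)).
Proof.
move=> [mf [M fM]] mg; split; first exact: measurableT_comp.
by exists M.
Qed.

Lemma bm_measurable f : bm f -> measurable_fun setT f.
Proof. by case. Qed.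

Lemma bm_set_ge f (a : R) : bm f -> measurable [set x | a <= f x].
Proof.
move=> [mf _]; rewrite (_ : [set x | _] = setT `&` f @^-1` `[a, +oo[%classic).
  exact: mf.
by apply/seteqP; split => x /=; rewrite in_itv /= andbT => // -[].
Qed.

Lemma bm_bool (A : T -> bool) : measurable [set x | A x] ->
  bm (fun x => (A x)%:R : R).
Proof.
move=> mA; rewrite (_ : (fun _ => _) = \1_[set x | A x]); first exact: bm_indic.
by apply/funext => x; rewrite indicE mem_setE.
Qed.

Lemma bmZ a f : bm f -> bm (fun x => a * f x).
Proof. by apply: bmM; exact: bm_cst. Qed.

End BoundedMeasurable.

Section Expectation.
Context {R : realType} {d : measure_display} {T : measurableType d}.
Variable P : probability T R.
Implicit Types f g : T -> R.

Lemma prob_setT : (P : {measure set T -> \bar R}) setT = 1%E.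
Proof. exact: probability_setT. Qed.

Lemma bm_integrable (D : set T) f : measurable D -> bm f ->
  P.-integrable D (EFin \o f).
Proof.
move=> mD [mf [M fM]]; apply: (@integrableS _ _ _ _ setT) => //.
apply: measurable_bounded_integrable => //.
  by rewrite (le_lt_trans (probability_le1 P measurableT))// ltry.
by exists M; split; [exact: num_real|move=> x Mx y _]; apply: le_trans (fM y) (ltW Mx).
Qed.

Lemma exp_cst (a : R) : \int[P]_x a = a.
Proof. by rewrite Rintegral_cst// prob_setT mulr1. Qed.

Lemma expD f g : bm f -> bm g ->
  \int[P]_x (f x + g x) = \int[P]_x f x + \int[P]_x g x.
Proof. by move=> bf bg; rewrite RintegralD//; exact: bm_integrable. Qed.

Lemma expB f g : bm f -> bm g ->
  \int[P]_x (f x - g x) = \int[P]_x f x - \int[P]_x g x.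
Proof. by move=> bf bg; rewrite RintegralB//; exact: bm_integrable. Qed.

Lemma expZ a f : bm f -> \int[P]_x (a * f x) = a * \int[P]_x f x.
Proof. by move=> bf; rewrite RintegralZl//; exact: bm_integrable. Qed.

Lemma expZr a f : bm f -> \int[P]_x (f x * a) = \int[P]_x f x * a.
Proof. by move=> bf; rewrite RintegralZr//; exact: bm_integrable. Qed.

Lemma exp_sum I (s : seq I) (p : pred I) (F : I -> T -> R) :
  (forall i, p i -> bm (F i)) ->
  \int[P]_x (\sum_(i <- s | p i) F i x) = \sum_(i <- s | p i) \int[P]_x F i x.
Proof.
move=> bF; elim: s => [|i s IH].
  by under eq_Rintegral do rewrite big_nil; rewrite big_nil exp_cst.
under eq_Rintegral do rewrite big_cons.
rewrite big_cons; case: ifP => // pi.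
by rewrite -IH expD//; [exact: bF|exact: bm_sum].
Qed.

Lemma exp_le f g : bm f -> bm g -> (forall x, f x <= g x) ->
  \int[P]_x f x <= \int[P]_x g x.
Proof.
by move=> bf bg fg; apply: le_Rintegral => //; exact: bm_integrable.
Qed.

Lemma exp_ge0 f : (forall x, 0 <= f x) -> 0 <= \int[P]_x f x.
Proof. by move=> f0; apply: Rintegral_ge0. Qed.

Lemma exp_abs f : bm f -> `|\int[P]_x f x| <= \int[P]_x `|f x|.
Proof. by move=> bf; apply: le_normr_Rintegral => //; exact: bm_integrable. Qed.

Lemma exp_le_cst f a : bm f -> (forall x, f x <= a) -> \int[P]_x f x <= a.
Proof.
by move=> bf fa; rewrite -[leRHS]exp_cst; apply: exp_le => //; exact: bm_cst.
Qed.

Lemma exp_abs_le f g : bm f -> bm g -> (forall x, `|f x| <= g x) ->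
  `|\int[P]_x f x| <= \int[P]_x g x.
Proof.
by move=> bf bg fg; apply: le_trans (exp_abs bf) _; apply: exp_le => //;
  exact: bm_norm.
Qed.

Lemma exp_abs_cst f a : bm f -> (forall x, `|f x| <= a) ->
  `|\int[P]_x f x| <= a.
Proof.
move=> bf fa; apply: le_trans (exp_abs bf) _.
by apply: exp_le_cst => //; exact: bm_norm.
Qed.

Lemma exp_indic (A : set T) : measurable A -> \int[P]_x \1_A x = Pr P A.
Proof. by move=> mA; rewrite /Rintegral integral_indic// setIT. Qed.

Lemma exp_in (D : set T) f : \int[P]_(x in D) f x = \int[P]_x (f x * \1_D x).
Proof.
rewrite Rintegral_mkcond; apply: eq_Rintegral => x _.
by rewrite patchE indicE; case: ifPn; rewrite ?mulr1 ?mulr0.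
Qed.

(** Two functions that agree almost surely have the same integral; no
   measurability is needed of the functions themselves. *)
Lemma exp_as (A : set T) f g : measurable A -> P A = 1%E ->
  measurable_fun setT f -> measurable_fun setT g ->
  (forall x, A x -> f x = g x) -> \int[P]_x f x = \int[P]_x g x.
Proof.
move=> mA PA mf mg fg; rewrite /Rintegral; congr fine.
apply: ae_eq_integral => //; try exact/measurable_EFinP.
exists (~` A); split; first exact: measurableC.
  by have := probability_setC P mA; rewrite PA subee// => h; exact: h.
by move=> x /= /existsNP[_ nfg] Ax; apply: nfg; rewrite fg.
Qed.

End Expectation.

Lemma sum_nat_mono_ltn m N : (m <= N)%N -> (\sum_(k < N) (k < m))%N = m.
Proof.
elim: N => [|N IH]; first by rewrite leqn0 => /eqP ->; rewrite big_ord0.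
rewrite big_ord_recr /= leq_eqVlt => /predU1P[->|].
  rewrite ltnSn (eq_bigr (fun=> 1%N)); first by rewrite sum1_card card_ord addn1.
  by move=> i _; rewrite (ltn_trans (ltn_ord i)).
by rewrite ltnS => mN; rewrite IH// ltnNge mN addn0.
Qed.

(** Staircase approximation from below, in a form that stays inside finite
   combinations of indicators of level sets. *)
Definition staircase (R : realType) (T : Type) (N : nat) (f : T -> R) (x : T) : R :=
  N%:R^-1 * \sum_(k < N) \1_[set y | k.+1%:R / N%:R <= f y] x.

Lemma staircaseP (R : realType) (T : Type) (N : nat) (f : T -> R) (x : T) :
  (0 < N)%N -> 0 <= f x <= 1 ->
  staircase N f x <= f x <= staircase N f x + N%:R^-1.
Proof.
move=> N0 /andP[f0 f1]; rewrite /staircase.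
have NR : 0 < N%:R :> R by rewrite ltr0n.
have -> : \sum_(k < N) \1_[set y | k.+1%:R / N%:R <= f y] x =
   (\sum_(k < N) (k < Num.truncn (N%:R * f x)))%N%:R :> R.
  rewrite natr_sum; apply: eq_bigr => k _.
  rewrite indicE; congr (_%:R); congr nat_of_bool.
  transitivity (k.+1%:R / N%:R <= f x); first by apply/idP/idP; rewrite inE.
  rewrite ler_pdivrMr// mulrC truncn_ge_nat //.
  by rewrite mulr_ge0.
have tN : (Num.truncn (N%:R * f x) <= N)%N.
  rewrite -(ler_nat R); apply: le_trans (_ : N%:R * f x <= _).
    by rewrite truncn_le mulr_ge0.
  by rewrite ler_piMr.
have -> : (\sum_(k < N) (k < Num.truncn (N%:R * f x)))%N =
    Num.truncn (N%:R * f x).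
  move: (Num.truncn _) tN => m mN.
  by rewrite sum_nat_mono_ltn.
have /andP[t1 t2] : (Num.truncn (N%:R * f x))%:R <= N%:R * f x < (Num.truncn (N%:R * f x)).+1%:R.
  by apply: truncn_itv; rewrite mulr_ge0.
rewrite ler_pdivrMl// t1 /=.
rewrite -[X in _ + X]mulr1 -mulrDr natr1 ler_pdivlMl//.
exact: ltW.
Qed.

Lemma bm_staircase (R : realType) d (T : measurableType d) N (f : T -> R) :
  bm f -> bm (staircase N f).
Proof.
move=> bf; apply: bmZ; apply: bm_sum => k _.
by apply: bm_indic; exact: bm_set_ge.
Qed.

Lemma bm_affine01 (R : realType) d (T : measurableType d) (f : T -> R) :
  bm f -> exists a b g, [/\ 0 < a, bm g, forall x, 0 <= g x <= 1 &
    f = fun x => a * g x + b].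
Proof.
move=> bf; case: (bf) => mf [M fM].
pose a := 2 * (`|M| + 1); have a0 : 0 < a by rewrite mulr_gt0// ltr_wpDl.
exists a, (- (`|M| + 1)), (fun x => a^-1 * (f x + (`|M| + 1))); split => //.
- by apply: bmZ; apply: bmD => //; exact: bm_cst.
- move=> x; have := fM x; have := ler_norm M; rewrite ler_norml => M1 /andP[f1 f2].
  rewrite mulr_ge0 ?invr_ge0 ?(ltW a0)//=; last lra.
  rewrite ler_pdivrMl// mulr1 /a; lra.
- by apply/funext => x; rewrite mulrA divff ?gt_eqF// mul1r addrK.
Qed.

(** Extension from indicators to bounded measurable functions: the level sets of
   [f] give uniform approximations. *)
Lemma linear_ext (R : realType) d (T : measurableType d) (L : (T -> R) -> R) (C : R) :
  (forall f g, bm f -> bm g -> L (fun x => f x + g x) = L f + L g) ->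
  (forall a f, bm f -> L (fun x => a * f x) = a * L f) ->
  (forall f e, bm f -> (forall x, `|f x| <= e) -> `|L f| <= C * e) ->
  (forall A, measurable A -> L \1_A = 0) ->
  forall f, bm f -> L f = 0.
Proof.
move=> LD LZ LC L0.
have Ls (I : Type) (s : seq I) (F : I -> T -> R) : (forall i, bm (F i)) ->
    L (fun x => \sum_(i <- s) F i x) = \sum_(i <- s) L (F i).
  move=> bF; elim: s => [|i s IH].
    rewrite big_nil (_ : (fun _ => _) = fun x => 0 * 0).
      by rewrite LZ ?mul0r//; exact: bm_cst.
    by apply/funext => x; rewrite big_nil mul0r.
  rewrite big_cons -IH -LD//; last exact: bm_sum.
  by congr L; apply/funext => x; rewrite big_cons.
have Lc b : L (fun=> b) = 0.
  rewrite (_ : (fun=> b) = fun x => b * \1_(@setT T) x); last first.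
    by apply/funext => x; rewrite indicT mulr1.
  by rewrite LZ ?L0 ?mulr0//; exact: bm_indic.
move=> f /bm_affine01[a [b [g [a0 bg g01 ->]]]].
rewrite LD; [|exact: bmZ|exact: bm_cst]; rewrite Lc addr0 LZ//.
suff -> : L g = 0 by rewrite mulr0.
have key N : (0 < N)%N -> `|L g| <= C * N%:R^-1.
  move=> N0; rewrite (_ : g = fun x => staircase N g x + (g x - staircase N g x)); last first.
    by apply/funext => x; rewrite addrC subrK.
  rewrite LD; [|exact: bm_staircase|by apply: bmB => //; exact: bm_staircase].
  rewrite [X in X + _](_ : _ = 0); last first.
    rewrite /staircase LZ; last first.
      by apply: bm_sum => k _; apply: bm_indic; exact: bm_set_ge.
    rewrite Ls; first by rewrite big1 ?mulr0// => k _; rewrite L0//; exact: bm_set_ge.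
    by move=> k; apply: bm_indic; exact: bm_set_ge.
  rewrite add0r; apply: LC; first by apply: bmB => //; exact: bm_staircase.
  move=> x; have /andP[s1 s2] := staircaseP N0 (g01 x).
  by rewrite ger0_norm ?subr_ge0// lerBlDl.
apply/eqP; rewrite -normr_le0; apply/ler_addgt0Pr => e e0; rewrite add0r.
pose N := (Num.truncn (`|C| / e)).+1.
apply: (le_trans (key N isT)).
rewrite ler_pdivrMr ?ltr0n//.
apply: le_trans (ler_norm C) _.
rewrite mulrC -ler_pdivrMr//.
by apply/ltW; rewrite /N truncnS_gt.
Qed.

(** * Independence *)

Section Orthogonality.
Context {R : realType} {d : measure_display} {T : measurableType d}.
Variable P : probability T R.

Lemma orth_sets (G : set (set T)) (h : T -> R) :
  setI_closed G -> G `<=` measurable -> bm h ->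
  \int[P]_x h x = 0 -> (forall A, G A -> \int[P]_(x in A) h x = 0) ->
  forall A, <<s G >> A -> \int[P]_(x in A) h x = 0.
Proof.
move=> GI Gm bh h0 hG.
have intE A : measurable A -> (\int[P]_(x in A) (h x)%:E)%E = (\int[P]_(x in A) h x)%:E.
  move=> mA; rewrite /Rintegral fineK//.
  by apply: integrable_fin_num => //; exact: bm_integrable.
rewrite -setI_closed_g_dynkin_g_sigma_algebra//.
suff : <<d G >> `<=` [set A | measurable A /\ \int[P]_(x in A) h x = 0].
  by move=> sub A /sub[].
apply: smallest_sub; last by move=> A GA; split; [exact: Gm|exact: hG].
split => //.
- move=> A [mA hA]; split; first exact: measurableC.
  have := h0; rewrite -(setUv A) Rintegral_setU//.
  + by rewrite hA add0r.
  + exact: measurableC.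
  + by apply: bm_integrable => //; rewrite setUv.
  + by rewrite disj_set2E setICr.
- move=> F tF mF; split; first by apply: bigcupT_measurable => k; case: (mF k).
  have mU : measurable (\bigcup_k F k).
    by apply: bigcupT_measurable => k; case: (mF k).
  apply: EFin_inj; rewrite -intE// integral_bigcup//.
  + by apply: eseries0 => k _ _; rewrite intE; case: (mF k) => // _ ->.
  + by move=> k; case: (mF k).
  + exact: bm_integrable.
Qed.

(** A bounded [h] that integrates to zero over a pi-system is orthogonal to every
   bounded function measurable for the generated sigma-algebra. *)
Lemma orth_fun (G : set (set T)) (h : T -> R) (g0 : g_sigma_algebraType G -> R) :
  setI_closed G -> G `<=` measurable -> bm h ->
  \int[P]_x h x = 0 -> (forall A, G A -> \int[P]_(x in A) h x = 0) ->
  bm g0 -> \int[P]_x (g0 x * h x) = 0.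
Proof.
move=> GI Gm bh h0 hG.
have sub : <<s G >> `<=` measurable.
  by apply: smallest_sub => //; exact: sigma_algebra_measurable.
have bm_sub g : bm (g : g_sigma_algebraType G -> R) -> bm (g : T -> R).
  move=> [mg gb]; split => // _ B mB; rewrite setTI.
  by apply: sub; have := mg measurableT _ mB; rewrite setTI.
have [_ [M hM]] := bh.
move=> bf0; apply: (@linear_ext R _ (g_sigma_algebraType G) (fun f => \int[P]_x (f x * h x)) `|M| _ _ _ _ g0 bf0).
- move=> f g /bm_sub bf /bm_sub bg.
  rewrite -expD; [|exact: bmM|exact: bmM].
  by apply: eq_Rintegral => x _; rewrite mulrDl.
- move=> a f /bm_sub bf; rewrite -expZ; last exact: bmM.
  by apply: eq_Rintegral => x _; rewrite mulrA.
- move=> f e /bm_sub bf fe; apply: exp_abs_cst; first exact: bmM.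
  move=> x; rewrite normrM mulrC ler_pM//.
  exact: le_trans (hM x) (ler_norm _).
- move=> A mA; transitivity (\int[P]_(x in A) h x).
    by rewrite (exp_in P (A : set T)); apply: eq_Rintegral => x _; rewrite mulrC.
  exact: orth_sets mA.
Qed.

End Orthogonality.

Definition preimages d (T : measurableType d) d' (T' : measurableType d')
    (X : T -> T') : set (set T) :=
  [set A | exists2 B, measurable B & A = X @^-1` B].

Lemma preimagesT d (T : measurableType d) d' (T' : measurableType d')
    (X : T -> T') : preimages X setT.
Proof. by exists setT => //; rewrite preimage_setT. Qed.

Lemma preimagesI d (T : measurableType d) d' (T' : measurableType d')
    (X : T -> T') : setI_closed (preimages X).
Proof.
move=> _ _ [B mB ->] [C mC ->]; exists (B `&` C); first exact: measurableI.
by rewrite preimage_setI.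
Qed.

Lemma preimages_measurable d (T : measurableType d) d' (T' : measurableType d')
    (X : T -> T') : measurable_fun setT X -> preimages X `<=` measurable.
Proof. by move=> mX _ [B mB ->]; rewrite -[X in measurable X]setTI; exact: mX. Qed.

(** Cylinders over the coordinates in [S]; a function is measurable for the
   sigma-algebra they generate when it only depends on these coordinates. *)
Definition cyl (T : Type) (I : finType) (F : I -> set (set T)) (S : {set I}) :
    set (set T) :=
  [set C | exists2 A : I -> set T, (forall i, F i (A i)) &
     C = [set w | forall i, i \in S -> A i w]].

Section Independence.
Context {R : realType} {d : measure_display} {T : measurableType d}.
Context {I : finType}.
Variables (P : probability T R) (F : I -> set (set T)).
Hypothesis FT : forall i, F i setT.
Hypothesis FI : forall i, setI_closed (F i).
Hypothesis Fm : forall i, F i `<=` measurable.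

Definition independent_coordinates : Prop :=
  forall A : I -> set T, (forall i, F i (A i)) ->
    Pr P [set w | forall i, A i w] = \prod_i Pr P (A i).

Lemma cyl_setI S : setI_closed (cyl F S).
Proof.
move=> _ _ [A FA ->] [B FB ->]; exists (fun i => A i `&` B i).
  by move=> i; exact: FI.
apply/seteqP; split => w /=.
  by move=> [Aw Bw] i iS; split; [exact: Aw|exact: Bw].
by move=> ABw; split => i /ABw[].
Qed.

Lemma measurable_forall_in (S : {set I}) (A : I -> set T) :
  (forall i, measurable (A i)) -> measurable [set w | forall i, i \in S -> A i w].
Proof.
move=> mA; rewrite (_ : [set w | _] = \big[setI/setT]_(i in S) A i).
  by apply: bigsetI_measurable => i _; exact: mA.
rewrite -bigcap_seq_cond; apply/seteqP; split => w /= h i.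
  by move=> /= /andP[_ iS]; exact: h.
by move=> iS; apply: h; rewrite /= mem_index_enum.
Qed.

Lemma cyl_measurable S : cyl F S `<=` measurable.
Proof.
by move=> _ [A FA ->]; apply: measurable_forall_in => i; exact: Fm.
Qed.

Lemma cyl_bm S (f : T -> R) : bm (f : g_sigma_algebraType (cyl F S) -> R) -> bm f.
Proof.
have sub : <<s cyl F S >> `<=` measurable.
  apply: smallest_sub; first exact: sigma_algebra_measurable.
  exact: cyl_measurable.
move=> [mg gb]; split => // _ B mB; rewrite setTI.
by apply: sub; have := mg measurableT _ mB; rewrite setTI.
Qed.

Lemma cyl_bm_sub (S S' : {set I}) (f : T -> R) : S \subset S' ->
  bm (f : g_sigma_algebraType (cyl F S) -> R) ->
  bm (f : g_sigma_algebraType (cyl F S') -> R).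
Proof.
move=> SS'; have sub : <<s cyl F S >> `<=` <<s cyl F S' >>.
  apply: sub_sigma_algebra2 => _ [A FA ->].
  exists (fun i => if i \in S then A i else setT); first by move=> i; case: ifP.
  apply/seteqP; split => w /= h i iS.
    by case: ifP => // /h.
  by have := h i (fintype.subsetP SS' i iS); rewrite iS.
move=> [mg gb]; split => // _ B mB; rewrite setTI.
by apply: sub; have := mg measurableT _ mB; rewrite setTI.
Qed.

Lemma cyl_coordinate (S : {set I}) d' (T' : measurableType d') (X : T -> T') i :
  i \in S -> preimages X `<=` F i ->
  measurable_fun setT (X : g_sigma_algebraType (cyl F S) -> T').
Proof.
move=> iS XF _ B mB; rewrite setTI; apply: sub_sigma_algebra.
exists (fun k => if k == i then X @^-1` B else setT).
  by move=> k; case: eqP => [->|_ //]; apply: XF; exists B.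
apply/seteqP; split => w /=.
  by move=> XB k _; case: eqP.
by move=> /(_ i iS); rewrite eqxx.
Qed.

Hypothesis ind : independent_coordinates.

Lemma Pr_cyl (S : {set I}) A : (forall i, F i (A i)) ->
  Pr P [set w | forall i, i \in S -> A i w] = \prod_(i in S) Pr P (A i).
Proof.
move=> FA; rewrite [RHS]big_mkcond /=.
transitivity (Pr P [set w | forall i, (if i \in S then A i else setT) w]).
  congr (Pr _ _); apply/seteqP; split => w /= h i; first by case: ifP => // /h.
  by move=> iS; have := h i; rewrite iS.
rewrite ind; last by move=> i; case: ifP.
by apply: eq_bigr => i _; case: ifP => // _; rewrite /Pr prob_setT.
Qed.

Lemma indep_exp (S S' : {set I}) (f : g_sigma_algebraType (cyl F S) -> R)
    (g : g_sigma_algebraType (cyl F S') -> R) :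
  [disjoint S & S']%bool -> bm f -> bm g ->
  \int[P]_x (f x * g x) = (\int[P]_x f x) * (\int[P]_x g x).
Proof.
move=> dS bf bg.
have bf' := cyl_bm bf; have bg' := cyl_bm bg.
have sets A B : cyl F S A -> cyl F S' B -> Pr P (A `&` B) = Pr P A * Pr P B.
  move=> [A0 FA ->] [B0 FB ->].
  rewrite !Pr_cyl//.
  rewrite (_ : _ `&` _ = [set w | forall i, i \in S :|: S' ->
      (if i \in S then A0 i else B0 i) w]); last first.
    apply/seteqP; split => w /=.
      move=> [Aw Bw] i; rewrite inE; case: ifP => [iS _|_ /=]; [exact: Aw|exact: Bw].
    move=> h; split => i iS; have := h i.
      by rewrite inE iS; apply.
    by rewrite inE (disjointFl dS iS) iS; apply.
  rewrite Pr_cyl; last by move=> i; case: ifP.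
  rewrite (eq_bigl [predU S & S']); last by move=> i; rewrite !inE.
  rewrite bigU//=; congr (_ * _).
    by apply: eq_bigr => i ->.
  by apply: eq_bigr => i iS; rewrite (disjointFl dS iS).
have exI A : measurable A -> \int[P]_x \1_A x = Pr P A by exact: exp_indic.
have orthB B : cyl F S' B -> \int[P]_x (f x * (\1_B x - Pr P B)) = 0.
  move=> GB; have mB := cyl_measurable GB.
  apply: (@orth_fun _ _ _ P (cyl F S)) => //.
  - exact: cyl_setI.
  - exact: cyl_measurable.
  - by apply: bmB; [exact: bm_indic|exact: bm_cst].
  - rewrite expB; [|exact: bm_indic|exact: bm_cst].
    by rewrite exp_cst exI// subrr.
  - move=> A GA; have mA := cyl_measurable GA; rewrite exp_in.
    rewrite (_ : (fun _ => _) = fun x => \1_(A `&` B) x - Pr P B * \1_A x); last first.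
      by apply/funext => x; rewrite indicI /= mulrBl [\1_B x * _]mulrC.
    rewrite expB; [|by apply: bm_indic; exact: measurableI|by apply: bmZ; exact: bm_indic].
    rewrite expZ; last exact: bm_indic.
    by rewrite !exI//; [rewrite sets// mulrC subrr|exact: measurableI].
have : \int[P]_x (g x * (f x - \int[P]_x f x)) = 0.
  apply: (@orth_fun _ _ _ P (cyl F S')) => //.
  - exact: cyl_setI.
  - exact: cyl_measurable.
  - by apply: bmB => //; exact: bm_cst.
  - by rewrite expB// ?exp_cst ?subrr//; exact: bm_cst.
  - move=> B GB; have mB := cyl_measurable GB; rewrite exp_in.
    have := orthB B GB.
    under eq_Rintegral do rewrite mulrBr.
    rewrite expB; [|by apply: bmM => //; exact: bm_indic|by apply: bmM => //; exact: bm_cst].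
    rewrite expZr// => /eqP; rewrite subr_eq0 => /eqP fB.
    under eq_Rintegral do rewrite mulrBl.
    rewrite expB; [|by apply: bmM => //; exact: bm_indic|by apply: bmZ; exact: bm_indic].
    rewrite expZ; last exact: bm_indic.
    by rewrite fB exI// subrr.
under eq_Rintegral do rewrite mulrBr.
rewrite expB; [|exact: bmM|by apply: bmM => //; exact: bm_cst].
rewrite expZr// => /eqP; rewrite subr_eq0 => /eqP gf.
by rewrite mulrC -gf; apply: eq_Rintegral => x _; rewrite mulrC.
Qed.

End Independence.

(** * Kernels *)

Section KernelAt.
Context d d' (X : measurableType d) (Y : measurableType d') (R : realType).
Variables (k : R.-pker X ~> Y) (x : X).

Definition kernel_fun : set Y -> \bar R := k x.

HB.instance Definition _ := Measure.on kernel_fun.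

Let kernel_fun_setT : kernel_fun setT = 1%E.
Proof. exact: prob_kernel. Qed.

HB.instance Definition _ :=
  Measure_isProbability.Build _ _ _ kernel_fun kernel_fun_setT.

Definition kat : probability Y R := kernel_fun.

End KernelAt.

Section KernelPullback.
Context d d' d2 (X : measurableType d) (Y : measurableType d')
  (X' : measurableType d2) (R : realType).
Variables (k : R.-pker X ~> Y) (g : X' -> X).

Definition kpull (mg : measurable_fun setT g) (x : X') : {measure set Y -> \bar R} :=
  k (g x).

Hypothesis mg : measurable_fun setT g.

Let measurable_kpull U : measurable U -> measurable_fun setT (kpull mg ^~ U).
Proof.
move=> mU; apply: (measurableT_comp (f := fun x => k x U)) => //.
exact: measurable_kernel.
Qed.

HB.instance Definition _ := isKernel.Build _ _ X' Y R (kpull mg) measurable_kpull.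

Let kpull_setT x : kpull mg x setT = 1%E.
Proof. exact: prob_kernel. Qed.

HB.instance Definition _ :=
  Kernel_isProbability.Build _ _ X' Y R (kpull mg) kpull_setT.

End KernelPullback.

Lemma bm_kernel d d' d2 (X : measurableType d) (Y : measurableType d')
    (X' : measurableType d2) (R : realType)
    (k : R.-pker X ~> Y) (g : X' -> X) (f : X' * Y -> R) :
  measurable_fun setT g -> bm f -> bm (fun x => \int[kat k (g x)]_y f (x, y)).
Proof.
move=> mg bf; have [a [b [h [a0 bh h01 fE]]]] := bm_affine01 bf.
have bhx x : bm (fun y => h (x, y)) by exact: bm_comp.
rewrite (_ : (fun _ => _) = fun x => a * \int[kat k (g x)]_y h (x, y) + b).
  apply: bmD; last exact: bm_cst.
  apply: bmZ; split; last first.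
    exists 1 => x; apply: exp_abs_cst => // y.
    by have /andP[h0 h1] := h01 (x, y); rewrite ger0_norm.
  apply: (measurableT_comp (f := fine)) => //.
  apply: (measurable_fun_integral_finite_kernel (EFin \o h) (kpull k mg)).
    by move=> z; rewrite lee_fin; case/andP: (h01 z).
  by apply/measurable_EFinP; case: bh.
apply/funext => x; rewrite -expZ// -[in RHS](exp_cst (kat k (g x)) b) -expD.
- by apply: eq_Rintegral => y _; rewrite fE.
- exact: bmZ.
- exact: bm_cst.
Qed.

Lemma bm_section d d' (X : measurableType d) (Y : measurableType d')
    (R : realType) (m : probability Y R) (f : X * Y -> R) :
  bm f -> bm (fun x => \int[m]_y f (x, y)).
Proof.
move=> bf.
have mm : measurable_fun [set: X] (fun _ : X => (m : pprobability Y R)).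
  exact: measurable_cst.
exact: (bm_kernel (kprobability mm) (@measurable_id _ _ setT) bf).
Qed.

(** * Elementary inequalities *)

Lemma prod_diff_le (R : realType) (I : Type) (s : seq I) (x y : I -> R) :
  (forall i, `|x i| <= 1) -> (forall i, `|y i| <= 1) ->
  `|\prod_(i <- s) x i - \prod_(i <- s) y i| <= \sum_(i <- s) `|x i - y i|.
Proof.
move=> x1 y1; elim: s => [|i s IH]; first by rewrite !big_nil subrr normr0.
rewrite !big_cons; set p := \prod_(j <- s) x j; set q := \prod_(j <- s) y j.
have q1 : `|q| <= 1.
  rewrite /q; elim: {IH p} s @q => [|j s IHs] q; rewrite ?big_nil ?normr1//.
  by rewrite /q big_cons normrM mulr_ile1.
rewrite (_ : _ - _ = x i * (p - q) + (x i - y i) * q); last by ring.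
rewrite (le_trans (ler_normD _ _))// addrC !normrM lerD//.
  by rewrite ler_piMr.
by apply: le_trans IH; rewrite ler_piMl.
Qed.

Lemma prod_norm_le1 (R : realType) (I : Type) (s : seq I) (x : I -> R) :
  (forall i, `|x i| <= 1) -> `|\prod_(i <- s) x i| <= 1.
Proof.
move=> x1; elim: s => [|i s IH]; first by rewrite big_nil normr1.
by rewrite big_cons normrM mulr_ile1.
Qed.

Lemma sq_convex (R : realType) (I : Type) (s : seq I) (w y : I -> R) :
  (forall i, 0 <= w i) -> \sum_(i <- s) w i <= 1 ->
  (\sum_(i <- s) w i * y i) ^+ 2 <= \sum_(i <- s) w i * y i ^+ 2.
Proof.
move=> w0 w1; set m := \sum_(i <- s) w i * y i.
have : 0 <= \sum_(i <- s) w i * (y i - m) ^+ 2.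
  by apply: sumr_ge0 => i _; rewrite mulr_ge0 ?sqr_ge0.
rewrite (_ : \sum_(i <- s) w i * (y i - m) ^+ 2 =
    \sum_(i <- s) w i * y i ^+ 2 - 2 * m * m + m ^+ 2 * \sum_(i <- s) w i).
  have := sqr_ge0 m; move: (\sum_(i <- s) w i) w1 => W w1.
  move: (\sum_(i <- s) _) => Y m2 h.
  have : m ^+ 2 * W <= m ^+ 2 by rewrite ler_piMr.
  lra.
have -> : 2 * m * m = \sum_(i <- s) 2 * m * (w i * y i) by rewrite -mulr_sumr.
rewrite [X in _ + X]mulr_sumr -sumrB -big_split/=.
by apply: eq_bigr => i _; ring.
Qed.

(** * Vectors with entries in the unit interval *)

Section Clip.
Context {R : realType} {l : nat}.
Notation V := (l.-tuple R).

Definition clip1 (x : R) : R := Num.max (-1) (Num.min x 1).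

Lemma clip1_le x : `|clip1 x| <= 1.
Proof.
rewrite /clip1 ler_norml le_max lexx /= ge_max ge_min lexx orbT andbT.
lra.
Qed.

Lemma clip1_id x : `|x| <= 1 -> clip1 x = x.
Proof.
by rewrite ler_norml /clip1 => /andP[x1 x2]; rewrite min_l// max_r.
Qed.

Lemma clip1_lip x y : `|clip1 x - clip1 y| <= `|x - y|.
Proof.
wlog xy : x y / x <= y.
  move=> h; case: (leP x y) => [|/ltW] /h//.
  by rewrite [in leLHS]distrC [in leRHS]distrC.
rewrite distrC [leRHS]distrC [leRHS]ger0_norm ?subr_ge0//.
rewrite /clip1 !maxEle !minEle.
by rewrite ger0_norm; repeat case: ifPn; rewrite ?ltNge; lra.
Qed.

Lemma measurable_clip1 : measurable_fun setT clip1.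
Proof.
apply: measurable_maxr; first exact: measurable_cst.
by apply: measurable_minr; [exact: measurable_id|exact: measurable_cst].
Qed.

Lemma bm_clip1 d (T : measurableType d) (f : T -> R) :
  measurable_fun setT f -> bm (fun x => clip1 (f x)).
Proof.
move=> mf; split; first exact: (measurableT_comp measurable_clip1).
by exists 1 => x; exact: clip1_le.
Qed.

Lemma measurable_mktuple d (T : measurableType d) d' (T' : measurableType d')
    m (f : 'I_m -> T -> T') :
  (forall k, measurable_fun setT (f k)) ->
  measurable_fun setT (fun x => [tuple f k x | k < m]).
Proof.
move=> mf; apply/measurable_fun_tnthP => k.
by rewrite (_ : _ \o _ = f k)//; apply/funext => x /=; rewrite tnth_mktuple.
Qed.

Lemma measurable_cube : measurable (cube : set V).
Proof.
rewrite (_ : cube = [set x | forall k, k \in [set: 'I_l]%SET ->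
    [set x : V | `|tnth x k| <= 1] x]).
  apply: measurable_forall_in => k.
  rewrite (_ : [set x | _] = setT `&` (fun x : V => `|tnth x k|) @^-1` `]-oo, 1]).
    apply: (measurableT_comp (f := fun x : R => `|x|)) => //.
    exact: measurable_tnth.
  by apply/seteqP; split => x /=; rewrite in_itv /= => // -[].
by apply/seteqP; split => x /= h k => [_|]; [exact: h|apply: h; rewrite inE].
Qed.

Definition dclip (x y : V) : R := \sum_(k < l) `|clip1 (tnth x k) - clip1 (tnth y k)|.

Lemma dclip_le x y : dclip x y <= dist1 x y.
Proof. by apply: ler_sum => k _; exact: clip1_lip. Qed.

Lemma dclipE x y : cube x -> cube y -> dclip x y = dist1 x y.
Proof. by move=> cx cy; apply: eq_bigr => k _; rewrite !clip1_id. Qed.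

Lemma bm_dclip d (T : measurableType d) (f g : T -> V) :
  measurable_fun setT f -> measurable_fun setT g -> bm (fun x => dclip (f x) (g x)).
Proof.
move=> mf mg; apply: bm_sum => k _; apply: bm_norm.
apply: bmB; apply: bm_clip1.
  exact: (measurableT_comp (measurable_tnth k)).
exact: (measurableT_comp (measurable_tnth k)).
Qed.

End Clip.

(** * The limiting one-vertex dynamics *)

Section Dynamics.
Context {R : realType} {K l : nat}.
Notation V := (l.-tuple R).
Variables (c d : R) (nu : 'I_K -> R.-pker V ~> V).
Variables (u : 'I_K -> 'I_l -> R) (ni : 'I_K -> bool).
Notation a := (1 - c - d).

Definition upd (r : 'I_K) (q z y : V) : V :=
  [tuple a * clip1 (tnth y k) + d * clip1 (tnth z k)
         + c * clip1 (tnth q k) * (ni r)%:R + c * u r k | k < l].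

Definition Lam (r : 'I_K) (phi : V * V -> R) (p : V * V) : R :=
  \int[kat (nu r) p.1]_z phi (p.1, upd r p.1 z p.2).

Definition lip1 (L : R) (phi : V * V -> R) : Prop :=
  forall q x y, `|phi (q, x) - phi (q, y)| <= L * dclip x y.

Lemma measurable_upd d1 (T : measurableType d1) r (q z y : T -> V) :
  measurable_fun setT q -> measurable_fun setT z -> measurable_fun setT y ->
  measurable_fun setT (fun x => upd r (q x) (z x) (y x)).
Proof.
move=> mq mz my; apply: measurable_mktuple => k.
have mt (g : T -> V) : measurable_fun setT g -> bm (fun x => clip1 (tnth (g x) k)).
  by move=> mg; apply: bm_clip1; exact: (measurableT_comp (measurable_tnth k)).
apply: bm_measurable; apply: bmD; last exact: bm_cst.
apply: bmD; last by apply: bmM; [apply: bmZ; exact: mt|exact: bm_cst].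
by apply: bmD; apply: bmZ; exact: mt.
Qed.

Lemma bm_upd d1 (T : measurableType d1) r (q z y : T -> V) (phi : V * V -> R) :
  bm phi ->
  measurable_fun setT q -> measurable_fun setT z -> measurable_fun setT y ->
  bm (fun x => phi (q x, upd r (q x) (z x) (y x))).
Proof.
move=> bphi mq mz my; apply: (bm_comp (g := fun x => (q x, upd r (q x) (z x) (y x)))) => //.
by apply: measurable_fun_pair => //; exact: measurable_upd.
Qed.

Lemma bm_Lam r phi : bm phi -> bm (Lam r phi).
Proof.
move=> bphi.
apply: (@bm_kernel _ _ _ _ _ _ _ (nu r) fst
  (fun x : (V * V) * V => phi (x.1.1, upd r x.1.1 x.2 x.1.2))); first exact: measurable_fst.
apply: bm_upd => //.
- exact: (measurableT_comp measurable_fst).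
- exact: (measurableT_comp measurable_snd).
Qed.

Lemma bm_upd_z r q y (phi : V * V -> R) : bm phi -> bm (fun z => phi (q, upd r q z y)).
Proof.
by move=> bphi; apply: (@bm_upd _ _ r (fun=> q) id (fun=> y)).
Qed.

Lemma Lam_le1 r phi : bm phi -> (forall p, `|phi p| <= 1) ->
  forall p, `|Lam r phi p| <= 1.
Proof. by move=> bphi p1 p; apply: exp_abs_cst => //; exact: bm_upd_z. Qed.

Hypothesis a0 : 0 <= a.

Lemma dclip_upd r q z x y : dclip (upd r q z x) (upd r q z y) <= a * dclip x y.
Proof.
rewrite /dclip mulr_sumr; apply: ler_sum => k _.
rewrite (le_trans (clip1_lip _ _))// !tnth_mktuple.
rewrite (_ : _ - _ = a * (clip1 (tnth x k) - clip1 (tnth y k))); last by ring.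
by rewrite normrM ger0_norm.
Qed.

Lemma Lam_lip r phi L : bm phi -> 0 <= L -> lip1 L phi -> lip1 (a * L) (Lam r phi).
Proof.
move=> bphi L0 Lphi q x y.
rewrite /Lam /= -expB; [|exact: bm_upd_z|exact: bm_upd_z].
apply: exp_abs_cst; first by apply: bmB; exact: bm_upd_z.
move=> z; apply: (le_trans (Lphi _ _ _)).
by rewrite mulrAC [leRHS]mulrC ler_wpM2l// dclip_upd.
Qed.

Lemma bm_LamT T r phi : bm phi -> bm (iter T (Lam r) phi).
Proof. by move=> bphi; elim: T => //= T IH; exact: bm_Lam. Qed.

Lemma LamT_le1 T r phi : bm phi -> (forall p, `|phi p| <= 1) ->
  forall p, `|iter T (Lam r) phi p| <= 1.
Proof.
move=> bphi p1; elim: T => //= T IH; apply: Lam_le1 => //.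
exact: bm_LamT.
Qed.

Lemma LamT_lip T r phi L : bm phi -> 0 <= L -> lip1 L phi ->
  lip1 (a ^+ T * L) (iter T (Lam r) phi).
Proof.
move=> bphi L0 Lphi; elim: T => [|T IH]; first by rewrite mul1r.
rewrite exprS -mulrA; apply: Lam_lip => //; first exact: bm_LamT.
by rewrite mulr_ge0// exprn_ge0.
Qed.

End Dynamics.

(** * Second moments *)

Lemma exp_sq_sum (R : realType) d (T : measurableType d) (P : probability T R)
    (I : finType) (f : I -> T -> R) :
  (forall i, bm (f i)) ->
  (forall i j, i != j -> \int[P]_x (f i x * f j x) = 0) ->
  \int[P]_x (\sum_i f i x) ^+ 2 = \sum_i \int[P]_x (f i x) ^+ 2.
Proof.
move=> bf orth.
transitivity (\int[P]_x \sum_i \sum_j f i x * f j x).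
  apply: eq_Rintegral => x _; rewrite expr2 mulr_suml.
  by apply: eq_bigr => i _; rewrite mulr_sumr.
rewrite exp_sum; last by move=> i _; apply: bm_sum => j _; exact: bmM.
apply: eq_bigr => i _; rewrite exp_sum; last by move=> j _; exact: bmM.
rewrite (bigD1 i)//= big1 ?addr0; last by move=> j ji; rewrite orth// eq_sym.
by apply: eq_Rintegral => x _; rewrite expr2.
Qed.

Lemma exp_prod_indep (R : realType) d (T : measurableType d) (P : probability T R)
    (I : finType) (F : I -> set (set T)) (J : eqType) (s : seq J) (v : J -> I)
    (f : J -> T -> R) :
  (forall i, F i setT) -> (forall i, setI_closed (F i)) ->
  (forall i, F i `<=` measurable) -> independent_coordinates P F ->
  injective v -> uniq s ->
  (forall j (S : {set I}), v j \in S ->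
     bm (f j : g_sigma_algebraType (cyl F S) -> R)) ->
  \int[P]_x (\prod_(j <- s) f j x) = \prod_(j <- s) \int[P]_x f j x.
Proof.
move=> FT FI Fm ind vinj + bf; elim: s => [|j s IH] /=.
  by under eq_Rintegral do rewrite big_nil; rewrite big_nil exp_cst.
move=> /andP[js us].
under eq_Rintegral do rewrite big_cons.
rewrite big_cons -IH//.
apply: (@indep_exp _ _ _ _ P F FT FI Fm ind [set v j] [set i in map v s]).
- rewrite disjoints1 inE; apply/mapP => -[k ks /vinj jk].
  by move: js; rewrite jk ks.
- by apply: bf; rewrite inE.
- rewrite (_ : (fun _ => _) = fun x => \prod_(i <- s | i \in s) f i x); last first.
    by apply/funext => x; rewrite big_seq.
  by apply: bm_prod => i si; apply: bf; rewrite inE map_f.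
Qed.

(** * Stationary opinions in a fixed environment *)

Section Weights.
Context {R : realType} {K l n : nat}.
Variable e : environment R K l n.
Hypothesis w0 : forall i j, 0 <= weight e i j.

Lemma total_weight_ge0 i : 0 <= total_weight e i.
Proof. by apply: sumr_ge0 => j _; rewrite mulr_ge0. Qed.

Lemma norm_weight_ge0 i j : 0 <= norm_weight e i j.
Proof.
rewrite /norm_weight; case: ifP => // /andP[/ltW t0 _].
by rewrite !mulr_ge0// invr_ge0.
Qed.

Lemma total_weight_indegree i : 0 < total_weight e i -> (indegree e i != 0)%N.
Proof.
apply: contraTneq => /eqP; rewrite sum_nat_eq0 => /forallP h.
rewrite -leNgt /total_weight big1// => j _.
by have := h j; rewrite /= => /eqP ->; rewrite mulr0.
Qed.

Lemma norm_weight_sum i :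
  \sum_j norm_weight e i j <= (indegree e i != 0%N)%:R.
Proof.
have [t0|t0] := ltP 0 (total_weight e i); last first.
  rewrite big1; first by case: (_ != _).
  by move=> j _; rewrite /norm_weight ltNge t0.
rewrite total_weight_indegree//.
apply: (@le_trans _ _ (\sum_j weight e i j * (edge e j i)%:R / total_weight e i)).
  apply: ler_sum => j _; rewrite /norm_weight t0; case: (i != j) => //=.
  by rewrite !mulr_ge0// invr_ge0 ltW.
by rewrite -mulr_suml divff// gt_eqF.
Qed.

Lemma norm_weight_sum1 i : \sum_j norm_weight e i j <= 1.
Proof. by apply: le_trans (norm_weight_sum i) _; case: (_ != _). Qed.

(** One step of the backward random walk with transition weights C_ij. *)
Definition average (h : 'I_n -> R) (i : 'I_n) : R := \sum_j norm_weight e i j * h j.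

Lemma average_le h h' : (forall i, h i <= h' i) -> forall i, average h i <= average h' i.
Proof.
by move=> hh i; apply: ler_sum => j _; rewrite ler_wpM2l ?norm_weight_ge0.
Qed.

Lemma average_ge0 h : (forall i, 0 <= h i) -> forall i, 0 <= average h i.
Proof.
by move=> h0 i; apply: sumr_ge0 => j _; rewrite mulr_ge0 ?norm_weight_ge0.
Qed.

Lemma average_cst_le a i : 0 <= a -> average (fun=> a) i <= a.
Proof. by move=> a0; rewrite /average -mulr_suml ler_piMl// norm_weight_sum1. Qed.

Lemma iter_average_ge0 s h : (forall i, 0 <= h i) -> forall i, 0 <= iter s average h i.
Proof. by move=> h0; elim: s => //= s IH; exact: average_ge0. Qed.

Lemma averageZD a b h h' i :
  average (fun j => a * h j + b * h' j) i = a * average h i + b * average h' i.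
Proof.
rewrite /average !mulr_sumr -big_split/=; apply: eq_bigr => j _; ring.
Qed.

Lemma average_norm h a i : (forall j, `|h j| <= a) -> `|average h i| <= a.
Proof.
move=> ha; apply: (le_trans (ler_norm_sum _ _ _)).
have a0 : 0 <= a by apply: le_trans (ha i).
apply: le_trans (average_cst_le i a0); apply: ler_sum => j _.
by rewrite normrM ger0_norm ?norm_weight_ge0// ler_wpM2l ?norm_weight_ge0.
Qed.

(** A subsolution of h <= q C h + g with q < 1 is bounded by finitely many
   averages of the source, up to a geometric error. *)
Lemma average_iterate (h g : 'I_n -> R) (q D : R) S :
  0 <= q <= 1 -> (forall i, 0 <= g i) -> (forall i, h i <= D) -> 0 <= D ->
  (forall i, h i <= q * average h i + g i) ->
  forall i, h i <= \sum_(s < S) iter s average g i + q ^+ S * D.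
Proof.
move=> /andP[q0 q1] g0 hD D0 hg; elim: S => [|S IH] i.
  by rewrite big_ord0 add0r mul1r.
apply: (le_trans (hg i)).
have avs : average (fun i => \sum_(s < S) iter s average g i + q ^+ S * D) i <=
    \sum_(s < S) iter s.+1 average g i + q ^+ S * D.
  rewrite (_ : (fun i => _) = fun i => 1 * (\sum_(s < S) iter s average g i) + 1 * (q ^+ S * D)).
    rewrite averageZD !mul1r; apply: lerD.
      rewrite /average /=.
      under eq_bigr do rewrite mulr_sumr.
      by rewrite exchange_big/= le_eqVlt; apply/orP; left; apply/eqP.
    by apply: average_cst_le; rewrite mulr_ge0// exprn_ge0.
  by apply/funext => j; rewrite !mul1r.
rewrite big_ord_recl/= exprS -mulrA.
have A0 : 0 <= \sum_(s < S) iter s.+1 average g i.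
  by apply: sumr_ge0 => s _; exact: iter_average_ge0.
have := le_trans (average_le IH i) avs.
move=> /(ler_wpM2l q0) h1.
rewrite addrC -addrA lerD2l; apply: (le_trans h1).
rewrite mulrDr lerD2r; rewrite ler_piMl//.
Qed.

End Weights.

Section Quenched.
Context {R : realType} {K l n : nat}.
Notation V := (l.-tuple R).
Variables (c d : R) (nu : 'I_K -> R.-pker V ~> V).
Variables (u : 'I_K -> 'I_l -> R) (ni : 'I_K -> bool).
Variable e : environment R K l n.
Notation a := (1 - c - d).
Hypotheses (c0 : 0 <= c) (d0 : 0 < d) (cd1 : c + d <= 1).
Hypothesis w0 : forall i j, 0 <= weight e i j.
Hypothesis q1 : forall i, cube (belief e i).
Hypothesis nuc : forall r q, cube q -> nu r q cube = 1%E.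
Hypothesis u1 : forall r k, `|u r k| <= 1.

Let a0 : 0 <= a. Proof. by rewrite -addrA -opprD subr_ge0. Qed.
Let a_le1 : a <= 1.
Proof. by rewrite -addrA gerDl -opprD oppr_le0 addr_ge0// ltW. Qed.
Let d_le1 : d <= 1. Proof. by apply: le_trans cd1; rewrite lerDr. Qed.

Notation av := (average e).
Notation nui i := (kat (nu (label e i)) (belief e i)).

Definition cl_step (z r : n.-tuple V) : n.-tuple V :=
  opinion_step c d e [tuple [tuple clip1 (tnth (tnth z i) k) | k < l] | i < n]
                     [tuple [tuple clip1 (tnth (tnth r i) k) | k < l] | i < n].

Definition nbr_mean (i : 'I_n) (k : 'I_l) (r : n.-tuple V) : R :=
  av (fun j => clip1 (tnth (tnth r j) k)) i.

Definition unlinked (i : 'I_n) : R := (indegree e i == 0%N)%:R.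

Lemma cl_stepE z r i k : tnth (tnth (cl_step z r) i) k =
  a * clip1 (tnth (tnth r i) k) + d * clip1 (tnth (tnth z i) k)
  + c * tnth (belief e i) k * unlinked i + c * nbr_mean i k r.
Proof.
rewrite /cl_step /opinion_step !tnth_mktuple /external_signal !tnth_mktuple.
rewrite (_ : \sum_(j < n) _ = nbr_mean i k r); first by rewrite /unlinked; ring.
by apply: eq_bigr => j _; rewrite !tnth_mktuple.
Qed.

Lemma nbr_mean_le i k r : `|nbr_mean i k r| <= 1.
Proof. by apply: average_norm => // j; exact: clip1_le. Qed.

Lemma nbr_mean_unlinked i k r : `|nbr_mean i k r| <= 1 - unlinked i.
Proof.
apply: (le_trans (ler_norm_sum _ _ _)).
apply: (@le_trans _ _ (\sum_j norm_weight e i j)).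
  apply: ler_sum => j _; rewrite normrM ger0_norm ?norm_weight_ge0//.
  by rewrite ler_piMr ?norm_weight_ge0// clip1_le.
apply: le_trans (norm_weight_sum w0 i) _; rewrite /unlinked.
by case: (_ == _); rewrite /= ?subrr ?subr0.
Qed.

Lemma cl_step_le z r i k : `|tnth (tnth (cl_step z r) i) k| <= 1.
Proof.
rewrite cl_stepE.
have A := clip1_le (tnth (tnth r i) k); have B := clip1_le (tnth (tnth z i) k).
have C := q1 i k; have D := nbr_mean_unlinked i k r.
have I0 : 0 <= unlinked i by rewrite /unlinked.
apply: (le_trans (ler_normD _ _)); apply: (@le_trans _ _ (a + d + c * unlinked i + c * (1 - unlinked i))).
  apply: lerD; last by rewrite normrM ger0_norm// ler_wpM2l.
  apply: (le_trans (ler_normD _ _)); apply: lerD; last first.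
    by rewrite !normrM (ger0_norm c0) (ger0_norm I0) ler_wpM2r// ler_piMr.
  apply: (le_trans (ler_normD _ _)); rewrite !normrM (ger0_norm a0) (gtr0_norm d0).
  by rewrite lerD// ler_piMr// ltW.
lra.
Qed.

Lemma measurable_tnth2 d1 (T : measurableType d1) (f : T -> n.-tuple V) i k :
  measurable_fun setT f -> measurable_fun setT (fun x => tnth (tnth (f x) i) k).
Proof.
move=> mf; apply: (measurableT_comp (measurable_tnth k)).
exact: (measurableT_comp (measurable_tnth i)).
Qed.

Lemma bm_nbr_mean d1 (T : measurableType d1) (f : T -> n.-tuple V) i k :
  measurable_fun setT f -> bm (fun x => nbr_mean i k (f x)).
Proof.
move=> mf; apply: bm_sum => j _; apply: bmZ; apply: bm_clip1.
exact: measurable_tnth2.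
Qed.

Lemma measurable_cl_step d1 (T : measurableType d1) (z r : T -> n.-tuple V) :
  measurable_fun setT z -> measurable_fun setT r ->
  measurable_fun setT (fun x => cl_step (z x) (r x)).
Proof.
move=> mz mr; apply/measurable_fun_tnthP => i; apply/measurable_fun_tnthP => k.
rewrite (_ : _ \o _ = fun x =>
  a * clip1 (tnth (tnth (r x) i) k) + d * clip1 (tnth (tnth (z x) i) k)
  + c * tnth (belief e i) k * unlinked i + c * nbr_mean i k (r x)).
  apply: bm_measurable; apply: bmD; last by apply: bmZ; exact: bm_nbr_mean.
  apply: bmD; last exact: bm_cst.
  by apply: bmD; apply: bmZ; apply: bm_clip1; exact: measurable_tnth2.
by apply/funext => x /=; rewrite cl_stepE.
Qed.

Lemma measurable_opinion_step d1 (T : measurableType d1) (z r : T -> n.-tuple V) :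
  measurable_fun setT z -> measurable_fun setT r ->
  measurable_fun setT (fun x => opinion_step c d e (z x) (r x)).
Proof.
move=> mz mr; apply: measurable_mktuple => i; apply: measurable_mktuple => k.
have mZ (b : R) (f : T -> R) : measurable_fun setT f -> measurable_fun setT (fun x => b * f x).
  by move=> mf; apply: measurable_funM => //; exact: measurable_cst.
apply: measurable_funD; last by apply/mZ; exact: measurable_tnth2.
apply: measurable_funD.
  by apply/mZ; apply: measurable_sum => j; apply/mZ; exact: measurable_tnth2.
apply: measurable_funD; last exact: measurable_cst.
by apply/mZ; exact: measurable_tnth2.
Qed.

Section Stationary.
Variables mu zeta : probability (n.-tuple V) R.
Hypothesis mu_cube : mu [set r | forall i, cube (tnth r i)] = 1%E.
Hypothesis media : media_law nu e zeta.
Hypothesis stat : forall S, measurable S ->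
  mu S = (\int[mu]_r zeta [set z | S (opinion_step c d e z r)])%E.

Lemma measurable_cubes : measurable [set r : n.-tuple V | forall i, cube (tnth r i)].
Proof.
rewrite (_ : [set r | _] = [set r | forall i, i \in [set: 'I_n]%SET ->
    [set r : n.-tuple V | cube (tnth r i)] r]).
  apply: measurable_forall_in => i.
  rewrite -[X in measurable X]setTI.
  by apply: (measurable_tnth i) => //; exact: measurable_cube.
by apply/seteqP; split => x /= h k => [_|]; [exact: h|apply: h; rewrite inE].
Qed.

Lemma media_marginal i A : measurable A ->
  Pr zeta ((tnth (T:=V))^~ i @^-1` A) = Pr (nui i) A.
Proof.
move=> mA; have := media (A := fun j => if j == i then A else setT).
rewrite (bigD1 i)//= eqxx big1 ?mulr1; last first.
  by move=> j /negbTE ->; rewrite /Pr prob_kernel.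
move=> h; transitivity (Pr (nu (label e i) (belief e i)) A) => //.
rewrite -h; last by move=> j; case: eqP.
congr (Pr _ _); apply/seteqP; split => z /=; first by move=> Az j; case: eqP => // ->.
by move=> /(_ i); rewrite eqxx.
Qed.

Lemma media_cube : zeta [set r | forall i, cube (tnth r i)] = 1%E.
Proof.
have := media (A := fun=> cube) (fun=> measurable_cube).
rewrite big1; last by move=> i _; rewrite /Pr nuc.
rewrite /Pr => h; rewrite -[LHS]fineK ?h//.
exact: fin_num_measure measurable_cubes.
Qed.

Notation coord := (fun i => preimages (fun z : n.-tuple V => tnth z i)).

Lemma media_indep : independent_coordinates zeta coord.
Proof.
move=> A FA.
have /choice[B /all_and2[mB AE]] : forall i, exists B, measurable B /\
    A i = (fun z : n.-tuple V => tnth z i) @^-1` B.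
  by move=> i; have [B mB AE] := FA i; exists B.
rewrite (_ : [set w | _] = [set z | forall i, B i (tnth z i)]); last first.
  by apply/seteqP; split => z /= h i; have := h i; rewrite AE.
rewrite (media mB); apply: eq_bigr => i _.
by rewrite AE media_marginal.
Qed.

Lemma media_exp i (f : V -> R) : bm f ->
  \int[zeta]_z f (tnth z i) = \int[nui i]_z f z.
Proof.
move=> bf; apply/eqP; rewrite -subr_eq0; apply/eqP.
have bt (g : V -> R) : bm g -> bm (fun z : n.-tuple V => g (tnth z i)).
  by move=> bg; apply: bm_comp => //; exact: measurable_tnth.
apply: (@linear_ext _ _ _ (fun f => \int[zeta]_z f (tnth z i) - \int[nui i]_z f z) 2 _ _ _ _ f bf).
- by move=> g h bg bh; rewrite !expD//; [ring|exact: bt|exact: bt].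
- by move=> b g bg; rewrite !expZ//; [ring|exact: bt].
- move=> g b bg gb; apply: (le_trans (ler_normB _ _)).
  rewrite mulrDl mul1r lerD//; apply: exp_abs_cst => //; exact: bt.
- move=> A mA; rewrite (exp_indic (nui i) mA) -media_marginal// -exp_indic; last first.
    by rewrite -[X in measurable X]setTI; exact: measurable_tnth.
  by apply/eqP; rewrite subr_eq0; apply/eqP; apply: eq_Rintegral.
Qed.

Lemma stationary_exp (f : n.-tuple V -> R) : bm f ->
  \int[mu]_r f r = \int[mu]_r \int[zeta]_z f (cl_step z r).
Proof.
move=> bf; apply/eqP; rewrite -subr_eq0; apply/eqP.
have bs (g : n.-tuple V -> R) : bm g -> bm (fun x : n.-tuple V * n.-tuple V => g (cl_step x.2 x.1)).
  by move=> bg; apply: bm_comp => //; exact: measurable_cl_step.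
have bi (g : n.-tuple V -> R) : bm g -> bm (fun r : n.-tuple V => \int[zeta]_z g (cl_step z r)).
  move=> bg; exact: (@bm_section _ _ _ _ _ zeta (fun x => g (cl_step x.2 x.1)) (bs _ bg)).
have bz (g : n.-tuple V -> R) r : bm g -> bm (fun z : n.-tuple V => g (cl_step z r)).
  by move=> bg; apply: bm_comp => //; exact: measurable_cl_step.
apply: (@linear_ext _ _ _ (fun f => \int[mu]_r f r -
  \int[mu]_r \int[zeta]_z f (cl_step z r)) 2 _ _ _ _ f bf).
- move=> g h bg bh; rewrite expD//.
  rewrite (_ : (fun r => \int[zeta]_z (g (cl_step z r) + h (cl_step z r))) =
      fun r => \int[zeta]_z g (cl_step z r) + \int[zeta]_z h (cl_step z r)).
    by rewrite expD//; [ring|exact: bi|exact: bi].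
  by apply/funext => r; rewrite expD//; exact: bz.
- move=> b g bg; rewrite expZ//.
  rewrite (_ : (fun r => \int[zeta]_z (b * g (cl_step z r))) =
      fun r => b * \int[zeta]_z g (cl_step z r)).
    by rewrite expZ//; [ring|exact: bi].
  by apply/funext => r; rewrite expZ//; exact: bz.
- move=> g b bg gb; apply: (le_trans (ler_normB _ _)).
  rewrite mulrDl mul1r lerD//; apply: exp_abs_cst => //; first exact: bi.
  by move=> r; apply: exp_abs_cst => //; exact: bz.
- move=> A mA; apply/eqP; rewrite subr_eq0; apply/eqP; rewrite exp_indic//.
  have bA : bm (\1_A : n.-tuple V -> R) by exact: bm_indic.
  have bop : bm (fun x : n.-tuple V * n.-tuple V => (\1_A (opinion_step c d e x.2 x.1) : R)).
    by apply: (bm_comp bA); exact: measurable_opinion_step.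
  have bopz r : bm (fun z : n.-tuple V => (\1_A (opinion_step c d e z r) : R)).
    by apply: (bm_comp bA); exact: measurable_opinion_step.
  transitivity (\int[mu]_r \int[zeta]_z (\1_A (opinion_step c d e z r) : R)).
    rewrite /Pr (stat mA : (mu : {measure set _ -> \bar R}) A = _).
    rewrite /Rintegral; congr fine; apply: eq_integral => r _.
    have mAr : measurable [set z | A (opinion_step c d e z r)].
      rewrite -[X in measurable X]setTI.
      by apply: (@measurable_opinion_step _ _ id (fun=> r)).
    have := exp_indic zeta mAr; rewrite /Rintegral /Pr => h.
    rewrite h fineK//; exact: fin_num_measure.
  apply: (exp_as measurable_cubes mu_cube).
  - exact: bm_measurable (@bm_section _ _ _ _ _ zeta _ bop).
  - exact: bm_measurable (bi _ bA).
  - move=> r rc; apply: (exp_as measurable_cubes media_cube).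
    + exact: bm_measurable.
    + exact: bm_measurable (bz _ r bA).
    + move=> z zc; congr (\1_A _); rewrite /cl_step.
      have cl (t : n.-tuple V) : (forall i, cube (tnth t i)) ->
          [tuple [tuple clip1 (tnth (tnth t i) k) | k < l] | i < n] = t.
        move=> tc; apply: eq_from_tnth => i; apply: eq_from_tnth => k.
        by rewrite !tnth_mktuple clip1_id//; exact: tc.
      by rewrite !cl.
Qed.

Definition media_mean i k : R := \int[nui i]_z clip1 (tnth z k).

Definition noise i k (z : n.-tuple V) : R :=
  \sum_j norm_weight e i j * (d * (clip1 (tnth (tnth z j) k) - media_mean j k)).

Definition signal_mean i k : R :=
  d * media_mean i k + c * tnth (belief e i) k * unlinked i.

(** What remains of the conditional drift of the neighbour average when the
   opinions are replaced by their limiting means. *)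
Definition drift i k : R :=
  av (fun j => c * u (label e j) k + signal_mean j k) i - (c + d) * u (label e i) k.

Definition spread i : R := \sum_j norm_weight e i j ^+ 2.

Definition mse i k : R :=
  \int[mu]_r (nbr_mean i k r - u (label e i) k) ^+ 2.

Lemma media_mean_le i k : `|media_mean i k| <= 1.
Proof.
apply: exp_abs_cst; last by move=> z; exact: clip1_le.
by apply: bm_clip1; exact: measurable_tnth.
Qed.

Let centered i k (z : V) : R := clip1 (tnth z k) - media_mean i k.

Let bm_centered i k : bm (centered i k).
Proof. by apply: bmB; [apply: bm_clip1; exact: measurable_tnth|exact: bm_cst]. Qed.

Let centered_exp i k : \int[zeta]_z centered i k (tnth z i) = 0.
Proof.
rewrite (media_exp i (bm_centered i k)).
have bt : bm (fun z : V => clip1 (tnth z k)) by apply: bm_clip1; exact: measurable_tnth.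
by rewrite expB//; [rewrite exp_cst subrr|exact: bm_cst].
Qed.

Let bm_centered_z i k : bm (fun z : n.-tuple V => centered i k (tnth z i)).
Proof. by apply: bm_comp => //; exact: measurable_tnth. Qed.

Lemma bm_noise i k : bm (noise i k).
Proof.
apply: bm_sum => j _; apply: bmZ; apply: bmZ; exact: (bm_centered_z j k).
Qed.

Lemma noise_exp i k : \int[zeta]_z noise i k z = 0.
Proof.
rewrite exp_sum; last first.
  by move=> j _; apply: bmZ; apply: bmZ; exact: (bm_centered_z j k).
apply: big1 => j _; rewrite expZ; last by apply: bmZ; exact: (bm_centered_z j k).
by rewrite expZ; [rewrite centered_exp !mulr0|exact: (bm_centered_z j k)].
Qed.

Lemma noise_sq i k : \int[zeta]_z (noise i k z) ^+ 2 <= spread i.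
Proof.
rewrite /noise exp_sq_sum.
- apply: ler_sum => j _.
  have bt : bm (fun z : V => clip1 (tnth z k)) by apply: bm_clip1; exact: measurable_tnth.
  have bt2 : bm (fun z : V => clip1 (tnth z k) ^+ 2) by exact: bmX.
  under eq_Rintegral do rewrite !exprMn mulrA.
  have := bmX 2 (bm_centered_z j k) => b2.
  rewrite expZ//.
  rewrite (media_exp j (f := fun z => centered j k z ^+ 2)); last exact: bmX.
  apply: (@le_trans _ _ (norm_weight e i j ^+ 2 * d ^+ 2)).
    rewrite ler_piMr// ?mulr_ge0 ?exprn_ge0 ?norm_weight_ge0 ?(ltW d0)//.
    rewrite (_ : (fun z => centered j k z ^+ 2) = fun z => clip1 (tnth z k) ^+ 2
       - (2 * media_mean j k * clip1 (tnth z k) - media_mean j k ^+ 2)); last first.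
      by apply/funext => z; rewrite /centered; ring.
    rewrite expB//; last by apply: bmB; [exact: bmZ|exact: bm_cst].
    rewrite expB; [|exact: bmZ|exact: bm_cst].
    rewrite expZ// exp_cst -/(media_mean j k).
    have : \int[nui j]_z clip1 (tnth z k) ^+ 2 <= 1.
      by apply: exp_le_cst => // z; rewrite -real_normK ?num_real// exprn_ile1 ?clip1_le.
    have := sqr_ge0 (media_mean j k); lra.
  by rewrite ler_piMr ?sqr_ge0// expr_le1 ?(ltW d0).
- by move=> j; apply: bmZ; apply: bmZ; exact: (bm_centered_z j k).
- move=> j m jm.
  have cc : \int[zeta]_z (centered j k (tnth z j) * centered m k (tnth z m)) = 0.
    rewrite (@indep_exp _ _ _ _ zeta coord _ _ _ media_indep [set j] [set m]).
    + by rewrite centered_exp mul0r.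
    + by move=> ?; exact: preimagesT.
    + by move=> ?; exact: preimagesI.
    + by move=> ?; apply: preimages_measurable; exact: measurable_tnth.
    + by rewrite disjoints1 inE.
    + apply: bm_comp (bm_centered j k) _.
      by apply: (@cyl_coordinate _ _ _ coord _ _ _ _ _ j) => //; [move=> ?; exact: preimagesT|rewrite inE].
    + apply: bm_comp (bm_centered m k) _.
      by apply: (@cyl_coordinate _ _ _ coord _ _ _ _ _ m) => //; [move=> ?; exact: preimagesT|rewrite inE].
  pose x := norm_weight e i j * d * (norm_weight e i m * d).
  transitivity (\int[zeta]_z (x * (centered j k (tnth z j) * centered m k (tnth z m)))).
    by apply: eq_Rintegral => z _; rewrite /x /centered; ring.
  by rewrite expZ ?cc ?mulr0//; apply: bmM; exact: bm_centered_z.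
Qed.

Lemma mse_le i k : mse i k <=
  c * av (mse ^~ k) i + a * mse i k + (drift i k ^+ 2 / d + spread i).
Proof.
pose y j r := nbr_mean j k r - u (label e j) k.
have by_ j : bm (y j) by apply: bmB; [exact: bm_nbr_mean|exact: bm_cst].
pose s r := c * av (y ^~ r) i + a * y i r + drift i k.
have bav : bm (fun r => av (y ^~ r) i) by apply: bm_sum => j _; exact: bmZ.
have bs : bm s by apply: bmD; [apply: bmD; exact: bmZ|exact: bm_cst].
have step z r : nbr_mean i k (cl_step z r) - u (label e i) k = s r + noise i k z.
  have -> : nbr_mean i k (cl_step z r) =
      av (fun j => a * clip1 (tnth (tnth r j) k) + d * clip1 (tnth (tnth z j) k)
       + c * tnth (belief e j) k * unlinked j + c * nbr_mean j k r) i.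
    by apply: eq_bigr => j _; rewrite clip1_id ?cl_step_le// cl_stepE.
  rewrite /s /drift /noise /y /average.
  set S1 := (X in _ = c * X + _ + _ + _).
  rewrite (_ : \sum_j _ = c * S1 + a * nbr_mean i k r +
     \sum_j norm_weight e i j * (c * u (label e j) k + signal_mean j k) +
     \sum_j norm_weight e i j * (d * (clip1 (tnth (tnth z j) k) - media_mean j k))).
    by ring.
  rewrite /S1 /nbr_mean /average !mulr_sumr -!big_split/=.
  by apply: eq_bigr => j _; rewrite /signal_mean; ring.
rewrite [leLHS]/mse [leLHS]stationary_exp; last by apply: bmX; apply: bmB; [exact: bm_nbr_mean|exact: bm_cst].
have inner r : \int[zeta]_z (nbr_mean i k (cl_step z r) - u (label e i) k) ^+ 2 <=
    s r ^+ 2 + spread i.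
  rewrite (_ : (fun z => _) = fun z => s r ^+ 2 + (2 * s r * noise i k z + noise i k z ^+ 2)); last first.
    by apply/funext => z; rewrite step; ring.
  have bN := bm_noise i k; have bN2 := bmX 2 bN.
  have b1 : bm (fun z => 2 * s r * noise i k z) by exact: bmZ.
  rewrite expD; [|exact: bm_cst|exact: bmD].
  by rewrite exp_cst expD// expZ// noise_exp mulr0 add0r lerD2l noise_sq.
have binner : bm (fun r => \int[zeta]_z (nbr_mean i k (cl_step z r) - u (label e i) k) ^+ 2).
  apply: (@bm_section _ _ _ _ _ zeta (fun x : n.-tuple V * n.-tuple V =>
    (nbr_mean i k (cl_step x.2 x.1) - u (label e i) k) ^+ 2)).
  apply: bmX; apply: bmB; last exact: bm_cst.
  by apply: bm_nbr_mean; exact: measurable_cl_step.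
have by2 j : bm (fun r => y j r ^+ 2) by exact: bmX.
have bav2 : bm (fun r => av (fun j => y j r ^+ 2) i) by apply: bm_sum => j _; exact: bmZ.
apply: (@le_trans _ _ (\int[mu]_r (c * av (fun j => y j r ^+ 2) i + a * y i r ^+ 2
    + (drift i k ^+ 2 / d + spread i)))).
  apply: exp_le => //.
    by apply: bmD; [apply: bmD; exact: bmZ|exact: bm_cst].
  move=> r; apply: (le_trans (inner r)); rewrite addrA lerD2r.
  have A : (av (y ^~ r) i) ^+ 2 <= av (fun j => y j r ^+ 2) i.
    apply: sq_convex => [j|]; first exact: norm_weight_ge0.
    exact: norm_weight_sum1.
  rewrite /s; move: (av _ i) (av _ i) A (y i r) (drift i k) => X2 X XX2 Y D.
  have -> : D ^+ 2 / d = d * (D / d) ^+ 2 by field; rewrite gt_eqF.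
  have {1}-> : D = d * (D / d) by field; rewrite gt_eqF.
  move: (D / d) => Z.
  have h0 := mulr_ge0 c0 a0; have h1 := mulr_ge0 c0 (ltW d0); have h2 := mulr_ge0 a0 (ltW d0).
  have -> : (c * X + a * Y + d * Z) ^+ 2 = c * X ^+ 2 + a * Y ^+ 2 + d * Z ^+ 2
     - (c * a * (X - Y) ^+ 2 + c * d * (X - Z) ^+ 2 + a * d * (Y - Z) ^+ 2) by ring.
  have t1 := mulr_ge0 h0 (sqr_ge0 (X - Y)); have t2 := mulr_ge0 h1 (sqr_ge0 (X - Z)).
  have t3 := mulr_ge0 h2 (sqr_ge0 (Y - Z)).
  have := ler_wpM2l c0 XX2; lra.
rewrite expD; [|by apply: bmD; exact: bmZ|exact: bm_cst].
rewrite exp_cst lerD2r expD; [|exact: bmZ|exact: bmZ].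
rewrite !expZ// exp_sum; last by move=> j _; exact: bmZ.
rewrite lerD2r ler_wpM2l//; apply: ler_sum => j _.
by rewrite expZ.
Qed.

Definition source i k := (drift i k ^+ 2 / d + spread i) / (c + d).

Lemma mse_bound S i k :
  mse i k <= \sum_(s < S) iter s av (source ^~ k) i + (c / (c + d)) ^+ S * 4.
Proof.
have cd0 : 0 < c + d by rewrite ltr_wpDl.
apply: (average_iterate w0 (h := mse ^~ k) (g := source ^~ k)) => //.
- by rewrite divr_ge0 ?(ltW cd0)//= ler_pdivrMr// mul1r lerDl ltW.
- move=> j; rewrite divr_ge0 ?(ltW cd0)// addr_ge0//.
    by rewrite mulr_ge0 ?sqr_ge0// invr_ge0 ltW.
  by apply: sumr_ge0 => m _; rewrite sqr_ge0.
- move=> j; apply: exp_le_cst.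
    by apply: bmX; apply: bmB; [exact: bm_nbr_mean|exact: bm_cst].
  move=> r; have := nbr_mean_le j k r; have := u1 (label e j) k.
  rewrite !ler_norml => /andP[u2 u3] /andP[v2 v3].
  rewrite -real_normK ?num_real// (_ : 4 = 2 ^+ 2 :> R); last by ring.
  by rewrite lerXn2r ?nnegrE// ler_norml; apply/andP; split; lra.
- move=> j; have := mse_le j k; rewrite /source => h.
  rewrite mulrAC -mulrDl ler_pdivlMr//; lra.
Qed.

Definition nbr_error i : R :=
  c * \sum_k (\int[mu]_r `|nbr_mean i k r - u (label e i) k| +
              `|unlinked i - (ni (label e i))%:R|).

Lemma nbr_abs_le lam i k : 0 < lam ->
  \int[mu]_r `|nbr_mean i k r - u (label e i) k| <= lam + lam^-1 * mse i k.
Proof.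
move=> lam0; rewrite -expZ; last by apply: bmX; apply: bmB; [exact: bm_nbr_mean|exact: bm_cst].
have b1 : bm (fun r => nbr_mean i k r - u (label e i) k).
  by apply: bmB; [exact: bm_nbr_mean|exact: bm_cst].
rewrite -[X in X + _](exp_cst mu) -expD; [|exact: bm_cst|by apply: bmZ; exact: bmX].
apply: exp_le; first exact: bm_norm.
  by apply: bmD; [exact: bm_cst|apply: bmZ; exact: bmX].
move=> r; move: (_ - _) => x; rewrite -[x ^+ 2]real_normK ?num_real//.
move: `|x| (normr_ge0 x) => y y0.
rewrite -(ler_pM2l lam0) mulrDr mulrA divff ?gt_eqF// mul1r -subr_ge0.
have -> : lam * lam + y ^+ 2 - lam * y = (lam - y) ^+ 2 + lam * y by ring.
by rewrite addr_ge0 ?sqr_ge0// mulr_ge0// ltW.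
Qed.

Notation updi i := (upd c d u ni (label e i) (belief e i)).
Notation Lami i := (Lam c d nu u ni (label e i)).

Lemma cl_step_upd i z r : dclip (tnth (cl_step z r) i) (updi i (tnth z i) (tnth r i)) <=
  c * \sum_k (`|nbr_mean i k r - u (label e i) k| + `|unlinked i - (ni (label e i))%:R|).
Proof.
rewrite /dclip mulr_sumr; apply: ler_sum => k _.
apply: (le_trans (clip1_lip _ _)); rewrite cl_stepE tnth_mktuple (@clip1_id _ (tnth (belief e i) k)); last exact: q1.
rewrite (_ : _ - _ = c * ((nbr_mean i k r - u (label e i) k) +
   tnth (belief e i) k * (unlinked i - (ni (label e i))%:R))); last by ring.
rewrite normrM (ger0_norm c0) ler_wpM2l// (le_trans (ler_normD _ _))// lerD2l.
by rewrite normrM ler_piMl// q1.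
Qed.

Lemma product_step m (v : 'I_m -> 'I_n) (phi : 'I_m -> V * V -> R) L :
  injective v -> (forall b, bm (phi b)) -> (forall b p, `|phi b p| <= 1) ->
  0 <= L -> (forall b, lip1 L (phi b)) ->
  `|\int[mu]_r \prod_b phi b (belief e (v b), tnth r (v b)) -
    \int[mu]_r \prod_b Lami (v b) (phi b) (belief e (v b), tnth r (v b))|
  <= L * \sum_b nbr_error (v b).
Proof.
move=> vinj bphi phi1 L0 Lphi.
have bpair (b : 'I_m) (f : V * V -> R) d1 (T : measurableType d1) (g : T -> n.-tuple V) :
    bm f -> measurable_fun setT g -> bm (fun r => f (belief e (v b), tnth (g r) (v b))).
  move=> bf mg; apply: (bm_comp bf); apply: measurable_fun_pair; first exact: measurable_cst.
  exact: (measurableT_comp (measurable_tnth (v b))).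
rewrite stationary_exp; last by apply: bm_prod => b _; exact: (bpair b _ _ _ id).
have mz i : measurable_fun setT (fun z : n.-tuple V => tnth z i) by exact: measurable_tnth.
have bupd b r : bm (fun z : V => phi b (belief e (v b), updi (v b) z (tnth r (v b)))).
  exact: bm_upd_z.
have LamE r : \prod_b Lami (v b) (phi b) (belief e (v b), tnth r (v b)) =
    \int[zeta]_z \prod_b phi b (belief e (v b), updi (v b) (tnth z (v b)) (tnth r (v b))).
  rewrite (@exp_prod_indep _ _ _ zeta _ coord _ (index_enum 'I_m) v
    (fun b z => phi b (belief e (v b), updi (v b) (tnth z (v b)) (tnth r (v b))))) //.
  - by apply: eq_bigr => b _; rewrite (media_exp (v b) (bupd b r)).
  - by move=> ?; exact: preimagesT.
  - by move=> ?; exact: preimagesI.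
  - by move=> ?; apply: preimages_measurable; exact: measurable_tnth.
  - exact: media_indep.
  - exact: index_enum_uniq.
  - move=> b S bS; apply: bm_comp (bupd b r) _.
    by apply: (@cyl_coordinate _ _ _ coord _ _ _ _ _ (v b)) => // ?; exact: preimagesT.
pose f1 (x : n.-tuple V * n.-tuple V) : R :=
  \prod_b phi b (belief e (v b), tnth (cl_step x.2 x.1) (v b)).
pose f2 (x : n.-tuple V * n.-tuple V) : R :=
  \prod_b phi b (belief e (v b), updi (v b) (tnth x.2 (v b)) (tnth x.1 (v b))).
have bf1 : bm f1 by apply: bm_prod => b _; apply: bpair => //; exact: measurable_cl_step.
have bf2 : bm f2.
  apply: bm_prod => b _.
  apply: (@bm_upd _ _ _ _ _ _ _ _ _ _ (fun=> belief e (v b)) (fun x => tnth x.2 (v b))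
     (fun x => tnth x.1 (v b))) => //.
  - exact: measurableT_comp (mz (v b)) measurable_snd.
  - exact: measurableT_comp (mz (v b)) measurable_fst.
rewrite -expB; last 2 first.
- exact: (@bm_section _ _ _ _ _ zeta f1 bf1).
- rewrite (_ : (fun r => _) = fun r => \int[zeta]_z f2 (r, z)); first exact: bm_section.
  by apply/funext => r; rewrite LamE.
have babs k b : bm (fun r => `|nbr_mean (v b) k r - u (label e (v b)) k|).
  by apply: bm_norm; apply: bmB; [exact: bm_nbr_mean|exact: bm_cst].
pose g r := L * \sum_b (c * \sum_k (`|nbr_mean (v b) k r - u (label e (v b)) k| +
   `|unlinked (v b) - (ni (label e (v b)))%:R|)).
have bg : bm g.
  apply: bmZ; apply: bm_sum => b _; apply: bmZ; apply: bm_sum => k _.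
  by apply: bmD => //; exact: bm_cst.
apply: (@le_trans _ _ (\int[mu]_r g r)).
  apply: exp_abs_le => //.
    apply: bmB; first exact: (@bm_section _ _ _ _ _ zeta f1 bf1).
    rewrite (_ : (fun r => _) = fun r => \int[zeta]_z f2 (r, z)); first exact: bm_section.
    by apply/funext => r; rewrite LamE.
  move=> r; rewrite LamE.
  have b1 : bm (fun z => f1 (r, z)) by apply: (bm_comp bf1); exact: measurable_fun_pair.
  have b2 : bm (fun z => f2 (r, z)) by apply: (bm_comp bf2); exact: measurable_fun_pair.
  rewrite -(expB zeta b1 b2); apply: exp_abs_cst; first exact: bmB.
  move=> z; apply: (le_trans (prod_diff_le _ _ _)) => //.
  rewrite /g mulr_sumr; apply: ler_sum => b _.
  by apply: (le_trans (Lphi _ _ _ _)); rewrite ler_wpM2l// cl_step_upd.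
rewrite /g expZ; last first.
  apply: bm_sum => b _; apply: bmZ; apply: bm_sum => k _.
  by apply: bmD => //; exact: bm_cst.
rewrite ler_wpM2l// exp_sum; last first.
  move=> b _; apply: bmZ; apply: bm_sum => k _; by apply: bmD => //; exact: bm_cst.
apply: ler_sum => b _; rewrite /nbr_error expZ; last first.
  by apply: bm_sum => k _; apply: bmD => //; exact: bm_cst.
rewrite ler_wpM2l// exp_sum; last by move=> k _; apply: bmD => //; exact: bm_cst.
by apply: ler_sum => k _; rewrite expD ?exp_cst//; exact: bm_cst.
Qed.

Lemma product_steps T m (v : 'I_m -> 'I_n) (phi : 'I_m -> V * V -> R) L :
  injective v -> (forall b, bm (phi b)) -> (forall b p, `|phi b p| <= 1) ->
  0 <= L -> (forall b, lip1 L (phi b)) ->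
  `|\int[mu]_r \prod_b phi b (belief e (v b), tnth r (v b)) -
    \int[mu]_r \prod_b iter T (Lami (v b)) (phi b) (belief e (v b), tnth r (v b))|
  <= T%:R * L * \sum_b nbr_error (v b).
Proof.
move=> vinj bphi phi1 L0 Lphi.
have err0 : 0 <= \sum_b nbr_error (v b).
  apply: sumr_ge0 => b _; rewrite mulr_ge0//; apply: sumr_ge0 => k _.
  by rewrite addr_ge0// exp_ge0.
elim: T => [|T IH]; first by rewrite subrr normr0 !mul0r.
set A := \int[mu]_r _ in IH *.
pose B t := \int[mu]_r \prod_b iter t (Lami (v b)) (phi b) (belief e (v b), tnth r (v b)).
rewrite -/(B T) -/(B T.+1) in IH *.
rewrite (_ : A - B T.+1 = (A - B T) + (B T - B T.+1)); last by ring.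
apply: (le_trans (ler_normD _ _)).
rewrite -natr1 !mulrDl mul1r lerD// {IH}.
apply: (@product_step m v (fun b => iter T (Lami (v b)) (phi b))) => //.
- by move=> b; exact: bm_LamT.
- by move=> b; exact: LamT_le1.
- move=> b q x y; apply: (le_trans (@LamT_lip _ _ _ c d nu u ni a0 T (label e (v b)) (phi b) L (bphi b) L0 (Lphi b) _ _ _)).
  by rewrite ler_wpM2r ?sumr_ge0// ler_piMl// exprn_ile1// a_le1.
Qed.

(** After [T] steps the initial opinions are forgotten up to a^T. *)
Lemma product_limit T m (v : 'I_m -> 'I_n) (phi : 'I_m -> V * V -> R) L (y0 : V) :
  injective v -> (forall b, bm (phi b)) -> (forall b p, `|phi b p| <= 1) ->
  0 <= L -> (forall b, lip1 L (phi b)) ->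
  `|\int[mu]_r \prod_b phi b (belief e (v b), tnth r (v b)) -
    \prod_b iter T (Lami (v b)) (phi b) (belief e (v b), y0)|
  <= \sum_b (T%:R * L * nbr_error (v b) + a ^+ T * L * (2 * l%:R)).
Proof.
move=> vinj bphi phi1 L0 Lphi.
rewrite big_split/= -mulr_sumr.
set A := \int[mu]_r _; set C := \prod_b _.
pose h r := \prod_b iter T (Lami (v b)) (phi b) (belief e (v b), tnth r (v b)).
have bh : bm h.
  apply: bm_prod => b _.
  apply: (bm_comp (g := fun r => (belief e (v b), tnth r (v b))) (bm_LamT c d nu u ni T (label e (v b)) (bphi b))).
  by apply: measurable_fun_pair; [exact: measurable_cst|exact: measurable_tnth].
rewrite (_ : A - C = (A - \int[mu]_r h r) + (\int[mu]_r h r - C)); last by ring.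
apply: (le_trans (ler_normD _ _)); apply: lerD; first exact: product_steps.
rewrite -[C](exp_cst mu) -expB//; last exact: bm_cst.
apply: exp_abs_cst; first by apply: bmB => //; exact: bm_cst.
move=> r; apply: (le_trans (prod_diff_le _ _ _)).
- by move=> b; exact: LamT_le1.
- by move=> b; exact: LamT_le1.
apply: ler_sum => b _; apply: (le_trans (@LamT_lip _ _ _ c d nu u ni a0 T (label e (v b)) (phi b) L (bphi b) L0 (Lphi b) _ _ _)).
rewrite ler_wpM2l// ?mulr_ge0// ?exprn_ge0//.
apply: (@le_trans _ _ (\sum_(k < l) 2)).
  apply: ler_sum => k _; apply: (le_trans (ler_normB _ _)).
  have := clip1_le (tnth (tnth r (v b)) k); have := clip1_le (tnth y0 k); lra.
by rewrite sumr_const card_ord mulr_natr.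
Qed.

Definition media_avg (r : 'I_K) (k : 'I_l) (q : V) : R :=
  \int[kat (nu r) q]_z clip1 (tnth z k).

(* The limiting mean opinion of a vertex of community r with belief q, times c + d. *)
Definition mean_mark (r : 'I_K) (k : 'I_l) (q : V) : R :=
  c * u r k + (d * media_avg r k q + c * clip1 (tnth q k) * (ni r)%:R).

Definition unlinked_error (i : 'I_n) : R := `|unlinked i - (ni (label e i))%:R|.

Definition mark_error (k : 'I_l) (i : 'I_n) : R :=
  `|\sum_j norm_weight e i j * mean_mark (label e j) k (belief e j)
    - (c + d) * u (label e i) k|.

Definition local_error (k : 'I_l) (i : 'I_n) : R :=
  mark_error k i + unlinked_error i + spread i.

Lemma media_avg_le r k q : `|media_avg r k q| <= 1.
Proof.
apply: exp_abs_cst; last by move=> z; exact: clip1_le.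
by apply: bm_clip1; exact: measurable_tnth.
Qed.

Lemma mean_mark_le r k q : `|mean_mark r k q| <= 2.
Proof.
apply: (@le_trans _ _ (c + (d + c))); last by have := cd1; have := c0; have := d0; lra.
have clq := clip1_le (tnth q k).
apply: (le_trans (ler_normD _ _)); apply: lerD.
  by rewrite normrM (ger0_norm c0) ler_piMr.
apply: (le_trans (ler_normD _ _)); apply: lerD.
  by rewrite normrM (gtr0_norm d0) ler_piMr ?(ltW d0)// media_avg_le.
rewrite !normrM (ger0_norm c0) -mulrA ler_piMr//.
by case: (ni r); rewrite ?normr1 ?normr0 ?mulr1 ?mulr0.
Qed.

Lemma spread_ge0 i : 0 <= spread i.
Proof. by apply: sumr_ge0 => m _; rewrite sqr_ge0. Qed.

Lemma spread_le1 i : spread i <= 1.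
Proof.
apply: le_trans (norm_weight_sum1 w0 i); apply: ler_sum => m _.
rewrite expr2 ler_piMr ?norm_weight_ge0//.
apply: le_trans (norm_weight_sum1 w0 i); rewrite (bigD1 m)//= lerDl.
by apply: sumr_ge0 => x _; exact: norm_weight_ge0.
Qed.

Lemma unlinked_error_le1 i : unlinked_error i <= 1.
Proof.
rewrite /unlinked_error /unlinked; case: (_ == _); case: (ni _);
by rewrite /= ?subrr ?subr0 ?sub0r ?normrN ?normr1 ?normr0.
Qed.

Let cd_norm x y (z : R) : `|z| <= 1 -> `|x| <= 2 -> y = x - (c + d) * z -> `|y| <= 3.
Proof.
move=> z1 x1 ->; apply: (le_trans (ler_normB _ _)).
have cd_ge0 : 0 <= c + d by rewrite addr_ge0// ltW.
have : `|(c + d) * z| <= 1 by rewrite normrM (ger0_norm cd_ge0) mulr_ile1.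
lra.
Qed.

Lemma mark_error_le3 k i : mark_error k i <= 3.
Proof.
apply: (cd_norm (u1 (label e i) k)); last by [].
by apply: average_norm => // j; exact: mean_mark_le.
Qed.

Lemma local_error_ge0 k i : 0 <= local_error k i.
Proof. by apply: addr_ge0 (spread_ge0 i); apply: addr_ge0; exact: normr_ge0. Qed.

Lemma local_error_le k i : local_error k i <= 5.
Proof.
rewrite (_ : 5 = 3 + 1 + 1 :> R); last by ring.
by rewrite !lerD ?mark_error_le3 ?unlinked_error_le1 ?spread_le1.
Qed.

Lemma drift_le k i : `|drift i k| <= mark_error k i + av unlinked_error i.
Proof.
rewrite (_ : drift i k = (\sum_j norm_weight e i j * mean_mark (label e j) k (belief e j)
    - (c + d) * u (label e i) k) + \sum_j norm_weight e i j *
    (c * tnth (belief e j) k * (unlinked j - (ni (label e j))%:R))); last first.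
  rewrite /drift /average addrAC; congr (_ - _); rewrite -big_split/=.
  apply: eq_bigr => j _; rewrite -mulrDr /mean_mark /signal_mean clip1_id; last exact: q1.
  by rewrite /media_avg -/(media_mean j k); ring.
apply: (le_trans (ler_normD _ _)); rewrite lerD2l.
apply: (le_trans (ler_norm_sum _ _ _)); apply: ler_sum => j _.
rewrite normrM (ger0_norm (norm_weight_ge0 w0 i j)) ler_wpM2l ?norm_weight_ge0//.
rewrite normrM ler_piMl// normrM mulr_ile1// ?q1// ger0_norm//.
by have := cd1; have := d0; lra.
Qed.

Definition source_const : R := (4 / d + 1) / (c + d).

Lemma source_const_ge0 : 0 <= source_const.
Proof. by rewrite divr_ge0 ?addr_ge0 ?divr_ge0 ?(ltW d0). Qed.

Lemma source_le i k : source i k <= source_const * (local_error k i + av (local_error k) i).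
Proof.
have cd0 : 0 < c + d by rewrite ltr_wpDl.
rewrite /source /source_const [leRHS]mulrAC ler_wpM2r ?invr_ge0 ?(ltW cd0)//.
have av0 : 0 <= av (local_error k) i by apply: average_ge0 => // j; exact: local_error_ge0.
have ava : av unlinked_error i <= av (local_error k) i.
  apply: average_le => // j; rewrite /local_error.
  have : 0 <= mark_error k j by exact: normr_ge0.
  have := spread_ge0 j; lra.
have dr := drift_le k i; have un1 : av unlinked_error i <= 1.
  apply: le_trans (average_cst_le w0 i ler01); apply: average_le => // j.
  exact: unlinked_error_le1.
have dr4 : `|drift i k| <= 4 by have := mark_error_le3 k i; lra.
have drsq : drift i k ^+ 2 <= 4 * (mark_error k i + av unlinked_error i).
  by rewrite -real_normK ?num_real// expr2 ler_pM.
have le0 := local_error_ge0 k i; have sp0 := spread_ge0 i.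
have me0 : 0 <= mark_error k i by exact: normr_ge0.
have ue0 : 0 <= unlinked_error i by exact: normr_ge0.
have leE : local_error k i = mark_error k i + unlinked_error i + spread i by [].
rewrite mulrDl mul1r; apply: lerD; last lra.
rewrite [leRHS]mulrAC ler_wpM2r ?invr_ge0 ?(ltW d0)//; lra.
Qed.

Lemma iter_average_source s i k : iter s av (source ^~ k) i <=
  source_const * (iter s av (local_error k) i + iter s.+1 av (local_error k) i).
Proof.
elim: s i => [|s IH] i; first exact: source_le.
apply: (le_trans (average_le w0 IH i)).
rewrite (_ : (fun _ => _) = fun j => source_const * iter s av (local_error k) j +
    source_const * iter s.+1 av (local_error k) j); last first.
  by apply/funext => j; rewrite mulrDr.
by rewrite averageZD mulrDr.
Qed.

Definition error_bound (S : nat) (lam : R) (i : 'I_n) : R :=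
  \sum_k (lam + lam^-1 * (2 * source_const * (\sum_(s < S.+1) iter s av (local_error k) i)
    + (c / (c + d)) ^+ S * 4) + unlinked_error i).

Lemma nbr_error_le S lam i : 0 < lam -> nbr_error i <= error_bound S lam i.
Proof.
move=> lam0; have c1 : c <= 1 by have := cd1; have := d0; lra.
have err0 : 0 <= \sum_k (\int[mu]_r `|nbr_mean i k r - u (label e i) k| +
    `|unlinked i - (ni (label e i))%:R|).
  by apply: sumr_ge0 => k _; rewrite addr_ge0// exp_ge0.
apply: (@le_trans _ _ (\sum_k (\int[mu]_r `|nbr_mean i k r - u (label e i) k| +
    `|unlinked i - (ni (label e i))%:R|))); first by rewrite ler_piMl.
apply: ler_sum => k _; rewrite lerD2r.
apply: (le_trans (nbr_abs_le i k lam0)); rewrite lerD2l ler_wpM2l ?invr_ge0 ?(ltW lam0)//.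
apply: (le_trans (mse_bound S i k)); rewrite lerD2r.
apply: (@le_trans _ _ (\sum_(s < S) source_const * (iter s av (local_error k) i
    + iter s.+1 av (local_error k) i))).
  by apply: ler_sum => s _; exact: iter_average_source.
have it0 s : 0 <= iter s av (local_error k) i.
  by apply: iter_average_ge0 => // j; exact: local_error_ge0.
rewrite -[leLHS]mulr_sumr (_ : 2 * source_const * _ = source_const *
  (\sum_(s < S.+1) iter s av (local_error k) i + \sum_(s < S.+1) iter s av (local_error k) i)).
  2: by ring.
rewrite ler_wpM2l ?source_const_ge0// big_split/= lerD//.
  by rewrite big_ord_recr/= lerDl.
by rewrite big_ord_recl/= lerDr local_error_ge0.
Qed.

End Stationary.
End Quenched.

(** * From the quenched to the annealed law *)

Import HBNNSimple.

(** The integral of a nonnegative function is a lower integral even without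
   measurability, so it is approached by measurable minorants. *)
Lemma measurable_minorant (R : realType) d (T : measurableType d)
    (P : probability T R) (D : set T) (f : T -> R) (eta : R) :
  (forall w, 0 <= f w <= 1) -> 0 < eta ->
  exists g : T -> R, [/\ bm g, forall w, 0 <= g w <= 1, forall w, D w -> g w <= f w &
    \int[P]_(w in D) f w <= \int[P]_w (g w * \1_D w) + eta].
Proof.
move=> f01 eta0.
have intE : (\int[P]_(w in D) (f w)%:E)%E = ereal_sup [set sintegral P h |
    h in [set h : {nnsfun T >-> R} | forall x, ((h x)%:E <= ((EFin \o f) \_ D) x)%E]].
  by rewrite ge0_integralE// => w _; rewrite lee_fin; case/andP: (f01 w).
have hfD (h : {nnsfun T >-> R}) x : ((h x)%:E <= ((EFin \o f) \_ D) x)%E ->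
    h x <= f x /\ (~ D x -> h x = 0).
  rewrite patchE; case: ifPn => [Dx|Dx]; rewrite lee_fin => h1.
    by split => // nD; move: Dx; rewrite inE.
  have h0 : h x = 0 by apply/eqP; rewrite eq_le h1 fun_ge0.
  by split => //; rewrite h0; case/andP: (f01 x).
have bh (h : {nnsfun T >-> R}) : (forall x, ((h x)%:E <= ((EFin \o f) \_ D) x)%E) ->
    bm (h : T -> R) /\ forall x, 0 <= h x <= 1.
  move=> hf; have h01 x : 0 <= h x <= 1.
    rewrite fun_ge0 /=; have [h1 _] := hfD h x (hf x).
    by apply: (le_trans h1); case/andP: (f01 x).
  split => //; split; first exact: measurable_funP.
  by exists 1 => x; have /andP[h0 h1] := h01 x; rewrite ger0_norm.
have sE (h : {nnsfun T >-> R}) : (forall x, ((h x)%:E <= ((EFin \o f) \_ D) x)%E) ->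
    sintegral P h = (\int[P]_x h x)%:E.
  move=> hf; have [bh1 h01] := bh h hf.
  rewrite /Rintegral fineK; last first.
    by apply: integrable_fin_num => //; exact: bm_integrable.
  by rewrite integralT_nnsfun.
have fin : (\int[P]_(w in D) (f w)%:E)%E \is a fin_num.
  rewrite ge0_fin_numE; last first.
    by apply: integral_ge0 => w _; rewrite lee_fin; case/andP: (f01 w).
  rewrite intE; apply: (@le_lt_trans _ _ 1%E); last exact: ltry.
  apply: ge_ereal_sup => _ [h hf <-]; rewrite sE// lee_fin.
  have [bh1 h01] := bh h hf.
  by apply: exp_le_cst => // w; case/andP: (h01 w).
rewrite intE in fin.
have [_ [h hf <-] hsup] := ub_ereal_sup_adherent eta0 fin.
have [bh1 h01] := bh h hf.
exists h; split => //.
  by move=> w _; case: (hfD h w (hf w)).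
have -> : \int[P]_w (h w * \1_D w) = \int[P]_w h w.
  apply: eq_Rintegral => w _; rewrite indicE; have [Dw|/= nDw] := boolP (w \in D).
    by rewrite mulr1.
  rewrite mulr0; case: (hfD h w (hf w)) => _ -> // Dw; move: nDw.
  by rewrite notin_setE.
have -> : \int[P]_(w in D) f w = fine (\int[P]_(w in D) (f w)%:E)%E by [].
rewrite intE -lerBlDr -lee_fin EFinB -sE// fineK//.
exact: ltW.
Qed.

(** The conditional law [mu w] is only given as a function of [w], without
   measurability, so the disintegration is used one level set at a time. *)
Lemma annealed_le (R : realType) d (T : measurableType d) d' (Y : measurableType d')
    (P : probability T R) (X : {RV P >-> Y}) (mu : T -> probability Y R) (D : set T)
    (Phi : Y -> R) (h : T -> R) :
  measurable D ->
  (forall S, measurable S -> Pr P (D `&` [set w | S (X w)]) =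
     \int[P]_(w in D) Pr (mu w) S) ->
  bm Phi -> bm h -> (forall w, D w -> \int[mu w]_y Phi y <= h w) ->
  \int[P]_w (Phi (X w) * \1_D w) <= \int[P]_w (h w * \1_D w).
Proof.
move=> mD dis bPhi0 bh0 hD0.
have bX (f : Y -> R) : bm f -> bm (fun w => f (X w)).
  by move=> bf; apply: (bm_comp bf); exact: measurable_funP.
have bD : bm (\1_D : T -> R) by exact: bm_indic.
have [b [b' [f [b0 bf f01 fE]]]] := bm_affine01 bPhi0.
suff main h' : bm h' -> (forall w, D w -> \int[mu w]_y f y <= h' w) ->
    \int[P]_w (f (X w) * \1_D w) <= \int[P]_w (h' w * \1_D w).
  have := main (fun w => b^-1 * (h w - b')).
  have bh' : bm (fun w => b^-1 * (h w - b')).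
    by apply: bmZ; apply: bmB => //; exact: bm_cst.
  have eqf : \int[P]_w (Phi (X w) * \1_D w) =
      b * \int[P]_w (f (X w) * \1_D w) + b' * \int[P]_w \1_D w.
    rewrite -!expZ//; last by apply: bmM => //; exact: bX.
    rewrite -expD; [|by apply: bmZ; apply: bmM => //; exact: bX|exact: bmZ].
    by apply: eq_Rintegral => w _; rewrite fE; ring.
  have eqh : \int[P]_w (h w * \1_D w) =
      b * \int[P]_w (b^-1 * (h w - b') * \1_D w) + b' * \int[P]_w \1_D w.
    rewrite -!expZ//; last exact: bmM.
    rewrite -expD; [|by apply: bmZ; exact: bmM|exact: bmZ].
    by apply: eq_Rintegral => w _; field; rewrite gt_eqF.
  move=> /(_ bh') H; rewrite eqf eqh lerD2r ler_pM2l//; apply: H => w Dw.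
  rewrite ler_pdivlMl// lerBrDr; apply: le_trans (hD0 w Dw).
  rewrite -[b' in leLHS](exp_cst (mu w)) -expZ// -expD ?fE//; [exact: bmZ|exact: bm_cst].
move=> bh' hD'.
apply/ler_addgt0Pr => eps eps0.
pose N := (Num.truncn (2 / eps)).+1.
have NR : 0 < N%:R :> R by rewrite ltr0n.
have Neps : 2 * N%:R^-1 <= eps.
  rewrite ler_pdivrMr// -ler_pdivrMl// mulrC; apply/ltW; exact: truncnS_gt.
pose S (k : 'I_N) := [set y | k.+1%:R / N%:R <= f y].
have mS k : measurable (S k) by exact: bm_set_ge.
have Ninv : 0 < N%:R^-1 :> R by rewrite invr_gt0.
have S01 k w : 0 <= Pr (mu w) (S k) <= 1.
  rewrite -(exp_indic _ (mS k)) exp_ge0//=; apply: exp_le_cst; first exact: bm_indic.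
  by move=> y; rewrite indicE; case: (_ \in _).
have /choice[g gP] : forall k, exists g : T -> R, [/\ bm g, forall w, 0 <= g w <= 1,
    forall w, D w -> g w <= Pr (mu w) (S k) &
    \int[P]_(w in D) Pr (mu w) (S k) <= \int[P]_w (g w * \1_D w) + N%:R^-1].
  by move=> k; apply: measurable_minorant => // w; exact: S01.
have bg k : bm (g k) by case: (gP k).
have bgD k : bm (fun w => g k w * \1_D w) by exact: bmM.
have bSX k : bm (fun w => (\1_(S k) (X w) * \1_D w : R)).
  by apply: bmM => //; apply: bX; exact: bm_indic.
apply: (@le_trans _ _ (N%:R^-1 * \sum_k \int[P]_w (\1_(S k) (X w) * \1_D w : R) + N%:R^-1)).
  rewrite -exp_sum// -expZ//; last exact: bm_sum.
  rewrite -[X in _ + X](exp_cst P) -expD; [|by apply: bmZ; exact: bm_sum|exact: bm_cst].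
  apply: exp_le; first by apply: bmM => //; exact: bX.
    by apply: bmD; [apply: bmZ; exact: bm_sum|exact: bm_cst].
  move=> w; rewrite -mulr_suml mulrA -/(staircase N f (X w)).
  have /andP[_] := staircaseP (N := N) isT (f01 (X w)).
  move: (staircase _ _ _) => s; rewrite indicE; case: (_ \in _) => /=; first by rewrite !mulr1.
  by rewrite !mulr0 add0r invr_ge0.
have dk k : \int[P]_w (\1_(S k) (X w) * \1_D w : R) <= \int[P]_w (g k w * \1_D w) + N%:R^-1.
  have [_ _ _ h4] := gP k; apply: le_trans h4; rewrite -dis//.
  have mSX : measurable (D `&` [set w | S k (X w)]).
    apply: measurableI => //; rewrite -[X in measurable X]setTI.
    by apply: (measurable_funP X) => //; exact: mS.
  rewrite -(exp_indic _ mSX) le_eqVlt; apply/orP; left; apply/eqP.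
  by apply: eq_Rintegral => w _; rewrite indicI mulrC.
apply: (@le_trans _ _ (N%:R^-1 * \sum_k (\int[P]_w (g k w * \1_D w) + N%:R^-1) + N%:R^-1)).
  by rewrite lerD2r ler_pM2l//; apply: ler_sum => k _.
rewrite big_split/= sumr_const card_ord -[N%:R^-1 *+ N]mulr_natr mulVf ?gt_eqF//.
rewrite mulrDr mulr1 -addrA -mulr2n -[N%:R^-1 *+ 2]mulr_natl.
apply: lerD => //.
rewrite -exp_sum// -expZ; last exact: bm_sum.
apply: exp_le; first by apply: bmZ; exact: bm_sum.
  exact: bmM.
move=> w; rewrite -mulr_suml mulrA indicE; have [Dw|_] := boolP (w \in D); last by rewrite !mulr0.
rewrite !mulr1; have Dw' : D w by rewrite inE in Dw.
apply: le_trans (hD' w Dw').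
apply: (@le_trans _ _ (\int[mu w]_y staircase N f y)).
  rewrite /staircase expZ; last by apply: bm_sum => k _; apply: bm_indic; exact: mS.
  rewrite exp_sum; last by move=> k _; apply: bm_indic; exact: mS.
  rewrite ler_pM2l//; apply: ler_sum => k _; rewrite exp_indic; last exact: (mS k).
  by case: (gP k) => _ _ h3 _; exact: h3.
apply: (@exp_le _ _ _ (mu w) (staircase N f) f) => //; first exact: bm_staircase.
by move=> y; have /andP[] := staircaseP (N := N) isT (f01 y).
Qed.

(** * Conditioning on an event *)

Section Conditioning.
Context {R : realType} {d : measure_display} {T : measurableType d}.
Variables (P : probability T R) (D : set T) (mD : measurable D).

Definition condp : probability T R := mnormalize (mrestr P mD) P.

Hypothesis PD : P D != 0%E.

Lemma condpE (A : set T) : measurable A -> Pr condp A = Pr P (A `&` D) / Pr P D.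
Proof.
move=> mA; rewrite /Pr /condp /= /mnormalize /=.
have mE B : mrestr P mD B = P (B `&` D) by [].
rewrite !mE setTI (negbTE PD) /=.
have fD : P D \is a fin_num by exact: fin_num_measure.
have fA : P (A `&` D) \is a fin_num.
  by apply: fin_num_measure; exact: measurableI.
rewrite ifF; last by apply/negbTE; move: fD; rewrite fin_numE => /andP[].
by rewrite fineM.
Qed.

Lemma Pr_gt0 : 0 < Pr P D.
Proof.
rewrite lt_neqAle fine_ge0// andbT eq_sym; apply: contra PD => /eqP h.
by rewrite -[P D]fineK -?/(Pr P D) ?h//; exact: fin_num_measure.
Qed.

Lemma condp_exp (f : T -> R) : bm f ->
  \int[condp]_x f x = (\int[P]_x (f x * \1_D x)) / Pr P D.
Proof.
move=> bf; apply/eqP; rewrite -subr_eq0; apply/eqP.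
have bD : bm (\1_D : T -> R) by exact: bm_indic.
have p0 := Pr_gt0.
apply: (@linear_ext _ _ _ (fun f => \int[condp]_x f x -
  (\int[P]_x (f x * \1_D x)) / Pr P D) (1 + (Pr P D)^-1) _ _ _ _ f bf).
- move=> g h bg bh; rewrite !expD//.
  under [X in X / _]eq_Rintegral do rewrite mulrDl.
  by rewrite expD; [ring|exact: bmM|exact: bmM].
- move=> b g bg; rewrite expZ//.
  under [X in X / _]eq_Rintegral do rewrite -mulrA.
  by rewrite expZ; [ring|exact: bmM].
- move=> g b bg gb; apply: (le_trans (ler_normB _ _)).
  rewrite mulrDl mul1r lerD//; first exact: exp_abs_cst.
  rewrite normrM [X in _ * X]ger0_norm ?invr_ge0 ?(ltW p0)// mulrC ler_wpM2l//.
    by rewrite invr_ge0 ltW.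
  apply: exp_abs_cst; first exact: bmM.
  move=> x; rewrite normrM indicE; case: (_ \in _); rewrite ?normr1 ?mulr1//.
  by rewrite normr0 mulr0; apply: le_trans (gb x).
- move=> A mA; rewrite exp_indic// condpE// -exp_indic; last exact: measurableI.
  by apply/eqP; rewrite subr_eq0 indicI.
Qed.

Lemma condE_condp (f : T -> R) : bm f -> condE P D f = \int[condp]_x f x.
Proof. by move=> bf; rewrite /condE exp_in condp_exp. Qed.

Lemma condp_supp : Pr condp D = 1.
Proof. by rewrite condpE// setIid divff// gt_eqF// Pr_gt0. Qed.

End Conditioning.

Lemma exp_zero_of (R : realType) d (T : measurableType d) (P : probability T R)
    (f g : T -> R) : bm f -> bm g -> (forall x, 0 <= f x) ->
  \int[P]_x f x = 0 -> (forall x, f x = 0 -> g x = 0) -> \int[P]_x g x = 0.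
Proof.
move=> bf bg f0 If0 fg.
have mf : measurable_fun setT (EFin \o f) by apply/measurable_EFinP; case: bf.
have mg : measurable_fun setT (EFin \o g) by apply/measurable_EFinP; case: bg.
have fin : (\int[P]_x (f x)%:E)%E \is a fin_num.
  by apply: integrable_fin_num => //; exact: bm_integrable.
have I0 : (\int[P]_x `|(EFin \o f) x| = 0)%E.
  under eq_integral do rewrite /= ger0_norm//.
  by rewrite -[LHS]fineK// -/(Rintegral P setT f) If0.
have [N [mN N0 hN]] := (ae_eq_integral_abs P measurableT mf).1 I0.
rewrite /Rintegral (ae_eq_integral (cst 0%E)) ?integral0//.
exists N; split => // x /= ngx; apply: hN => /= h; apply: ngx => _.
by congr EFin; apply: fg; have [] := h I.
Qed.

(** * The environment given the labels *)

Lemma measurable_forall_ord d (T : measurableType d) (I : finType) (A : I -> set T) :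
  (forall i, measurable (A i)) -> measurable [set w | forall i, A i w].
Proof.
move=> mA; rewrite (_ : [set w | _] = [set w | forall i, i \in [set: I]%SET -> A i w]).
  exact: measurable_forall_in.
by apply/seteqP; split => w /= h i => [_|]; [exact: h|apply: h; rewrite inE].
Qed.

Section Environment.
Context {R : realType} {K l : nat} {dO : measure_display}.
Context {Omega : measurableType dO}.
Notation V := (l.-tuple R).
Variables (kappa : 'I_K -> 'I_K -> R) (theta : nat -> R).
Variables (F : 'I_K -> probability V R) (G : 'I_K -> 'I_K -> probability R R).
Variables (H : R) (P : probability Omega R).
Variables (J : forall n, 'I_n -> Omega -> 'I_K).
Variables (E : forall n, 'I_n -> 'I_n -> {RV P >-> bool}).
Variables (Q : forall n, 'I_n -> {RV P >-> V}).
Variables (B : forall n, 'I_n -> 'I_n -> {RV P >-> R}).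
Hypothesis model : network_model kappa theta F G H J E Q B.

Lemma measurable_label_atom n (j : {ffun 'I_n -> 'I_K}) : measurable (label_atom J j).
Proof.
case: model => mJ _ _ _.
rewrite (_ : label_atom J j = [set w | forall i, [set w | J i w = j i] w]).
  by apply: measurable_forall_ord => i; exact: mJ.
apply/seteqP; split => w /=.
  by move=> <- i; rewrite /labels ffunE.
by move=> h; apply/ffunP => i; rewrite /labels ffunE h.
Qed.

Variables (n : nat) (j : {ffun 'I_n -> 'I_K}).
Hypothesis Pj0 : P (label_atom J j) != 0%E.

Notation atom := (label_atom J j).
Definition label_law : probability Omega R := condp P (measurable_label_atom j).

Notation p i k := (edge_prob kappa theta n (j i) (j k)).

(* The Bernoulli law of the edge from i to k. *)
Definition edge_law (i k : 'I_n) (S : set bool) : R :=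
  \sum_(b : bool) \1_S b * (if b then p i k else 1 - p i k).

Lemma edge_law_setT i k : edge_law i k setT = 1.
Proof. by rewrite /edge_law big_bool /= !indicT !mul1r addrC subrK. Qed.

Definition env_event (S : 'I_n -> 'I_n -> set bool) (A : 'I_n -> set V)
    (D : 'I_n -> 'I_n -> set R) : set Omega :=
  [set w | [/\ forall i k, S i k (E i k w), forall i, A i (Q i w) &
    forall i k, D i k (B i k w)]].

Lemma measurable_env_event (S : 'I_n -> 'I_n -> set bool) A D :
  (forall i, measurable (A i)) -> (forall i k, measurable (D i k)) ->
  measurable (env_event S A D).
Proof.
move=> mA mD; rewrite (_ : env_event S A D =
    [set w | forall i, [set w | forall k, (E i k @^-1` S i k) w] w] `&`
    [set w | forall i, (Q i @^-1` A i) w] `&`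
    [set w | forall i, [set w | forall k, (B i k @^-1` D i k) w] w]); last first.
  by apply/seteqP; split => w /= [] // [].
apply: measurableI; first apply: measurableI.
- apply: measurable_forall_ord => i; apply: measurable_forall_ord => k.
  by rewrite -[X in measurable X]setTI; apply: (measurable_funP (E i k)).
- apply: measurable_forall_ord => i.
  by rewrite -[X in measurable X]setTI; apply: (measurable_funP (Q i)).
- apply: measurable_forall_ord => i; apply: measurable_forall_ord => k.
  by rewrite -[X in measurable X]setTI; apply: (measurable_funP (B i k)).
Qed.

Lemma Pj_env_event (S : 'I_n -> 'I_n -> set bool) A D :
  (forall i, measurable (A i)) -> (forall i k, measurable (D i k)) ->
  Pr label_law (env_event S A D) =
  (\prod_i \prod_k edge_law i k (S i k)) * (\prod_i Pr (F (j i)) (A i))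
  * (\prod_i \prod_k Pr (G (j i) (j k)) (D i k)).
Proof.
move=> mA mD; have mev := measurable_env_event S mA mD.
have matom := measurable_label_atom j.
have p0 := Pr_gt0 matom Pj0.
rewrite /label_law condpE//.
pose ev (g : {ffun 'I_n * 'I_n -> bool}) :=
  environment_event J E Q B j (fun i k => g (i, k)) A D.
have evE g : ev g = env_event (fun i k => [set g (i, k)]) A D `&` atom.
  apply/seteqP; split => w /=; first by move=> [h1 h2 h3 h4]; split.
  by move=> [[h1 h2 h3] h4]; split.
have mevg g : measurable (ev g).
  by rewrite evE; apply: measurableI => //; exact: measurable_env_event.
pose inS (g : {ffun 'I_n * 'I_n -> bool}) : R := \prod_ik \1_(S ik.1 ik.2) (g ik).
have -> : Pr P (env_event S A D `&` atom) = \sum_g inS g * Pr P (ev g).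
  rewrite -exp_indic; last exact: measurableI.
  transitivity (\int[P]_w (\sum_g inS g * \1_(ev g) w)); last first.
    rewrite exp_sum; last by move=> g _; apply: bmZ; exact: bm_indic.
    by apply: eq_bigr => g _; rewrite expZ ?exp_indic//; exact: bm_indic.
  apply: eq_Rintegral => w _.
  pose gw : {ffun 'I_n * 'I_n -> bool} := [ffun ik => E ik.1 ik.2 w].
  rewrite (bigD1 gw)//= [X in _ + X]big1 ?addr0; last first.
    move=> g ggw; rewrite indicE [_ \in _](_ : _ = false) ?mulr0//.
    apply/negbTE; apply: contra ggw; rewrite inE => -[_ gE _ _].
    by apply/eqP/ffunP => -[i k]; rewrite ffunE /= gE.
  have inSE : inS gw = \1_[set w | forall i k, S i k (E i k w)] w.
    rewrite /inS indicE; have [Sw|nSw] := boolP (_ \in _).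
      rewrite big1// => -[i k] _; rewrite ffunE /= indicE mem_set//.
      by rewrite inE in Sw; exact: Sw.
    have [i [k nS]] : exists i k, ~ S i k (E i k w).
      move: nSw; rewrite notin_setE => /existsNP[i /existsNP[k nS]].
      by exists i, k.
    by rewrite (bigD1 (i, k))//= ffunE /= indicE memNset// mul0r.
  have -> : inS gw * \1_(ev gw) w =
      \1_([set w | forall i k, S i k (E i k w)] `&` ev gw) w by rewrite inSE indicI.
  rewrite !indicE; congr (_%:R); congr nat_of_bool; apply/idP/idP; rewrite !inE /=.
    by move=> [[h1 h2 h3] h4]; split => //; split => // i k; rewrite ffunE.
  by move=> [h1 [h4 _ h2 h3]].
case: model => _ _ _ mod.
rewrite (eq_bigr (fun g : {ffun 'I_n * 'I_n -> bool} => Pr P atom * (\prod_i Pr (F (j i)) (A i))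
    * (\prod_i \prod_k Pr (G (j i) (j k)) (D i k)) *
    \prod_ik (\1_(S ik.1 ik.2) (g ik) * (if g ik then p ik.1 ik.2 else 1 - p ik.1 ik.2)))); last first.
  move=> g _; rewrite mod// big_split/= -/(inS g).
  have -> : \prod_(i < n) \prod_(k < n) (if g (i, k) then p i k else 1 - p i k) =
      \prod_ik (if g ik then p ik.1 ik.2 else 1 - p ik.1 ik.2).
    by rewrite pair_big/=; apply: eq_bigr => -[].
  ring.
rewrite -mulr_sumr.
rewrite -(bigA_distr_bigA (fun ik b => \1_(S ik.1 ik.2) b * (if b then p ik.1 ik.2 else 1 - p ik.1 ik.2)))/=.
have -> : \prod_i \prod_k edge_law i k (S i k) = \prod_ik edge_law ik.1 ik.2 (S ik.1 ik.2).
  by rewrite pair_big.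
rewrite /edge_law; field.
by rewrite gt_eqF.
Qed.

Lemma prod2_single (f : 'I_n -> 'I_n -> R) i m :
  (forall x y, (x, y) != (i, m) -> f x y = 1) -> \prod_x \prod_y f x y = f i m.
Proof.
move=> f1; rewrite pair_big/= (bigD1 (i, m))//= big1 ?mulr1//.
by move=> [x y] /f1.
Qed.

Let Pr1 (m : probability V R) : Pr m setT = 1. Proof. by rewrite /Pr prob_setT. Qed.
Let Pr1r (m : probability R R) : Pr m setT = 1. Proof. by rewrite /Pr prob_setT. Qed.

Lemma Pj_edge i m S : Pr label_law (E i m @^-1` S) = edge_law i m S.
Proof.
pose S' x y := if (x, y) == (i, m) then S else setT.
transitivity (Pr label_law (env_event S' (fun=> setT) (fun _ _ => setT))).
  congr (Pr _ _); apply/seteqP; split => w /=.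
    by move=> Sw; split => // x y; rewrite /S'; case: eqP => // -[-> ->].
  by move=> [h _ _]; have := h i m; rewrite /S' eqxx.
rewrite Pj_env_event// (@prod2_single _ i m); last first.
  by move=> x y /negbTE xy; rewrite /S' xy edge_law_setT.
rewrite /S' eqxx big1 ?mulr1; last by move=> *; exact: Pr1.
by rewrite big1 ?mulr1// => x _; rewrite big1// => *; exact: Pr1r.
Qed.

Lemma Pj_weight i m D : measurable D ->
  Pr label_law (B i m @^-1` D) = Pr (G (j i) (j m)) D.
Proof.
move=> mD; pose D' x y := if (x, y) == (i, m) then D else setT.
transitivity (Pr label_law (env_event (fun _ _ => setT) (fun=> setT) D')).
  congr (Pr _ _); apply/seteqP; split => w /=.
    by move=> Sw; split => // x y; rewrite /D'; case: eqP => // -[-> ->].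
  by move=> [_ _ h]; have := h i m; rewrite /D' eqxx.
rewrite Pj_env_event//; last by move=> x y; rewrite /D'; case: eqP.
rewrite [X in _ * X](@prod2_single _ i m); last first.
  by move=> x y /negbTE xy; rewrite /D' xy Pr1r.
rewrite /D' eqxx [X in _ * X * _]big1 ?mulr1; last by move=> *; exact: Pr1.
by rewrite big1 ?mul1r// => x _; rewrite big1// => *; rewrite edge_law_setT.
Qed.

Lemma Pj_belief i A : measurable A -> Pr label_law (Q i @^-1` A) = Pr (F (j i)) A.
Proof.
move=> mA; pose A' x := if x == i then A else setT.
transitivity (Pr label_law (env_event (fun _ _ => setT) A' (fun _ _ => setT))).
  congr (Pr _ _); apply/seteqP; split => w /=.
    by move=> Sw; split => // x; rewrite /A'; case: eqP => // ->.
  by move=> [_ h _]; have := h i; rewrite /A' eqxx.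
rewrite Pj_env_event//; last by move=> x; rewrite /A'; case: eqP.
rewrite [X in _ * X * _](bigD1 i)//= /A' eqxx [X in _ * (_ * X) * _]big1 ?mulr1; last first.
  by move=> x /negbTE ->; rewrite Pr1.
rewrite [X in _ * _ * X]big1 ?mulr1; last by move=> x _; rewrite big1// => *; exact: Pr1r.
by rewrite big1 ?mul1r// => x _; rewrite big1// => *; rewrite edge_law_setT.
Qed.

Definition coordinate := ('I_n * 'I_n + 'I_n * 'I_n + 'I_n)%type.

(* The first two kinds of coordinates are indexed by (listener, speaker), so that
   the row of i gathers all that norm_weight i depends on. *)
Definition coord_events (q : coordinate) : set (set Omega) :=
  match q with
  | inl (inl (i, m)) => preimages (E m i)
  | inl (inr (i, m)) => preimages (B i m)
  | inr i => preimages (Q i)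
  end.

Lemma coord_eventsT q : coord_events q setT.
Proof. by case: q => [[[i m]|[i m]]|i]; exact: preimagesT. Qed.

Lemma coord_eventsI q : setI_closed (coord_events q).
Proof. by case: q => [[[i m]|[i m]]|i]; exact: preimagesI. Qed.

Lemma coord_events_measurable q : coord_events q `<=` measurable.
Proof.
by case: q => [[[i m]|[i m]]|i]; apply: preimages_measurable; exact: measurable_funP.
Qed.

Lemma environment_indep : independent_coordinates label_law coord_events.
Proof.
move=> A FA.
have /choice[S SE] : forall im : 'I_n * 'I_n, exists S, A (inl (inl im)) = E im.2 im.1 @^-1` S.
  by move=> [i m]; have [S _ SE] := FA (inl (inl (i, m))); exists S.
have /choice[D /all_and2[mD DE]] : forall im : 'I_n * 'I_n, exists D, measurable D /\
    A (inl (inr im)) = B im.1 im.2 @^-1` D.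
  by move=> [i m]; have [D mD DE] := FA (inl (inr (i, m))); exists D.
have /choice[C /all_and2[mC CE]] : forall i : 'I_n, exists D, measurable D /\
    A (inr i) = Q i @^-1` D.
  by move=> i; have [D' mD' DE'] := FA (inr i); exists D'.
rewrite (_ : [set w | _] = env_event (fun i m => S (m, i)) C (fun i m => D (i, m))); last first.
  apply/seteqP; split => w /=.
    move=> h; split => [i m|i|i m].
    + by have := h (inl (inl (m, i))); rewrite SE.
    + by have := h (inr i); rewrite CE.
    + by have := h (inl (inr (i, m))); rewrite DE.
  by move=> [h1 h2 h3] [[[i m]|[i m]]|i]; rewrite ?SE ?DE ?CE /=.
rewrite Pj_env_event// !big_sumType/=.
rewrite mulrAC; congr (_ * _ * _).
- rewrite exchange_big pair_big/=; apply: eq_bigr => -[i m] _ /=.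
  by rewrite SE Pj_edge.
- by rewrite pair_big/=; apply: eq_bigr => -[i m] _ /=; rewrite DE Pj_weight.
- by apply: eq_bigr => i _; rewrite CE Pj_belief.
Qed.

(** Expectations of functions of one coordinate. *)
Lemma exp_pushforward d1 (T1 : measurableType d1) d2 (T2 : measurableType d2)
    (P1 : probability T1 R) (P2 : probability T2 R) (X : T1 -> T2) (f : T2 -> R) :
  measurable_fun setT X ->
  (forall A, measurable A -> Pr P1 (X @^-1` A) = Pr P2 A) -> bm f ->
  \int[P1]_w f (X w) = \int[P2]_x f x.
Proof.
move=> mX h bf; apply/eqP; rewrite -subr_eq0; apply/eqP.
have bt (g : T2 -> R) : bm g -> bm (fun w => g (X w)) by move=> bg; exact: bm_comp mX.
apply: (@linear_ext _ _ _ (fun f => \int[P1]_z f (X z) - \int[P2]_z f z) 2 _ _ _ _ f bf).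
- by move=> g g' bg bg'; rewrite !expD//; [ring|exact: bt|exact: bt].
- by move=> b g bg; rewrite !expZ//; [ring|exact: bt].
- move=> g b bg gb; apply: (le_trans (ler_normB _ _)).
  rewrite mulrDl mul1r lerD//; apply: exp_abs_cst => //; exact: bt.
- move=> A mA; rewrite (exp_indic P2 mA) -h// -exp_indic; last first.
    by rewrite -[X in measurable X]setTI; exact: mX.
  by apply/eqP; rewrite subr_eq0; apply/eqP; apply: eq_Rintegral.
Qed.

Lemma exp_edge i m : \int[label_law]_w (E i m w)%:R = p i m.
Proof.
rewrite (_ : (fun w => _) = \1_(E i m @^-1` [set true])); last first.
  by apply/funext => w; rewrite indicE; case: (E i m w) / idP => h;
     [rewrite mem_set|rewrite memNset] => //=; rewrite h.
rewrite exp_indic; last first.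
  by rewrite -[X in measurable X]setTI; apply: (measurable_funP (E i m)).
by rewrite Pj_edge /edge_law big_bool /= !indicE mem_set// memNset//= mul1r mul0r addr0.
Qed.

Lemma exp_weight i m (f : R -> R) : bm f ->
  \int[label_law]_w f (B i m w) = \int[G (j i) (j m)]_x f x.
Proof.
apply: exp_pushforward; first exact: measurable_funP.
exact: Pj_weight.
Qed.

Lemma exp_belief i (f : V -> R) : bm f ->
  \int[label_law]_w f (Q i w) = \int[F (j i)]_x f x.
Proof.
apply: exp_pushforward; first exact: measurable_funP.
exact: Pj_belief.
Qed.

End Environment.

(** * Annealed estimates *)

Section Annealed.
Context {R : realType} {K l : nat} {dO : measure_display}.
Context {Omega : measurableType dO}.
Notation V := (l.-tuple R).
Variables (kappa : 'I_K -> 'I_K -> R) (theta : nat -> R).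
Variables (F : 'I_K -> probability V R) (G : 'I_K -> 'I_K -> probability R R).
Variables (H : R) (P : probability Omega R).
Variables (J : forall n, 'I_n -> Omega -> 'I_K).
Variables (E : forall n, 'I_n -> 'I_n -> {RV P >-> bool}).
Variables (Q : forall n, 'I_n -> {RV P >-> V}).
Variables (B : forall n, 'I_n -> 'I_n -> {RV P >-> R}).
Hypothesis model : network_model kappa theta F G H J E Q B.
Hypothesis H0 : 0 < H.
Variables (n : nat) (j : {ffun 'I_n -> 'I_K}).
Hypothesis Pj0 : P (label_atom J j) != 0%E.

Notation Pj := (label_law model j).
Notation coord := (@coord_events R l dO Omega P E Q B n).
Notation p i k := (edge_prob kappa theta n (j i) (j k)).

Definition env_j (w : Omega) : environment R K l n :=
  Environment (fun i => j i) (fun i k => E i k w) (fun i => Q i w) (fun i k => B i k w).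

Lemma env_jE w : label_atom J j w -> environment_at J E Q B n w = env_j w.
Proof.
move=> jw; rewrite /environment_at /env_j; congr Environment.
by apply/funext => i; rewrite -jw /labels ffunE.
Qed.

Lemma env_w0 w i k : 0 <= weight (env_j w) i k.
Proof. by case: model => _ _ h _; case/andP: (h n i k w). Qed.

Lemma env_wH w i k : weight (env_j w) i k <= H.
Proof. by case: model => _ _ h _; case/andP: (h n i k w). Qed.

Notation link i m w := (weight (env_j w) i m * (edge (env_j w) m i)%:R).
Notation C i m w := (norm_weight (env_j w) i m).
Notation T i w := (total_weight (env_j w) i).

Section Measurability.
Variable S : {set coordinate n}.
Notation OS := (g_sigma_algebraType (cyl coord S)).

Lemma cyl_edge i m : inl (inl (i, m)) \in S ->
  bm ((fun w => (E m i w)%:R) : OS -> R).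
Proof.
move=> iS.
have mE : measurable_fun setT (E m i : OS -> bool).
  by apply: (@cyl_coordinate _ _ _ coord _ _ _ _ _ (inl (inl (i, m)))) => //; exact: coord_eventsT.
apply: (bm_comp (f := fun b : bool => b%:R : R) _ mE).
by split; [by []|exists 1 => -[]; rewrite ?normr1 ?normr0].
Qed.

Lemma cyl_weight i m : inl (inr (i, m)) \in S ->
  bm ((fun w => weight (env_j w) i m) : OS -> R).
Proof.
move=> iS; split.
  by apply: (@cyl_coordinate _ _ _ coord _ _ _ _ _ (inl (inr (i, m)))) => //; exact: coord_eventsT.
by exists H => w; rewrite ger0_norm ?env_w0// env_wH.
Qed.

Lemma cyl_belief i (f : V -> R) : inr i \in S -> bm f ->
  bm ((fun w => f (Q i w)) : OS -> R).
Proof.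
move=> iS bf; apply: (bm_comp bf).
by apply: (@cyl_coordinate _ _ _ coord _ _ _ _ _ (inr i)) => //; exact: coord_eventsT.
Qed.

Lemma cyl_link i m : inl (inl (i, m)) \in S -> inl (inr (i, m)) \in S ->
  bm ((fun w => link i m w) : OS -> R).
Proof. by move=> iS iS'; apply: bmM; [exact: cyl_weight|exact: cyl_edge]. Qed.

Hypothesis row : 'I_n.
Hypothesis rowS : forall m, inl (inl (row, m)) \in S /\ inl (inr (row, m)) \in S.

Lemma cyl_total : bm ((fun w => T row w) : OS -> R).
Proof. by apply: bm_sum => m _; have [] := rowS m; exact: cyl_link. Qed.

Lemma cyl_norm_weight m : bm ((fun w => C row m w) : OS -> R).
Proof.
split; last first.
  exists 1 => w; rewrite ger0_norm; last by apply: norm_weight_ge0; exact: env_w0.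
  apply: le_trans (norm_weight_sum1 (env_w0 w) row); rewrite (bigD1 m)//= lerDl.
  by apply: sumr_ge0 => k _; apply: norm_weight_ge0; exact: env_w0.
have bT := cyl_total; have [iS iS'] := rowS m; have bl := cyl_link iS iS'.
rewrite (_ : (fun w => _) = fun w => if (0 < T row w) && (row != m)
    then link row m w * expR (- ln (T row w)) else 0); last first.
  apply/funext => w; rewrite /norm_weight; case: ifPn => // /andP[t0 _].
  by rewrite expRN lnK// posrE.
apply: measurable_fun_ifT; last exact: measurable_cst.
  case: (row != m).
    under eq_fun do rewrite andbT.
    by apply: measurable_fun_ltr; [exact: measurable_cst|case: bT].
  under eq_fun do rewrite andbF.
  exact: measurable_cst.
apply: measurable_funM; first by case: bl.
apply: measurableT_comp; first exact: measurable_expR.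
apply: measurableT_comp => //; apply: measurableT_comp; first exact: measurable_ln.
by case: bT.
Qed.

Lemma cyl_unlinked : bm ((fun w => unlinked (env_j w) row) : OS -> R).
Proof.
rewrite (_ : (fun w => _) = fun w => \prod_m (1 - (E m row w)%:R)).
  apply: bm_prod => m _; apply: bmB; first exact: bm_cst.
  by apply: cyl_edge; case: (rowS m).
apply/funext => w; rewrite /unlinked /indegree /=.
have [|] := boolP (_ == 0%N).
  rewrite sum_nat_eq0 => /forallP h; rewrite big1// => m _.
  by have := h m; rewrite /= eqb0 => /negbTE ->; rewrite subr0.
rewrite sum_nat_eq0 => /forallPn[m]; rewrite /= eqb0 negbK => Em.
by rewrite (bigD1 m)//= Em subrr mul0r.
Qed.

End Measurability.

Lemma cyl_bmT S (f : Omega -> R) :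
  bm (f : g_sigma_algebraType (cyl coord S) -> R) -> bm f.
Proof. by apply: cyl_bm; exact: coord_events_measurable. Qed.

Lemma indepE (S S' : {set coordinate n}) (f : g_sigma_algebraType (cyl coord S) -> R)
    (g : g_sigma_algebraType (cyl coord S') -> R) :
  [disjoint S & S']%bool -> bm f -> bm g ->
  \int[Pj]_x (f x * g x) = (\int[Pj]_x f x) * (\int[Pj]_x g x).
Proof.
apply: indep_exp; [exact: coord_eventsT|exact: coord_eventsI|exact: coord_events_measurable|].
exact: environment_indep.
Qed.

(* The coordinates that the m-th term of a sum over the in-neighbours of i may
   depend on. *)
Definition term_coord (i m : 'I_n) : {set coordinate n} :=
  [set inl (inl (i, m)); inl (inr (i, m)); inr m].

Lemma term_coord_disjoint i m m' : m != m' ->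
  [disjoint term_coord i m & term_coord i m']%bool.
Proof.
move=> mm'; rewrite -setI_eq0; apply/eqP/setP => q; rewrite !inE.
apply/negbTE; apply/negP => /andP[].
by move=> /orP[/orP[]|] /eqP -> /orP[/orP[]|] /eqP[] // mm; rewrite mm eqxx in mm'.
Qed.

(** Variance of a sum over in-neighbours: the terms are independent and vanish
   unless the edge is present. *)
Lemma row_variance i (X : 'I_n -> Omega -> R) (A : R) : 0 <= A ->
  (forall m, bm (X m : g_sigma_algebraType (cyl coord (term_coord i m)) -> R)) ->
  (forall m w, `|X m w| <= A * (E m i w)%:R) ->
  \int[Pj]_w (\sum_m (X m w - \int[Pj]_w' X m w')) ^+ 2 <= A ^+ 2 * \sum_m p m i.
Proof.
move=> A0 bX XA.
have bX' m : bm (X m) by exact: cyl_bmT (bX m).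
pose mu m := \int[Pj]_w' X m w'.
have bc m : bm (fun w => X m w - mu m) by apply: bmB => //; exact: bm_cst.
rewrite (@exp_sq_sum _ _ _ Pj _ (fun m w => X m w - mu m)) //.
- rewrite mulr_sumr; apply: ler_sum => m _.
  have bX2 : bm (fun w => X m w ^+ 2) by exact: bmX.
  apply: (@le_trans _ _ (\int[Pj]_w X m w ^+ 2)).
    rewrite (_ : (fun w => (X m w - mu m) ^+ 2) = fun w => X m w ^+ 2 -
        (2 * mu m * X m w - mu m ^+ 2)); last by apply/funext => w; ring.
    rewrite expB//; last by apply: bmB; [exact: bmZ|exact: bm_cst].
    rewrite expB; [|exact: bmZ|exact: bm_cst].
    rewrite expZ// exp_cst -/(mu m) gerBl.
    by have := sqr_ge0 (mu m); rewrite expr2; lra.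
  rewrite -(exp_edge model Pj0 m i) -expZ; last first.
    by apply: (@cyl_bmT (term_coord i m)); apply: cyl_edge; rewrite !inE eqxx.
  apply: exp_le => //.
    apply: bmZ; apply: (@cyl_bmT (term_coord i m)); apply: cyl_edge; by rewrite !inE eqxx.
  move=> w; rewrite -real_normK ?num_real//.
  have := XA m w; have := normr_ge0 (X m w); move: `|X m w| => x.
  case: (E m i w); rewrite /= ?mulr1 ?mulr0 => x0 xA; first by rewrite lerXn2r ?nnegrE.
  by rewrite (_ : x = 0) ?expr0n//; apply/eqP; rewrite eq_le x0 xA.
- move=> m m' mm'.
  rewrite (@indepE (term_coord i m) (term_coord i m')).
  + rewrite expB ?exp_cst ?subrr ?mul0r//; exact: bm_cst.
  + exact: term_coord_disjoint.
  + by apply: bmB => //; exact: bm_cst.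
  + by apply: bmB => //; exact: bm_cst.
Qed.


Implicit Types i m : 'I_n.

Lemma p01 i k : 0 < theta n -> (forall r s, 0 <= kappa r s) -> 0 <= p i k <= 1.
Proof.
move=> t0 k0; rewrite /edge_prob ge_min lexx orbT le_min ler01 !andbT.
by rewrite !mulr_ge0// ?invr_ge0// ltW.
Qed.

Lemma bm_edge i m : bm (fun w => (E m i w)%:R : R).
Proof.
by apply: (@cyl_bmT (term_coord i m)); apply: cyl_edge; rewrite !inE eqxx.
Qed.

Lemma bm_link i m : bm (fun w => link i m w).
Proof.
by apply: (@cyl_bmT (term_coord i m)); apply: cyl_link; rewrite !inE eqxx ?orbT.
Qed.

Lemma link_ge0 i m w : 0 <= link i m w.
Proof. by rewrite mulr_ge0// env_w0. Qed.

Lemma link_le i m w : link i m w <= H * (E m i w)%:R.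
Proof. by rewrite ler_wpM2r// env_wH. Qed.

Definition row_coord (i : 'I_n) : {set coordinate n} :=
  [set q | match q with inl (inl (k, _)) | inl (inr (k, _)) => k == i | inr _ => false end].

Lemma row_coordP i m : inl (inl (i, m)) \in row_coord i /\ inl (inr (i, m)) \in row_coord i.
Proof. by rewrite !inE. Qed.

Lemma bm_total i : bm (fun w => T i w).
Proof. exact: cyl_bmT (cyl_total (row_coordP i)). Qed.

Lemma bm_norm_weight i m : bm (fun w => C i m w).
Proof. exact: cyl_bmT (cyl_norm_weight (row_coordP i) m). Qed.

Lemma C_ge0 i m w : 0 <= C i m w.
Proof. by apply: norm_weight_ge0; exact: env_w0. Qed.

Lemma C_le1 i m w : C i m w <= 1.
Proof.
apply: le_trans (norm_weight_sum1 (env_w0 w) i); rewrite (bigD1 m)//= lerDl.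
by apply: sumr_ge0 => k _; exact: C_ge0.
Qed.

Lemma C_le_link i m w : C i m w * T i w <= link i m w.
Proof.
rewrite /norm_weight; case: ifPn => [/andP[t0 _]|_]; last by rewrite mul0r link_ge0.
by rewrite divfK// gt_eqF.
Qed.

(* Expected degree, expected total weight. *)
Notation deg i := (\sum_m p m i).
Definition mean_total (i : 'I_n) : R := \int[Pj]_w T i w.

Lemma mean_totalE i : mean_total i = \sum_m \int[Pj]_w link i m w.
Proof. by rewrite /mean_total /total_weight exp_sum// => m _; exact: bm_link. Qed.

(** Expectation of an in-link term with an independent mark on the speaker. *)
Lemma exp_term i m (psi : V -> R) : bm psi ->
  \int[Pj]_w (link i m w * psi (Q m w)) =
  (\int[Pj]_w weight (env_j w) i m) * p m i * (\int[F (j m)]_q psi q).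
Proof.
move=> bpsi; have S1 : inl (inl (i, m)) \in row_coord i by rewrite inE.
have S2 : inl (inr (i, m)) \in row_coord i by rewrite inE.
rewrite (@indepE (row_coord i) [set inr m]).
- rewrite (exp_belief model Pj0)//; congr (_ * _).
  rewrite (@indepE [set inl (inr (i, m))] [set inl (inl (i, m))]).
  + by rewrite (exp_edge model Pj0).
  + by rewrite disjoints1 !inE.
  + by apply: cyl_weight; rewrite inE.
  + by apply: cyl_edge; rewrite inE.
- by rewrite disjoint_sym disjoints1 !inE.
- exact: cyl_link.
- by apply: cyl_belief => //; rewrite inE.
Qed.

Lemma exp_link i m : \int[Pj]_w link i m w = (\int[Pj]_w weight (env_j w) i m) * p m i.
Proof.
have := @exp_term i m (fun=> 1) (bm_cst _); rewrite exp_cst mulr1 => <-.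
by apply: eq_Rintegral => w _; rewrite mulr1.
Qed.

Lemma centered_sum (X : 'I_n -> Omega -> R) w : (forall m, bm (X m)) ->
  \sum_m (X m w - \int[Pj]_w' X m w') =
  \sum_m X m w - \int[Pj]_w' \sum_m X m w'.
Proof. by move=> bX; rewrite sumrB exp_sum. Qed.

(** The same variance bound for an arbitrary family of bounded marks; marks that
   vanish remove a term from the sum. *)
Lemma marked_variance i (psi : 'I_n -> V -> R) (A : R) : 0 <= A ->
  (forall m, bm (psi m)) -> (forall m q, `|psi m q| <= A) ->
  \int[Pj]_w (\sum_m link i m w * psi m (Q m w)
     - \int[Pj]_w' \sum_m link i m w' * psi m (Q m w')) ^+ 2
  <= (H * A) ^+ 2 * deg i.
Proof.
move=> A0 bpsi psiA.
have bX m : bm ((fun w => link i m w * psi m (Q m w)) :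
    g_sigma_algebraType (cyl coord (term_coord i m)) -> R).
  apply: bmM; first by apply: cyl_link; rewrite !inE eqxx ?orbT.
  by apply: cyl_belief => //; rewrite !inE eqxx orbT.
have bX' m : bm (fun w => link i m w * psi m (Q m w)) by exact: cyl_bmT (bX m).
under eq_Rintegral do rewrite -(@centered_sum (fun m w => link i m w * psi m (Q m w)))//.
apply: (@row_variance i _ (H * A)) => //; first by rewrite mulr_ge0// ltW.
move=> m w; rewrite normrM ger0_norm ?link_ge0// [leRHS]mulrAC ler_pM ?link_ge0//.
exact: link_le.
Qed.

Lemma total_variance i :
  \int[Pj]_w (T i w - mean_total i) ^+ 2 <= H ^+ 2 * deg i.
Proof.
have := @marked_variance i (fun _ _ => 1) 1 ler01 (fun=> bm_cst _) (fun _ _ => _).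
rewrite mulr1 normr1 lexx => /(_ (fun _ _ => isT)); apply: le_trans.
rewrite le_eqVlt; apply/orP; left; apply/eqP; apply: eq_Rintegral => w _.
by congr ((_ - _) ^+ 2); [|apply: eq_Rintegral => w' _];
   apply: eq_bigr => m _; rewrite mulr1.
Qed.

Hypothesis theta0 : 0 < theta n.
Hypothesis kappa0 : forall r s, 0 <= kappa r s.
Hypothesis n0 : (0 < n)%N.
Variable kbar : R.
Hypothesis kbarP : forall r s, kappa r s <= kbar.

Notation th := (theta n).

Lemma kbar_ge0 (r s : 'I_K) : 0 <= kbar.
Proof. exact: le_trans (kappa0 r s) (kbarP r s). Qed.

Lemma p_le i m : p i m <= kbar * th / n%:R.
Proof.
apply: (@le_trans _ _ (kappa (j i) (j m) * th / n%:R)).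
  by rewrite /edge_prob ge_min lexx.
by rewrite -!mulrA ler_wpM2r// mulr_ge0 ?ltW ?invr_gt0// ltr0n.
Qed.

Lemma deg_le i : deg i <= kbar * th.
Proof.
apply: (@le_trans _ _ (\sum_(m < n) kbar * th / n%:R)).
  by apply: ler_sum => m _; exact: p_le.
by rewrite sumr_const card_ord -[leLHS]mulr_natr divfK// pnatr_eq0 -lt0n.
Qed.

(** If the mean [M] of a total weight is positive, a ratio below [M] costs one
   variance. *)
Lemma cap_le (t M x h : R) : 0 < M -> 0 <= h -> x <= 1 -> (M / 2 <= t -> x * t <= h) ->
  x <= 2 * h / M + 4 / M ^+ 2 * (t - M) ^+ 2.
Proof.
move=> M0 h0 x1 xt; have M2 : 0 < M ^+ 2 by rewrite exprn_gt0.
case: (leP (M / 2) t) => [Mt|tM].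
  have t0 : 0 < t by apply: lt_le_trans Mt; rewrite divr_gt0.
  apply: (@le_trans _ _ (2 * h / M)); last first.
    by rewrite lerDl mulr_ge0 ?sqr_ge0// divr_ge0// ltW.
  have {}xt := xt Mt; rewrite ler_pdivlMr//.
  case: (leP x 0) => [x0|x0]; first by apply: (@le_trans _ _ 0); [rewrite mulr_le0_ge0// ltW|rewrite mulr_ge0].
  have : x * (M / 2) <= x * t by rewrite ler_wpM2l// ltW.
  lra.
apply: (le_trans x1); apply: (@le_trans _ _ (4 / M ^+ 2 * (t - M) ^+ 2)); last first.
  by rewrite lerDr divr_ge0 ?mulr_ge0// ltW.
rewrite mulrAC ler_pdivlMr// mul1r -[(t - M) ^+ 2]sqrrN opprB.
have : (M / 2) ^+ 2 <= (M - t) ^+ 2.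
  by rewrite lerXn2r ?nnegrE; lra.
rewrite expr_div_n; lra.
Qed.

Section LargeDegree.
Variables (i : 'I_n) (t0 : R).
Hypothesis t0_gt0 : 0 < t0.
Hypothesis Mi : t0 * th <= mean_total i.

Let M0 : 0 < mean_total i.
Proof. by apply: lt_le_trans Mi; rewrite mulr_gt0. Qed.

Let tt0 : 0 < t0 * th. Proof. by rewrite mulr_gt0. Qed.

Lemma var_over_mean (A b : R) (k : R) : 0 <= b -> 0 <= k -> A <= k * deg i ->
  b / mean_total i ^+ 2 * A <= b * k * kbar / (t0 ^+ 2 * th).
Proof.
move=> b0 k0 Ak; have kb := kbar_ge0 (j i) (j i).
have M2 : (t0 * th) ^+ 2 <= mean_total i ^+ 2.
  by rewrite lerXn2r ?nnegrE ?(ltW tt0) ?(ltW M0).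
apply: (@le_trans _ _ (b / (t0 * th) ^+ 2 * (k * (kbar * th)))).
  have A' : A <= k * (kbar * th).
    by apply: (le_trans Ak); rewrite ler_wpM2l// deg_le.
  apply: (@le_trans _ _ (b / mean_total i ^+ 2 * (k * (kbar * th)))).
    by rewrite ler_wpM2l// divr_ge0// exprn_ge0// ltW.
  rewrite ler_wpM2r// ?mulr_ge0// ?(ltW theta0)//.
  by rewrite ler_wpM2l// lef_pV2// posrE exprn_gt0.
rewrite le_eqVlt; apply/orP; left; apply/eqP; field.
by rewrite !gt_eqF.
Qed.

Lemma inv_mean (b : R) : 0 <= b -> b / mean_total i <= b / (t0 * th).
Proof. by move=> b0; rewrite ler_wpM2l// lef_pV2// posrE. Qed.

Lemma exp_spread_le : \int[Pj]_w spread (env_j w) i <=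
  2 * H / (t0 * th) + 4 * H ^+ 2 * kbar / (t0 ^+ 2 * th).
Proof.
have bT := bm_total i.
have bT2 : bm (fun w => (T i w - mean_total i) ^+ 2).
  by apply: bmX; apply: bmB => //; exact: bm_cst.
apply: (@le_trans _ _ (\int[Pj]_w (2 * H / mean_total i +
    4 / mean_total i ^+ 2 * (T i w - mean_total i) ^+ 2))).
  apply: exp_le.
  - by apply: bm_sum => m _; apply: bmX; exact: bm_norm_weight.
  - by apply: bmD; [exact: bm_cst|exact: bmZ].
  move=> w; apply: cap_le => //; first exact: ltW.
    apply: le_trans (norm_weight_sum1 (env_w0 w) i); apply: ler_sum => m _.
    by rewrite expr2 ler_piMr ?C_ge0// C_le1.
  move=> _; rewrite /spread mulr_suml.
  apply: (@le_trans _ _ (\sum_m H * C i m w)); last first.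
    by rewrite -mulr_sumr ler_piMr ?(ltW H0)// norm_weight_sum1//; exact: env_w0.
  apply: ler_sum => m _; rewrite expr2 -mulrA mulrC ler_wpM2r ?C_ge0//.
  apply: (le_trans (C_le_link i m w)); apply: (le_trans (link_le i m w)).
  by rewrite ler_piMr ?(ltW H0)//; case: (E m i w).
rewrite expD; [|exact: bm_cst|exact: bmZ].
rewrite exp_cst expZ//; apply: lerD.
  by apply: inv_mean; rewrite mulr_ge0// ltW.
apply: var_over_mean; [by []|exact: sqr_ge0|exact: total_variance].
Qed.

(** The link from m to i is independent of the other links into i, whose total
   weight is of order theta. *)
Lemma exp_norm_weight_le m : 2 * H <= t0 * th ->
  \int[Pj]_w C i m w <= kbar * (4 * H / t0 + 16 * H ^+ 2 * kbar / t0 ^+ 2) / n%:R.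
Proof.
move=> Ht; have kb := kbar_ge0 (j i) (j i).
have nR : 0 < n%:R :> R by rewrite ltr0n.
pose T' w := \sum_(k | k != m) link i k w.
pose S' : {set coordinate n} := row_coord i :\: [set inl (inl (i, m))].
have cT' : bm (T' : g_sigma_algebraType (cyl coord (~: [set inl (inl (i, m))])) -> R).
  apply: bm_sum => k km; apply: cyl_link; rewrite !inE//.
  by apply: contra km => /eqP[->].
have bT' : bm T' by exact: cyl_bmT cT'.
pose M' := \int[Pj]_w T' w.
have TT' w : T i w = link i m w + T' w by rewrite /total_weight (bigD1 m).
have MM' : mean_total i <= H + M'.
  rewrite /mean_total /M' -[X in X + _](exp_cst Pj) -expD//; last exact: bm_cst.
  apply: exp_le; [exact: bm_total|by apply: bmD => //; exact: bm_cst|].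
  move=> w; rewrite TT' lerD2r; apply: (le_trans (link_le i m w)).
  by rewrite ler_piMr ?(ltW H0)//; case: (E m i w).
have M'0 : t0 * th / 2 <= M' by have := Mi; lra.
have M'p : 0 < M' by have := tt0; lra.
have var' : \int[Pj]_w (T' w - M') ^+ 2 <= H ^+ 2 * (kbar * th).
  have b1 (k : 'I_n) (q : V) : `|(k != m)%:R : R| <= 1 by case: (k != m); rewrite ?normr1 ?normr0.
  have h := @marked_variance i (fun k _ => (k != m)%:R) 1 ler01 (fun=> bm_cst _) b1.
  apply: (@le_trans _ _ ((H * 1) ^+ 2 * deg i)); last first.
    by rewrite mulr1 ler_wpM2l ?sqr_ge0// deg_le.
  apply: le_trans h.
  have T'E w : T' w = \sum_k link i k w * (k != m)%:R.
    by rewrite /T' big_mkcond/=; apply: eq_bigr => k _; case: (k != m); rewrite ?mulr1 ?mulr0.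
  rewrite le_eqVlt; apply/orP; left; apply/eqP; apply: eq_Rintegral => w _.
  by rewrite T'E /M'; congr ((_ - _) ^+ 2); apply: eq_Rintegral => w' _; rewrite T'E.
pose Y w := 2 * H / M' + 4 / M' ^+ 2 * (T' w - M') ^+ 2.
have cY : bm (Y : g_sigma_algebraType (cyl coord (~: [set inl (inl (i, m))])) -> R).
  by apply: bmD; [exact: bm_cst|apply: bmZ; apply: bmX; apply: bmB => //; exact: bm_cst].
have bY := cyl_bmT cY.
have Y0 w : 0 <= Y w.
  apply: addr_ge0; first by rewrite divr_ge0 ?(ltW M'p)// mulr_ge0// ltW.
  by rewrite mulr_ge0 ?sqr_ge0// divr_ge0// exprn_ge0// ltW.
apply: (@le_trans _ _ (\int[Pj]_w ((E m i w)%:R * Y w))).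
  apply: exp_le; [exact: bm_norm_weight|by apply: bmM => //; exact: bm_edge|].
  move=> w; have := C_le_link i m w; have := link_le i m w.
  case: (E m i w) / idP => Em; rewrite /= ?mulr1 ?mulr0 ?mul1r ?mul0r => lk cl.
    apply: cap_le => //; [exact: ltW|exact: C_le1|].
    move=> _; apply: le_trans lk; apply: le_trans cl.
    by rewrite ler_wpM2l ?C_ge0// TT' lerDr link_ge0.
  rewrite /norm_weight; case: ifPn => // _; rewrite /= (negbTE (introN idP Em)).
  by rewrite mulr0 mul0r.
rewrite (@indepE [set inl (inl (i, m))] (~: [set inl (inl (i, m))])) //.
- rewrite (exp_edge model Pj0); have /andP[pp0 _] := p01 m i theta0 kappa0.
  have bT2 : bm (fun w => (T' w - M') ^+ 2) by apply: bmX; apply: bmB => //; exact: bm_cst.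
  have YE : \int[Pj]_w Y w <= 4 * H / (t0 * th) + 16 * H ^+ 2 * kbar / (t0 ^+ 2 * th).
    rewrite /Y expD; [|exact: bm_cst|exact: bmZ].
    rewrite exp_cst expZ//; apply: lerD.
      rewrite ler_pdivrMr// mulrAC ler_pdivlMr//.
      have := ler_wpM2l (ltW H0) M'0; lra.
    apply: (@le_trans _ _ (4 / (t0 * th / 2) ^+ 2 * (H ^+ 2 * (kbar * th)))).
      apply: ler_pM => //; rewrite ?divr_ge0 ?sqr_ge0 ?exp_ge0//.
        by move=> w; rewrite sqr_ge0.
      by rewrite ler_wpM2l// lef_pV2 ?posrE ?exprn_gt0 ?divr_gt0// lerXn2r ?nnegrE ?(ltW M'p)// divr_ge0// ltW.
    rewrite le_eqVlt; apply/orP; left; apply/eqP; field.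
    by rewrite !gt_eqF.
  apply: (@le_trans _ _ (kbar * th / n%:R * (4 * H / (t0 * th) + 16 * H ^+ 2 * kbar / (t0 ^+ 2 * th)))).
    apply: ler_pM => //; [exact: exp_ge0|exact: p_le].
  rewrite le_eqVlt; apply/orP; left; apply/eqP; field.
  by rewrite !gt_eqF.
- by rewrite disjoints1 !inE eqxx.
- by apply: cyl_edge; rewrite inE.
Qed.

End LargeDegree.

(** A total weight with mean zero vanishes almost surely, and with it all that it
   dominates. *)
Lemma exp_no_weight i (g : Omega -> R) : mean_total i = 0 -> bm g ->
  (forall w, T i w = 0 -> g w = 0) -> \int[Pj]_w g w = 0.
Proof.
move=> M0 bg; apply: exp_zero_of bg _ M0; first exact: bm_total.
by move=> w; apply: total_weight_ge0; exact: env_w0.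
Qed.

Lemma C_no_weight i m w : T i w = 0 -> C i m w = 0.
Proof. by move=> T0; rewrite /norm_weight T0 ltxx. Qed.

Notation ndeg i w := (\sum_m (E m i w)%:R).

Lemma bm_unlinked i : bm (fun w => unlinked (env_j w) i).
Proof. exact: cyl_bmT (cyl_unlinked (row_coordP i)). Qed.

Lemma unlinkedE i w : unlinked (env_j w) i = (ndeg i w == 0 :> R)%:R.
Proof.
rewrite /unlinked /indegree; congr (_%:R); congr nat_of_bool.
by rewrite -natr_sum pnatr_eq0.
Qed.

Lemma bm_ndeg i : bm (fun w => ndeg i w : R).
Proof. by apply: bm_sum => m _; exact: bm_edge. Qed.

Lemma exp_ndeg i : \int[Pj]_w (ndeg i w : R) = deg i.
Proof.
rewrite exp_sum; last by move=> m _; exact: bm_edge.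
by apply: eq_bigr => m _; rewrite (exp_edge model Pj0).
Qed.

Lemma exp_unlinked_zero i : deg i = 0 ->
  \int[Pj]_w `|unlinked (env_j w) i - 1| = 0.
Proof.
move=> d0; apply: (exp_zero_of (bm_ndeg i)).
- by apply: bm_norm; apply: bmB; [exact: bm_unlinked|exact: bm_cst].
- by move=> w; apply: sumr_ge0.
- by rewrite exp_ndeg.
- by move=> w h; rewrite unlinkedE h eqxx subrr normr0.
Qed.

Lemma exp_unlinked_le i s0 : 0 < s0 -> s0 * th <= deg i ->
  \int[Pj]_w `|unlinked (env_j w) i - 0| <= kbar / (s0 ^+ 2 * th).
Proof.
move=> s0_gt0 di; have st : 0 < s0 * th by rewrite mulr_gt0.
have dp : 0 < deg i by apply: lt_le_trans di.
have bN := bm_ndeg i.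
have b2 : bm (fun w => ((ndeg i w : R) - deg i) ^+ 2).
  by apply: bmX; apply: bmB => //; exact: bm_cst.
apply: (@le_trans _ _ (\int[Pj]_w ((deg i ^+ 2)^-1 * ((ndeg i w : R) - deg i) ^+ 2))).
  apply: exp_le; last 1 first.
  - move=> w; rewrite subr0 unlinkedE; case: eqP => [->|_]; last first.
      by rewrite normr0 mulr_ge0 ?sqr_ge0// invr_ge0 sqr_ge0.
    by rewrite normr1 sub0r sqrrN mulVf// expf_eq0/= gt_eqF.
  - by apply: bm_norm; apply: bmB; [exact: bm_unlinked|exact: bm_cst].
  - exact: bmZ.
rewrite expZ//.
have var : \int[Pj]_w ((ndeg i w : R) - deg i) ^+ 2 <= deg i.
  have := @row_variance i (fun m w => (E m i w)%:R) 1 ler01.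
  have vE w : \sum_m ((E m i w)%:R - \int[Pj]_w' (E m i w')%:R) = (ndeg i w : R) - deg i.
    by rewrite (@centered_sum (fun m w => (E m i w)%:R)) ?exp_ndeg// => m; exact: bm_edge.
  rewrite expr1n mul1r; under eq_Rintegral do rewrite vE.
  apply.
    by move=> m; apply: cyl_edge; rewrite !inE eqxx.
  by move=> m w; rewrite mul1r ger0_norm.
apply: (@le_trans _ _ ((deg i ^+ 2)^-1 * deg i)).
  by rewrite ler_wpM2l// invr_ge0 sqr_ge0.
rewrite expr2 invfM -mulrA mulVf ?gt_eqF// mulr1.
apply: (@le_trans _ _ (s0 * th)^-1); first by rewrite lef_pV2 ?posrE.
have sk : s0 <= kbar.
  by rewrite -(ler_pM2r theta0); apply: (le_trans di); exact: deg_le.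
rewrite ler_pdivlMr ?mulr_gt0 ?exprn_gt0//.
have -> : (s0 * th)^-1 * (s0 ^+ 2 * th) = s0 by field; rewrite !gt_eqF.
exact: sk.
Qed.

Section MarkedAverage.
Variables (i : 'I_n) (t0 : R).
Hypothesis t0_gt0 : 0 < t0.
Hypothesis Mi : t0 * th <= mean_total i.
Variables (psi : 'I_n -> V -> R) (A U0 : R).
Hypothesis A0 : 0 <= A.
Hypothesis bpsi : forall m, bm (psi m).
Hypothesis psiA : forall m q, `|psi m q| <= A.

Let M := mean_total i.
Let M0 : 0 < M.
Proof. by apply: lt_le_trans Mi; rewrite mulr_gt0. Qed.

Let psi' m q := (m != i)%:R * psi m q.
Let N' w := \sum_m link i m w * psi' m (Q m w).
Let nu' := \int[Pj]_w N' w.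
Let nu := \int[Pj]_w \sum_m link i m w * psi m (Q m w).

Let bpsi' m : bm (psi' m). Proof. exact: bmZ. Qed.

Let psi'A m q : `|psi' m q| <= A.
Proof.
rewrite /psi' normrM; case: (m != i); rewrite ?normr1 ?normr0 ?mul1r ?mul0r//.
Qed.

Let bQ m (f : V -> R) : bm f -> bm (fun w => f (Q m w)).
Proof. by move=> bf; apply: (bm_comp bf); exact: measurable_funP. Qed.

Let bN' : bm N'.
Proof. by apply: bm_sum => m _; apply: bmM; [exact: bm_link|exact: bQ]. Qed.

Let N'_le w : `|N' w| <= A * T i w.
Proof.
apply: (le_trans (ler_norm_sum _ _ _)); rewrite /total_weight mulr_sumr.
apply: ler_sum => m _; rewrite normrM ger0_norm ?link_ge0// mulrC.
by rewrite ler_wpM2r ?link_ge0.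
Qed.

Let avgE w : \sum_m C i m w * psi m (Q m w) = N' w / T i w.
Proof.
rewrite /N' mulr_suml; apply: eq_bigr => m _; rewrite /norm_weight /psi'.
have [t0'|t0'] := ltP 0 (T i w); last first.
  have -> : T i w = 0 by apply/eqP; rewrite eq_le t0' total_weight_ge0//; exact: env_w0.
  by rewrite /= invr0 mul0r mulr0.
by rewrite eq_sym; case: (m != i); rewrite /= ?mul1r ?mul0r ?mulr0 ?mul0r// mulrAC.
Qed.

Let pointwise w : `|N' w / T i w - U0| <= `|nu' / M - U0| +
  M^-1 * (`|N' w - nu'| + A * `|T i w - M|).
Proof.
rewrite (_ : N' w / T i w - U0 = (N' w / T i w - nu' / M) + (nu' / M - U0)); last by ring.
apply: (le_trans (ler_normD _ _)); rewrite addrC lerD2l.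
have Tge0 : 0 <= T i w by apply: total_weight_ge0; exact: env_w0.
have key : N' w / T i w - nu' / M = M^-1 * ((N' w - nu') + N' w / T i w * (M - T i w)).
  have [T0|T0] := eqVneq (T i w) 0.
    have : N' w = 0.
      by apply/eqP; rewrite -normr_le0; apply: (le_trans (N'_le w)); rewrite T0 mulr0.
    by move=> ->; rewrite !mul0r !sub0r addr0 mulrN mulrC.
  by field; rewrite T0 gt_eqF.
rewrite key normrM ger0_norm ?invr_ge0 ?(ltW M0)// ler_wpM2l ?invr_ge0 ?(ltW M0)//.
rewrite (le_trans (ler_normD _ _))// lerD2l normrM distrC ler_wpM2r//.
have [T0|T0] := eqVneq (T i w) 0; first by rewrite T0 invr0 mulr0 normr0.
by rewrite normrM normfV (ger0_norm Tge0) ler_pdivrMr// lt_neqAle eq_sym T0.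
Qed.

Let exp_abs_var (f : Omega -> R) (a k lam : R) : bm f -> 0 < lam -> 0 <= k ->
  \int[Pj]_w (f w - a) ^+ 2 <= k * deg i ->
  M^-1 * \int[Pj]_w `|f w - a| <= lam + k * kbar / (lam * t0 ^+ 2 * th).
Proof.
move=> bf lam0 k0 hv; have lM : 0 < lam * M by rewrite mulr_gt0.
have bfa : bm (fun w => f w - a) by apply: bmB => //; exact: bm_cst.
have bfa2 : bm (fun w => (f w - a) ^+ 2) by exact: bmX.
rewrite -expZ; last exact: bm_norm.
apply: (@le_trans _ _ (\int[Pj]_w (lam + (lam^-1 / M ^+ 2) * (f w - a) ^+ 2))).
  apply: exp_le; [by apply: bmZ; exact: bm_norm|by apply: bmD; [exact: bm_cst|exact: bmZ]|].
  move=> w; rewrite -[(f w - a) ^+ 2]real_normK ?num_real//.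
  move: `|f w - a| (normr_ge0 (f w - a)) => x x0.
  rewrite -subr_ge0.
  have -> : lam + lam^-1 / M ^+ 2 * x ^+ 2 - M^-1 * x =
      lam * ((1 - M^-1 * x / lam) ^+ 2 + M^-1 * x / lam).
    by field; rewrite !gt_eqF.
  rewrite mulr_ge0 ?(ltW lam0)// addr_ge0 ?sqr_ge0//.
  by rewrite divr_ge0 ?(ltW lam0)// mulr_ge0// invr_ge0 ltW.
rewrite expD; [|exact: bm_cst|exact: bmZ].
rewrite exp_cst lerD2l expZ//.
have := @var_over_mean i t0 t0_gt0 Mi _ lam^-1 k _ k0 hv.
rewrite invr_ge0 (ltW lam0) => /(_ isT) /le_trans; apply.
rewrite le_eqVlt; apply/orP; left; apply/eqP; field.
by rewrite !gt_eqF.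
Qed.

(** The normalized average of the marks concentrates around the ratio of means. *)
Lemma exp_marked_average lam : 0 < lam ->
  \int[Pj]_w `|\sum_m C i m w * psi m (Q m w) - U0| <=
  `|nu / M - U0| + A * H / (t0 * th) + (1 + A) * lam
  + (A ^+ 2 + A) * H ^+ 2 * kbar / (lam * t0 ^+ 2 * th).
Proof.
move=> lam0.
have bT := bm_total i.
have b1 : bm (fun w => `|N' w - nu'|) by apply: bm_norm; apply: bmB => //; exact: bm_cst.
have b2 : bm (fun w => `|T i w - M|) by apply: bm_norm; apply: bmB => //; exact: bm_cst.
have b3 : bm (fun w => `|N' w - nu'| + A * `|T i w - M|) by apply: bmD => //; exact: bmZ.
have b0 : bm (fun w => \sum_m C i m w * psi m (Q m w)).
  by apply: bm_sum => m _; apply: bmM; [exact: bm_norm_weight|exact: bQ].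
apply: (@le_trans _ _ (\int[Pj]_w (`|nu' / M - U0| +
  M^-1 * (`|N' w - nu'| + A * `|T i w - M|)))).
  apply: exp_le; [by apply: bm_norm; apply: bmB => //; exact: bm_cst|
    by apply: bmD; [exact: bm_cst|exact: bmZ]|].
  by move=> w; rewrite avgE; exact: pointwise.
rewrite expD; [|exact: bm_cst|exact: bmZ].
rewrite exp_cst expZ// expD//; last exact: bmZ.
rewrite expZ// mulrDr [M^-1 * (A * _)]mulrCA.
have v1 : \int[Pj]_w (N' w - nu') ^+ 2 <= (H * A) ^+ 2 * deg i.
  exact: marked_variance.
have v2 := total_variance i.
have e1 := exp_abs_var bN' lam0 (sqr_ge0 (H * A)) v1.
have e2 := exp_abs_var bT lam0 (sqr_ge0 H) v2.
have e3 : `|nu' / M - U0| <= `|nu / M - U0| + A * H / (t0 * th).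
  rewrite (_ : nu' / M - U0 = (nu / M - U0) - (nu - nu') / M); last by ring.
  apply: (le_trans (ler_normB _ _)); rewrite lerD2l normrM normfV (gtr0_norm M0).
  apply: (@le_trans _ _ (A * H / M)).
    rewrite ler_wpM2r ?invr_ge0 ?(ltW M0)// /nu /nu' -expB//; last first.
      by apply: bm_sum => m _; apply: bmM; [exact: bm_link|exact: bQ].
    apply: exp_abs_cst.
      by apply: bmB => //; apply: bm_sum => m _; apply: bmM; [exact: bm_link|exact: bQ].
    move=> w; rewrite /N' -sumrB (bigD1 i)//= big1 => [|m mi]; last first.
      by rewrite /psi' mi mul1r subrr.
    rewrite addr0 /psi' eqxx mul0r mulr0 subr0 normrM mulrC ler_pM//.
    rewrite ger0_norm ?link_ge0//; apply: (le_trans (link_le _ _ _)).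
    by rewrite ler_piMr ?(ltW H0)//; case: (E i i w).
  by apply: (inv_mean t0_gt0 Mi); rewrite mulr_ge0// ltW.
have := ler_wpM2l A0 e2 => e4.
apply: le_trans (lerD e3 (lerD e1 e4)) _.
rewrite le_eqVlt; apply/orP; left; apply/eqP; field.
by rewrite !gt_eqF.
Qed.

End MarkedAverage.

(** * Revisits of the backward walk *)

Section Revisits.
Variables (xi : 'I_n -> Omega -> R) (D : R).

Definition row_belief_coord (m : 'I_n) : {set coordinate n} :=
  [set q | match q with inl (inl (k, _)) | inl (inr (k, _)) => k == m | inr _ => true end].

Hypothesis bxi : forall m, bm (xi m : g_sigma_algebraType (cyl coord (row_belief_coord m)) -> R).
Hypothesis xi0 : forall m w, 0 <= xi m w.
Hypothesis xiD : forall m w, xi m w <= D.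

Fixpoint hit (s : nat) (S : {set 'I_n}) (m : 'I_n) (w : Omega) : R :=
  if m \in S then D else
  if s is s'.+1 then \sum_k C m k w * hit s' (m |: S) k w else xi m w.

Definition free_coord (S : {set 'I_n}) : {set coordinate n} :=
  [set q | match q with inl (inl (k, _)) | inl (inr (k, _)) => k \notin S | inr _ => true end].

Lemma hitE s (S : {set 'I_n}) m w : m \notin S ->
  hit s.+1 S m w = \sum_k C m k w * hit s (m |: S) k w.
Proof. by move=> mS; rewrite /= (negbTE mS). Qed.

Lemma hit_bm s (S : {set 'I_n}) m : bm (hit s S m : g_sigma_algebraType (cyl coord (free_coord S)) -> R).
Proof.
elim: s S m => [|s IH] S m.
  rewrite /hit; have [mS|mS] := boolP (m \in S); first exact: bm_cst.
  apply: cyl_bm_sub (bxi m); first exact: coord_eventsT.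
  by apply/fintype.subsetP => -[[[k x]|[k x]]|k]; rewrite !inE// => /eqP ->.
have [mS|mS] := boolP (m \in S).
  rewrite (_ : hit _ _ _ = fun=> D); first exact: bm_cst.
  by apply/funext => w; rewrite /= mS.
rewrite (_ : hit _ _ _ = fun w => \sum_k C m k w * hit s (m |: S) k w); last first.
  by apply/funext => w; rewrite hitE.
apply: bm_sum => k _; apply: bmM; first by apply: cyl_norm_weight => x; rewrite !inE.
apply: cyl_bm_sub (IH (m |: S) k); first exact: coord_eventsT.
apply/fintype.subsetP => -[[[y x]|[y x]]|y]; rewrite !inE// negb_or => /andP[_ ->] //.
Qed.

Lemma bm_hit s (S : {set 'I_n}) m : bm (hit s S m).
Proof. exact: cyl_bmT (hit_bm s S m). Qed.

Lemma iter_average_le_D s m w : iter s (average (env_j w)) (xi ^~ w) m <= D.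
Proof.
have D0 : 0 <= D by apply: le_trans (xi0 m w) (xiD m w).
elim: s m => //= s IH m; apply: le_trans (average_cst_le (env_w0 w) m D0).
by apply: average_le; [exact: env_w0|exact: IH].
Qed.

Lemma iter_average_hit s (S : {set 'I_n}) m w : iter s (average (env_j w)) (xi ^~ w) m <= hit s S m w.
Proof.
elim: s S m => [|s IH] S m.
  by rewrite /=; case: ifP => // _; exact: xiD.
have [mS|mS] := boolP (m \in S).
  by rewrite [leRHS]/= mS; exact: iter_average_le_D.
rewrite hitE//; apply: ler_sum => k _.
by rewrite ler_wpM2l ?C_ge0//; exact: IH.
Qed.

Variables (k1 eps : R).
Hypothesis k1_ge1 : 1 <= k1.
Hypothesis Ck1 : forall m k, m != k -> \int[Pj]_w C m k w <= k1 / n%:R.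
Hypothesis xieps : forall m, \int[Pj]_w xi m w <= eps.

(** Forbidding the vertices already visited makes the rows used along a path
   independent; a forbidden vertex is hit with probability O(1/n). *)
Lemma exp_hit s (S : {set 'I_n}) m : m \notin S ->
  \int[Pj]_w hit s S m w <= k1 ^+ s * (eps + (s * (s + #|S|))%:R * D / n%:R).
Proof.
have nR : 0 < n%:R :> R by rewrite ltr0n.
have D0 : 0 <= D.
  case: model => _ _ _ _; have [w] : exists w : Omega, True by exists point.
  by move=> _; apply: le_trans (xi0 m w) (xiD m w).
have k10 : 0 <= k1 by exact: le_trans ler01 k1_ge1.
elim: s S m => [|s IH] S m mS.
  rewrite mul0n mul0r mul0r addr0 mul1r /hit (negbTE mS); exact: xieps.
under eq_Rintegral do rewrite hitE//.
have bh k := bm_hit s (m |: S) k.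
rewrite exp_sum; last by move=> k _; apply: bmM => //; exact: bm_norm_weight.
set b := k1 ^+ s * (eps + (s * (s + #|m |: S|))%:R * D / n%:R) in IH *.
have b0 : 0 <= b.
  rewrite mulr_ge0 ?exprn_ge0// addr_ge0//; last by rewrite divr_ge0 ?mulr_ge0// ltW.
  by apply: le_trans (xieps m); apply: exp_ge0.
apply: (@le_trans _ _ (\sum_k k1 / n%:R * ((k \in S)%:R * D + b))).
  apply: ler_sum => k _.
  have [<-|mk] := eqVneq m k.
    rewrite (_ : (fun w => _) = fun=> 0); last first.
      by apply/funext => w; rewrite /norm_weight eqxx andbF mul0r.
    rewrite exp_cst mulr_ge0 ?divr_ge0 ?(ltW nR)// addr_ge0// mulr_ge0//.
  rewrite (@indepE (row_coord m) (free_coord (m |: S))).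
  - apply: ler_pM; [by apply: exp_ge0 => w; exact: C_ge0| |exact: Ck1|].
      apply: exp_ge0 => w; apply: le_trans (iter_average_hit s (m |: S) k w).
      by apply: iter_average_ge0; [exact: env_w0|move=> x; exact: xi0].
    have [kS|kS] := boolP (k \in S).
      rewrite (_ : hit _ _ _ = fun=> D) ?exp_cst ?mul1r ?lerDl//.
      by apply/funext => w; case: (s) => [|s'] /=; rewrite !inE kS orbT.
    by rewrite mul0r add0r; apply: IH; rewrite !inE negb_or eq_sym mk.
  - rewrite -setI_eq0; apply/eqP/setP => -[[[y x]|[y x]]|y]; rewrite !inE ?andbF//.
      by case: (y == m); rewrite ?andbF.
    by case: (y == m); rewrite ?andbF.
  - by apply: cyl_norm_weight => x; rewrite !inE eqxx.
  - exact: hit_bm.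
have cardE : \sum_k (k \in S)%:R = #|S|%:R :> R.
  rewrite -natr_sum; congr (_ *+ _); rewrite -sum1_card [RHS]big_mkcond/=.
  by apply: eq_bigr => k _; case: (k \in S).
rewrite -mulr_sumr big_split/= -mulr_suml cardE sumr_const card_ord.
rewrite -[b *+ n]mulr_natr.
rewrite /b cardsU1 mS /=.
set A := k1 ^+ s; set N := n%:R; set cS := #|S|.
have A1 : 1 <= A by rewrite exprn_ege1.
have -> : k1 / N * (cS%:R * D + A * (eps + (s * (s + (1 + cS)))%:R * D / N) * N) =
  k1 * A * (eps + (s * (s + (1 + cS)))%:R * D / N) + k1 * (cS%:R * D / N).
  by field; rewrite gt_eqF.
rewrite exprS -/A.
have h1 : k1 * (cS%:R * D / N) <= k1 * A * (cS%:R * D / N).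
  by rewrite -[leRHS]mulrA ler_wpM2l// ler_peMl// divr_ge0 ?mulr_ge0// ltW.
apply: (le_trans (lerD (lexx _) h1)).
rewrite -mulrDr ler_wpM2l ?mulr_ge0 ?(le_trans ler01 A1)//.
rewrite -addrA lerD2l -mulrDl -mulrDl ler_wpM2r ?invr_ge0 ?(ltW nR)// ler_wpM2r//.
by rewrite -natrD ler_nat; nia.
Qed.

End Revisits.

Lemma sum_ord_const (N : nat) (x : R) : \sum_(k < N) x = N%:R * x.
Proof. by rewrite sumr_const card_ord mulr_natl. Qed.

(** * From the environment to the opinions *)

Section Opinions.
Variables (c d : R) (nu : 'I_K -> R.-pker V ~> V).
Variables (u : 'I_K -> 'I_l -> R) (ni : 'I_K -> bool).
Hypotheses (c0 : 0 <= c) (d0 : 0 < d) (cd1 : c + d <= 1).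
Hypothesis nuc : forall r q, cube q -> nu r q cube = 1%E.
Hypothesis u1 : forall r k, `|u r k| <= 1.
Variable X : {RV P >-> n.-tuple V}.
Variable mu : Omega -> probability (n.-tuple V) R.
Hypothesis mu_stat : forall w, stationary_law c d nu (environment_at J E Q B n w) (mu w).
Hypothesis mu_dis : forall j' g A D S, (forall i, measurable (A i)) ->
  (forall i k, measurable (D i k)) -> measurable S ->
  Pr P (environment_event J E Q B (n := n) j' g A D `&` [set w | S (X w)]) =
  \int[P]_(w in environment_event J E Q B j' g A D) Pr (mu w) S.

Notation lerr k i w := (local_error c d nu u ni (env_j w) k i).

Lemma env_q1 w i : cube (belief (env_j w) i).
Proof. by case: model => _ h _ _; exact: h. Qed.

Lemma annealed_atom (Phi : n.-tuple V -> R) (h : Omega -> R) : bm Phi -> bm h ->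
  (forall w, label_atom J j w -> \int[mu w]_r Phi r <= h w) ->
  \int[Pj]_w Phi (X w) <= \int[Pj]_w h w.
Proof.
move=> bPhi bh hPhi.
have bX : bm (fun w => Phi (X w)) by apply: (bm_comp bPhi); exact: measurable_funP.
have matom := measurable_label_atom model j.
rewrite /Pj !condp_exp// ler_wpM2r ?invr_ge0 ?(ltW (Pr_gt0 matom Pj0))//.
pose ev (g : {ffun 'I_n * 'I_n -> bool}) :=
  environment_event J E Q B j (fun i k => g (i, k)) (fun=> setT) (fun _ _ => setT).
have evE g : ev g = env_event E Q B (fun i k => [set g (i, k)]) (fun=> setT) (fun _ _ => setT)
    `&` label_atom J j.
  apply/seteqP; split => w /=; first by move=> [h1 h2 h3 h4]; split.
  by move=> [[h1 h2 h3] h4]; split.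
have mev g : measurable (ev g).
  by rewrite evE; apply: measurableI => //; exact: measurable_env_event.
have atomE w : \1_(label_atom J j) w = \sum_g \1_(ev g) w :> R.
  pose gw : {ffun 'I_n * 'I_n -> bool} := [ffun ik => E ik.1 ik.2 w].
  rewrite (bigD1 gw)//= [X in _ + X]big1 ?addr0; last first.
    move=> g ggw; rewrite indicE [_ \in _](_ : _ = false)//.
    apply/negbTE; apply: contra ggw; rewrite inE => -[_ gE _ _].
    by apply/eqP/ffunP => -[i k]; rewrite ffunE /= gE.
  rewrite !indicE; congr (_%:R); congr nat_of_bool; apply/idP/idP; rewrite !inE /=.
    by move=> jw; split => // i k; rewrite ffunE.
  by case.
have split f : bm f -> \int[P]_w (f w * \1_(label_atom J j) w) =
    \sum_g \int[P]_w (f w * \1_(ev g) w).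
  move=> bf; rewrite -exp_sum; last by move=> g _; apply: bmM => //; exact: bm_indic.
  by apply: eq_Rintegral => w _; rewrite atomE mulr_sumr.
rewrite !split//; apply: ler_sum => g _.
apply: annealed_le => //.
  by move=> S mS; exact: mu_dis.
by move=> w [jw _ _ _]; exact: hPhi.
Qed.

Lemma bm_media_avg r k : bm (media_avg nu r k).
Proof.
apply: (@bm_kernel _ _ _ _ _ _ _ (nu r) id (fun x : V * V => clip1 (tnth x.2 k))) => //.
by apply: bm_clip1; apply: (measurableT_comp (measurable_tnth k)).
Qed.

Lemma bm_mean_mark r k : bm (mean_mark c d nu u ni r k).
Proof.
apply: bmD; first exact: bm_cst.
apply: bmD; first by apply: bmZ; exact: bm_media_avg.
by apply: bmM; [apply: bmZ; apply: bm_clip1; exact: measurable_tnth|exact: bm_cst].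
Qed.

Lemma local_error_bm k m :
  bm ((fun w => lerr k m w) : g_sigma_algebraType (cyl coord (row_belief_coord m)) -> R).
Proof.
have rowm x : inl (inl (m, x)) \in row_belief_coord m /\ inl (inr (m, x)) \in row_belief_coord m.
  by rewrite !inE.
apply: bmD; first apply: bmD.
- apply: bm_norm; apply: bmB; last exact: (bm_cst ((c + d) * u (j m) k)).
  apply: bm_sum => x _; apply: bmM; first exact: cyl_norm_weight.
  by apply: (@cyl_belief _ x (mean_mark c d nu u ni (j x) k)); [rewrite inE|exact: bm_mean_mark].
- by apply: bm_norm; apply: bmB; [exact: cyl_unlinked|exact: (bm_cst (ni (j m))%:R)].
- by apply: bm_sum => x _; apply: bmX; exact: cyl_norm_weight.
Qed.

Lemma bm_local_error k m : bm (fun w => lerr k m w).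
Proof. exact: cyl_bmT (local_error_bm k m). Qed.

Lemma bm_iter_average s (h : 'I_n -> Omega -> R) m : (forall i, bm (h i)) ->
  bm (fun w => iter s (average (env_j w)) (h ^~ w) m).
Proof.
move=> bh; elim: s m => //= s IH m.
by apply: bm_sum => k _; apply: bmM; [exact: bm_norm_weight|exact: IH].
Qed.

Lemma lerr_ge0 k m w : 0 <= lerr k m w.
Proof. exact: local_error_ge0. Qed.

Lemma lerr_le k m w : lerr k m w <= 5.
Proof.
by apply: local_error_le => //; first [exact: env_w0|exact: env_q1].
Qed.

Variables (k1 eps : R).
Hypothesis k1_ge1 : 1 <= k1.
Hypothesis Ck1 : forall m k, m != k -> \int[Pj]_w C m k w <= k1 / n%:R.
Hypothesis lerr_eps : forall k m, \int[Pj]_w lerr k m w <= eps.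

Definition mean_error_bound (S : nat) (lam : R) : R :=
  l%:R * (lam + lam^-1 * (2 * source_const c d *
    (\sum_(s < S.+1) k1 ^+ s * (eps + (s * s)%:R * 5 / n%:R))
    + (c / (c + d)) ^+ S * 4) + eps).

Lemma bm_error_bound S lam i : bm (fun w => error_bound c d nu u ni (env_j w) S lam i).
Proof.
have bu : bm (fun w => unlinked_error ni (env_j w) i).
  by apply: bm_norm; apply: bmB; [exact: bm_unlinked|exact: (bm_cst (ni (j i))%:R)].
apply: bm_sum => k _; apply: bmD => //; apply: bmD; first exact: bm_cst.
apply: bmZ; apply: bmD; last exact: bm_cst; apply: bmZ; apply: bm_sum => s _.
by apply: (@bm_iter_average _ (fun m w => lerr k m w)) => m; exact: bm_local_error.
Qed.

Lemma exp_error_bound S lam i : 0 < lam ->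
  \int[Pj]_w error_bound c d nu u ni (env_j w) S lam i <= mean_error_bound S lam.
Proof.
move=> lam0.
have bu : bm (fun w => unlinked_error ni (env_j w) i).
  by apply: bm_norm; apply: bmB; [exact: bm_unlinked|exact: (bm_cst (ni (j i))%:R)].
have bit k s : bm (fun w => iter s (average (env_j w)) (fun m => lerr k m w) i).
  by apply: (@bm_iter_average _ (fun m w => lerr k m w)) => m; exact: bm_local_error.
have bsum k : bm (fun w => \sum_(s < S.+1) iter s (average (env_j w)) (fun m => lerr k m w) i).
  by apply: bm_sum.
have bsum2 k : bm (fun w => 2 * source_const c d *
    (\sum_(s < S.+1) iter s (average (env_j w)) (fun m => lerr k m w) i)
    + (c / (c + d)) ^+ S * 4) by apply: bmD; [exact: bmZ|exact: bm_cst].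
have bin k : bm (fun w => lam + lam^-1 * (2 * source_const c d *
    (\sum_(s < S.+1) iter s (average (env_j w)) (fun m => lerr k m w) i)
    + (c / (c + d)) ^+ S * 4)) by apply: bmD; [exact: bm_cst|exact: bmZ].
rewrite exp_sum; last by move=> k _; exact: bmD.
rewrite /mean_error_bound -(sum_ord_const l); apply: ler_sum => k _.
have ue_le w : unlinked_error ni (env_j w) i <= lerr k i w.
  rewrite /local_error addrAC lerDr addr_ge0//; first exact: normr_ge0.
  exact: spread_ge0.
rewrite expD//; apply: lerD; last first.
  apply: le_trans (lerr_eps k i); apply: exp_le => //; exact: bm_local_error.
rewrite expD; [|exact: bm_cst|exact: bmZ].
rewrite exp_cst lerD2l expZ// ler_wpM2l ?invr_ge0 ?(ltW lam0)//.
rewrite expD; [|exact: bmZ|exact: bm_cst].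
have K0 : 0 <= 2 * source_const c d by apply: mulr_ge0 => //; exact: source_const_ge0.
rewrite exp_cst lerD2r expZ//; apply: ler_wpM2l => //.
rewrite exp_sum//; apply: ler_sum => s _.
have := @exp_hit (fun m w => lerr k m w) 5 (local_error_bm k) (lerr_ge0 k) (lerr_le k)
  k1 eps k1_ge1 Ck1 (lerr_eps k) s finset.set0 i.
rewrite inE cards0 addn0 => /(_ isT); apply: le_trans.
apply: exp_le => //; first exact: bm_hit (local_error_bm k) _ _ _.
move=> w; apply: iter_average_hit; [exact: lerr_ge0|exact: lerr_le].
Qed.

Notation LamT T r f := (iter T (Lam c d nu u ni r) (fun x => f x.2)).

Lemma vertex_product S lam T (m : nat) (v : 'I_m -> 'I_n) (f : 'I_m -> V -> R) L (y0 : V) :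
  0 < lam -> injective v -> (forall b, bm (f b)) -> (forall b y, `|f b y| <= 1) ->
  0 <= L -> (forall b x y, `|f b x - f b y| <= L * dclip x y) ->
  `|\int[Pj]_w \prod_b f b (tnth (X w) (v b)) -
    \prod_b \int[F (j (v b))]_q LamT T (j (v b)) (f b) (q, y0)|
  <= m%:R * (T%:R * L * mean_error_bound S lam + (1 - c - d) ^+ T * L * (2 * l%:R)).
Proof.
move=> lam0 vinj bf f1 L0 Lf.
have a0 : 0 <= 1 - c - d by rewrite -addrA -opprD subr_ge0.
have bphi b : bm (fun x : V * V => f b x.2) by exact: bm_comp (bf b) measurable_snd.
pose h b q := LamT T (j (v b)) (f b) (q, y0).
have bh b : bm (h b).
  apply: (bm_comp (bm_LamT c d nu u ni T (j (v b)) (bphi b))).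
  by apply: measurable_fun_pair => //; exact: measurable_cst.
pose Pi w := \prod_b h b (Q (v b) w).
have bPi : bm Pi.
  by apply: bm_prod => b _; apply: (bm_comp (bh b)); exact: measurable_funP.
have -> : \prod_b \int[F (j (v b))]_q LamT T (j (v b)) (f b) (q, y0) = \int[Pj]_w Pi w.
  rewrite (@exp_prod_indep _ _ _ Pj _ coord _ (index_enum 'I_m) (fun b => inr (v b))
    (fun b w => h b (Q (v b) w))).
  - by apply: eq_bigr => b _; rewrite (exp_belief model Pj0).
  - exact: coord_eventsT.
  - exact: coord_eventsI.
  - exact: coord_events_measurable.
  - exact: environment_indep.
  - by move=> b b' [/vinj].
  - exact: index_enum_uniq.
  - by move=> b S' bS; exact: cyl_belief.
pose Gm w := \sum_b (T%:R * L * error_bound c d nu u ni (env_j w) S lam (v b)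
  + (1 - c - d) ^+ T * L * (2 * l%:R)).
have bG : bm Gm.
  apply: bm_sum => b _; apply: bmD; last exact: bm_cst.
  by apply: bmZ; exact: bm_error_bound.
pose Phi (r : n.-tuple V) := \prod_b f b (tnth r (v b)).
have bPhi : bm Phi.
  by apply: bm_prod => b _; apply: (bm_comp (bf b)); exact: measurable_tnth.
have quenched w : label_atom J j w -> `|\int[mu w]_r Phi r - Pi w| <= Gm w.
  move=> jw; have [mcube [zeta media stat]] := mu_stat w.
  rewrite env_jE// in media stat.
  have := @product_limit _ _ _ _ c d nu u ni (env_j w) c0 d0 cd1 (env_q1 w) nuc
    (mu w) zeta mcube media stat T m v (fun b x => f b x.2) L y0 vinj bphi
    (fun b p => f1 b p.2) L0 (fun b q x y => Lf b x y).
  move=> /le_trans; apply; apply: ler_sum => b _; rewrite lerD2r ler_wpM2l ?mulr_ge0//.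
  apply: (@nbr_error_le _ _ _ _ c d nu u ni (env_j w) c0 d0 cd1 (env_w0 w) (env_q1 w) nuc u1
    (mu w) zeta mcube media stat) => //.
have expG : \int[Pj]_w Gm w <=
    m%:R * (T%:R * L * mean_error_bound S lam + (1 - c - d) ^+ T * L * (2 * l%:R)).
  rewrite -(sum_ord_const m).
  have bb b : bm (fun w => T%:R * L * error_bound c d nu u ni (env_j w) S lam (v b)).
    by apply: bmZ; exact: bm_error_bound.
  rewrite exp_sum; last by move=> b _; apply: bmD => //; exact: bm_cst.
  apply: ler_sum => b _; rewrite expD//; last exact: bm_cst.
  rewrite exp_cst lerD2r expZ; last exact: bm_error_bound.
  by rewrite ler_wpM2l ?mulr_ge0// exp_error_bound.
apply: le_trans expG.
have bPX : bm (fun w => Phi (X w)) by apply: (bm_comp bPhi); exact: measurable_funP.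
have up : \int[Pj]_w Phi (X w) <= \int[Pj]_w Pi w + \int[Pj]_w Gm w.
  rewrite -expD//; apply: annealed_atom => //; first exact: bmD.
  by move=> w jw; have := quenched w jw; rewrite ler_norml => /andP[_]; lra.
have dn : -1 * \int[Pj]_w Phi (X w) <= \int[Pj]_w Gm w - \int[Pj]_w Pi w.
  rewrite -expB// -expZ//; apply: (annealed_atom (bmZ (-1) bPhi)); first exact: bmB.
  by move=> w jw; rewrite expZ//; have := quenched w jw; rewrite ler_norml => /andP[+ _]; lra.
by rewrite ler_norml; apply/andP; split; rewrite /Phi in up dn; lra.
Qed.

End Opinions.
End Annealed.

(** * Conditional laws given by kernels *)

Lemma disintegration (R : realType) d (T : measurableType d)
    d1 (T1 : measurableType d1) d2 (T2 : measurableType d2)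
    (P : probability T R) (W : T -> T1) (Z : T -> T2) (k : R.-pker T1 ~> T2) :
  measurable_fun setT W -> measurable_fun setT Z ->
  (forall S D, measurable S -> measurable D ->
     \int[P]_w (\1_S (W w) * \1_D (Z w)) =
     \int[P]_w (\1_S (W w) * Pr (kat k (W w)) D : R)) ->
  forall f : T1 * T2 -> R, bm f ->
  \int[P]_w f (W w, Z w) = \int[P]_w \int[kat k (W w)]_z f (W w, z).
Proof.
move=> mW mZ rect f bf; apply/eqP; rewrite -subr_eq0; apply/eqP.
have mWZ : measurable_fun setT (fun w => (W w, Z w)) by exact: measurable_fun_pair.
have bWZ (g : T1 * T2 -> R) : bm g -> bm (fun w => g (W w, Z w)).
  by move=> bg; exact: (bm_comp bg).
have bk (g : T1 * T2 -> R) : bm g -> bm (fun w => \int[kat k (W w)]_z g (W w, z)).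
  move=> bg; apply: (@bm_kernel _ _ _ _ _ _ _ k W (fun x => g (W x.1, x.2))) => //.
  apply: (bm_comp bg); apply: measurable_fun_pair => //.
  exact: (measurableT_comp mW).
have bz (g : T1 * T2 -> R) x : bm g -> bm (fun z => g (x, z)).
  by move=> bg; apply: (bm_comp bg); exact: measurable_fun_pair.
apply: (@linear_ext _ _ _ (fun f => \int[P]_w f (W w, Z w) -
  \int[P]_w \int[kat k (W w)]_z f (W w, z)) 2 _ _ _ _ f bf).
- move=> g h bg bh; rewrite expD; [|exact: bWZ|exact: bWZ].
  rewrite (_ : (fun w => \int[kat k (W w)]_z (g (W w, z) + h (W w, z))) =
      fun w => \int[kat k (W w)]_z g (W w, z) + \int[kat k (W w)]_z h (W w, z)).
    by rewrite expD; [ring|exact: bk|exact: bk].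
  by apply/funext => w; rewrite expD//; exact: bz.
- move=> b g bg; rewrite expZ; last exact: bWZ.
  rewrite (_ : (fun w => \int[kat k (W w)]_z (b * g (W w, z))) =
      fun w => b * \int[kat k (W w)]_z g (W w, z)).
    by rewrite expZ; [ring|exact: bk].
  by apply/funext => w; rewrite expZ//; exact: bz.
- move=> g b bg gb; apply: (le_trans (ler_normB _ _)).
  rewrite mulrDl mul1r lerD//; apply: exp_abs_cst => //; [exact: bWZ|exact: bk|].
  by move=> w; apply: exp_abs_cst => //; exact: bz.
- move=> A mA; apply/eqP; rewrite subr_eq0; apply/eqP.
  have sec (B : set (T1 * T2)) x : measurable B -> measurable [set z | B (x, z)].
    move=> mB; rewrite -[X in measurable X]setTI.
    by apply: (measurable_fun_pair (f := fun=> x) (g := id)).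
  have mk (B : set (T1 * T2)) : measurable B ->
      measurable_fun setT (fun w => kat k (W w) [set z | B (W w, z)]).
    move=> mB; have [mkB _] := bk _ (bm_indic mB).
    rewrite (_ : (fun w => _) = EFin \o (fun w => \int[kat k (W w)]_z \1_B (W w, z))).
      exact/measurable_EFinP.
    apply/funext => w /=.
    rewrite (_ : (fun z => \1_B (W w, z)) = \1_[set z | B (W w, z)])//.
    by rewrite exp_indic ?/Pr ?fineK//; [exact: fin_num_measure (sec _ _ mB)|exact: sec].
  pose eqB (B : set (T1 * T2)) :=
    P [set w | B (W w, Z w)] = (\int[P]_w kat k (W w) [set z | B (W w, z)])%E.
  have mpre (B : set (T1 * T2)) : measurable B -> measurable [set w | B (W w, Z w)].
    by move=> mB; rewrite -[X in measurable X]setTI; exact: mWZ.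
  suff eA : eqB A.
    rewrite (_ : (fun w => \1_A (W w, Z w)) = \1_[set w | A (W w, Z w)])//.
    rewrite exp_indic; last exact: mpre.
    rewrite /Pr (eA : (P : {measure set _ -> \bar R}) _ = _) /Rintegral; congr fine.
    apply: eq_integral => w _; rewrite -(fineK (fin_num_measure _ _ (sec _ (W w) mA))).
    by congr EFin; exact: (esym (exp_indic (kat k (W w)) (sec _ (W w) mA))).
  pose G : set (set (T1 * T2)) := [set C | exists S, exists D, [/\ measurable S, measurable D &
    C = S `*` D]].
  have GI : setI_closed G.
    move=> _ _ [S [D [mS mD ->]]] [S' [D' [mS' mD' ->]]].
    exists (S `&` S'), (D `&` D'); rewrite setXI; split => //; exact: measurableI.
  have mG : @measurable _ (T1 * T2)%type = <<s G >>.
    rewrite measurable_prod_measurableType; congr (<<s _ >>).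
    apply/seteqP; split => C /=.
      by move=> [S mS [D mD <-]]; exists S, D.
    by move=> [S [D [mS mD ->]]]; exists S => //; exists D.
  have mA' := mA; rewrite mG -setI_closed_g_dynkin_g_sigma_algebra// in mA'.
  suff : <<d G >> `<=` [set B | measurable B /\ eqB B] by move=> /(_ A mA')[].
  apply: smallest_sub; last first.
    move=> _ [S [D [mS mD ->]]].
    have mSD : measurable (S `*` D) by exact: measurableX.
    split => //; rewrite /eqB.
    have := rect S D mS mD.
    have -> : \int[P]_w (\1_S (W w) * \1_D (Z w)) = Pr P [set w | (S `*` D) (W w, Z w)] :> R.
      rewrite -exp_indic; last exact: mpre.
      apply: eq_Rintegral => w _; rewrite !indicE -natrM mulnb; congr (_%:R).
      congr nat_of_bool; apply/idP/idP.
        by move=> /andP[/set_mem Sw /set_mem Dw]; apply/mem_set; split.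
      by move=> /set_mem[Sw Dw]; rewrite !mem_set.
    rewrite /Rintegral => h; rewrite -[LHS]fineK; last exact: fin_num_measure (mpre _ mSD).
    rewrite -/(Pr P _) h fineK.
      apply: eq_integral => w _; rewrite indicE.
      have [Sw|nSw] := boolP (_ \in _).
        rewrite mul1r /Pr fineK; last exact: fin_num_measure.
        congr (kat _ _ _); apply/seteqP; split => z; last by case.
        by move=> Dz; split => //=; rewrite inE in Sw.
      rewrite mul0r (_ : [set z | _] = set0) ?measure0//.
      by apply/seteqP; split => z //= -[Sw]; move: nSw; rewrite notin_setE.
    apply: integrable_fin_num => //; apply: bm_integrable => //.
    apply: bmM; first by apply: (bm_comp (bm_indic mS)).
    have bD : bm (\1_D : T2 -> R) by exact: bm_indic.
    rewrite (_ : (fun w => _) = fun w => \int[kat k (W w)]_z \1_D z); last first.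
      by apply/funext => w; rewrite exp_indic.
    apply: (@bm_kernel _ _ _ _ _ _ _ k W (fun x => \1_D x.2)) => //.
    by apply: (bm_comp bD).
  split => //.
  + split => //; rewrite /eqB (_ : [set w | _] = setT)// probability_setT.
    rewrite (eq_integral (cst 1%E)); last by move=> w _; exact: probability_setT.
    by rewrite integral_cst// mul1e prob_setT.
  + move=> B [mB eB]; have mBC := measurableC mB; split => //; rewrite /eqB.
    rewrite (_ : [set w | _] = ~` [set w | B (W w, Z w)])//.
    rewrite probability_setC; last exact: mpre.
    rewrite eB.
    have -> : (\int[P]_w kat k (W w) [set z | (~` B) (W w, z)])%E =
        (\int[P]_w (1 - kat k (W w) [set z | B (W w, z)]))%E.
      apply: eq_integral => w _.
      rewrite (_ : [set z | _] = ~` [set z | B (W w, z)])//.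
      by rewrite probability_setC//; exact: sec.
    rewrite integralB//.
    * by rewrite integral_cst// mul1e prob_setT.
    * apply: (@bm_integrable _ _ _ P setT (fun=> 1)) => //; exact: bm_cst.
    * have [mkB _] := bk _ (bm_indic mB).
      rewrite (_ : (fun w => _) = EFin \o (fun w => \int[kat k (W w)]_z \1_B (W w, z))).
        by apply: bm_integrable => //; exact: bk (bm_indic mB).
      apply/funext => w /=.
      rewrite (_ : (fun z => \1_B (W w, z)) = \1_[set z | B (W w, z)])//.
      by rewrite exp_indic ?/Pr ?fineK//; [exact: fin_num_measure (sec _ _ mB)|exact: sec].
  + move=> B tB mB; have mU : measurable (\bigcup_i B i).
      by apply: bigcupT_measurable => i; case: (mB i).
    split => //; rewrite /eqB.
    have tsec (X : Type) (g : X -> T1 * T2) : trivIset setT (fun i => [set x | B i (g x)]).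
      apply/trivIsetP => i i' _ _ ii'; move/trivIsetP : tB => /(_ i i' I I ii').
      by move=> /seteqP[h _]; apply/seteqP; split => x //= [? ?]; apply: (h (g x)).
    rewrite (_ : [set w | _] = \bigcup_i [set w | B i (W w, Z w)])//.
    have mpB i : measurable [set w | B i (W w, Z w)] by apply: mpre; case: (mB i).
    rewrite (measure_semi_bigcup P mpB (tsec _ (fun w => (W w, Z w)))); last first.
      exact: bigcupT_measurable.
    have eBi i : P [set w | B i (W w, Z w)] = (\int[P]_w kat k (W w) [set z | B i (W w, z)])%E.
      by case: (mB i).
    transitivity (\sum_(0 <= i <oo) \int[P]_w kat k (W w) [set z | B i (W w, z)])%E.
      by congr (limn _); apply/funext => N; apply: eq_bigr => i _; exact: eBi.
    rewrite -integral_nneseries//; last by move=> i; apply: mk; case: (mB i).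
    apply: eq_integral => w _.
    rewrite (_ : [set z | _] = \bigcup_i [set z | B i (W w, z)])//.
    have msB i : measurable [set z | B i (W w, z)] by apply: sec; case: (mB i).
    rewrite (measure_semi_bigcup (kat k (W w)) msB (tsec _ (fun z => (W w, z))))//.
    exact: bigcupT_measurable.
Qed.

(** * The limiting vertex *)

Section Typical.
Context {R : realType} {K l : nat} {d0 : measure_display}.
Context {Omega0 : measurableType d0}.
Notation V := (l.-tuple R).
Variables (pi_ : 'I_K -> R) (F : 'I_K -> probability V R).
Variables (nu : 'I_K -> R.-pker V ~> V).
Variables (P0 : probability Omega0 R) (J0 : Omega0 -> 'I_K) (Q0 : {RV P0 >-> V}).
Variable Z0 : nat -> {RV P0 >-> V}.
Hypothesis typical : typical_vertex pi_ F nu J0 Q0 Z0.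
Hypothesis pi_gt0 : forall r, 0 < pi_ r.

Notation atom0 r := [set w | J0 w = r].

Lemma measurable_atom0 r : measurable (atom0 r).
Proof. by case: typical. Qed.

Lemma Pr_atom0 r : Pr P0 (atom0 r) = pi_ r.
Proof.
case: typical => _ _ _ h.
have := h r setT 0%N (fun=> setT) measurableT (fun=> measurableT).
under eq_Rintegral do rewrite big_ord0.
rewrite exp_cst mulr1 => <-; congr (Pr _ _).
by apply/seteqP; split => w //= [].
Qed.

Lemma atom0_neq0 r : P0 (atom0 r) != 0%E.
Proof.
apply/eqP => h; have := pi_gt0 r.
by rewrite -Pr_atom0 /Pr (h : (P0 : {measure set _ -> \bar R}) _ = _) ltxx.
Qed.

Definition community_law r : probability Omega0 R := condp P0 (measurable_atom0 r).

Lemma typical_rect r A N (D : nat -> set V) :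
  measurable A -> (forall t, measurable (D t)) ->
  Pr (community_law r) [set w | A (Q0 w) /\ forall t, (t < N)%N -> D t (Z0 t w)] =
  \int[F r]_(q in A) \prod_(t < N) Pr (kat (nu r) q) (D t).
Proof.
move=> mA mD; have mset : measurable [set w | A (Q0 w) /\ forall t, (t < N)%N -> D t (Z0 t w)].
  rewrite (_ : [set w | _] = Q0 @^-1` A `&`
      [set w | forall t : 'I_N, [set w | D t (Z0 t w)] w]); last first.
    apply/seteqP; split => w /= [h1 h2]; split => //; first by move=> t; exact: h2.
    by move=> t tN; exact: (h2 (Ordinal tN)).
  apply: measurableI; first by rewrite -[X in measurable X]setTI; exact: (measurable_funP Q0).
  apply: measurable_forall_ord => t; rewrite -[X in measurable X]setTI.
  exact: (measurable_funP (Z0 t)).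
rewrite /community_law condpE//; last exact: atom0_neq0.
case: typical => _ _ _ h; rewrite Pr_atom0.
rewrite (_ : _ `&` _ = [set w | [/\ J0 w = r, A (Q0 w) &
    forall t, (t < N)%N -> D t (Z0 t w)]]); last first.
  by apply/seteqP; split => w /=; [move=> [[? ?] ?]|move=> []]; split.
by rewrite h// mulrC mulKf// gt_eqF.
Qed.

(* Events depending on the belief and on the signals at times in (t, N). *)
Definition past (t N : nat) : set (set Omega0) :=
  [set C | exists A, exists D : nat -> set V, [/\ measurable A, forall s, measurable (D s) &
    C = [set w | A (Q0 w) /\ forall s, (t < s < N)%N -> D s (Z0 s w)]]].

Lemma past_setI t N : setI_closed (past t N).
Proof.
move=> _ _ [A [D [mA mD ->]]] [A' [D' [mA' mD' ->]]].
exists (A `&` A'), (fun s => D s `&` D' s); split; [exact: measurableI|by move=> s; exact: measurableI|].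
apply/seteqP; split => w /=.
  by move=> [[h1 h2] [h3 h4]]; split => // s sN; split; [exact: h2|exact: h4].
by move=> [[h1 h2] h3]; split; split => // s sN; case: (h3 s sN).
Qed.

Let past_form t N A (D : nat -> set V) :
  [set w | A (Q0 w) /\ forall s, (t < s < N)%N -> D s (Z0 s w)] =
  [set w | A (Q0 w) /\ forall s, (s < N)%N -> (if (t < s)%N then D s else setT) (Z0 s w)].
Proof.
apply/seteqP; split => w /= [h1 h2]; split => // s sN.
  by case: ifPn => // ts; apply: h2; rewrite ts.
by case/andP: sN => ts sN; have := h2 s sN; rewrite ts.
Qed.

Lemma measurable_typical_set N A (D : nat -> set V) : measurable A ->
  (forall s, measurable (D s)) ->
  measurable [set w | A (Q0 w) /\ forall s, (s < N)%N -> D s (Z0 s w)].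
Proof.
move=> mA mD.
rewrite (_ : [set w | _] = Q0 @^-1` A `&`
    [set w | forall t : 'I_N, [set w | D t (Z0 t w)] w]); last first.
  apply/seteqP; split => w /= [h1 h2]; split => //; first by move=> t; exact: h2.
  by move=> t tN; exact: (h2 (Ordinal tN)).
apply: measurableI; first by rewrite -[X in measurable X]setTI; exact: (measurable_funP Q0).
apply: measurable_forall_ord => t; rewrite -[X in measurable X]setTI.
exact: (measurable_funP (Z0 t)).
Qed.

Lemma past_measurable t N : past t N `<=` measurable.
Proof.
move=> _ [A [D [mA mD ->]]]; rewrite past_form.
apply: (@measurable_typical_set N A (fun s => if (t < s)%N then D s else setT)) => //.
by move=> s; case: ifP.
Qed.

Let bm_Pr_kat r D : measurable D -> bm (fun q => Pr (kat (nu r) q) D : R).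
Proof.
move=> mD; rewrite (_ : (fun q => _) = fun q => \int[kat (nu r) q]_z \1_D z); last first.
  by apply/funext => q; rewrite exp_indic.
apply: (@bm_kernel _ _ _ _ _ _ R (nu r) id (fun x : V * V => \1_D x.2 : R)) => //.
by apply: (bm_comp (bm_indic mD)).
Qed.

Let Pr_kat_setT r q : Pr (kat (nu r) q) setT = 1.
Proof. by rewrite /Pr prob_setT. Qed.

(** Given the belief, the signal at time t is independent of the later ones. *)
Lemma typical_orth r t N D (f : g_sigma_algebraType (past t N) -> R) :
  (t < N)%N -> measurable D -> bm f ->
  \int[community_law r]_w (f w * (\1_D (Z0 t w) - Pr (kat (nu r) (Q0 w)) D)) = 0.
Proof.
move=> tN mD bf.
have bD : bm (fun w => \1_D (Z0 t w) : R).
  have bD1 : bm (\1_D : V -> R) by exact: bm_indic.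
  exact: (bm_comp bD1 (measurable_funP (Z0 t))).
have bQ (psi : V -> R) : bm psi -> bm (fun w => psi (Q0 w)).
  by move=> bpsi; exact: (bm_comp bpsi (measurable_funP Q0)).
have bk := bm_Pr_kat r mD.
have bh : bm (fun w => \1_D (Z0 t w) - Pr (kat (nu r) (Q0 w)) D : R).
  by apply: bmB => //; exact: (bQ _ bk).
have pG C : past t N C ->
    \int[community_law r]_(w in C) (\1_D (Z0 t w) - Pr (kat (nu r) (Q0 w)) D : R) = 0.
  move=> pC; have mC := past_measurable pC; rewrite exp_in.
  case: pC => A [D1 [mA mD1 CE]].
  pose D2 s := if (t < s)%N then D1 s else setT.
  have mD2 s : measurable (D2 s) by rewrite /D2; case: ifP.
  have CE2 : C = [set w | A (Q0 w) /\ forall s, (s < N)%N -> D2 s (Z0 s w)].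
    by rewrite CE past_form.
  pose rho q : R := \prod_(s < N) Pr (kat (nu r) q) (D2 s).
  have brho : bm rho by apply: bm_prod => s _; exact: bm_Pr_kat.
  have bC : bm (\1_C : Omega0 -> R) by exact: bm_indic.
  have psiE (psi : V -> R) : bm psi ->
      \int[community_law r]_w (psi (Q0 w) * \1_C w) = \int[F r]_q (psi q * (\1_A q * rho q)).
    move=> bpsi; apply/eqP; rewrite -subr_eq0; apply/eqP.
    have bA : bm (fun q => \1_A q * rho q) by apply: bmM => //; exact: bm_indic.
    have [_ [M0 hM0]] := bA.
    have M00 : 0 <= M0 by apply: le_trans (hM0 [tuple 0 | k < l]).
    apply: (@linear_ext _ _ _ (fun psi => \int[community_law r]_w (psi (Q0 w) * \1_C w) -
      \int[F r]_q (psi q * (\1_A q * rho q))) (1 + M0) _ _ _ _ psi bpsi).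
    - move=> g h bg bh'; under eq_Rintegral do rewrite mulrDl.
      rewrite expD; [|by apply: bmM => //; exact: bQ|by apply: bmM => //; exact: bQ].
      under [X in _ - X]eq_Rintegral do rewrite mulrDl.
      by rewrite expD; [ring|exact: bmM|exact: bmM].
    - move=> b g bg; under eq_Rintegral do rewrite -mulrA.
      rewrite expZ; last by apply: bmM => //; exact: bQ.
      under [X in _ - X]eq_Rintegral do rewrite -mulrA.
      by rewrite expZ; [ring|exact: bmM].
    - move=> g b bg gb; apply: (le_trans (ler_normB _ _)); rewrite mulrDl mul1r.
      have b0 : 0 <= b by apply: le_trans (gb [tuple 0 | k < l]).
      apply: lerD; apply: exp_abs_cst.
      + by apply: bmM => //; exact: bQ.
      + move=> w; rewrite normrM indicE; case: (_ \in _); rewrite ?normr1 ?normr0 ?mulr1 ?mulr0//.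
      + exact: bmM.
      + by move=> q; rewrite normrM mulrC ler_pM.
    - move=> A' mA'; apply/eqP; rewrite subr_eq0; apply/eqP.
      transitivity (Pr (community_law r) [set w | (A' `&` A) (Q0 w) /\
          forall s, (s < N)%N -> D2 s (Z0 s w)]).
        rewrite -exp_indic; last by apply: measurable_typical_set => //; exact: measurableI.
        apply: eq_Rintegral => w _; rewrite CE2 !indicE -natrM mulnb; congr (_%:R).
        congr nat_of_bool; apply/idP/idP.
          by move=> /andP[/set_mem h1 /set_mem [h2 h3]]; apply/mem_set.
        by move=> /set_mem[[h1 h2] h3]; rewrite !mem_set.
      rewrite typical_rect//; last exact: measurableI.
      rewrite exp_in; apply: eq_Rintegral => q _.
      by rewrite indicI /= -/(rho q) mulrC mulrA.
  rewrite (_ : (fun w => _) = fun w => \1_D (Z0 t w) * \1_C w -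
      Pr (kat (nu r) (Q0 w)) D * \1_C w); last by apply/funext => w; rewrite mulrBl.
  rewrite expB; [|exact: bmM|by apply: bmM => //; exact: (bQ (fun q => Pr (kat (nu r) q) D))].
  rewrite (psiE (fun q => Pr (kat (nu r) q) D))//; apply/eqP; rewrite subr_eq0; apply/eqP.
  pose D3 s := if s == t then D else D2 s.
  have mD3 s : measurable (D3 s) by rewrite /D3; case: ifP.
  transitivity (Pr (community_law r) [set w | A (Q0 w) /\ forall s, (s < N)%N -> D3 s (Z0 s w)]).
    rewrite -exp_indic; last exact: measurable_typical_set.
    apply: eq_Rintegral => w _; rewrite CE2 !indicE -natrM mulnb; congr (_%:R).
    congr nat_of_bool; apply/idP/idP.
      move=> /andP[/set_mem h1 /set_mem [h2 h3]]; apply/mem_set; split => // s sN.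
      by rewrite /D3; case: eqP => [->//|_]; exact: h3.
    move=> /set_mem[h1 h2]; rewrite !mem_set//.
      by split => // s sN; have := h2 s sN; rewrite /D3; case: eqP => // -> _; rewrite /D2 ltnn.
    by have := h2 t tN; rewrite /D3 eqxx.
  rewrite typical_rect// exp_in; apply: eq_Rintegral => q _.
  rewrite mulrCA mulrC; congr (_ * _); rewrite /rho.
  rewrite (bigD1 (Ordinal tN))//= [in RHS](bigD1 (Ordinal tN))//= /D3 eqxx.
  rewrite /D2 ltnn Pr_kat_setT mul1r; congr (_ * _).
  by apply: eq_bigr => s st; rewrite ifN//; apply: contraNneq st => st; apply/eqP/val_inj.
apply: (orth_fun _ _ bh _ pG bf); [exact: past_setI|exact: past_measurable|].
apply: pG; exists setT, (fun=> setT); split => //.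
by apply/seteqP; split.
Qed.

Lemma past_belief t N : measurable_fun setT (Q0 : g_sigma_algebraType (past t N) -> V).
Proof.
move=> _ A mA; rewrite setTI; apply: sub_sigma_algebra.
exists A, (fun=> setT); split => //.
by apply/seteqP; split => w //= [].
Qed.

Lemma past_signal t N s : (t < s < N)%N ->
  measurable_fun setT (Z0 s : g_sigma_algebraType (past t N) -> V).
Proof.
move=> sN _ A mA; rewrite setTI; apply: sub_sigma_algebra.
exists setT, (fun s' => if s' == s then A else setT); split => //.
  by move=> s'; case: ifP.
apply/seteqP; split => w /=.
  by move=> Aw; split => // s' _; case: eqP => // ->.
by move=> [_ /(_ s sN)]; rewrite eqxx.
Qed.

Lemma past_sub t N d1 (T1 : measurableType d1) (W : Omega0 -> T1) :
  measurable_fun setT (W : g_sigma_algebraType (past t N) -> T1) ->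
  measurable_fun setT W.
Proof.
have sub : <<s past t N >> `<=` measurable.
  apply: smallest_sub; first exact: sigma_algebra_measurable.
  exact: past_measurable.
by move=> mW _ A mA; rewrite setTI; apply: sub; have := mW measurableT A mA; rewrite setTI.
Qed.

Lemma typical_disint r t N d1 (T1 : measurableType d1) (W : Omega0 -> T1) (q : T1 -> V)
    (psi : T1 * V -> R) : (t < N)%N ->
  measurable_fun setT (W : g_sigma_algebraType (past t N) -> T1) ->
  measurable_fun setT q -> (forall w, q (W w) = Q0 w) -> bm psi ->
  \int[community_law r]_w psi (W w, Z0 t w) =
  \int[community_law r]_w \int[kat (nu r) (Q0 w)]_z psi (W w, z).
Proof.
move=> tN mW mq qW bpsi.
transitivity (\int[community_law r]_w \int[kat (kpull (nu r) mq) (W w)]_z psi (W w, z)); last first.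
  by apply: eq_Rintegral => w _; rewrite -(qW w).
apply: (disintegration (Z := Z0 t)) => //; [exact: past_sub mW|].
move=> S D mS mD; apply/eqP; rewrite -subr_eq0; apply/eqP.
have bS : bm ((fun w => \1_S (W w)) : g_sigma_algebraType (past t N) -> R).
  have bS1 : bm (\1_S : T1 -> R) by exact: bm_indic.
  exact: (bm_comp bS1 mW).
have bS' : bm (fun w => \1_S (W w) : R).
  have bS1 : bm (\1_S : T1 -> R) by exact: bm_indic.
  exact: (bm_comp bS1 (past_sub mW)).
have bD : bm (fun w => \1_D (Z0 t w) : R).
  have bD1 : bm (\1_D : V -> R) by exact: bm_indic.
  exact: (bm_comp bD1 (measurable_funP (Z0 t))).
have bk : bm (fun w => Pr (kat (nu r) (Q0 w)) D : R).
  exact: (bm_comp (bm_Pr_kat r mD) (measurable_funP Q0)).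
rewrite -[RHS](@typical_orth r t N D (fun w => \1_S (W w)) tN mD bS).
under [RHS]eq_Rintegral do rewrite mulrBr.
rewrite [RHS]expB; [|exact: bmM|exact: bmM].
by congr (_ - _); apply: eq_Rintegral => w _; rewrite -(qW w).
Qed.

Lemma typical_belief r (f : V -> R) : bm f ->
  \int[community_law r]_w f (Q0 w) = \int[F r]_q f q.
Proof.
apply: exp_pushforward; first exact: measurable_funP.
move=> A mA; have := @typical_rect r A 0 (fun=> setT) mA (fun=> measurableT).
under eq_Rintegral do rewrite big_ord0.
rewrite exp_in; under eq_Rintegral do rewrite mul1r.
rewrite exp_indic// => <-; congr (Pr _ _).
by apply/seteqP; split => w //= [].
Qed.

Section Truncated.
Variables (c d : R) (u : 'I_K -> 'I_l -> R) (ni : 'I_K -> bool).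
Notation a := (1 - c - d).
Notation LamT r := (Lam c d nu u ni r).

(* The opinion after [m] steps driven by the signals at times t + m - 1, ..., t,
   in this order: the most recent signal has the smallest index. *)
Fixpoint truncated (r : 'I_K) (m t : nat) (w : Omega0) : V :=
  if m is m'.+1 then upd c d u ni r (Q0 w) (Z0 t w) (truncated r m' t.+1 w)
  else [tuple 0 | k < l].

Lemma truncated_past r m t N s : (s < t)%N -> (t + m <= N)%N ->
  measurable_fun setT (truncated r m t : g_sigma_algebraType (past s N) -> V).
Proof.
elim: m t => [|m IH] t st tN; first exact: measurable_cst.
apply: measurable_upd; first exact: past_belief.
- by apply: past_signal; rewrite st (leq_trans _ tN)// addnS ltnS leq_addr.
- by apply: IH; [exact: ltnW|rewrite addSnnS].
Qed.

Lemma truncated_exp r m t (phi : V * V -> R) : bm phi ->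
  \int[community_law r]_w phi (Q0 w, truncated r m t w) =
  \int[community_law r]_w iter m (LamT r) phi (Q0 w, [tuple 0 | k < l]).
Proof.
elim: m t phi => [//|m IH] t phi bphi; rewrite iterSr -(IH t.+1); last exact: bm_Lam.
pose W w := (Q0 w, truncated r m t.+1 w).
apply: (@typical_disint r t (t + m.+1) _ _ W fst
  (fun x => phi (x.1.1, upd c d u ni r x.1.1 x.2 x.1.2))) => //.
- by rewrite addnS ltnS leq_addr.
- apply: measurable_fun_pair; first exact: past_belief.
  by apply: truncated_past => //; rewrite addSnnS.
- apply: bm_upd => //.
  + exact: (measurableT_comp measurable_fst).
  + exact: (measurableT_comp measurable_snd).
Qed.

Lemma truncated_law r m (f : V -> R) : bm f ->
  \int[community_law r]_w f (truncated r m 0 w) =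
  \int[F r]_q iter m (LamT r) (fun x => f x.2) (q, [tuple 0 | k < l]).
Proof.
move=> bf; have bphi : bm (fun x : V * V => f x.2) by exact: (bm_comp bf measurable_snd).
rewrite (@truncated_exp r m 0 (fun x => f x.2))//.
apply: (@typical_belief r (fun q => iter m (LamT r) (fun x => f x.2) (q, [tuple 0 | k < l]))).
apply: (bm_comp (bm_LamT c d nu u ni m r bphi)).
by apply: measurable_fun_pair => //; exact: measurable_cst.
Qed.

Hypotheses (c0 : 0 <= c) (dpos : 0 < d) (cd1 : c + d <= 1).
Hypothesis u1 : forall r k, `|u r k| <= 1.
Hypothesis ni_u : forall r k, ni r -> u r k = 0.

Lemma upd_le1 r q z y k : `|tnth (upd c d u ni r q z y) k| <= 1.
Proof.
rewrite tnth_mktuple; have A := clip1_le (tnth y k); have B := clip1_le (tnth z k).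
have C := clip1_le (tnth q k).
have a0 : 0 <= a by rewrite -addrA -opprD subr_ge0.
have h1 : `|a * clip1 (tnth y k) + d * clip1 (tnth z k)| <= a + d.
  apply: (le_trans (ler_normD _ _)); rewrite !normrM (ger0_norm a0) (gtr0_norm dpos).
  by rewrite lerD// ler_piMr// ltW.
have h2 : `|c * clip1 (tnth q k) * (ni r)%:R + c * u r k| <= c.
  have [nir|nir] := boolP (ni r).
    by rewrite ni_u// mulr0 addr0 mulr1 normrM (ger0_norm c0) ler_piMr.
  by rewrite mulr0 add0r normrM (ger0_norm c0) ler_piMr.
rewrite -addrA; apply: (le_trans (ler_normD _ _)); apply: (le_trans (lerD h1 h2)).
by have -> : a + d + c = 1 by ring.
Qed.

Lemma truncated_le1 r m t w k : `|tnth (truncated r m t w) k| <= 1.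
Proof.
by case: m => [|m]; [rewrite tnth_mktuple normr0|exact: upd_le1].
Qed.

Lemma truncatedE r m t w k : tnth (truncated r m t w) k =
  \sum_(s < m) a ^+ s * (d * tnth (Z0 (t + s) w) k + c * tnth (Q0 w) k * (ni r)%:R
     + c * u r k).
Proof.
case: typical => _ Qc Zc _.
elim: m t => [|m IH] t; first by rewrite big_ord0 tnth_mktuple.
rewrite [LHS]tnth_mktuple clip1_id ?truncated_le1// IH.
rewrite !clip1_id; [|exact: Qc|exact: Zc].
rewrite big_ord_recl addn0 mul1r mulr_sumr.
rewrite (_ : \sum_(i < m) _ = \sum_(i < m) a ^+ bump 0 i *
   (d * tnth (Z0 (t + bump 0 i) w) k + c * tnth (Q0 w) k * (ni r)%:R + c * u r k)).
  by ring.
by apply: eq_bigr => i _; rewrite /bump /= add1n exprS mulrA addSnnS.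
Qed.

End Truncated.

End Typical.

(** * The mean-field series *)

Lemma geo_series (R : realType) (x : nat -> R) (C q : R) :
  0 <= q < 1 -> (forall t, `|x t| <= C * q ^+ t) ->
  cvgn (series x) /\ forall T, `|limn (series x) - series x T| <= C * q ^+ T / (1 - q).
Proof.
move=> /andP[q0 q1] xC; have q1' : 0 < 1 - q by rewrite subr_gt0.
have C0 : 0 <= C by have := le_trans (normr_ge0 _) (xC 0%N); rewrite expr0 mulr1.
have cv : cvgn (series x).
  apply: normed_cvg; apply: (@series_le_cvg _ _ (geometric C q)).
  - by move=> t; exact: normr_ge0.
  - by move=> t; apply: mulr_ge0 => //; exact: exprn_ge0.
  - by move=> t; exact: xC.
  by apply: is_cvg_geometric_series; rewrite ger0_norm.
split => // T.
have step N : `|series x (N + T)%N - series x T| <= C * (q ^+ T - q ^+ (N + T)) / (1 - q).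
  elim: N => [|N IH]; first by rewrite add0n !subrr normr0 mulr0 mul0r.
  rewrite addSn (_ : series x (N + T).+1 = series x (N + T)%N + x (N + T)%N); last first.
    by rewrite /series /= big_nat_recr.
  rewrite addrAC; apply: (le_trans (ler_normD _ _)).
  apply: (le_trans (lerD IH (xC _))).
  rewrite le_eqVlt; apply/orP; left; apply/eqP; rewrite exprS; field.
  by rewrite gt_eqF.
have bnd N : (T <= N)%N -> `|series x N - series x T| <= C * q ^+ T / (1 - q).
  move=> TN; rewrite -(subnK TN); apply: (le_trans (step _)).
  by rewrite ler_wpM2r ?invr_ge0 ?(ltW q1')// ler_wpM2l// gerBl exprn_ge0.
rewrite ler_norml lerBrDr lerBlDr; apply/andP; split.
  apply: limr_ge => //; near=> N.
  have := bnd N; rewrite ler_norml lerBrDr => h.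
  by have /h/andP[] : (T <= N)%N by near: N; exact: nbhs_infty_ge.
apply: limr_le => //; near=> N.
have := bnd N; rewrite ler_norml !lerBrDr !lerBlDr => h.
by have /h/andP[] : (T <= N)%N by near: N; exact: nbhs_infty_ge.
Unshelve. all: by end_near. Qed.

Lemma cvgn_sum (R : realType) (I : Type) (s : seq I) (f : I -> nat -> R) (x : I -> R) :
  (forall i, f i @ \oo --> x i) ->
  (fun N => \sum_(i <- s) f i N) @ \oo --> \sum_(i <- s) x i.
Proof.
move=> fx; elim: s => [|i s IH].
  rewrite big_nil (_ : (fun N => _) = fun=> 0); first exact: cvg_cst.
  by apply/funext => N; rewrite big_nil.
rewrite big_cons (_ : (fun N => _) = fun N => f i N + \sum_(j <- s) f j N).
  by apply: cvgD => //; exact: fx.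
by apply/funext => N; rewrite big_cons.
Qed.

Lemma measurable_uniform_limit (R : realType) d (T : measurableType d) (g : T -> R) :
  (forall eps, 0 < eps ->
     exists2 f : T -> R, measurable_fun setT f & forall x, `|g x - f x| <= eps) ->
  measurable_fun setT g.
Proof.
move=> h; have h' n : {f : T -> R | measurable_fun setT f /\
    forall x, `|g x - f x| <= n.+1%:R^-1}.
  by apply: cid; have [|f mf gf] := h n.+1%:R^-1; [rewrite invr_gt0|exists f].
apply: (@measurable_fun_cvg _ _ _ _ (fun n => sval (h' n))).
  by move=> n; case: (svalP (h' n)).
move=> x _; apply/cvgrPdist_le => eps eps0; near=> n.
have [_ /(_ x) /le_trans] := svalP (h' n); apply.
by rewrite ltW//; near: n; exact: near_infty_natSinv_lt (PosNum eps0).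
Unshelve. all: by end_near. Qed.

Lemma exprZmx (R : comNzRingType) n (b : R) (A : 'M[R]_n) i :
  (b *: A) ^+ i = b ^+ i *: A ^+ i.
Proof.
elim: i => [|i IH]; first by rewrite !expr0 scale1r.
rewrite !exprS IH -[_ * _]/((b *: A) *m (b ^+ i *: A ^+ i)).
by rewrite -scalemxAl -scalemxAr scalerA.
Qed.

Section MeanField.
Context {R : realType} {K l : nat} {d0 : measure_display}.
Context {Omega0 : measurableType d0}.
Notation V := (l.-tuple R).
Variables (kappa : 'I_K -> 'I_K -> R) (pi_ : 'I_K -> R) (F : 'I_K -> probability V R).
Variables (G : 'I_K -> 'I_K -> probability R R).
Variables (nu : 'I_K -> R.-pker V ~> V) (c d H : R).
Variables (P0 : probability Omega0 R) (J0 : Omega0 -> 'I_K) (Q0 : {RV P0 >-> V}).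
Variable Z0 : nat -> {RV P0 >-> V}.
Hypothesis typical : typical_vertex pi_ F nu J0 Q0 Z0.
Hypothesis pi_gt0 : forall r, 0 < pi_ r.
Hypotheses (c0 : 0 <= c) (dpos : 0 < d) (cd1 : c + d <= 1) (H0 : 0 < H).
Hypothesis kappa0 : forall r s, 0 <= kappa r s.
Hypothesis G_support : forall r s, G r s `[0, H]%classic = 1%E.

Notation a := (1 - c - d).
Notation M := (mean_matrix kappa pi_ G).
Notation ni := (no_inbound kappa pi_).
Notation Wb := (mean_signal kappa pi_ c d J0 Q0 Z0).
Notation R0 := (mean_field_opinion kappa pi_ G c d J0 Q0 Z0).
Notation P0r := (community_law typical).

Let a0 : 0 <= a. Proof. by rewrite -addrA -opprD subr_ge0. Qed.
Let cd0 : 0 < c + d. Proof. by rewrite ltr_wpDl. Qed.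
Let a1 : a < 1. Proof. by rewrite -addrA -opprD gtrBl. Qed.

Definition clipH (x : R) : R := Num.max 0 (Num.min x H).

Lemma clipH_id x : 0 <= x <= H -> clipH x = x.
Proof. by move=> /andP[x0 xH]; rewrite /clipH min_l// max_r. Qed.

Lemma clipH_itv x : 0 <= clipH x <= H.
Proof. by rewrite /clipH le_max lexx/= ge_max (ltW H0) ge_min lexx orbT. Qed.

Lemma bm_clipH : bm clipH.
Proof.
split.
  apply: measurable_maxr; first exact: measurable_cst.
  by apply: measurable_minr; [exact: measurable_id|exact: measurable_cst].
by exists H => x; have /andP[h1 h2] := clipH_itv x; rewrite ger0_norm.
Qed.

Lemma mean_weightE r s : mean_weight G r s = \int[G r s]_x clipH x.
Proof.
apply: (exp_as (A := `[0, H]%classic)) => //.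
- by case: bm_clipH.
-
by move=> x; rewrite /= in_itv/= => xH; rewrite clipH_id.
Qed.

Lemma mean_weight_ge0 r s : 0 <= mean_weight G r s.
Proof. by rewrite mean_weightE exp_ge0// => x; case/andP: (clipH_itv x). Qed.

(* Limit of the total weight of a vertex of community r, divided by theta. *)
Definition inflow r : R := \sum_t pi_ t * mean_weight G r t * kappa t r.

Lemma tau_term_ge0 r t : 0 <= pi_ t * mean_weight G r t * kappa t r.
Proof. by rewrite !mulr_ge0 ?mean_weight_ge0// ltW. Qed.

Lemma tau_ge0 r : 0 <= inflow r.
Proof. by apply: sumr_ge0 => t _; exact: tau_term_ge0. Qed.

Lemma meanME r s : M r s = if 0 < inflow r
  then pi_ s * mean_weight G r s * kappa s r / inflow r else 0.
Proof. by rewrite mxE. Qed.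

Lemma meanM_ge0 r s : 0 <= M r s.
Proof.
by rewrite meanME; case: ifP => // _; rewrite divr_ge0 ?tau_term_ge0 ?tau_ge0.
Qed.

Lemma meanM_sum r : \sum_s M r s <= 1.
Proof.
have [t0|t0] := ltP 0 (inflow r); last first.
  by rewrite big1// => s _; rewrite meanME ltNge t0.
under eq_bigr do rewrite meanME t0.
by rewrite -mulr_suml -/(inflow r) divff// gt_eqF.
Qed.

Lemma no_inbound_inflow r : ni r -> inflow r = 0.
Proof.
rewrite /no_inbound psumr_eq0; last by move=> s _; rewrite mulr_ge0// ltW.
move=> /allP h; rewrite /inflow big1// => s _.
have := h s (mem_index_enum s); rewrite /= mulf_eq0 gt_eqF//= => /eqP ->.
by rewrite mulr0.
Qed.

Definition walk_mx : 'M[R]_K := a *: 1%:M + c *: M.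

Definition walk_mean (t : nat) (r : 'I_K) (k : 'I_l) : R := (walk_mx ^+ t *m Wb) r k.

Lemma walk_mean0 r k : walk_mean 0 r k = Wb r k.
Proof. by rewrite /walk_mean expr0 mul1mx. Qed.

Lemma walk_meanS t r k : walk_mean t.+1 r k =
  a * walk_mean t r k + c * \sum_s M r s * walk_mean t s k.
Proof.
rewrite /walk_mean exprS -mulmxA /walk_mx mulmxDl -!scalemxAl mul1mx !mxE.
by congr (_ + c * _); apply: eq_bigr => s _.
Qed.

Lemma walk_mean_bound : exists B, forall t r k, `|walk_mean t r k| <= B * (1 - d) ^+ t.
Proof.
exists (\sum_r \sum_k `|Wb r k|) => t; elim: t => [|t IH] r k.
  rewrite expr0 mulr1 walk_mean0 (bigD1 r)//= (bigD1 k)//= -addrA lerDl addr_ge0//.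
    by apply: sumr_ge0.
  by apply: sumr_ge0 => ? _; apply: sumr_ge0.
rewrite walk_meanS; apply: (le_trans (ler_normD _ _)).
set B := \sum_r _ in IH *; set b := B * (1 - d) ^+ t in IH *.
have b0 : 0 <= b by apply: le_trans (IH r k).
rewrite exprS mulrCA -/b (_ : (1 - d) * b = a * b + c * b); last by ring.
apply: lerD; first by rewrite normrM ger0_norm// ler_wpM2l.
rewrite normrM ger0_norm// ler_wpM2l//; apply: (le_trans (ler_norm_sum _ _ _)).
apply: (@le_trans _ _ (\sum_s M r s * b)).
  by apply: ler_sum => s _; rewrite normrM ger0_norm ?meanM_ge0// ler_wpM2l ?meanM_ge0.
by rewrite -mulr_suml ler_piMl// meanM_sum.
Qed.

Let d01 : 0 <= 1 - d < 1.
Proof. by rewrite subr_ge0 gtrBl dpos andbT; apply: le_trans cd1; rewrite lerDr. Qed.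

Lemma walk_mean_cvg r k : cvgn (series (fun t => walk_mean t r k)).
Proof.
have [B hB] := walk_mean_bound.
by have [] := @geo_series _ (fun t => walk_mean t r k) B (1 - d) d01 (fun t => hB t r k).
Qed.

Definition mean_opinion (r : 'I_K) (k : 'I_l) : R :=
  limn (series (fun t => walk_mean t r k)).

Definition nbr_limit (r : 'I_K) (k : 'I_l) : R := \sum_s M r s * mean_opinion s k.

(** The limiting mean opinions solve the stationary balance equation. *)
Lemma mean_opinion_eq r k :
  (c + d) * mean_opinion r k = c * nbr_limit r k + Wb r k.
Proof.
have cv s : series (fun t => walk_mean t s k) @ \oo --> mean_opinion s k.
  exact: walk_mean_cvg.
have h1 : (fun N => series (fun t => walk_mean t r k) N.+1) @ \oo --> mean_opinion r k.
  by rewrite (cvg_shiftS (series (fun t => walk_mean t r k))).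
have h2 : (fun N => series (fun t => walk_mean t r k) N.+1) @ \oo -->
    Wb r k + (a * mean_opinion r k + c * nbr_limit r k).
  rewrite (_ : (fun N => _) = fun N => Wb r k + (a * series (fun t => walk_mean t r k) N +
      c * \sum_s M r s * series (fun t => walk_mean t s k) N)); last first.
    apply/funext => N; rewrite /series /= big_nat_recl// walk_mean0; congr (_ + _).
    under eq_bigr do rewrite walk_meanS.
    rewrite big_split/= -mulr_sumr; congr (_ + _).
    rewrite -mulr_sumr; congr (_ * _).
    rewrite exchange_big/=; apply: eq_bigr => s _; by rewrite mulr_sumr.
  apply: cvgD; first exact: cvg_cst.
  apply: cvgD; first by apply: cvgM => //; exact: cvg_cst.
  apply: cvgM; first exact: cvg_cst.
  rewrite /nbr_limit; apply: cvgn_sum => s.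
  by apply: cvgM => //; exact: cvg_cst.
have E := cvg_unique (@norm_hausdorff _ R) h1 h2.
have -> : (c + d) * mean_opinion r k = mean_opinion r k - a * mean_opinion r k by ring.
by rewrite {1}E; ring.
Qed.

Let signal0E r k : Wb r k = \int[P0r r]_w (d * clip1 (tnth (Z0 0%N w) k) +
   c * clip1 (tnth (Q0 w) k) * (ni r)%:R).
Proof.
have [_ Qc Zc _] := typical.
pose sg r' w := d * clip1 (tnth (Z0 0%N w) k) + c * clip1 (tnth (Q0 w) k) * (ni r')%:R.
have bsg r' : bm (sg r').
  apply: bmD; first by apply/bmZ/bm_clip1/(measurableT_comp (measurable_tnth k)).
  apply: bmM; last exact: bm_cst.
  by apply/bmZ/bm_clip1/(measurableT_comp (measurable_tnth k)).
rewrite mxE -(condE_condp (measurable_atom0 typical r) (atom0_neq0 typical pi_gt0 r) (bsg r)).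
rewrite /condE; congr (_ / _); apply: eq_Rintegral => w.
by rewrite inE /= /signal => ->; rewrite /sg !clip1_id//; [exact: Qc|exact: Zc].
Qed.

Lemma mean_signal_le r k : `|Wb r k| <= d + c * (ni r)%:R.
Proof.
rewrite signal0E; apply: exp_abs_cst.
  apply: bmD; first by apply/bmZ/bm_clip1/(measurableT_comp (measurable_tnth k)).
  apply: bmM; last exact: bm_cst.
  by apply/bmZ/bm_clip1/(measurableT_comp (measurable_tnth k)).
move=> w; apply: (le_trans (ler_normD _ _)); apply: lerD.
  by rewrite normrM (gtr0_norm dpos) ler_piMr ?clip1_le// ltW.
rewrite !normrM (ger0_norm c0) -mulrA ler_wpM2l//.
by rewrite [leLHS]mulrC normr_nat ler_piMr// clip1_le.
Qed.

Lemma nbr_limit_no_inbound r k : ni r -> nbr_limit r k = 0.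
Proof.
move=> nir; rewrite /nbr_limit big1// => s _.
by rewrite meanME no_inbound_inflow// ltxx mul0r.
Qed.

Lemma mean_opinion_le r k : `|mean_opinion r k| <= 1.
Proof.
suff [s smax] : exists s, forall r, `|mean_opinion r k| <= `|mean_opinion s k|.
  apply: (le_trans (smax r)); rewrite -(ler_pM2l cd0) mulr1.
  have sE := mean_opinion_eq s k.
  have hs : (c + d) * `|mean_opinion s k| <= `|c * nbr_limit s k| + `|Wb s k|.
    by rewrite -(gtr0_norm cd0) -normrM sE ler_normD.
  have hW := mean_signal_le s k.
  have [nis|nis] := boolP (ni s).
    apply: (le_trans hs); rewrite nbr_limit_no_inbound// mulr0 normr0 add0r.
    by move: hW; rewrite nis mulr1 [d + c]addrC.
  have hu : `|nbr_limit s k| <= `|mean_opinion s k|.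
    apply: (le_trans (ler_norm_sum _ _ _)).
    apply: (@le_trans _ _ (\sum_t M s t * `|mean_opinion s k|)).
      by apply: ler_sum => t _; rewrite normrM ger0_norm ?meanM_ge0// ler_wpM2l ?meanM_ge0.
    by rewrite -mulr_suml ler_piMl// meanM_sum.
  have cu : `|c * nbr_limit s k| <= c * `|mean_opinion s k|.
    by rewrite normrM (ger0_norm c0) ler_wpM2l.
  have m1 : d * `|mean_opinion s k| <= d * 1.
    move: hs hW cu; rewrite (negbTE nis) mulr0 addr0 mulrDl mulr1; lra.
  have : `|mean_opinion s k| <= 1 by rewrite -(ler_pM2l dpos).
  by move=> h; rewrite ler_piMr// ltW.
by exists [arg max_(s > r) `|mean_opinion s k|]%O; case: arg_maxP => // s _ h t; exact: h.
Qed.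

Lemma nbr_limit_le r k : `|nbr_limit r k| <= 1.
Proof.
apply: (le_trans (ler_norm_sum _ _ _)); apply: le_trans (meanM_sum r).
apply: ler_sum => t _; rewrite normrM ger0_norm ?meanM_ge0//.
by rewrite ler_piMr ?meanM_ge0// mean_opinion_le.
Qed.

Lemma exp_mean_mark r k :
  \int[F r]_q mean_mark c d nu nbr_limit ni r k q = (c + d) * mean_opinion r k.
Proof.
rewrite mean_opinion_eq signal0E.
have bc : bm (fun q : V => clip1 (tnth q k)) by apply: bm_clip1; exact: measurable_tnth.
have bmed : bm (media_avg nu r k).
  by apply: (@bm_kernel _ _ _ _ _ _ _ (nu r) id (fun x : V * V => clip1 (tnth x.2 k))) => //;
    exact: (bm_comp bc measurable_snd).
have bq : bm (fun q => d * media_avg nu r k q + c * clip1 (tnth q k) * (ni r)%:R).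
  by apply: bmD; [exact: bmZ|apply: bmM; [exact: bmZ|exact: bm_cst]].
rewrite /mean_mark (expD (F r) (bm_cst (c * nbr_limit r k)) bq).
rewrite exp_cst; congr (_ + _).
rewrite -(typical_belief typical)//.
rewrite (@typical_disint _ _ _ _ _ _ _ _ _ _ _ _ typical pi_gt0 r 0 1 _ _ Q0 id
  (fun x => d * clip1 (tnth x.2 k) + c * clip1 (tnth x.1 k) * (ni r)%:R))//.
- apply: eq_Rintegral => w _.
  by rewrite (expD _ (bmZ d bc) (bm_cst (c * clip1 (tnth (Q0 w) k) * (ni r)%:R))) expZ// exp_cst.
- exact: past_belief.
- apply: bmD; first exact: (bmZ _ (bm_comp bc measurable_snd)).
  apply: bmM; last exact: bm_cst.
  exact: (bmZ _ (bm_comp bc measurable_fst)).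
Qed.

Lemma walk_meanE t r k :
  walk_mean t r k = \sum_(0 <= s < t.+1) coef c d s t * (M ^+ s *m Wb) r k.
Proof.
rewrite /walk_mean /walk_mx exprDn_comm; last first.
  rewrite /GRing.comm -[_ * _]/((a *: 1%:M) *m (c *: M)) -[RHS]/((c *: M) *m (a *: 1%:M)).
  by rewrite -!scalemxAl -!scalemxAr mul1mx mulmx1 !scalerA mulrC.
rewrite mulmx_suml summxE big_mkord; apply: eq_bigr => s _.
rewrite !exprZmx expr1n -[_ * _]/((a ^+ (t - s) *: 1%:M) *m (c ^+ s *: M ^+ s)).
rewrite -scalemxAl mul1mx scalerA -scaler_nat scalerA -scalemxAl mxE.
by rewrite /coef mulrA.
Qed.

Let a01 : 0 <= a < 1. Proof. by rewrite a0 a1. Qed.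

Let geoE T : \sum_(s < T) a ^+ s = (1 - a ^+ T) / (c + d).
Proof.
have cdN : c + d != 0 by rewrite gt_eqF.
elim: T => [|T IH]; first by rewrite big_ord0 expr0 subrr mul0r.
by rewrite big_ord_recr IH /= exprS; field.
Qed.

Let second_series r k :
  limn (series (fun t => \sum_(1 <= s < t.+1) coef c d s t * (M ^+ s *m Wb) r k)) =
  c * nbr_limit r k / (c + d).
Proof.
have cdN : c + d != 0 by rewrite gt_eqF.
apply/cvg_lim => //.
have -> : c * nbr_limit r k / (c + d) = mean_opinion r k - Wb r k / (c + d).
  have -> : c * nbr_limit r k = (c + d) * mean_opinion r k - Wb r k.
    by rewrite mean_opinion_eq addrK.
  by field.
rewrite (_ : series _ = fun N => series (fun t => walk_mean t r k) N -
   series (fun t => Wb r k * a ^+ t) N); last first.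
  apply/funext => N; rewrite /series/= -sumrB; apply: eq_bigr => t _.
  rewrite walk_meanE [in RHS]big_ltn// {2}/coef bin0 subn0 !expr0 mul1mx mulr1 mul1r.
  by rewrite [X in _ = X - _]addrC [X in _ = _ - X]mulrC addrK.
apply: cvgB; first exact: walk_mean_cvg.
have -> : c + d = 1 - a by ring.
by apply: (cvg_geometric_series (z := a)); rewrite ger0_norm.
Qed.

Lemma mean_field_truncated T w k :
  `|tnth (R0 w) k - tnth (truncated Q0 Z0 c d nbr_limit ni (J0 w) T 0 w) k| <= a ^+ T.
Proof.
rewrite (truncatedE typical)//; [|exact: nbr_limit_le|by move=> r' k'; exact: nbr_limit_no_inbound].
have [_ Qc Zc _] := typical.
rewrite tnth_mktuple second_series.
set r := J0 w; set u := nbr_limit r k.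
have cu : `|c * u| <= c - c * (ni r)%:R.
  have [nir|nir] := boolP (ni r).
    by rewrite /u nbr_limit_no_inbound// mulr0 normr0 mulr1 subrr.
  by rewrite mulr0 subr0 normrM (ger0_norm c0) ler_piMr// nbr_limit_le.
clearbody u.
under [X in _ - X]eq_bigr do rewrite add0n.
pose x t := a ^+ t * signal kappa pi_ c d J0 Q0 Z0 t w k.
pose C := d + c * (ni r)%:R.
have xC t : `|x t| <= C * a ^+ t.
  rewrite normrM ger0_norm ?exprn_ge0// mulrC ler_wpM2r ?exprn_ge0//.
  rewrite /signal -/r; apply: (le_trans (ler_normD _ _)); apply: lerD.
    by rewrite normrM (gtr0_norm dpos) ler_piMr ?(ltW dpos)//; exact: Zc.
  rewrite !normrM (ger0_norm c0) -mulrA ler_wpM2l//.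
  by rewrite [leLHS]mulrC normr_nat ler_piMr//; exact: Qc.
have [_ /(_ T) hx] := geo_series a01 xC.
have -> : \sum_(i < T) a ^+ i * (d * tnth (Z0 i w) k + c * tnth (Q0 w) k * (ni r)%:R + c * u) =
    series x T + c * u * ((1 - a ^+ T) / (c + d)).
  rewrite -geoE mulr_sumr /series/= big_mkord -big_split/=; apply: eq_bigr => i _.
  by rewrite /x /signal; ring.
have cdN : c + d != 0 by rewrite gt_eqF.
have -> : limn (series x) + c * u / (c + d) - (series x T + c * u * ((1 - a ^+ T) / (c + d)))
  = (limn (series x) - series x T) + c * u * (a ^+ T / (c + d)) by field.
apply: (le_trans (ler_normD _ _)); apply: (le_trans (lerD hx (lexx _))).
have -> : 1 - a = c + d by ring.
have q0 : 0 <= a ^+ T / (c + d) by rewrite divr_ge0 ?exprn_ge0// ltW.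
rewrite normrM (ger0_norm q0) -mulrA; apply: (le_trans (lerD (lexx _) (ler_wpM2r q0 cu))).
rewrite -mulrDl /C (_ : d + _ + _ = c + d); last by ring.
by rewrite mulrC divfK.
Qed.

Lemma mean_field_cube w : cube (R0 w).
Proof.
move=> k; have := mean_field_truncated 0 w k.
by rewrite [X in _ - X]tnth_mktuple subr0.
Qed.

Lemma measurable_truncated r T t :
  measurable_fun setT (truncated Q0 Z0 c d nbr_limit ni r T t).
Proof.
elim: T t => [|T IH] t; first exact: measurable_cst.
by apply: measurable_upd; [exact: measurable_funP|exact: measurable_funP|exact: IH].
Qed.

Lemma measurable_mean_field : measurable_fun setT R0.
Proof.
apply: measurable_mktuple => k; apply: measurable_uniform_limit => eps eps0.
have [T aT] : exists T, a ^+ T <= eps.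
  have : (fun T => a ^+ T) @ \oo --> (0 : R) by apply: cvg_expr; rewrite ger0_norm.
  move=> /cvgrPdist_le /(_ _ eps0) [T _ /(_ T (leqnn T))].
  by rewrite sub0r normrN ger0_norm ?exprn_ge0//; exists T.
pose f w := \sum_r (J0 w == r)%:R * tnth (truncated Q0 Z0 c d nbr_limit ni r T 0 w) k.
exists f => [|w].
  apply: bm_measurable; apply: bm_sum => r _; apply: bmM.
    by apply: bm_bool; rewrite (_ : [set w | _] = [set w | J0 w = r]);
      [exact: measurable_atom0 typical r|apply/seteqP; split => w /= /eqP].
  split; first by apply: (measurableT_comp (measurable_tnth k)); exact: measurable_truncated.
  exists 1 => w; apply: truncated_le1 => //; first exact: nbr_limit_le.
  by move=> r' k'; exact: nbr_limit_no_inbound.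
rewrite /f (bigD1 (J0 w))//= eqxx mul1r big1 ?addr0; last first.
  by move=> r rw; rewrite eq_sym (negbTE rw) mul0r.
apply: le_trans aT; have := mean_field_truncated T w k.
by rewrite tnth_mktuple.
Qed.

(** The truncations identify the law of the limiting opinion given the community. *)
Lemma mean_field_law r (f : V -> R) L T : 0 <= L -> bm f ->
  (forall x y, `|f x - f y| <= L * dclip x y) ->
  `|\int[P0r r]_w f (R0 w) -
    \int[F r]_q iter T (Lam c d nu nbr_limit ni r) (fun x => f x.2) (q, [tuple 0 | k < l])|
  <= L * (l%:R * a ^+ T).
Proof.
move=> L0 bf fL; rewrite -(truncated_law typical pi_gt0)//.
have mR := measurable_mean_field; have mT := measurable_truncated r T 0.
have bR : bm (fun w => f (R0 w)) by exact: (bm_comp bf).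
have bT : bm (fun w => f (truncated Q0 Z0 c d nbr_limit ni r T 0 w)) by exact: (bm_comp bf).
rewrite -expB//.
set g := fun w => _.
have bg : bm g by exact: bmB.
rewrite (exp_as (A := [set w | J0 w = r]) (g := fun w => g w * \1_[set w | J0 w = r] w)).
- apply: exp_abs_cst; first by apply: bmM => //; apply: bm_indic; exact: (measurable_atom0 typical).
  move=> w; rewrite indicE; have [/set_mem Jw|_] := boolP (_ \in _); last first.
    by rewrite mulr0 normr0 !mulr_ge0// exprn_ge0.
  rewrite mulr1 /g; apply: (le_trans (fL _ _)); rewrite ler_wpM2l//.
  apply: (le_trans (dclip_le _ _)).
  apply: (@le_trans _ _ (\sum_(k < l) a ^+ T)).
    by apply: ler_sum => k _; rewrite -Jw; exact: mean_field_truncated.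
  by rewrite sumr_const card_ord mulr_natl.
- exact: (measurable_atom0 typical).
- have := condp_supp (measurable_atom0 typical r) (atom0_neq0 typical pi_gt0 r).
  by rewrite /Pr => h; rewrite -[LHS]fineK ?h// fin_num_measure//; exact: (measurable_atom0 typical).
- by case: bg.
- by apply: bm_measurable; apply: bmM => //; apply: bm_indic; exact: (measurable_atom0 typical).
- by move=> w Jw; rewrite indicE mem_set// mulr1.
Qed.

End MeanField.

(** * A Lipschitz partition of unity on the cube *)

Section Hat.
Context {R : realType}.
Implicit Types x y t : R.

Definition clamp01 (y : R) : R := Num.max 0 (Num.min y 1).

Lemma clamp01_le0 y : y <= 0 -> clamp01 y = 0.
Proof. by move=> h; rewrite /clamp01 min_l ?max_l// (le_trans h). Qed.

Lemma clamp01_ge1 y : 1 <= y -> clamp01 y = 1.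
Proof. by move=> h; rewrite /clamp01 min_r// max_r. Qed.

Lemma clamp01_id y : 0 <= y <= 1 -> clamp01 y = y.
Proof. by move=> /andP[h1 h2]; rewrite /clamp01 min_l// max_r. Qed.

Lemma clamp01P y : (y <= 0 /\ clamp01 y = 0) \/ (0 <= y <= 1 /\ clamp01 y = y) \/
  (1 <= y /\ clamp01 y = 1).
Proof.
have [y0|y0] := leP y 0; first by left; rewrite clamp01_le0.
have [y1|y1] := leP 1 y; first by right; right; rewrite clamp01_ge1.
by right; left; rewrite clamp01_id// ?(ltW y0) ?(ltW y1).
Qed.

Lemma clamp01_mono x y : x <= y -> clamp01 x <= clamp01 y.
Proof.
by case: (clamp01P x) => [[? ->]|[[/andP[? ?] ->]|[? ->]]];
  case: (clamp01P y) => [[? ->]|[[/andP[? ?] ->]|[? ->]]] => ?; lra.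
Qed.

Lemma clamp01_lip x y : `|clamp01 x - clamp01 y| <= `|x - y|.
Proof.
wlog xy : x y / y <= x.
  by move=> h; case: (leP y x) => [/h//|/ltW/h]; rewrite distrC [leRHS]distrC.
rewrite !ger0_norm ?subr_ge0//; last exact: clamp01_mono.
by move: xy; case: (clamp01P x) => [[? ->]|[[/andP[? ?] ->]|[? ->]]];
  case: (clamp01P y) => [[? ->]|[[/andP[? ?] ->]|[? ->]]] => ?; lra.
Qed.

(* The piecewise linear tent around the integer j; written as a difference so
   that the sum over j telescopes. *)
Definition hat (j : nat) (y : R) : R := clamp01 (y - j%:R + 1) - clamp01 (y - j%:R).

Lemma hat_ge0 j y : 0 <= hat j y.
Proof. by rewrite subr_ge0 clamp01_mono// lerDl. Qed.

Lemma hat_sum N y : 0 <= y <= N%:R -> \sum_(j < N.+1) hat j y = 1.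
Proof.
move=> /andP[y0 yN].
have -> : \sum_(j < N.+1) hat j y = clamp01 (y + 1) - clamp01 (y - N%:R).
  elim: N {yN} => [|N IH]; first by rewrite big_ord1 /hat subr0.
  rewrite big_ord_recr IH /= /hat.
  have -> : y - N.+1%:R + 1 = y - N%:R by rewrite -natr1; ring.
  by ring.
by rewrite clamp01_ge1 ?lerDr// clamp01_le0 ?subr0// subr_le0.
Qed.

Lemma hat_le1 j y : hat j y <= 1.
Proof.
rewrite /hat; case: (clamp01P (y - j%:R)) => [[? ->]|[[/andP[? ?] ->]|[? ->]]];
case: (clamp01P (y - j%:R + 1)) => [[? ->]|[[/andP[? ?] ->]|[? ->]]]; lra.
Qed.

Lemma hat_lip j x y : `|hat j x - hat j y| <= 2 * `|x - y|.
Proof.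
rewrite /hat (_ : _ - _ = (clamp01 (x - j%:R + 1) - clamp01 (y - j%:R + 1)) -
   (clamp01 (x - j%:R) - clamp01 (y - j%:R))); last by ring.
apply: (le_trans (ler_normB _ _)).
have h1 := clamp01_lip (x - j%:R + 1) (y - j%:R + 1).
have h2 := clamp01_lip (x - j%:R) (y - j%:R).
have e1 : x - j%:R + 1 - (y - j%:R + 1) = x - y by ring.
have e2 : x - j%:R - (y - j%:R) = x - y by ring.
by rewrite mulr_natl mulr2n; rewrite e1 in h1; rewrite e2 in h2; exact: lerD.
Qed.

Lemma hat_supp j y : hat j y != 0 -> `|y - j%:R| <= 1.
Proof.
apply: contraNT; rewrite -ltNge /hat lter_normr => /orP[h|h]; apply/eqP.
  by rewrite !clamp01_ge1 ?subrr//; lra.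
by rewrite !clamp01_le0 ?subrr//; lra.
Qed.

Lemma measurable_clamp01 : measurable_fun setT clamp01.
Proof.
apply: measurable_maxr; first exact: measurable_cst.
by apply: measurable_minr; [exact: measurable_id|exact: measurable_cst].
Qed.

Lemma bm_hat d (T : measurableType d) j (f : T -> R) :
  measurable_fun setT f -> bm (fun z => hat j (f z)).
Proof.
move=> mf; split; last first.
  by exists 1 => z; rewrite ger0_norm ?hat_ge0// hat_le1.
apply: measurable_funB.
  apply: (measurableT_comp measurable_clamp01).
  by apply: measurable_funD; [apply: measurable_funB|]; last exact: measurable_cst.
apply: (measurableT_comp measurable_clamp01).
by apply: measurable_funB => //; exact: measurable_cst.
Qed.

End Hat.

Section Grid.
Context {R : realType} {l : nat}.
Notation V := (l.-tuple R).
Variable N : nat.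
Notation I := {ffun 'I_l -> 'I_N.+1}.

Definition grid_coord (t : R) : R := N%:R * ((clip1 t + 1) / 2).

Definition grid_point (b : I) : V := [tuple 2 * (b k)%:R / N%:R - 1 | k < l].

Definition tent (b : I) (x : V) : R := \prod_(k < l) hat (b k) (grid_coord (tnth x k)).

Lemma grid_coord_itv t : 0 <= grid_coord t <= N%:R.
Proof.
have := clip1_le t; rewrite ler_norml => /andP[h1 h2].
rewrite /grid_coord mulr_ge0//=; last by lra.
by rewrite ler_piMr//; lra.
Qed.

Lemma tent_ge0 b x : 0 <= tent b x.
Proof. by apply: prodr_ge0 => k _; exact: hat_ge0. Qed.

Lemma tent_sum x : \sum_b tent b x = 1.
Proof.
rewrite /tent -(bigA_distr_bigA (fun k (j : 'I_N.+1) => hat j (grid_coord (tnth x k)))).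
by rewrite big1// => k _; rewrite hat_sum// grid_coord_itv.
Qed.

Lemma tent_le1 b x : tent b x <= 1.
Proof.
by rewrite -(tent_sum x) (bigD1 b)//= lerDl sumr_ge0// => *; exact: tent_ge0.
Qed.

Lemma tent_lip b x y : `|tent b x - tent b y| <= N%:R * dclip x y.
Proof.
have h1 z k : `|hat (b k) (grid_coord (tnth z k))| <= 1 by rewrite ger0_norm ?hat_ge0 ?hat_le1.
apply: (le_trans (prod_diff_le _ (h1 x) (h1 y))).
rewrite /dclip mulr_sumr; apply: ler_sum => k _; apply: (le_trans (hat_lip _ _ _)).
rewrite /grid_coord -mulrBr normrM normr_nat.
have -> : (clip1 (tnth x k) + 1) / 2 - (clip1 (tnth y k) + 1) / 2 =
  (clip1 (tnth x k) - clip1 (tnth y k)) / 2 by ring.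
rewrite normrM [`|2^-1|]ger0_norm ?invr_ge0//.
by rewrite le_eqVlt; apply/orP; left; apply/eqP; field.
Qed.

Lemma bm_tent b : bm (tent b).
Proof.
apply: bm_prod => k _; apply: bm_hat; apply: measurable_funM; first exact: measurable_cst.
apply: measurable_funM; last exact: measurable_cst.
apply: measurable_funD; last exact: measurable_cst.
by apply: bm_measurable; apply: bm_clip1; exact: measurable_tnth.
Qed.

Hypothesis N0 : (0 < N)%N.

Lemma grid_point_cube b : cube (grid_point b).
Proof.
move=> k; rewrite tnth_mktuple.
have NR : 0 < N%:R :> R by rewrite ltr0n.
have h1 : 0 <= (b k)%:R / N%:R :> R by rewrite divr_ge0.
have h2 : (b k)%:R / N%:R <= 1 :> R by rewrite ler_pdivrMr// mul1r ler_nat -ltnS ltn_ord.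
by rewrite -mulrA ler_norml; apply/andP; split; lra.
Qed.

Lemma tent_supp b x : tent b x != 0 -> dclip x (grid_point b) <= l%:R * (2 / N%:R).
Proof.
move=> /prodf_neq0 h; have NR : 0 < N%:R :> R by rewrite ltr0n.
apply: (@le_trans _ _ (\sum_(k < l) (2 / N%:R))); last by rewrite sumr_const card_ord -[leLHS]mulr_natl.
apply: ler_sum => k _; have := hat_supp (h k isT).
have gk : tnth (grid_point b) k = 2 * (b k)%:R / N%:R - 1 by rewrite tnth_mktuple.
rewrite (clip1_id (grid_point_cube b k)) gk /grid_coord.
move: (clip1 (tnth x k)) => t.
have -> : t - (2 * (b k)%:R / N%:R - 1) =
  (N%:R * ((t + 1) / 2) - (b k)%:R) * (2 / N%:R) by field; rewrite gt_eqF.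
move=> hk; rewrite normrM [X in _ * X]ger0_norm ?divr_ge0//.
by rewrite ler_piMl// divr_ge0.
Qed.

End Grid.

(** Compactness of the cube. *)
Lemma continuous_modulus (R : realType) l (f : l.-tuple R -> R) : (0 < l)%N ->
  bounded_continuous f -> forall eps, 0 < eps ->
  exists2 L, 0 <= L & forall x y, cube x -> cube y -> `|f x - f y| <= eps + L * dist1 x y.
Proof.
case: l f => // l f _ [[C fC] cf] eps eps0.
apply: contrapT => nh.
have h n : exists xy : l.+1.-tuple R * l.+1.-tuple R, [/\ cube xy.1, cube xy.2 &
    eps + n%:R * dist1 xy.1 xy.2 < `|f xy.1 - f xy.2|].
  apply: contrapT => nh'; apply: nh; exists n%:R => // x y cx cy.
  by rewrite leNgt; apply/negP => hlt; apply: nh'; exists (x, y).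
have [xy xyP] := choice h.
pose X n : 'rV[R]_l.+1 := \row_k tnth (xy n).1 k.
have cptI : compact `[(-1 : R), 1]%classic by exact: segment_compact.
have cpt := rV_compact (fun _ : 'I_l.+1 => cptI).
have [|p [pc clp]] := cpt (X @ \oo) _.
  exists 0%N => // n _ /= k; rewrite mxE in_itv/= -ler_norml.
  by have [/(_ k)] := xyP n.
pose px : l.+1.-tuple R := [tuple p ord0 k | k < l.+1].
have cpx : cube px.
  by move=> k; rewrite tnth_mktuple ler_norml; have := pc k; rewrite /= in_itv.
have [del del0 hdel] := cf px cpx (eps / 2) ltac:(by rewrite divr_gt0).
have C0 : 0 <= C by apply: le_trans (fC px cpx).
have distxy n : (0 < n)%N -> dist1 (xy n).1 (xy n).2 <= 2 * C / n%:R.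
  move=> n0; have [c1 c2 hh] := xyP n.
  have := fC _ c1; have := fC _ c2 => f2 f1.
  have hb := ler_normB (f (xy n).1) (f (xy n).2).
  rewrite ler_pdivlMr ?ltr0n// mulrC; lra.
have [M M0] : exists M : nat, 2 * C / M.+1%:R < del / 2.
  pose M := Num.truncn (4 * C / del); exists M.
  have hM : 4 * C / del < M.+1%:R by exact: truncnS_gt.
  rewrite ltr_pdivrMr ?ltr0n//; rewrite ltr_pdivrMr// in hM; lra.
pose r := del / 2 / l.+1%:R.
have r0 : 0 < r by rewrite !divr_gt0.
have FA : (X @ \oo) [set X n | n in [set n | (M < n)%N]].
  by exists M.+1 => // n /= Mn; exists n.
have [z [[n /= Mn zE] zp]] := clp _ _ FA (nbhsx_ballx p r r0).
have [c1 c2 hh] := xyP n.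
have d1 : dist1 px (xy n).1 < del / 2.
  rewrite (_ : del / 2 = \sum_(k < l.+1) r); last first.
    by rewrite sumr_const card_ord -[RHS]mulr_natr /r divfK// pnatr_eq0.
  apply: ltr_sum => [|k _]; first by apply/hasP; exists ord0.
  by rewrite tnth_mktuple; have := zp.2 ord0 k; rewrite -zE mxE.
have d2 : dist1 (xy n).1 (xy n).2 < del / 2.
  apply: le_lt_trans (distxy n _) _; first by apply: leq_trans Mn.
  apply: le_lt_trans M0; rewrite ler_wpM2l ?mulr_ge0//.
  by rewrite lef_pV2 ?posrE ?ltr0n ?ler_nat//; apply: leq_trans Mn.
have tri (x y z' : l.+1.-tuple R) : dist1 x z' <= dist1 x y + dist1 y z'.
  rewrite /dist1 -big_split/=; apply: ler_sum => k _; exact: ler_distD.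
have half : del / 2 < del by lra.
have f1 := hdel _ c1 (lt_trans d1 half).
have f2 : `|f px - f (xy n).2| < eps / 2.
  apply: hdel => //; apply: (le_lt_trans (tri px (xy n).1 (xy n).2)).
  by rewrite [del]splitr; exact: ltrD.
have dd : 0 <= n%:R * dist1 (xy n).1 (xy n).2 by rewrite mulr_ge0// sumr_ge0.
have := ler_distD (f px) (f (xy n).1) (f (xy n).2).
by rewrite (distrC (f (xy n).1) (f px)); lra.
Qed.

(** Functions continuous on the cube are uniform limits there of Lipschitz ones. *)
Lemma lipschitz_approx (R : realType) l (f : l.-tuple R -> R) C eps : (0 < l)%N ->
  bounded_continuous f -> (forall x, cube x -> `|f x| <= C) -> 0 < eps ->
  exists g L, [/\ 0 <= L, bm g, forall x, `|g x| <= C,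
    forall x y, `|g x - g y| <= L * dclip x y &
    forall x, cube x -> `|f x - g x| <= eps].
Proof.
move=> l0 cf fC eps0.
have [|L L0 fL] := continuous_modulus l0 cf (eps := eps / 2); first by rewrite divr_gt0.
have [N N0 hN] : exists2 N, (0 < N)%N & L * (l%:R * (2 / N%:R)) <= eps / 2.
  pose N := Num.truncn (4 * L * l%:R / eps); exists N.+1 => //.
  have hN : 4 * L * l%:R / eps < N.+1%:R by exact: truncnS_gt.
  rewrite !mulrA ler_pdivrMr ?ltr0n//; rewrite ltr_pdivrMr// in hN; lra.
pose I := {ffun 'I_l -> 'I_N.+1}.
have fg (b : I) : `|f (grid_point b)| <= C by apply: fC; exact: grid_point_cube.
exists (fun x => \sum_(b : I) f (grid_point b) * tent b x).
exists (\sum_(b : I) C * N%:R); split.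
- apply: sumr_ge0 => b _; apply: mulr_ge0 => //.
  by apply: le_trans (fg b).
- by apply: bm_sum => b _; apply: bmZ; exact: bm_tent.
- move=> x; apply: (le_trans (ler_norm_sum _ _ _)).
  rewrite -[C]mulr1 -(tent_sum N x) mulr_sumr; apply: ler_sum => b _.
  by rewrite normrM (ger0_norm (tent_ge0 b x)) ler_wpM2r ?tent_ge0.
- move=> x y; rewrite -sumrB; apply: (le_trans (ler_norm_sum _ _ _)).
  rewrite mulr_suml; apply: ler_sum => b _; rewrite -mulrBr normrM -mulrA.
  by apply: ler_pM => //; exact: tent_lip.
- move=> x cx; rewrite -[f x]mulr1 -(tent_sum N x) mulr_sumr -sumrB.
  apply: (le_trans (ler_norm_sum _ _ _)).
  rewrite -[eps]mulr1 -(tent_sum N x) mulr_sumr; apply: ler_sum => b _.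
  rewrite -mulrBl normrM (ger0_norm (tent_ge0 b x)).
  have [->|nz] := eqVneq (tent b x) 0; first by rewrite !mulr0.
  rewrite ler_wpM2r ?tent_ge0//; apply: (le_trans (fL _ _ cx (grid_point_cube N0 b))).
  rewrite [leRHS]splitr lerD//; apply: le_trans hN; rewrite ler_wpM2l//.
  by rewrite -dclipE//; [exact: tent_supp|exact: grid_point_cube].
Qed.

Lemma bm_continuous (R : realType) l (f : l.-tuple R -> R) d (T : measurableType d)
    (Y : T -> l.-tuple R) : (0 < l)%N ->
  bounded_continuous f -> measurable_fun setT Y -> (forall w, cube (Y w)) ->
  bm (fun w => f (Y w)).
Proof.
move=> l0 cf mY cY; have [[C fC] _] := cf.
split; last by exists C => w; exact: fC.
apply: measurable_uniform_limit => eps eps0.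
have [g [L [_ bg _ _ fg]]] := lipschitz_approx l0 cf fC eps0.
exists (fun w => g (Y w)); first by apply: bm_measurable; exact: (bm_comp bg).
by move=> w; exact: fg.
Qed.

(** * Label frequencies close to their limits *)

Lemma pos_lower (R : realType) (I : finType) (x : I -> R) :
  exists2 t, 0 < t & forall i, 0 < x i -> t <= x i.
Proof.
exists (\big[Num.min/1]_(i | 0 < x i) x i).
  elim/big_ind: _ => //.
  by move=> a b a0 b0; rewrite lt_min a0.
by move=> i xi; rewrite (bigD1 i)//= ge_min lexx.
Qed.

Lemma limn_esup_lt (R : realType) (x : nat -> R) (b e : R) : 0 < e ->
  (limn_esup (fun n => (x n)%:E) <= b%:E)%E -> \forall n \near \oo, x n <= b + e.
Proof.
move=> e0; rewrite limn_esup_lim (cvg_lim _ (@cvg_esups_inf _ _))// => xb.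
have : (ereal_inf (range (esups (fun n => (x n)%:E))) < (b + e)%:E)%E.
  by apply: (le_lt_trans xb); rewrite lte_fin ltrDl.
move=> /ereal_inf_lt[_ [N _ <-] hN]; exists N => // n /= Nn.
rewrite -lee_fin; apply/ltW; apply: le_lt_trans hN.
by apply: ereal_sup_ubound; exists n.
Qed.

Lemma ratio_diff_le (R : realType) (x b x' b' : R) : 0 < b -> 0 < b' -> 0 <= x' <= b' ->
  `|x / b - x' / b'| <= (`|x - x'| + `|b - b'|) / b.
Proof.
move=> b0 b'0 /andP[x'0 xb'].
have -> : x / b - x' / b' = (x - x') / b - x' / b' * ((b - b') / b).
  by field; rewrite !gt_eqF.
have nb z : `|z / b| = `|z| / b by rewrite normrM normfV (gtr0_norm b0).
apply: (le_trans (ler_normB _ _)); rewrite [leRHS]mulrDl nb normrM nb lerD2l.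
rewrite ger0_norm; last by rewrite divr_ge0// ltW.
rewrite ler_piMl//; first by rewrite divr_ge0// ltW.
by rewrite ler_pdivrMr// mul1r.
Qed.

Section Asymptotics.
Context {R : realType} {K l : nat} {dO : measure_display}.
Context {Omega : measurableType dO}.
Notation V := (l.-tuple R).
Variables (kappa : 'I_K -> 'I_K -> R) (pi_ : 'I_K -> R) (theta : nat -> R).
Variables (F : 'I_K -> probability V R) (G : 'I_K -> 'I_K -> probability R R).
Variables (nu : 'I_K -> R.-pker V ~> V) (c d H : R) (P : probability Omega R).
Variables (J : forall n, 'I_n -> Omega -> 'I_K).
Variables (E : forall n, 'I_n -> 'I_n -> {RV P >-> bool}).
Variables (Q : forall n, 'I_n -> {RV P >-> V}).
Variables (B : forall n, 'I_n -> 'I_n -> {RV P >-> R}).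
Hypothesis model : network_model kappa theta F G H J E Q B.
Context {d0 : measure_display} {Omega0 : measurableType d0}.
Variables (P0 : probability Omega0 R) (J0 : Omega0 -> 'I_K) (Q0 : {RV P0 >-> V}).
Variable Z0 : nat -> {RV P0 >-> V}.
Hypothesis typical : typical_vertex pi_ F nu J0 Q0 Z0.
Hypothesis pi_gt0 : forall r, 0 < pi_ r.
Hypothesis pi_sum1 : \sum_r pi_ r = 1.
Hypotheses (c0 : 0 <= c) (dpos : 0 < d) (cd1 : c + d <= 1) (H0 : 0 < H).
Hypothesis kappa0 : forall r s, 0 <= kappa r s.
Hypothesis G_support : forall r s, G r s `[0, H]%classic = 1%E.
Hypothesis theta0 : forall n, 0 < theta n.

Notation u := (nbr_limit kappa pi_ G c d J0 Q0 Z0).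
Notation ni := (no_inbound kappa pi_).
Notation g := (mean_opinion kappa pi_ G c d J0 Q0 Z0).
Notation tau := (inflow kappa pi_ G).
Notation beta := (mean_weight G).

Definition freq n (j : {ffun 'I_n -> 'I_K}) (s : 'I_K) : R :=
  (\sum_(i < n) (j i == s)%:R) / n%:R.

Definition capped n (r s : 'I_K) : R := edge_prob kappa theta n r s * n%:R / theta n.

Definition balanced (del : R) n (j : {ffun 'I_n -> 'I_K}) : Prop :=
  forall s, `|freq j s - pi_ s| <= del /\
    forall r, `|freq j s * capped n s r - pi_ s * kappa s r| <= del.

Lemma sum_by_label n (j : {ffun 'I_n -> 'I_K}) (h : 'I_K -> R) : (0 < n)%N ->
  \sum_(m < n) h (j m) = \sum_s freq j s * n%:R * h s.
Proof.
move=> n0; under [RHS]eq_bigr do rewrite /freq divfK ?pnatr_eq0 -?lt0n// mulr_suml.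
rewrite exchange_big/=; apply: eq_bigr => m _.
rewrite (bigD1 (j m))//= eqxx mul1r big1 ?addr0// => s sm.
by rewrite eq_sym (negbTE sm) mul0r.
Qed.

Section Labels.
Variables (n : nat) (j : {ffun 'I_n -> 'I_K}).
Hypotheses (n0 : (0 < n)%N) (Pj0 : P (label_atom J j) != 0%E).
Notation Pj := (label_law model j).
Notation th := (theta n).
Notation env := (env_j E Q B j).

Let nR : n%:R != 0 :> R. Proof. by rewrite pnatr_eq0 -lt0n. Qed.
Let thN : th != 0. Proof. by rewrite gt_eqF. Qed.

Lemma edge_prob_capped r s : edge_prob kappa theta n r s = capped n r s * th / n%:R.
Proof. by rewrite /capped; field; rewrite nR. Qed.

Lemma exp_label_weight i m : \int[Pj]_w weight (env w) i m = beta (j i) (j m).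
Proof.
rewrite (mean_weightE H0 G_support) -(exp_weight model Pj0 i m (bm_clipH H0)).
apply: eq_Rintegral => w _ /=; rewrite clipH_id//.
by case: model.
Qed.

Lemma mean_total_capped i :
  mean_total model j i = th * \sum_s freq j s * capped n s (j i) * beta (j i) s.
Proof.
rewrite mean_totalE.
under eq_bigr do rewrite (exp_link model Pj0) exp_label_weight.
rewrite (@sum_by_label n j (fun s => beta (j i) s * edge_prob kappa theta n s (j i)))//.
rewrite mulr_sumr; apply: eq_bigr => s _.
by rewrite edge_prob_capped; field.
Qed.

Lemma mean_deg_capped i :
  \sum_m edge_prob kappa theta n (j m) (j i) = th * \sum_s freq j s * capped n s (j i).
Proof.
rewrite (@sum_by_label n j (fun s => edge_prob kappa theta n s (j i)))//.
rewrite mulr_sumr; apply: eq_bigr => s _.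
by rewrite edge_prob_capped; field.
Qed.

Lemma mean_marked_capped i k :
  \int[Pj]_w (\sum_m weight (env w) i m * (edge (env w) m i)%:R *
      mean_mark c d nu u ni (j m) k (Q m w)) =
  th * \sum_s freq j s * capped n s (j i) * beta (j i) s * ((c + d) * g s k).
Proof.
rewrite exp_sum; last first.
  move=> m _; apply: bmM; first exact: (bm_link model).
  by apply: (bm_comp (bm_mean_mark _ _ _ _ _ _ _)); exact: measurable_funP.
under eq_bigr => m _.
  rewrite (exp_term model Pj0 i m (bm_mean_mark c d nu u ni (j m) k)) exp_label_weight.
  rewrite (exp_mean_mark typical pi_gt0 c0 dpos cd1 H0 kappa0 G_support).
  over.
rewrite (@sum_by_label n j (fun s => beta (j i) s * edge_prob kappa theta n s (j i) *
  ((c + d) * g s k)))//.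
rewrite mulr_sumr; apply: eq_bigr => s _.
by rewrite edge_prob_capped; field.
Qed.

Variables (kbar t0 s0 del : R).
Hypothesis kbarP : forall r s, kappa r s <= kbar.
Hypotheses (t0_gt0 : 0 < t0) (s0_gt0 : 0 < s0) (del0 : 0 <= del).
Hypothesis tau_t0 : forall r, 0 < tau r -> 2 * t0 <= tau r.
Hypothesis sigma_s0 : forall r, 0 < \sum_s pi_ s * kappa s r -> 2 * s0 <= \sum_s pi_ s * kappa s r.
Hypothesis balanced_j : balanced del j.
Hypotheses (del_t0 : K%:R * (H * del) <= t0) (del_s0 : K%:R * del <= s0).

Let bal r s : `|freq j s * capped n s r - pi_ s * kappa s r| <= del.
Proof. by have [] := balanced_j s. Qed.

Let beta0 r s : 0 <= beta r s. Proof. exact: (mean_weight_ge0 H0 G_support). Qed.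

Let betaH r s : beta r s <= H.
Proof.
rewrite (mean_weightE H0 G_support); apply: exp_le_cst; first exact: bm_clipH.
by move=> x; case/andP: (clipH_itv H0 x).
Qed.

Let kbar0 (r : 'I_K) : 0 <= kbar. Proof. exact: le_trans (kappa0 r r) (kbarP r r). Qed.

Lemma capped_kappa0 r s : kappa r s = 0 -> capped n r s = 0.
Proof. by move=> k0; rewrite /capped /edge_prob k0 !mul0r min_l// !mul0r. Qed.

Let xb r s := freq j s * capped n s r * beta r s.
Let pb r s := pi_ s * beta r s * kappa s r.

Let xb_pb r s : `|xb r s - pb r s| <= H * del.
Proof.
rewrite /xb /pb (_ : _ - _ = beta r s * (freq j s * capped n s r - pi_ s * kappa s r)); last by ring.
by rewrite normrM (ger0_norm (beta0 _ _)) ler_pM.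
Qed.

Let pb0 r s : 0 <= pb r s. Proof. by rewrite !mulr_ge0// ltW. Qed.

Let tau_close r : `|\sum_s xb r s - tau r| <= K%:R * (H * del).
Proof.
rewrite /inflow -sumrB -(sum_ord_const K); apply: (le_trans (ler_norm_sum _ _ _)).
by apply: ler_sum => s _; exact: xb_pb.
Qed.

Let total_lower i : 0 < tau (j i) -> t0 * th <= mean_total model j i.
Proof.
move=> ti; rewrite mean_total_capped mulrC ler_wpM2l ?(ltW (theta0 _))//.
have := tau_close (j i); rewrite ler_norml => /andP[h _].
have := tau_t0 ti; have := del_t0; move: h; rewrite /xb; lra.
Qed.

Let tau0 r : ~~ (0 < tau r) -> forall s, kappa s r * beta r s = 0.
Proof.
rewrite -leNgt /inflow => h s.
have : \sum_t pb r t == 0 by rewrite eq_le h sumr_ge0.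
rewrite psumr_eq0// => /allP/(_ s (mem_index_enum s))/=.
by rewrite /pb -mulrA mulf_eq0 gt_eqF//= mulrC => /eqP.
Qed.

Let total_zero i : ~~ (0 < tau (j i)) -> mean_total model j i = 0.
Proof.
move=> ti; rewrite mean_total_capped big1 ?mulr0// => s _.
have /eqP := tau0 ti s; rewrite mulf_eq0 => /orP[/eqP k0|/eqP ->]; last by rewrite mulr0.
by rewrite capped_kappa0// mulr0 mul0r.
Qed.

Let nbr_limitE r k : (c + d) * u r k = \sum_s (if 0 < tau r then pb r s / tau r else 0) *
   ((c + d) * g s k).
Proof.
rewrite /nbr_limit mulr_sumr; apply: eq_bigr => s _.
by rewrite meanME mulrCA.
Qed.

Let y1 s k : `|(c + d) * g s k| <= 1.
Proof.
have cd0 : 0 <= c + d by rewrite addr_ge0// ltW.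
rewrite normrM ger0_norm// mulr_ile1//.
exact: (mean_opinion_le typical pi_gt0 c0 dpos cd1 H0 kappa0 G_support).
Qed.

Let mark_ratio i k : 0 < tau (j i) ->
  `|\int[Pj]_w (\sum_m weight (env w) i m * (edge (env w) m i)%:R *
      mean_mark c d nu u ni (j m) k (Q m w)) / mean_total model j i - (c + d) * u (j i) k|
  <= K%:R * (K.+1%:R * (H * del) / t0).
Proof.
move=> ti; have lo := total_lower ti.
rewrite mean_marked_capped// mean_total_capped// nbr_limitE ti.
set X := \sum_s freq j s * capped n s (j i) * beta (j i) s.
have Xt0 : t0 <= X.
  by move: lo; rewrite mean_total_capped// mulrC ler_pM2l.
have X0 : 0 < X by apply: lt_le_trans Xt0.
rewrite -mulf_div divff// mul1r mulr_suml -sumrB -(sum_ord_const K).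
apply: (le_trans (ler_norm_sum _ _ _)); apply: ler_sum => s _.
rewrite -/(xb (j i) s) mulrAC -mulrBl normrM.
apply: (@le_trans _ _ (`|xb (j i) s / X - pb (j i) s / tau (j i)| * 1)).
  by rewrite ler_wpM2l.
rewrite mulr1; apply: (le_trans (ratio_diff_le _ X0 ti _)).
  by rewrite pb0 /inflow (bigD1 s)//= lerDl; apply: sumr_ge0 => t _; exact: pb0.
apply: ler_pM; [by rewrite addr_ge0|by rewrite invr_ge0 ltW| |by rewrite lef_pV2].
rewrite -natr1 mulrDl mul1r addrC; apply: lerD; last exact: xb_pb.
exact: tau_close.
Qed.

Notation lerr := (local_error c d nu u ni).

Definition local_bound (lam : R) : R :=
  3 * lam + K%:R * (K.+1%:R * (H * del) / t0) +
  (4 * H / t0 + (6 / lam + 4) * H ^+ 2 * kbar / t0 ^+ 2 + kbar / s0 ^+ 2) / th.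

Let bm_mark i k : bm (fun w => mark_error c d nu u ni (env w) k i).
Proof.
apply: bm_norm; apply: bmB; last exact: (bm_cst ((c + d) * u (j i) k)).
apply: bm_sum => x _; apply: bmM; first exact: (bm_norm_weight model).
by apply: (bm_comp (bm_mean_mark c d nu u ni (j x) k)); exact: measurable_funP.
Qed.

Let bm_unl i : bm (fun w => unlinked_error ni (env w) i).
Proof.
by apply: bm_norm; apply: bmB; [exact: bm_unlinked|exact: (bm_cst (ni (j i))%:R)].
Qed.

Let bm_spread i : bm (fun w => spread (env w) i).
Proof. by apply: bm_sum => x _; apply: bmX; exact: (bm_norm_weight model). Qed.

Let exp_unl i : \int[Pj]_w unlinked_error ni (env w) i <= kbar / (s0 ^+ 2 * th).
Proof.
have [nii|nii] := boolP (ni (j i)).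
  rewrite /unlinked_error /= nii (exp_unlinked_zero model Pj0).
    by rewrite divr_ge0 ?(kbar0 (j i))// mulr_ge0 ?sqr_ge0// ltW.
  rewrite mean_deg_capped// big1 ?mulr0// => s _.
  move: nii; rewrite /no_inbound psumr_eq0; last by move=> t _; rewrite mulr_ge0// ltW.
  move=> /allP/(_ s (mem_index_enum s)); rewrite /= mulf_eq0 gt_eqF//= => /eqP k0.
  by rewrite capped_kappa0// mulr0.
rewrite /unlinked_error /= (negbTE nii).
apply: (@exp_unlinked_le _ _ _ _ _ _ _ _ _ _ _ _ _ _ _ model _ _ Pj0 (theta0 n) n0 _ kbarP i _ s0_gt0).
rewrite mean_deg_capped// mulrC ler_wpM2l ?(ltW (theta0 _))//.
have sp : 0 < \sum_s pi_ s * kappa s (j i).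
  by rewrite lt_neqAle eq_sym nii sumr_ge0// => s _; rewrite mulr_ge0// ltW.
have := sigma_s0 sp.
have : `|\sum_s freq j s * capped n s (j i) - \sum_s pi_ s * kappa s (j i)| <= K%:R * del.
  rewrite -sumrB -(sum_ord_const K); apply: (le_trans (ler_norm_sum _ _ _)).
  by apply: ler_sum => s _; exact: bal.
rewrite ler_norml => /andP[h _]; have := del_s0; move: h; lra.
Qed.

Lemma exp_local_error i k lam : 0 < lam ->
  \int[Pj]_w lerr (env w) k i <= local_bound lam.
Proof.
move=> lam0; have kb := kbar0 (j i).
have thp := theta0 n.
have rest0 : 0 <= 3 * lam + K%:R * (K.+1%:R * (H * del) / t0).
  have Hd : 0 <= H * del by rewrite mulr_ge0// ltW.
  apply: addr_ge0; first by rewrite mulr_ge0// ltW.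
  by apply: mulr_ge0 => //; apply: divr_ge0; [exact: mulr_ge0|exact: ltW].
rewrite /local_error expD//; last by apply: bmD.
rewrite expD//.
have eU := exp_unl i.
have [ti|ti] := boolP (0 < tau (j i)); last first.
  have [eM eS] : \int[Pj]_w mark_error c d nu u ni (env w) k i = 0 /\
      \int[Pj]_w spread (env w) i = 0.
    split; apply: (exp_no_weight (total_zero ti)) => // w T0.
      rewrite /mark_error big1 => [|m _]; last by rewrite (C_no_weight _ T0) mul0r.
      by rewrite sub0r normrN nbr_limitE (negbTE ti) big1 ?normr0// => s _; rewrite mul0r.
    by rewrite /spread big1// => m _; rewrite (C_no_weight _ T0) expr0n.
  rewrite eM eS add0r addr0; apply: (le_trans eU); rewrite /local_bound.
  rewrite -[leLHS]add0r lerD// mulrDl -[X in X <= _]add0r lerD//.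
    have h1 : 0 <= 4 * H / t0 by apply: divr_ge0; [apply: mulr_ge0 => //; exact: ltW|exact: ltW].
    have h2 : 0 <= 6 / lam + 4 by apply: addr_ge0 => //; apply: divr_ge0 => //; exact: ltW.
    apply: divr_ge0; last exact: ltW; apply: addr_ge0 => //.
    by apply: divr_ge0; [rewrite mulr_ge0// mulr_ge0// sqr_ge0|exact: sqr_ge0].
  by rewrite invfM mulrA.
have lo := total_lower ti.
have eS := @exp_spread_le _ _ _ _ _ _ _ _ _ _ _ _ _ _ _ model H0 _ _ Pj0 thp kappa0 n0 _ kbarP i t0
  t0_gt0 lo.
have eM := @exp_marked_average _ _ _ _ _ _ _ _ _ _ _ _ _ _ _ model H0 _ _ Pj0 thp kappa0 n0 _ kbarP
  i t0 t0_gt0 lo (fun m => mean_mark c d nu u ni (j m) k) 2 ((c + d) * u (j i) k).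
have {}eM := eM ltac:(by []) (fun m => bm_mean_mark c d nu u ni (j m) k) _ lam lam0.
have ub := nbr_limit_le typical pi_gt0 c0 dpos cd1 H0 kappa0 G_support.
have {}eM := eM (fun m q => mean_mark_le nu ni c0 dpos cd1 ub (j m) k q).
have rk := mark_ratio k ti.
apply: (le_trans (lerD (lerD (le_trans eM _) eU) eS)).
  by apply: lerD; [apply: lerD; [apply: lerD; [exact: rk|exact: lexx]|exact: lexx]|exact: lexx].
rewrite /local_bound le_eqVlt; apply/orP; left; apply/eqP.
by field; rewrite !gt_eqF.
Qed.

Definition link_const : R := (1 + kbar * (4 * H / t0 + 16 * H ^+ 2 * kbar / t0 ^+ 2))%R.

Lemma link_const_ge1 : (0 < K)%N -> 1 <= link_const.
Proof.
case: K kbar0 => // K' kb _; have k0 := kb ord0.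
rewrite /link_const lerDl; apply: mulr_ge0 => //; apply: addr_ge0; apply: divr_ge0.
- by apply: mulr_ge0 => //; exact: ltW.
- exact: ltW.
- by rewrite mulr_ge0// mulr_ge0// sqr_ge0.
- exact: sqr_ge0.
Qed.

Lemma exp_norm_weight_uniform i m : 2 * H <= t0 * th ->
  \int[Pj]_w norm_weight (env w) i m <= link_const / n%:R.
Proof.
move=> Ht.
have [ti|ti] := boolP (0 < tau (j i)); last first.
  rewrite (exp_no_weight (total_zero ti)).
  - rewrite divr_ge0//; apply: le_trans ler01 _; apply: link_const_ge1.
    exact: leq_ltn_trans (leq0n _) (ltn_ord (j i)).
  - exact: (bm_norm_weight model).
  - by move=> w T0; exact: C_no_weight.
have h := @exp_norm_weight_le _ _ _ _ _ _ _ _ _ _ _ _ _ _ _ model H0 _ _ Pj0 (theta0 n) kappa0 n0 _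
  kbarP i t0 t0_gt0 (total_lower ti) m Ht.
by apply: (le_trans h); rewrite ler_wpM2r ?invr_ge0// lerDr.
Qed.

End Labels.

Lemma exists_small (A eta : R) : 0 <= A -> 0 < eta ->
  exists2 x, 0 < x & forall y, y <= x -> A * y <= eta.
Proof.
move=> A0 eta0; exists (eta / (A + 1)); first by rewrite divr_gt0// ltr_wpDl.
move=> y yx; apply: (le_trans (ler_wpM2l A0 yx)).
rewrite mulrCA ler_piMr//; first exact: ltW.
by rewrite ler_pdivrMr ?mul1r ?lerDl// ltr_wpDl.
Qed.

Lemma exists_pow (q A eta : R) : 0 <= q < 1 -> 0 <= A -> 0 < eta ->
  exists T, A * q ^+ T <= eta.
Proof.
move=> /andP[q0 q1] A0 eta0; have [x x0 hx] := exists_small A0 eta0.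
have : (fun T => q ^+ T) @ \oo --> (0 : R) by apply: cvg_expr; rewrite ger0_norm.
move=> /cvgrPdist_le /(_ _ x0) [T _ /(_ T (leqnn T))].
by rewrite sub0r normrN ger0_norm ?exprn_ge0// => /hx; exists T.
Qed.

Lemma mean_error_small (k1 eta : R) : 0 < eta -> 1 <= k1 ->
  exists S, exists lam eps xi : R, [/\ 0 < lam, 0 < eps, 0 < xi &
    forall n : nat, n%:R^-1 <= xi -> @mean_error_bound R l n c d k1 eps S lam <= eta].
Proof.
move=> eta0 k11; have cd0 : 0 < c + d by rewrite ltr_wpDl.
have eta4 : 0 < eta / 4 by rewrite divr_gt0.
have [lam lam0 hlam] := exists_small (ler0n R l) eta4.
have q01 : 0 <= c / (c + d) < 1.
  by rewrite divr_ge0 ?(ltW cd0)//= ltr_pdivrMr// mul1r ltrDl.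
have li : 0 <= lam^-1 by rewrite invr_ge0 ltW.
have [|S hS] := exists_pow (A := l%:R * (lam^-1 * 4)) q01 _ eta4; first by rewrite !mulr_ge0.
pose sc := lam^-1 * (2 * source_const c d).
have sc0 : 0 <= sc.
  by apply: mulr_ge0 => //; apply: mulr_ge0 => //; exact: source_const_ge0.
pose A1 := \sum_(s < S.+1) k1 ^+ s.
pose A2 := \sum_(s < S.+1) k1 ^+ s * ((s * s)%:R * 5).
have k10 : 0 <= k1 by apply: le_trans k11.
have A10 : 0 <= A1 by apply: sumr_ge0 => s _; exact: exprn_ge0.
have A20 : 0 <= A2 by apply: sumr_ge0 => s _; rewrite !mulr_ge0// exprn_ge0.
have [|eps eps0 heps] := exists_small (A := l%:R * (sc * A1 + 1)) _ eta4.
  by rewrite mulr_ge0// addr_ge0// mulr_ge0.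
have [|xi xi0 hxi] := exists_small (A := l%:R * (sc * A2)) _ eta4.
  by apply: mulr_ge0 => //; exact: mulr_ge0.
exists S, lam, eps, xi; split => // n nxi.
rewrite /mean_error_bound.
have -> : \sum_(s < S.+1) k1 ^+ s * (eps + (s * s)%:R * 5 / n%:R) = A1 * eps + A2 / n%:R.
  rewrite /A1 /A2 !mulr_suml -big_split/=; apply: eq_bigr => s _.
  by move: (k1 ^+ s) ((s * s)%:R : R) (n%:R^-1 : R) => x y z; ring.
have -> : l%:R * (lam + lam^-1 * (2 * source_const c d * (A1 * eps + A2 / n%:R) +
    (c / (c + d)) ^+ S * 4) + eps) = l%:R * lam + l%:R * (lam^-1 * 4) * (c / (c + d)) ^+ S
    + l%:R * (sc * A1 + 1) * eps + l%:R * (sc * A2) / n%:R by rewrite /sc; ring.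
have := hlam _ (lexx _); have := heps _ (lexx _); have := hxi _ nxi; move: hS.
lra.
Qed.

Hypothesis nu_cube : forall r q, cube q -> nu r q cube = 1%E.
Hypothesis theta_cvgy : theta @ \oo --> +oo.
Hypothesis K0 : (0 < K)%N.
Variable X : forall n, {RV P >-> n.-tuple V}.
Hypothesis stationary : stationary_opinions nu c d J E Q B X.
Notation R0 := (mean_field_opinion kappa pi_ G c d J0 Q0 Z0).
Notation P0r := (community_law typical).

Lemma sum_kappa_lower : exists2 s0, 0 < s0 &
  forall r, 0 < \sum_s pi_ s * kappa s r -> 2 * s0 <= \sum_s pi_ s * kappa s r.
Proof.
have [t t0 ht] := pos_lower (fun r => \sum_s pi_ s * kappa s r).
by exists (t / 2) => [|r /ht]; [rewrite divr_gt0|rewrite mulrC divfK].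
Qed.

Lemma vertex_limit (m : nat) (L eta : R) : 0 < eta -> 0 <= L ->
  exists2 del, 0 < del & \forall n \near \oo, forall j : {ffun 'I_n -> 'I_K},
    balanced del j -> P (label_atom J j) != 0%E ->
    forall (v : 'I_m -> 'I_n) (f : 'I_m -> V -> R),
    injective v -> (forall b, bm (f b)) -> (forall b y, `|f b y| <= 1) ->
    (forall b x y, `|f b x - f b y| <= L * dclip x y) ->
    `|\int[label_law model j]_w \prod_b f b (tnth (X n w) (v b)) -
      \prod_b \int[P0r (j (v b))]_w f b (R0 w)| <= eta.
Proof.
move=> eta0 L0.
have a01 : 0 <= 1 - c - d < 1.
  by apply/andP; split; [rewrite -addrA -opprD subr_ge0|rewrite -addrA -opprD gtrBl ltr_wpDl].
have eta2 : 0 < eta / 2 by rewrite divr_gt0.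
have [|T hT] := exists_pow (A := m%:R * (3 * L * l%:R)) a01 _ eta2; first by rewrite !mulr_ge0.
have [|eta1 eta10 heta1] := exists_small (A := m%:R * (T%:R * L)) _ eta2; first by rewrite !mulr_ge0.
have [t tp ht] := pos_lower tau; pose t0 := t / 2.
have t00 : 0 < t0 by rewrite divr_gt0.
have tau_t0 r : 0 < tau r -> 2 * t0 <= tau r by move=> /ht; rewrite /t0 mulrC divfK.
have [s0 s00 sigma_s0] := sum_kappa_lower.
pose kbar := \sum_r \sum_s kappa r s.
have kbarP r s : kappa r s <= kbar.
  rewrite /kbar (bigD1 r)//= (bigD1 s)//= -addrA lerDl addr_ge0//.
    by apply: sumr_ge0.
  by apply: sumr_ge0 => r' _; apply: sumr_ge0.
have k11 : 1 <= link_const kbar t0 := link_const_ge1 kbarP t00 K0.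
have [S [lam [eps [xi [lam0 eps0 xi0 hmeb]]]]] := mean_error_small eta10 k11.
have eps3 : 0 < eps / 3 by rewrite divr_gt0.
have eps9 : 0 < eps / 9 by rewrite divr_gt0.
have [|x1 x10 hx1] := exists_small (A := K%:R * (K.+1%:R * H / t0)) _ eps3.
  by rewrite mulr_ge0// divr_ge0 ?(ltW t00)// mulr_ge0// ltW.
have [|x2 x20 hx2] := exists_small (A := K%:R * H) _ t00; first by rewrite mulr_ge0// ltW.
have [x3 x30 hx3] := exists_small (ler0n R K) s00.
pose del := Num.min x1 (Num.min x2 x3).
have del0 : 0 < del by rewrite !lt_min x10 x20.
pose D := 4 * H / t0 + (6 / (eps / 9) + 4) * H ^+ 2 * kbar / t0 ^+ 2 + kbar / s0 ^+ 2.
exists del => //; near=> n => j bal Pj0 v f vinj bf f1 fL.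
have n0 : (0 < n)%N by near: n; exact: nbhs_infty_gt.
have nxi : n%:R^-1 <= xi.
  rewrite -[xi]invrK lef_pV2 ?posrE ?invr_gt0 ?ltr0n//; near: n; exact: nbhs_infty_ger.
have th1 : 2 * H / t0 <= theta n by near: n; move/cvgryPge: theta_cvgy; apply.
have th2 : D / (eps / 3) <= theta n by near: n; move/cvgryPge: theta_cvgy; apply.
have [_ [mu [mu_stat mu_dis]]] := stationary n.
have dt : K%:R * (H * del) <= t0 by rewrite mulrA hx2// !ge_min lexx ?orbT.
have ds : K%:R * del <= s0 by rewrite hx3// !ge_min lexx ?orbT.
have lerr k i : \int[label_law model j]_w local_error c d nu u ni (env_j E Q B j w) k i <= eps.
  have h := @exp_local_error n j n0 Pj0 kbar t0 s0 del kbarP t00 s00 (ltW del0) tau_t0 sigma_s0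
    bal dt ds i k (eps / 9) eps9.
  apply: (le_trans h); rewrite /local_bound -/D.
  have h1 : K%:R * (K.+1%:R * (H * del) / t0) <= eps / 3.
    rewrite (_ : _ * _ = K%:R * (K.+1%:R * H / t0) * del); last by ring.
    by apply: hx1; rewrite ge_min lexx.
  have h2 : D / theta n <= eps / 3.
    by rewrite ler_pdivrMr// mulrC -ler_pdivrMr.
  move: h1 h2; lra.
have ck i k : i != k -> \int[label_law model j]_w norm_weight (env_j E Q B j w) i k <=
    link_const kbar t0 / n%:R.
  move=> _; apply: (@exp_norm_weight_uniform n j n0 Pj0 kbar t0 del kbarP t00 tau_t0
    bal dt i k).
  by rewrite [leRHS]mulrC -ler_pdivrMr.
have ub := nbr_limit_le typical pi_gt0 c0 dpos cd1 H0 kappa0 G_support.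
have main := @vertex_product _ _ _ _ _ _ _ _ _ _ _ _ _ _ _ model H0 n j Pj0 (theta0 n) n0 c d nu u ni
  c0 dpos cd1 nu_cube ub (X n) mu mu_stat mu_dis _ _ k11 ck lerr S lam T m v f L
  [tuple 0 | k < l] lam0 vinj bf f1 L0 fL.
have mR := measurable_mean_field typical pi_gt0 c0 dpos cd1 H0 kappa0 G_support.
have bT b : bm (fun q => iter T (Lam c d nu u ni (j (v b))) (fun x : V * V => f b x.2)
    (q, [tuple 0 | _ < l])).
  have bphi : bm (fun x : V * V => f b x.2) by exact: (bm_comp (bf b) measurable_snd).
  apply: (bm_comp (bm_LamT c d nu u ni T (j (v b)) bphi)).
  by apply: measurable_fun_pair => //; exact: measurable_cst.
have second : `|\prod_b \int[F (j (v b))]_q iter T (Lam c d nu u ni (j (v b)))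
     (fun x : V * V => f b x.2) (q, [tuple 0 | _ < l]) - \prod_b \int[P0r (j (v b))]_w f b (R0 w)|
   <= m%:R * (L * (l%:R * (1 - c - d) ^+ T)).
  apply: (le_trans (prod_diff_le _ _ _)).
  - move=> b; apply: exp_abs_cst => // q.
    by apply: LamT_le1 => //; exact: (bm_comp (bf b) measurable_snd).
  - move=> b; apply: exp_abs_cst => //; exact: (bm_comp (bf b) mR).
  rewrite -(sum_ord_const m); apply: ler_sum => b _; rewrite distrC.
  exact: (mean_field_law typical pi_gt0 c0 dpos cd1 H0 kappa0 G_support _ _ L0 (bf b) (fL b)).
apply: (le_trans (ler_distD (\prod_b \int[F (j (v b))]_q iter T (Lam c d nu u ni (j (v b)))
     (fun x : V * V => f b x.2) (q, [tuple 0 | _ < l])) _ _)).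
apply: (le_trans (lerD main second)).
have h1 := heta1 _ (hmeb n nxi).
move: h1 hT; lra.
Unshelve. all: by end_near. Qed.

End Asymptotics.

(** * From balanced labels to convergence in probability *)

Section Labels.
Context {R : realType} {K l : nat} {dO : measure_display}.
Context {Omega : measurableType dO}.
Notation V := (l.-tuple R).
Variables (kappa : 'I_K -> 'I_K -> R) (pi_ : 'I_K -> R) (theta : nat -> R).
Variables (F : 'I_K -> probability V R) (G : 'I_K -> 'I_K -> probability R R).
Variables (H : R) (P : probability Omega R).
Variables (J : forall n, 'I_n -> Omega -> 'I_K).
Variables (E : forall n, 'I_n -> 'I_n -> {RV P >-> bool}).
Variables (Q : forall n, 'I_n -> {RV P >-> V}).
Variables (B : forall n, 'I_n -> 'I_n -> {RV P >-> R}).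
Hypothesis model : network_model kappa theta F G H J E Q B.
Hypothesis pi_gt0 : forall r, 0 < pi_ r.
Hypothesis pi_sum1 : \sum_r pi_ r = 1.
Hypothesis kappa0 : forall r s, 0 <= kappa r s.
Hypothesis theta0 : forall n, 0 < theta n.
Hypothesis theta_limsup : (limn_esup (fun n =>
  (\big[Num.max/0]_r \big[Num.max/0]_s (kappa r s * theta n / n%:R))%:E) <= 1)%E.
Hypothesis label_freq : forall r : 'I_K,
  cvg_in_prob P (fun n w => (\sum_(i < n) (@J n i w == r)%:R) / n%:R) (pi_ r).

Notation balanced := (balanced kappa pi_ theta).
Notation capped := (capped kappa theta).

Lemma capped_near x : 0 < x -> \forall n \near \oo, forall r s,
  capped n r s <= kappa r s /\ kappa r s - capped n r s <= kappa r s * x.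
Proof.
move=> x0; near=> n => r s.
have n0 : (0 < n)%N by near: n; exact: nbhs_infty_gt.
have nR : 0 < n%:R :> R by rewrite ltr0n.
have th := theta0 n.
have hx : kappa r s * theta n / n%:R <= 1 + x.
  have : \big[Num.max/0]_r \big[Num.max/0]_s (kappa r s * theta n / n%:R) <= 1 + x.
    by near: n; exact: limn_esup_lt.
  apply: le_trans; apply: (le_trans (le_bigmax _ (fun s => kappa r s * theta n / n%:R) s)).
  exact: (le_bigmax _ (fun r => \big[Num.max/0]_s (kappa r s * theta n / n%:R)) r).
set y := kappa r s * theta n / n%:R in hx *.
have y0 : 0 <= y by rewrite /y divr_ge0 ?mulr_ge0// ltW.
have kE : kappa r s = y * (n%:R / theta n).
  by rewrite /y; field; rewrite !gt_eqF.
have cE : capped n r s = Num.min y 1 * (n%:R / theta n) by rewrite [RHS]mulrA.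
have q0 : 0 <= n%:R / theta n by rewrite divr_ge0// ltW.
rewrite cE {1 2 3}kE; split; first by rewrite ler_wpM2r// ge_min lexx.
rewrite -mulrBl mulrAC ler_wpM2r//.
have [y1|y1] := leP y 1; first by rewrite subrr mulr_ge0// ltW.
have x1 : 1 * x <= y * x by rewrite ler_pM2r// ltW.
lra.
Unshelve. all: by end_near. Qed.

Lemma balanced_of_freq del n (j : {ffun 'I_n -> 'I_K}) x :
  0 <= x -> (forall r s, capped n r s <= kappa r s /\ kappa r s - capped n r s <= kappa r s * x) ->
  (forall s, `|freq j s - pi_ s| <= x) -> x <= del -> (forall r s, kappa r s * x * 2 <= del) ->
  balanced del j.
Proof.
move=> x0 cp fr xdel kx s; split=> [|r]; first exact: le_trans (fr s) xdel.
have [c1 c2] := cp s r.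
have f0 : (0 : R) <= freq j s by apply: divr_ge0 => //; apply: sumr_ge0.
have f1 : freq j s <= 1 :> R.
  rewrite /freq; case: n j {cp fr c1 c2 f0} => [|n] j; first by rewrite big_ord0 mul0r.
  rewrite ler_pdivrMr ?ltr0n// mul1r; apply: (@le_trans _ _ (\sum_(i < n.+1) 1)).
    by apply: ler_sum => i _; case: (_ == _).
  by rewrite sumr_const card_ord.
have -> : freq j s * capped n s r - pi_ s * kappa s r =
  (freq j s - pi_ s) * kappa s r - freq j s * (kappa s r - capped n s r) by ring.
apply: (le_trans (ler_normB _ _)); apply: le_trans (kx s r).
rewrite mulr_natr mulr2n; apply: lerD.
  by rewrite normrM (ger0_norm (kappa0 _ _)) mulrC ler_wpM2l.
rewrite normrM (ger0_norm f0) ger0_norm ?subr_ge0//; apply: le_trans c2.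
by rewrite ler_piMl ?subr_ge0.
Qed.

Notation unbal del n := [set w | ~ balanced del (labels J n w)].

Lemma labels_event n (phi : {ffun 'I_n -> 'I_K} -> Prop) :
  measurable [set w | phi (labels J n w)].
Proof.
rewrite (_ : [set w | _] = \big[setU/set0]_(j : {ffun 'I_n -> 'I_K} | `[< phi j >]) label_atom J j).
  by apply: bigsetU_measurable => j _; exact: (measurable_label_atom model).
rewrite -bigcup_seq_cond; apply/seteqP; split => w /=.
  by move=> h; exists (labels J n w) => //=; rewrite mem_index_enum asboolT.
by move=> [j /andP[_ /asboolP phij]] /= ->.
Qed.

Lemma Pr_cvg0 (A : nat -> set Omega) : (forall n, measurable (A n)) ->
  (forall eta, 0 < eta -> \forall n \near \oo, Pr P (A n) <= eta) ->
  (fun n => P (A n)) @ \oo --> 0%E.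
Proof.
move=> mA h; apply: cvg_EFin.
  by near=> n; apply: fin_num_measure; exact: mA.
apply/cvgrPdist_le => eta eta0; near=> n.
rewrite sub0r normrN ger0_norm; first by near: n; exact: h.
by rewrite fine_ge0.
Unshelve. all: by end_near. Qed.

Lemma cvg0_Pr (A : nat -> set Omega) eta : (forall n, measurable (A n)) ->
  (fun n => P (A n)) @ \oo --> 0%E -> 0 < eta -> \forall n \near \oo, Pr P (A n) <= eta.
Proof.
move=> mA /fine_cvg /cvgrPdist_le h eta0; near=> n.
have : `|0 - Pr P (A n)| <= eta by near: n; exact: h.
by rewrite sub0r normrN ger0_norm// fine_ge0.
Unshelve. all: by end_near. Qed.

Lemma Pr_le (A C : set Omega) : measurable A -> measurable C -> A `<=` C -> Pr P A <= Pr P C.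
Proof.
move=> mA mC AC; rewrite -!exp_indic//; apply: exp_le; [exact: bm_indic|exact: bm_indic|].
by move=> w; rewrite !indicE ler_nat; case: (boolP (w \in A)) => // /set_mem/AC/mem_set ->.
Qed.

Lemma unbalanced_near del eta : 0 < del -> 0 < eta ->
  \forall n \near \oo, Pr P (unbal del n) <= eta.
Proof.
move=> del0 eta0.
pose kbar := \sum_r \sum_s kappa r s.
have kbar0 : 0 <= kbar by apply: sumr_ge0 => r _; apply: sumr_ge0.
have kbarP r s : kappa r s <= kbar.
  rewrite /kbar (bigD1 r)//= (bigD1 s)//= -addrA lerDl addr_ge0//.
    by apply: sumr_ge0.
  by apply: sumr_ge0 => r' _; apply: sumr_ge0.
have [|y y0 hy] := exists_small (A := kbar * 2) _ del0; first exact: mulr_ge0.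
pose x := Num.min y del.
have x0 : 0 < x by rewrite lt_min y0.
have hx : kbar * 2 * x <= del by apply: hy; rewrite ge_min lexx.
pose Bad n (r : 'I_K) := [set w | x <= `|freq (labels J n w) r - pi_ r|].
have mBad n r : measurable (Bad n r).
  exact: (labels_event (fun j => x <= `|freq j r - pi_ r|)).
have K1 : 0 < K.+1%:R :> R by rewrite ltr0n.
have e0 : 0 < eta / K.+1%:R by rewrite divr_gt0.
have Badsmall r : \forall n \near \oo, Pr P (Bad n r) <= eta / K.+1%:R.
  apply: (cvg0_Pr (mBad ^~ r) _ e0).
  rewrite (_ : (fun n => _) = fun n => P [set w | x <= `|(\sum_(i < n) (@J n i w == r)%:R) / n%:R - pi_ r|]).
    exact: label_freq.
  apply/funext => n; congr (P _); apply/funext => w; rewrite /Bad /freq /=.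
  by under eq_bigr do rewrite /labels ffunE.
have Badall : \forall n \near \oo, forall r, Pr P (Bad n r) <= eta / K.+1%:R.
  by apply: filter_forall.
near=> n.
have hB : forall r, Pr P (Bad n r) <= eta / K.+1%:R by near: n.
have hC : forall r s, capped n r s <= kappa r s /\ kappa r s - capped n r s <= kappa r s * x.
  by near: n; exact: capped_near.
have mU : measurable (unbal del n) by exact: (labels_event (fun j => ~ balanced del j)).
apply: (@le_trans _ _ (\sum_r Pr P (Bad n r))); last first.
  apply: (@le_trans _ _ (\sum_(r < K) (eta / K.+1%:R))).
    by apply: ler_sum => r _; exact: hB.
  rewrite sum_ord_const mulrCA ler_piMr//; first exact: ltW.
  by rewrite ler_pdivrMr// mul1r ler_nat.
under [leRHS]eq_bigr do rewrite -exp_indic//.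
rewrite -exp_sum; last by move=> r _; exact: bm_indic.
rewrite -exp_indic//; apply: exp_le; [exact: bm_indic|by apply: bm_sum => r _; exact: bm_indic|].
move=> w; rewrite indicE; case: (boolP (w \in _)) => [/set_mem /= ub|_]; last first.
  by apply: sumr_ge0 => r _; rewrite indicE.
suff [r rb] : exists r, Bad n r w.
  rewrite (bigD1 r)//= indicE mem_set// lerDl.
  by apply: sumr_ge0 => r' _; rewrite indicE.
apply: contrapT => nb; apply: ub.
apply: (@balanced_of_freq _ _ _ x); first exact: ltW.
- exact: hC.
- by move=> s; rewrite leNgt; apply/negP => h; apply: nb; exists s; rewrite /Bad /= ltW.
- by rewrite ge_min lexx orbT.
- move=> r s; rewrite mulrAC; apply: le_trans hx.
  by rewrite ler_wpM2r ?(ltW x0)// ler_wpM2r.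
Unshelve. all: by end_near. Qed.

(** Total probability over the label vectors. *)
Lemma conditional_small (A : nat -> set Omega) : (forall n, measurable (A n)) ->
  (forall eta, 0 < eta -> exists2 del, 0 < del & \forall n \near \oo,
     forall j : {ffun 'I_n -> 'I_K}, balanced del j -> P (label_atom J j) != 0%E ->
     Pr (label_law model j) (A n) <= eta) ->
  (fun n => P (A n)) @ \oo --> 0%E.
Proof.
move=> mA h; apply: Pr_cvg0 => // eta eta0.
have e2 : 0 < eta / 2 by rewrite divr_gt0.
have [del del0 hdel] := h _ e2.
near=> n.
pose atom (j : {ffun 'I_n -> 'I_K}) := label_atom J j.
have matom j : measurable (atom j) by exact: (measurable_label_atom model).
have split_sum (phi : {ffun 'I_n -> 'I_K} -> Prop) (C : set Omega) :
    measurable C -> (forall w, C w -> phi (labels J n w)) ->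
    Pr P C = \sum_(j | `[< phi j >]) Pr P (C `&` atom j).
  move=> mC Cphi; rewrite -exp_indic//.
  under [RHS]eq_bigr do rewrite -(exp_indic P (measurableI _ _ mC (matom _))).
  rewrite -exp_sum; last by move=> j _; apply: bm_indic; exact: measurableI.
  apply: eq_Rintegral => w _; rewrite indicE.
  case: (boolP (w \in C)) => [/set_mem Cw|nC]; last first.
    by rewrite big1// => j _; rewrite indicE memNset// => -[/mem_set]; rewrite (negbTE nC).
  rewrite (bigD1 (labels J n w))/=; last by apply/asboolP; exact: Cphi.
  rewrite indicE mem_set// big1 ?addr0// => j /andP[_ jw].
  by rewrite indicE memNset// => -[_ /= jE]; rewrite jE eqxx in jw.
have mU : measurable (unbal del n) by exact: (labels_event (fun j => ~ balanced del j)).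
rewrite (split_sum (fun=> True) (A n))//.
apply: (@le_trans _ _ (\sum_(j : {ffun 'I_n -> 'I_K} | `[< True >]) (eta / 2 * Pr P (atom j)) +
   \sum_(j | `[< ~ balanced del j >]) Pr P (atom j))).
  rewrite [X in _ <= _ + X]big_mkcond [X in _ <= _ + X](_ : _ =
    \sum_(j : {ffun 'I_n -> 'I_K} | `[< True >]) if `[< ~ balanced del j >] then Pr P (atom j) else 0).
    rewrite -big_split/=; apply: ler_sum => j _.
    have pj0 : 0 <= Pr P (atom j) by rewrite fine_ge0.
    case: asboolP => [nb|/contrapT bal].
      apply: ler_wpDl; first by rewrite mulr_ge0// ltW.
      by apply: Pr_le => //; exact: measurableI.
    rewrite addr0; have [z|nz] := eqVneq (P (atom j)) 0%E.
      have -> : Pr P (A n `&` atom j) = 0.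
        apply/eqP; rewrite eq_le fine_ge0// andbT.
        apply: (@le_trans _ _ (Pr P (atom j))); last by rewrite /Pr (z : (P : {measure set _ -> \bar R}) _ = _).
        by apply: Pr_le => //; exact: measurableI.
      by rewrite mulr_ge0// ltW.
    have p0 := Pr_gt0 (matom j) nz.
    rewrite -ler_pdivrMr// -(@condpE _ _ _ P _ (measurable_label_atom model j) nz)//.
    have hn : forall j : {ffun 'I_n -> 'I_K}, balanced del j -> P (label_atom J j) != 0%E ->
     Pr (label_law model j) (A n) <= eta / 2 by near: n; exact: hdel.
    exact: (hn j bal nz).
  by apply: eq_bigl => j; rewrite asboolT.
rewrite [leRHS]splitr; apply: lerD.
  rewrite -mulr_sumr -[leRHS]mulr1; apply: ler_wpM2l; first exact: ltW.
  have := split_sum (fun=> True) setT measurableT (fun _ _ => I).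
  by under [in X in _ = X -> _]eq_bigr do rewrite setTI; move=> <-; rewrite /Pr prob_setT.
apply: (@le_trans _ _ (Pr P (unbal del n))); last by near: n; exact: unbalanced_near.
rewrite (split_sum (fun j => ~ balanced del j) (unbal del n))//.
apply: ler_sum => j /asboolP nb; apply: Pr_le => //; first exact: measurableI.
by move=> w /= jw; split => //=; rewrite jw.
Unshelve. all: by end_near. Qed.

End Labels.

(** * Couplings *)

Lemma exp_ext (R : realType) d (T : measurableType d) (P : probability T R)
    (Lam : (T -> R) -> R) (C : R) :
  (forall f g, bm f -> bm g -> Lam (fun x => f x + g x) = Lam f + Lam g) ->
  (forall a f, bm f -> Lam (fun x => a * f x) = a * Lam f) ->
  (forall f e, bm f -> (forall x, `|f x| <= e) -> `|Lam f| <= C * e) ->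
  (forall A, measurable A -> Pr P A = Lam \1_A) ->
  forall f, bm f -> \int[P]_x f x = Lam f.
Proof.
move=> LD LZ LC LA f bf; apply/eqP; rewrite -subr_eq0; apply/eqP.
apply: (@linear_ext _ _ _ (fun f => \int[P]_x f x - Lam f) (1 + C)) => //.
- by move=> g h bg bh; rewrite expD// LD//; ring.
- by move=> a g bg; rewrite expZ// LZ//; ring.
- move=> g e bg ge; apply: (le_trans (ler_normB _ _)); rewrite mulrDl mul1r.
  by apply: lerD; [exact: exp_abs_cst|exact: LC].
- by move=> A mA; rewrite exp_indic// LA// subrr.
Qed.

Section Constructions.
Context {R : realType} {d : measure_display} {T : measurableType d}.

Lemma Pr_mnormalize (mu : {measure set T -> \bar R}) (P : probability T R) A (a b : R) :
  mu setT = b%:E -> b != 0 -> mu A = a%:E -> Pr (mnormalize mu P) A = a / b.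
Proof. by move=> mT b0 mA; rewrite /Pr /= /mnormalize mT eqe (negbTE b0) /= mA. Qed.

Lemma mixture_exists n (P : 'I_n.+1 -> probability T R) :
  exists Q : probability T R, forall f, bm f ->
    \int[Q]_x f x = n.+1%:R^-1 * \sum_i \int[P i]_x f x.
Proof.
pose m k : {measure set T -> \bar R} := P (inord k).
pose Q : probability T R := mnormalize (msum m n.+1) (P ord0).
have mE A : measurable A -> msum m n.+1 A = (\sum_i Pr (P i) A)%:E.
  move=> mA; rewrite -sumEFin; apply: eq_bigr => i _.
  by rewrite /m inord_val /Pr fineK// fin_num_measure.
have m1 : msum m n.+1 setT = n.+1%:R%:E.
  rewrite mE//; congr (_%:E); under eq_bigr do rewrite /Pr prob_setT.
  by rewrite sumr_const card_ord.
exists Q; apply: (@exp_ext _ _ _ Q _ 1).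
- move=> f g bf bg; rewrite -mulrDr -big_split/=; congr (_ * _).
  by apply: eq_bigr => i _; rewrite expD.
- move=> a f bf; rewrite mulrCA; congr (_ * _); rewrite mulr_sumr.
  by apply: eq_bigr => i _; rewrite expZ.
- move=> f e bf fe; rewrite mul1r normrM ger0_norm ?invr_ge0//.
  rewrite ler_pdivrMl ?ltr0n//; apply: (le_trans (ler_norm_sum _ _ _)).
  apply: (@le_trans _ _ (\sum_(i < n.+1) e)); last by rewrite sumr_const card_ord mulr_natl.
  by apply: ler_sum => i _; exact: exp_abs_cst.
- move=> A mA; rewrite /Q (Pr_mnormalize _ m1 _ (mE A mA)) ?pnatr_eq0// mulrC.
  by congr (_ * _); apply: eq_bigr => i _; rewrite exp_indic.
Qed.

Section Density.
Variables (P : probability T R) (f : T -> R).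
Hypotheses (bf : bm f) (f0 : forall x, 0 <= f x).

Definition weighted (A : set T) : \bar R := (\int[P]_(x in A) (f x)%:E)%E.

Let weighted0 : weighted set0 = 0%E.
Proof. by rewrite /weighted integral_set0. Qed.

Let weighted_ge0 A : (0 <= weighted A)%E.
Proof. by apply: integral_ge0 => x _; rewrite lee_fin. Qed.

Let weighted_sigma_additive : semi_sigma_additive weighted.
Proof.
move=> A mA tA mUA; rewrite /weighted ge0_integral_bigcup//.
- by apply: is_cvg_ereal_nneg_natsum => k _; exact: weighted_ge0.
- by apply/measurable_EFinP; apply: measurable_funTS; case: bf.
- by move=> x _; rewrite lee_fin.
Qed.

HB.instance Definition _ := isMeasure.Build _ _ _ weighted
  weighted0 weighted_ge0 weighted_sigma_additive.

Lemma density_exists : \int[P]_x f x = 1 ->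
  exists Q : probability T R, forall g, bm g -> \int[Q]_x g x = \int[P]_x (g x * f x).
Proof.
move=> f1; pose Q : probability T R := mnormalize weighted P.
have wE A : measurable A -> weighted A = (\int[P]_x (\1_A x * f x))%:E.
  move=> mA; under eq_Rintegral do rewrite mulrC.
  rewrite -exp_in /Rintegral fineK//; apply: integrable_fin_num => //.
  exact: bm_integrable.
have w1 : weighted setT = 1%E.
  by rewrite wE//; congr (_%:E); rewrite -[RHS]f1; apply: eq_Rintegral => x _; rewrite indicT mul1r.
exists Q; apply: (@exp_ext _ _ _ Q _ 1).
- by move=> g h bg bh; rewrite -expD; [apply: eq_Rintegral => x _; ring|exact: bmM|exact: bmM].
- by move=> a g bg; rewrite -expZ; [apply: eq_Rintegral => x _; ring|exact: bmM].
- move=> g e bg ge; rewrite mul1r -[e]mulr1 -f1 -expZ//.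
  apply: exp_abs_le; [exact: bmM|exact: bmZ|].
  by move=> x; rewrite normrM (ger0_norm (f0 x)) ler_wpM2r.
- by move=> A mA; rewrite /Q (Pr_mnormalize _ w1 _ (wE A mA)) ?oner_eq0// divr1.
Qed.

End Density.

Lemma law_exists d' (S : measurableType d') (P : probability S R) (Y : S -> T) :
  measurable_fun setT Y ->
  exists Q : probability T R, forall f, bm f -> \int[Q]_x f x = \int[P]_w f (Y w).
Proof.
move=> mY; pose Y' : {RV P >-> T} := mfun_Sub (mem_set mY).
exists (distribution P Y') => f bf; apply/esym; apply: exp_pushforward => //.
Qed.

End Constructions.

Lemma exp_mul_ext (R : realType) d (T : measurableType d) d' (S : measurableType d')
    (Q : probability T R) (P : probability S R) (Y : T -> S) (g : T -> R) (c : R) :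
  measurable_fun setT Y -> bm g ->
  (forall A, measurable A -> \int[Q]_x (\1_A (Y x) * g x) = Pr P A * c) ->
  forall h, bm h -> \int[Q]_x (h (Y x) * g x) = \int[P]_y h y * c.
Proof.
move=> mY bg gA h bh; apply/eqP; rewrite -subr_eq0; apply/eqP.
have bY (f : S -> R) : bm f -> bm (fun x => f (Y x) * g x).
  by move=> bf; apply: bmM => //; exact: (bm_comp bf).
have [_ [M gM]] := bg.
apply: (@linear_ext _ _ _ (fun h => \int[Q]_x (h (Y x) * g x) - \int[P]_y h y * c)
  (`|M| + `|c|)) => //.
- move=> f k bf bk; rewrite (expD P)//.
  under eq_Rintegral do rewrite mulrDl.
  by rewrite expD; [ring|exact: bY|exact: bY].
- move=> a f bf; rewrite (expZ P)//; under eq_Rintegral do rewrite -mulrA.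
  by rewrite expZ; [ring|exact: bY].
- move=> f e bf fe; apply: (le_trans (ler_normB _ _)); rewrite mulrDl; apply: lerD.
    apply: exp_abs_cst => [|x]; first exact: bY.
    by rewrite normrM mulrC ler_pM//; apply: le_trans (gM x) (ler_norm M).
  by rewrite normrM mulrC ler_wpM2l//; exact: exp_abs_cst.
- by move=> A mA; rewrite gA// (exp_indic P)// subrr.
Qed.

Lemma exp_product (R : realType) d1 (T1 : measurableType d1) d2 (T2 : measurableType d2)
    (P1 : probability T1 R) (P2 : probability T2 R) (h1 : T1 -> R) (h2 : T2 -> R) :
  bm h1 -> bm h2 ->
  \int[(P1 \x P2)%E]_x (h1 x.1 * h2 x.2) = \int[P1]_x h1 x * \int[P2]_y h2 y.
Proof.
move=> b1 b2.
have bs (f : T2 -> R) : bm f -> bm (fun x : T1 * T2 => f x.2).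
  by move=> bf; exact: (bm_comp bf measurable_snd).
have bf1 (f : T1 -> R) : bm f -> bm (fun x : T1 * T2 => f x.1).
  by move=> bf; exact: (bm_comp bf measurable_fst).
apply: (@exp_mul_ext _ _ _ _ _ (P1 \x P2)%E P1 fst (fun x => h2 x.2)) => //; first exact: bs.
move=> A mA; under eq_Rintegral do rewrite mulrC.
have bA : bm (\1_A : T1 -> R) by exact: bm_indic.
rewrite [RHS]mulrC.
apply: (@exp_mul_ext _ _ _ _ _ (P1 \x P2)%E P2 snd (fun x => \1_A x.1)) => //.
  exact: (bf1 _ bA).
move=> B mB; have mAB : measurable (A `*` B) by exact: measurableX.
transitivity (Pr (P1 \x P2)%E (A `*` B)).
  rewrite -exp_indic//; apply: eq_Rintegral => x _.
  by rewrite !indicE -natrM mulnb in_setX andbC.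
rewrite mulrC /Pr; have := product_measure1E P1 P2 mA mB => /= ->.
by rewrite fineM// fin_num_measure.
Qed.

Section CouplingMatrix.
Context {R : realType} {I : finType}.
Variables (al be : I -> R).
Hypotheses (al0 : forall a, 0 <= al a) (be0 : forall a, 0 <= be a).
Hypotheses (al1 : \sum_a al a = 1) (be1 : \sum_a be a = 1).

Let m a : R := Num.min (al a) (be a).
Let s : R := 1 - \sum_a m a.

Let mal a : 0 <= al a - m a. Proof. by rewrite subr_ge0 ge_min lexx. Qed.
Let mbe a : 0 <= be a - m a. Proof. by rewrite subr_ge0 ge_min lexx orbT. Qed.

Let sal : \sum_a (al a - m a) = s. Proof. by rewrite sumrB al1. Qed.
Let sbe : \sum_a (be a - m a) = s. Proof. by rewrite sumrB be1. Qed.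

Let s0 : 0 <= s. Proof. by rewrite -sal; apply: sumr_ge0. Qed.

Let rest (x : I -> R) (a : I) : (forall a, 0 <= x a) -> \sum_a x a = s -> x a * s / s = x a.
Proof.
move=> x0 xs; have [sz|sn] := eqVneq s 0; last by rewrite mulfK.
move: xs; rewrite sz => /eqP; rewrite psumr_eq0// => /allP/(_ a (mem_index_enum a))/eqP ->.
by rewrite !mul0r.
Qed.

(** The diagonal carries the common mass; the excess is coupled independently. *)
Lemma coupling_matrix : exists gam : I -> I -> R, [/\ forall a b, 0 <= gam a b,
  forall a, \sum_b gam a b = al a, forall b, \sum_a gam a b = be b &
  \sum_a \sum_(b | b != a) gam a b <= \sum_a `|al a - be a|].
Proof.
pose gam a b := (if b == a then m a else 0) + (al a - m a) * (be b - m b) / s.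
have m0 a : 0 <= m a by rewrite le_min al0 be0.
have r0 a b : 0 <= (al a - m a) * (be b - m b) / s by rewrite divr_ge0// mulr_ge0.
exists gam; split.
- by move=> a b; apply: addr_ge0 => //; case: ifP.
- move=> a; rewrite big_split/= -big_mkcond big_pred1_eq -mulr_suml -mulr_sumr sbe.
  by rewrite (@rest (fun a => al a - m a))// addrC subrK.
- move=> b; rewrite big_split/=.
  rewrite (eq_bigr (fun a => if a == b then m a else 0)); last by move=> a _; rewrite eq_sym.
  rewrite -big_mkcond big_pred1_eq -mulr_suml -mulr_suml sal [s * _]mulrC.
  rewrite (_ : (be b - m b) * s / s = be b - m b); first by rewrite addrC subrK.
  exact: (@rest (fun a => be a - m a)).
- apply: (@le_trans _ _ (\sum_a (al a - m a))).
    apply: ler_sum => a _; rewrite -[leRHS](@rest (fun a => al a - m a))// -{1}sbe mulr_sumr mulr_suml.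
    rewrite [leRHS](bigD1 a)//=; apply: ler_wpDl => //; apply: ler_sum => b ba.
    by rewrite /gam (negbTE ba) add0r.
  apply: ler_sum => a _; rewrite /m /Num.min; case: ifP => _; first by rewrite subrr.
  exact: ler_norm.
Qed.

End CouplingMatrix.

Section Coupling.
Context {R : realType} {d : measure_display} {T : measurableType d} {I : finType}.
Variables (al be : probability T R) (phi : I -> T -> R).
Hypotheses (bphi : forall a, bm (phi a)) (phi0 : forall a x, 0 <= phi a x).
Hypothesis phi1 : forall x, \sum_a phi a x = 1.

Let mass (P : probability T R) a := \int[P]_x phi a x.

Let mass0 P a : 0 <= mass P a. Proof. exact: exp_ge0. Qed.

Let mass1 P : \sum_a mass P a = 1.
Proof.
rewrite -exp_sum//; under eq_Rintegral do rewrite phi1.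
by rewrite exp_cst.
Qed.

Let part (P : probability T R) a x := phi a x / mass P a.

Let bpart P a : bm (part P a).
Proof. by apply: bmM => //; exact: bm_cst. Qed.

Let part0 P a x : 0 <= part P a x. Proof. by rewrite divr_ge0. Qed.

Let exp_part (P : probability T R) a (u : T -> R) : bm u ->
  mass P a * \int[P]_x (u x * part P a x) = \int[P]_x (u x * phi a x).
Proof.
move=> bu; under eq_Rintegral do rewrite mulrA.
rewrite expZr; last exact: bmM.
have [m0|mn] := eqVneq (mass P a) 0; last by rewrite mulrC divfK.
rewrite m0 mul0r; have [_ [M uM]] := bu; apply/esym/eqP; rewrite -normr_le0.
apply: (@le_trans _ _ (\int[P]_x (M * phi a x))); last by rewrite expZ// -/(mass P a) m0 mulr0.
apply: exp_abs_le; [exact: bmM|exact: bmZ|move=> x].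
by rewrite normrM (ger0_norm (phi0 a x)) ler_wpM2r.
Qed.

Let exp_part_le (P : probability T R) a : \int[P]_x part P a x <= 1.
Proof.
rewrite /part expZr//; have [->|mn] := eqVneq (mass P a) 0; first by rewrite invr0 mulr0.
by rewrite divff.
Qed.

Lemma coupling_exists : exists Gam : probability (T * T)%type R,
  [/\ forall A, measurable A -> Pr Gam [set x | A x.1] = Pr al A,
      forall A, measurable A -> Pr Gam [set x | A x.2] = Pr be A &
      forall D h M, bm D -> 0 <= h -> 0 <= M -> (forall x, D x <= M) ->
        (forall a x, phi a x.1 != 0 -> phi a x.2 != 0 -> D x <= h) ->
        \int[Gam]_x D x <= h + M * \sum_a `|mass al a - mass be a|].
Proof.
have [gam [gam0 row col off]] := coupling_matrix (mass0 al) (mass0 be) (mass1 al) (mass1 be).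
pose dens (k : I -> I -> R) (x : T * T) := \sum_a \sum_b k a b * (part al a x.1 * part be b x.2).
have bm1 (f : T -> R) : bm f -> bm (fun x : T * T => f x.1).
  by move=> bf; exact: (bm_comp bf measurable_fst).
have bm2 (f : T -> R) : bm f -> bm (fun x : T * T => f x.2).
  by move=> bf; exact: (bm_comp bf measurable_snd).
have bd k : bm (dens k).
  by apply: bm_sum => a _; apply: bm_sum => b _; apply: bmZ; apply: bmM; [exact: bm1|exact: bm2].
have d0 k x : (forall a b, 0 <= k a b) -> 0 <= dens k x.
  move=> k0; apply: sumr_ge0 => a _; apply: sumr_ge0 => b _.
  by apply: mulr_ge0 => //; apply: mulr_ge0; exact: part0.
have expd k (u v : T -> R) : bm u -> bm v ->
    \int[(al \x be)%E]_x (u x.1 * v x.2 * dens k x) =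
    \sum_a \sum_b k a b * (\int[al]_x (u x * part al a x) * \int[be]_x (v x * part be b x)).
  move=> bu bv.
  transitivity (\int[(al \x be)%E]_x (\sum_a \sum_b k a b *
      ((u x.1 * part al a x.1) * (v x.2 * part be b x.2)))).
    apply: eq_Rintegral => x _; rewrite /dens mulr_sumr; apply: eq_bigr => a _.
    by rewrite mulr_sumr; apply: eq_bigr => b _; ring.
  have b12 a b : bm (fun x : T * T => (u x.1 * part al a x.1) * (v x.2 * part be b x.2)).
    by apply: bmM; [apply: (bm1 (fun x => u x * part al a x))|
      apply: (bm2 (fun x => v x * part be b x))]; exact: bmM.
  rewrite exp_sum; last by move=> a _; apply: bm_sum => b _; exact: bmZ.
  apply: eq_bigr => a _; rewrite exp_sum; last by move=> b _; exact: bmZ.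
  apply: eq_bigr => b _; rewrite expZ//; congr (_ * _).
  by apply: (@exp_product _ _ _ _ _ al be (fun x => u x * part al a x) (fun x => v x * part be b x));
    exact: bmM.
have le_col a b : gam a b <= mass be b by rewrite -col (bigD1 a)//= lerDl sumr_ge0.
have le_row a b : gam a b <= mass al a by rewrite -row (bigD1 b)//= lerDl sumr_ge0.
have bone : bm (fun _ : T => 1 : R) by exact: bm_cst.
have one_part (P : probability T R) a x : 0 <= x -> x <= mass P a -> x * \int[P]_z (1 * part P a z) = x.
  move=> x0 xm; have [m0|mn] := eqVneq (mass P a) 0.
    have -> : x = 0 by apply/eqP; rewrite eq_le x0 andbT -m0.
    by rewrite mul0r.
  suff -> : \int[P]_z (1 * part P a z) = 1 by rewrite mulr1.
  apply: (mulfI mn); rewrite exp_part// mulr1.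
  by apply: eq_Rintegral => z _; rewrite mul1r.
have first_marginal u : bm u ->
    \int[(al \x be)%E]_x (u x.1 * dens gam x) = \int[al]_x u x.
  move=> bu; transitivity (\int[(al \x be)%E]_x (u x.1 * 1 * dens gam x)).
    by apply: eq_Rintegral => x _; rewrite mulr1.
  rewrite (expd gam u (fun=> 1))//.
  transitivity (\sum_a mass al a * \int[al]_x (u x * part al a x)).
    apply: eq_bigr => a _; rewrite -[in RHS]row mulr_suml; apply: eq_bigr => b _.
    by rewrite mulrCA mulrC one_part// mulrC.
  under eq_bigr do rewrite exp_part//.
  rewrite -exp_sum; last by move=> a _; exact: bmM.
  by apply: eq_Rintegral => x _; rewrite -mulr_sumr phi1 mulr1.
have second_marginal v : bm v ->
    \int[(al \x be)%E]_x (v x.2 * dens gam x) = \int[be]_x v x.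
  move=> bv; transitivity (\int[(al \x be)%E]_x (1 * v x.2 * dens gam x)).
    by apply: eq_Rintegral => x _; rewrite mul1r.
  rewrite (expd gam (fun=> 1) v)// exchange_big/=.
  transitivity (\sum_b mass be b * \int[be]_x (v x * part be b x)).
    apply: eq_bigr => b _; rewrite -[in RHS]col mulr_suml; apply: eq_bigr => a _.
    by rewrite mulrA one_part.
  under eq_bigr do rewrite exp_part//.
  rewrite -exp_sum; last by move=> a _; exact: bmM.
  by apply: eq_Rintegral => x _; rewrite -mulr_sumr phi1 mulr1.
have [|Gam GamE] := @density_exists _ _ _ (al \x be)%E _ (bd gam) (fun x => d0 gam x gam0).
  have := first_marginal (fun=> 1) bone; rewrite exp_cst => <-.
  by apply: eq_Rintegral => x _; rewrite mul1r.
exists Gam; split.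
- move=> A mA; have bA : bm (\1_A : T -> R) by exact: bm_indic.
  rewrite -(exp_indic al mA) -first_marginal// -(GamE _ (bm1 _ bA)) -exp_indic//.
  by rewrite -[X in measurable X]setTI; exact: measurable_fst.
- move=> A mA; have bA : bm (\1_A : T -> R) by exact: bm_indic.
  rewrite -(exp_indic be mA) -second_marginal// -(GamE _ (bm2 _ bA)) -exp_indic//.
  by rewrite -[X in measurable X]setTI; exact: measurable_snd.
- move=> D h M bD h0 M0 DM Dh; rewrite GamE//.
  pose k a b := gam a b * (if b == a then h else M).
  apply: (@le_trans _ _ (\int[(al \x be)%E]_x dens k x)).
    apply: exp_le => //; first exact: bmM.
    move=> x; rewrite /dens mulr_sumr; apply: ler_sum => a _.
    rewrite mulr_sumr; apply: ler_sum => b _.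
    have p0 : 0 <= part al a x.1 * part be b x.2 by apply: mulr_ge0; exact: part0.
    rewrite /k mulrCA -mulrA ler_wpM2l//.
    have [ba|_] := eqVneq b a; last by rewrite ler_wpM2r.
    have [z|nz] := eqVneq (part al a x.1 * part be b x.2) 0; first by rewrite z !mulr0.
    rewrite ler_wpM2r//; apply: (Dh a).
      by apply: contra nz => /eqP z; rewrite /part z !mul0r.
    by apply: contra nz => /eqP z; rewrite ba /part z mul0r mulr0.
  have -> : \int[(al \x be)%E]_x dens k x =
      \sum_a \sum_b k a b * (\int[al]_x (1 * part al a x) * \int[be]_x (1 * part be b x)).
    rewrite -(expd k (fun=> 1) (fun=> 1))//.
    by apply: eq_Rintegral => x _; rewrite !mul1r.
  have oneP (P : probability T R) a : 0 <= \int[P]_x (1 * part P a x) <= 1.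
    under eq_Rintegral do rewrite mul1r.
    by rewrite exp_part_le exp_ge0// => x; exact: part0.
  apply: (@le_trans _ _ (\sum_a \sum_b k a b)).
    apply: ler_sum => a _; apply: ler_sum => b _; apply: ler_piMr.
      by rewrite /k mulr_ge0//; case: ifP.
    have /andP[? ?] := oneP al a; have /andP[? ?] := oneP be b.
    exact: mulr_ile1.
  apply: (@le_trans _ _ (\sum_a (h * mass al a + M * \sum_(b | b != a) gam a b))).
    apply: ler_sum => a _; rewrite (bigD1 a)//= /k eqxx; apply: lerD.
      by rewrite mulrC ler_wpM2l.
    rewrite mulr_sumr; apply: ler_sum => b ba.
    by rewrite (negbTE ba) mulrC.
  rewrite big_split/= -!mulr_sumr mass1 mulr1 lerD2l ler_wpM2l//.
Qed.

End Coupling.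

(** * The limit theorems *)

Section Limits.
Context {R : realType} {K l : nat} {dO : measure_display}.
Context {Omega : measurableType dO}.
Notation V := (l.-tuple R).
Variables (kappa : 'I_K -> 'I_K -> R) (pi_ : 'I_K -> R) (theta : nat -> R).
Variables (F : 'I_K -> probability V R) (G : 'I_K -> 'I_K -> probability R R).
Variables (nu : 'I_K -> R.-pker V ~> V) (c d H : R) (P : probability Omega R).
Variables (J : forall n, 'I_n -> Omega -> 'I_K).
Variables (E : forall n, 'I_n -> 'I_n -> {RV P >-> bool}).
Variables (Q : forall n, 'I_n -> {RV P >-> V}).
Variables (B : forall n, 'I_n -> 'I_n -> {RV P >-> R}).
Hypothesis model : network_model kappa theta F G H J E Q B.
Context {d0 : measure_display} {Omega0 : measurableType d0}.
Variables (P0 : probability Omega0 R) (J0 : Omega0 -> 'I_K) (Q0 : {RV P0 >-> V}).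
Variable Z0 : nat -> {RV P0 >-> V}.
Hypothesis typical : typical_vertex pi_ F nu J0 Q0 Z0.
Hypotheses (K0 : (0 < K)%N) (l0 : (0 < l)%N).
Hypothesis pi_gt0 : forall r, 0 < pi_ r.
Hypothesis pi_sum1 : \sum_r pi_ r = 1.
Hypotheses (c0 : 0 <= c) (dpos : 0 < d) (cd1 : c + d <= 1) (H0 : 0 < H).
Hypothesis kappa0 : forall r s, 0 <= kappa r s.
Hypothesis G_support : forall r s, G r s `[0, H]%classic = 1%E.
Hypothesis nu_cube : forall r q, cube q -> nu r q cube = 1%E.
Hypothesis theta0 : forall n, 0 < theta n.
Hypothesis theta_limsup : (limn_esup (fun n =>
  (\big[Num.max/0]_r \big[Num.max/0]_s (kappa r s * theta n / n%:R))%:E) <= 1)%E.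
Hypothesis theta_cvgy : theta @ \oo --> +oo.
Hypothesis label_freq : forall r : 'I_K,
  cvg_in_prob P (fun n w => (\sum_(i < n) (@J n i w == r)%:R) / n%:R) (pi_ r).
Variable X : forall n, {RV P >-> n.-tuple V}.
Hypothesis stationary : stationary_opinions nu c d J E Q B X.

Notation R0 := (mean_field_opinion kappa pi_ G c d J0 Q0 Z0).
Notation P0r := (community_law typical).
Notation balanced := (balanced kappa pi_ theta).
Notation Pj := (label_law model).
Notation atom0 r := [set w | J0 w = r].

Let mR0 : measurable_fun setT R0.
Proof. exact: (measurable_mean_field typical pi_gt0 c0 dpos cd1 H0 kappa0 G_support). Qed.

Let cR0 w : cube (R0 w).
Proof. exact: (mean_field_cube typical pi_gt0 c0 dpos cd1 H0 kappa0 G_support). Qed.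

Let mX n (i : 'I_n) : measurable_fun setT (fun w => tnth (X n w) i).
Proof. exact: (measurableT_comp (measurable_tnth i) (measurable_funP (X n))). Qed.

Let cX n (i : 'I_n) w : cube (tnth (X n w) i).
Proof. by have [cx _] := stationary n; exact: cx. Qed.

Let bX f n (i : 'I_n) : bounded_continuous f -> bm (fun w => f (tnth (X n w) i)).
Proof. by move=> cf; exact: (bm_continuous l0 cf (mX i) (cX i)). Qed.

Let bR0 f : bounded_continuous f -> bm (fun w => f (R0 w)).
Proof. by move=> cf; exact: (bm_continuous l0 cf mR0 cR0). Qed.

(** Asymptotic independence for continuous test functions, uniformly over the
   vertices and the balanced label vectors. *)
Lemma product_limit_continuous (m : nat) (f : 'I_m -> V -> R) (eta : R) :
  (forall b, bounded_continuous (f b)) -> 0 < eta ->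
  exists2 del, 0 < del & \forall n \near \oo, forall j : {ffun 'I_n -> 'I_K},
    balanced del j -> P (label_atom J j) != 0%E ->
    forall v : 'I_m -> 'I_n, injective v ->
    `|\int[Pj j]_w \prod_b f b (tnth (X n w) (v b)) -
      \prod_b \int[P0r (j (v b))]_w f b (R0 w)| <= eta.
Proof.
move=> cf eta0.
have [C C1 fC] : exists2 C : R, 1 <= C & forall b x, cube x -> `|f b x| <= C.
  have hC b : exists C : R, 0 <= C /\ forall x, cube x -> `|f b x| <= C.
    have [[C fC] _] := cf b; exists `|C|; split => // x cx.
    by apply: le_trans (fC x cx) (ler_norm C).
  have [C hC'] := choice hC; exists (1 + \sum_b C b).
    by rewrite lerDl; apply: sumr_ge0 => b _; case: (hC' b).
  move=> b x cx; apply: (le_trans ((hC' b).2 x cx)); rewrite (bigD1 b)//= addrA.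
  rewrite addrAC; apply: ler_wpDl => //; apply: addr_ge0 => //.
  by apply: sumr_ge0 => b' _; case: (hC' b').
have C0 : 0 < C by apply: lt_le_trans C1.
have Cm0 : 0 <= C ^+ m by rewrite exprn_ge0// ltW.
have eta2 : 0 < eta / 2 by rewrite divr_gt0.
have [x x0 hx] := exists_small Cm0 eta2.
have [|y y0 hy] := exists_small (A := C ^+ m * (m%:R * 2)) _ eta2; first by rewrite !mulr_ge0.
have hg b : exists gL : (V -> R) * R, [/\ 0 <= gL.2, bm gL.1, forall x, `|gL.1 x| <= C,
    forall x x', `|gL.1 x - gL.1 x'| <= gL.2 * dclip x x' &
    forall x, cube x -> `|f b x - gL.1 x| <= y].
  by have [g [L hgL]] := lipschitz_approx l0 (cf b) (fC b) y0; exists (g, L).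
have [gL hgL] := choice hg.
pose h b z := (gL b).1 z / C.
pose L := \sum_b (gL b).2.
have L0 : 0 <= L by apply: sumr_ge0 => b _; case: (hgL b).
have bh b : bm (h b) by apply: bmM; [case: (hgL b)|exact: bm_cst].
have h1 b z : `|h b z| <= 1.
  rewrite normrM normfV (gtr0_norm C0) ler_pdivrMr// mul1r.
  by case: (hgL b).
have hL b z z' : `|h b z - h b z'| <= L * dclip z z'.
  rewrite -mulrBl normrM normfV (gtr0_norm C0) ler_pdivrMr//.
  have D0 : 0 <= dclip z z' by apply: sumr_ge0.
  have [g0 _ _ gl _] := hgL b; apply: (le_trans (gl z z')).
  have gLL : (gL b).2 <= L.
    by rewrite /L (bigD1 b)//= lerDl; apply: sumr_ge0 => b' _; case: (hgL b').
  apply: (le_trans (ler_wpM2r D0 gLL)); rewrite ler_peMr//; exact: mulr_ge0.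
have fh b z : cube z -> `|f b z / C - h b z| <= y.
  move=> cz; rewrite -mulrBl normrM normfV (gtr0_norm C0) ler_pdivrMr//.
  have [_ _ _ _ fg] := hgL b; apply: (le_trans (fg z cz)).
  by rewrite ler_peMr// ltW.
have f1 b z : cube z -> `|f b z / C| <= 1.
  by move=> cz; rewrite normrM normfV (gtr0_norm C0) ler_pdivrMr// mul1r fC.
have [del del0 near_lim] := vertex_limit model typical
  pi_gt0 c0 dpos cd1 H0 kappa0 G_support theta0 nu_cube theta_cvgy K0 stationary m x0 L0.
exists del => //; apply: filterS near_lim => n lim j bal Pj0 v vinj.
have bfX b : bm (fun w => f b (tnth (X n w) (v b)) / C).
  by apply: bmM; [exact: bX|exact: bm_cst].
have bhX b : bm (fun w => h b (tnth (X n w) (v b))) by exact: (bm_comp (bh b)).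
have bfR b : bm (fun w => f b (R0 w) / C) by apply: bmM; [exact: bR0|exact: bm_cst].
have bhR b : bm (fun w => h b (R0 w)) by exact: (bm_comp (bh b)).
have step1 : `|\int[Pj j]_w \prod_b (f b (tnth (X n w) (v b)) / C) -
    \int[Pj j]_w \prod_b h b (tnth (X n w) (v b))| <= m%:R * y.
  rewrite -expB; [|exact: bm_prod|exact: bm_prod].
  apply: exp_abs_cst; first by apply: bmB; exact: bm_prod.
  move=> w; apply: (le_trans (prod_diff_le _ _ _)) => [b|b|]; [exact: f1|exact: h1|].
  by rewrite -sum_ord_const; apply: ler_sum => b _; exact: fh.
have step2 := lim j bal Pj0 v h vinj bh h1 hL.
have step3 : `|\prod_b \int[P0r (j (v b))]_w h b (R0 w) -
    \prod_b \int[P0r (j (v b))]_w (f b (R0 w) / C)| <= m%:R * y.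
  apply: (le_trans (prod_diff_le _ _ _)).
  - by move=> b; apply: exp_abs_cst.
  - by move=> b; apply: exp_abs_cst => // w; exact: f1.
  rewrite -sum_ord_const; apply: ler_sum => b _; rewrite -expB//.
  by apply: exp_abs_cst => [|w]; [exact: bmB|rewrite distrC; exact: fh].
have prodC (g : 'I_m -> R) : \prod_b g b = C ^+ m * \prod_b (g b / C).
  rewrite -[m in C ^+ m]card_ord -prodr_const -big_split/=.
  by apply: eq_bigr => b _; rewrite mulrC divfK// gt_eqF.
have -> : \int[Pj j]_w \prod_b f b (tnth (X n w) (v b)) =
    C ^+ m * \int[Pj j]_w \prod_b (f b (tnth (X n w) (v b)) / C).
  rewrite -expZ; last exact: bm_prod.
  by apply: eq_Rintegral => w _; rewrite -prodC.
have -> : \prod_b \int[P0r (j (v b))]_w f b (R0 w) =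
    C ^+ m * \prod_b \int[P0r (j (v b))]_w (f b (R0 w) / C).
  by rewrite prodC; congr (_ * _); apply: eq_bigr => b _; rewrite expZr//; exact: bR0.
rewrite -mulrBr normrM (ger0_norm Cm0).
apply: (@le_trans _ _ (C ^+ m * (m%:R * y + (x + m%:R * y)))).
  rewrite ler_wpM2l//; apply: (le_trans (ler_distD _ _ _)); apply: lerD; first exact: step1.
  by apply: (le_trans (ler_distD _ _ _)); apply: lerD; [exact: step2|exact: step3].
have := hx x (lexx _); have := hy y (lexx _); lra.
Qed.

Let condE_atom n (j : {ffun 'I_n -> 'I_K}) f : P (label_atom J j) != 0%E -> bm f ->
  condE P (label_atom J j) f = \int[Pj j]_w f w.
Proof. by move=> Pj0 bf; rewrite (condE_condp (measurable_label_atom model j)). Qed.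

Let condE_atom0 r f : bm f -> condE P0 (atom0 r) f = \int[P0r r]_w f w.
Proof.
by move=> bf; rewrite (condE_condp (measurable_atom0 typical r))//; exact: (atom0_neq0 typical pi_gt0).
Qed.

(** Events that depend on the labels only. *)
Lemma label_event_small (phi : forall n, {ffun 'I_n -> 'I_K} -> Prop) :
  (exists2 del, 0 < del & \forall n \near \oo, forall j : {ffun 'I_n -> 'I_K},
     balanced del j -> P (label_atom J j) != 0%E -> ~ phi n j) ->
  (fun n => P [set w | phi n (labels J n w)]) @ \oo --> 0%E.
Proof.
move=> [del del0 h]; apply: (conditional_small (model := model) kappa0 theta0 theta_limsup label_freq).
  by move=> n; exact: (labels_event model (phi n)).
move=> eta eta0; exists del => //; apply: filterS h => n h j bal Pj0.
have mA : measurable [set w | phi n (labels J n w)] by exact: (labels_event model (phi n)).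
rewrite /label_law (condpE (measurable_label_atom model j))// (_ : _ `&` _ = set0).
  by rewrite /Pr measure0 mul0r ltW.
by apply/seteqP; split => w //= [+ jw]; rewrite jw => /h; apply.
Qed.

Theorem vertices_asymptotically_independent (m : nat) (r : 'I_m -> 'I_K) (f : 'I_m -> V -> R) eps :
  (forall a, bounded_continuous (f a)) -> 0 < eps ->
  (fun n => P [set w | exists i : 'I_m -> 'I_n,
        [/\ injective i, forall a, @J n (i a) w = r a &
            eps <= `| condE P (label_atom J (labels J n w))
                        (fun w' => \prod_(a < m) f a (tnth (X n w') (i a)))
                    - \prod_(a < m) condE P0 [set w' | J0 w' = r a]
                                      (fun w' => f a (R0 w')) |]])
       @ \oo --> 0%E.
Proof.
move=> cf eps0; have eps2 : 0 < eps / 2 by rewrite divr_gt0.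
have [del del0 lim] := product_limit_continuous cf eps2.
pose phi n (j : {ffun 'I_n -> 'I_K}) := exists i : 'I_m -> 'I_n,
  [/\ injective i, forall a, j (i a) = r a &
   eps <= `| condE P (label_atom J j) (fun w' => \prod_(a < m) f a (tnth (X n w') (i a)))
     - \prod_(a < m) condE P0 [set w' | J0 w' = r a] (fun w' => f a (R0 w')) |].
rewrite (_ : (fun n => _) = fun n => P [set w | phi n (labels J n w)]); last first.
  apply/funext => n; congr (P _); apply/seteqP; split => w /= [i [i1 i2 i3]]; exists i; split => // a.
    by rewrite /labels ffunE.
  by rewrite -(i2 a) /labels ffunE.
apply: label_event_small; exists del => //; apply: filterS lim => n lim j bal Pj0 [i [iinj ji]].
apply/negP; rewrite -ltNge; apply: (@le_lt_trans _ _ (eps / 2)); last by lra.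
rewrite condE_atom//; last by apply: bm_prod => a _; exact: bX.
rewrite (eq_bigr (fun a => \int[P0r (j (i a))]_w f a (R0 w))); first exact: lim.
by move=> a _; rewrite condE_atom0 ?ji//; exact: bR0.
Qed.

Let exp_atom_le n (j : {ffun 'I_n -> 'I_K}) (h g : Omega -> R) :
  P (label_atom J j) != 0%E -> bm h -> bm g ->
  (forall w, label_atom J j w -> h w <= g w) -> \int[Pj j]_w h w <= \int[Pj j]_w g w.
Proof.
move=> Pj0 bh bg hg; have mA := measurable_label_atom model j.
have bA : bm (\1_(label_atom J j) : Omega -> R) by exact: bm_indic.
rewrite /label_law !(condp_exp (measurable_label_atom model j) Pj0)// ler_wpM2r ?invr_ge0 ?fine_ge0//.
apply: exp_le; [exact: bmM|exact: bmM|move=> w].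
rewrite indicE; case: (boolP (w \in _)) => [/set_mem jw|_]; last by rewrite !mulr0.
by rewrite !mulr1 hg.
Qed.

Let bm_label n (i : 'I_n) r : bm (fun w => (J i w == r)%:R : R).
Proof.
apply: bm_bool; rewrite (_ : [set w | _] = [set w | J i w = r]); first by case: model.
by apply/seteqP; split => w /= /eqP.
Qed.

Let exp_community f r : bm (fun w => f (R0 w)) ->
  \int[P0]_w (f (R0 w) * (J0 w == r)%:R) = pi_ r * \int[P0r r]_w f (R0 w).
Proof.
move=> bf; rewrite (condp_exp (measurable_atom0 typical r) (atom0_neq0 typical pi_gt0 r))//.
rewrite (Pr_atom0 typical) mulrCA mulfV ?mulr1 ?gt_eqF//.
apply: eq_Rintegral => w _; rewrite indicE; congr (_ * (nat_of_bool _)%:R).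
by apply/eqP/idP => [h|/set_mem//]; apply/mem_set.
Qed.

Lemma bounded_continuousB f (b : R) :
  bounded_continuous f -> @bounded_continuous R l (fun x => f x - b).
Proof.
move=> [[C fC] cf]; split.
  exists (C + `|b|) => x cx; apply: (le_trans (ler_normB _ _)).
  by rewrite lerD2r; exact: fC.
move=> x cx eps eps0; have [del del0 h] := cf x cx eps eps0.
exists del => // y cy xy; rewrite (_ : _ - _ = f x - f y); last by ring.
exact: h.
Qed.

Let second_moment f r C eta : bounded_continuous f -> \int[P0r r]_w f (R0 w) = 0 ->
  0 <= C -> (forall x, cube x -> `|f x| <= C) -> 0 < eta ->
  exists2 del, 0 < del & \forall n \near \oo, forall j : {ffun 'I_n -> 'I_K},
    balanced del j -> P (label_atom J j) != 0%E ->
    \int[Pj j]_w (n%:R^-1 * \sum_i f (tnth (X n w) i) * (j i == r)%:R) ^+ 2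
      <= eta + C ^+ 2 / n%:R.
Proof.
move=> cf f0 C0 fC eta0.
have [del del0 lim] := @product_limit_continuous 2 (fun _ => f) _ (fun _ => cf) eta0.
exists del => //; near=> n => j bal Pj0.
have lim' : forall j : {ffun 'I_n -> 'I_K},
    balanced del j -> P (label_atom J j) != 0%E -> forall v : 'I_2 -> 'I_n, injective v ->
    `|\int[Pj j]_w \prod_b f (tnth (X n w) (v b)) -
      \prod_b \int[P0r (j (v b))]_w f (R0 w)| <= eta by near: n.
have n0 : (0 < n)%N by near: n; exact: nbhs_infty_gt.
have nR : 0 < n%:R :> R by rewrite ltr0n.
pose D i w := f (tnth (X n w) i) * (j i == r)%:R.
have bD i : bm (D i) by apply: bmM; [exact: bX|exact: bm_cst].
have DC i w : `|D i w| <= C.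
  rewrite /D; case: (j i == r); rewrite ?mulr1 ?mulr0 ?normr0//.
  exact: fC (cX i w).
have DD i k : \int[Pj j]_w (D i w * D k w) <= if i == k then C ^+ 2 else eta.
  have [->|ik] := eqVneq i k.
    apply: exp_le_cst; first exact: bmM.
    by move=> w; rewrite -expr2 -[leLHS]ger0_norm ?sqr_ge0// normrX ler_pXn2r ?nnegrE.
  rewrite /D; have [jir|_] := eqVneq (j i) r; last first.
    under eq_Rintegral do rewrite mulr0 mul0r.
    by rewrite exp_cst ltW.
  have [jkr|_] := eqVneq (j k) r; last first.
    under eq_Rintegral do rewrite !mulr0.
    by rewrite exp_cst ltW.
  pose v (b : 'I_2) := if b == ord0 then i else k.
  have vinj : injective v.
    move=> b b'; rewrite /v; case: (unliftP ord0 b) => [b1|] ->;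
      case: (unliftP ord0 b') => [b1'|] ->; rewrite ?eqxx //=.
    - by move=> _; rewrite [b1]ord1 [b1']ord1.
    - by move=> h; rewrite h eqxx in ik.
    - by move=> h; rewrite h eqxx in ik.
  have := lim' j bal Pj0 v vinj.
  rewrite big_ord_recl [v ord0]/v eqxx jir f0 mul0r subr0 ler_norml => /andP[_].
  apply: le_trans; rewrite le_eqVlt; apply/orP; left; apply/eqP.
  apply: eq_Rintegral => w _.
  by rewrite big_ord_recl big_ord_recl big_ord0 /v eqxx /= !mulr1.
have -> : \int[Pj j]_w (n%:R^-1 * \sum_i D i w) ^+ 2 =
    n%:R^-1 ^+ 2 * \sum_i \sum_k \int[Pj j]_w (D i w * D k w).
  transitivity (\int[Pj j]_w (n%:R^-1 ^+ 2 * (\sum_i \sum_k D i w * D k w))).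
    apply: eq_Rintegral => w _; rewrite exprMn; congr (_ * _).
    rewrite expr2 mulr_suml; apply: eq_bigr => i _; by rewrite mulr_sumr.
  rewrite expZ; last by apply: bm_sum => i _; apply: bm_sum => k _; exact: bmM.
  congr (_ * _); rewrite exp_sum; last by move=> i _; apply: bm_sum => k _; exact: bmM.
  by apply: eq_bigr => i _; rewrite exp_sum// => k _; exact: bmM.
apply: (@le_trans _ _ (n%:R^-1 ^+ 2 * \sum_(i < n) (n%:R * eta + C ^+ 2))).
  rewrite ler_wpM2l ?sqr_ge0//; apply: ler_sum => i _.
  apply: (le_trans (ler_sum _ (fun k _ => DD i k))).
  apply: (@le_trans _ _ (\sum_(k < n) (eta + if k == i then C ^+ 2 else 0))).
    apply: ler_sum => k _; rewrite eq_sym; case: ifP => _; last by rewrite addr0.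
    by rewrite lerDr ltW.
  by rewrite big_split/= sum_ord_const -big_mkcond big_pred1_eq.
rewrite sum_ord_const le_eqVlt; apply/orP; left; apply/eqP; field.
by rewrite gt_eqF.
Unshelve. all: by end_near. Qed.

Theorem community_averages f r : bounded_continuous f ->
  cvg_in_prob P
    (fun n w => n%:R^-1 * \sum_(i < n) f (tnth (X n w) i) * (@J n i w == r)%:R)
    (\int[P0]_w (f (R0 w) * (J0 w == r)%:R)).
Proof.
move=> cf eps eps0; rewrite (exp_community _ (bR0 cf)).
set mu := \int[P0r r]_w f (R0 w).
pose g x := f x - mu.
have cg : bounded_continuous g by exact: bounded_continuousB.
have g0 : \int[P0r r]_w g (R0 w) = 0.
  by rewrite expB; [rewrite exp_cst subrr|exact: bR0|exact: bm_cst].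
have [C C0 gC] : exists2 C, 0 <= C & forall x, cube x -> `|g x| <= C.
  have [[C gC] _] := cg; exists `|C| => // x cx.
  by apply: le_trans (gC x cx) (ler_norm C).
pose Y n w : R := n%:R^-1 * \sum_(i < n) f (tnth (X n w) i) * (@J n i w == r)%:R.
have bY n : bm (Y n).
  apply: bmZ; apply: bm_sum => i _; apply: bmM; [exact: bX|exact: bm_label].
apply: (conditional_small (model := model) kappa0 theta0 theta_limsup label_freq
  (A := fun n => [set w | eps <= `|Y n w - pi_ r * mu|])).
  by move=> n; apply: bm_set_ge; apply: bm_norm; apply: bmB; [exact: bY|exact: bm_cst].
move=> eta eta0.
have e2 : 0 < eps / 2 by rewrite divr_gt0.
have e4 : 0 < (eps / 2) ^+ 2 by rewrite exprn_gt0.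
have x0 : 0 < eta / 2 * (eps / 2) ^+ 2 by rewrite mulr_gt0// divr_gt0.
have [del1 del10 lim] := second_moment cg g0 C0 gC x0.
have [del2 del20 hdel2] := exists_small (normr_ge0 mu) e2.
exists (Num.min del1 del2); first by rewrite lt_min del10.
near=> n => j bal Pj0.
have n0 : (0 < n)%N by near: n; exact: nbhs_infty_gt.
have nR : 0 < n%:R :> R by rewrite ltr0n.
have bal1 : balanced del1 j.
  move=> s; have [b1 b2] := bal s; split => [|t].
    by apply: (le_trans b1); rewrite ge_min lexx.
  by apply: (le_trans (b2 t)); rewrite ge_min lexx.
have fr : `|freq j r - pi_ r| * `|mu| <= eps / 2.
  rewrite mulrC; apply: hdel2; have [b1 _] := bal r; apply: (le_trans b1).
  by rewrite ge_min lexx orbT.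
pose D w := n%:R^-1 * \sum_i g (tnth (X n w) i) * (j i == r)%:R.
have bD : bm D.
  by apply: bmZ; apply: bm_sum => i _; apply: bmM; [exact: bX|exact: bm_cst].
have YD w : label_atom J j w -> Y n w - pi_ r * mu = D w + (freq j r - pi_ r) * mu.
  move=> jw; rewrite /Y /D (eq_bigr (fun i => g (tnth (X n w) i) * (j i == r)%:R + mu * (j i == r)%:R)).
    rewrite big_split/= -mulr_sumr /freq; ring.
  by move=> i _; rewrite -jw /labels ffunE /g; ring.
have mA : measurable [set w | eps <= `|Y n w - pi_ r * mu|].
  by apply: bm_set_ge; apply: bm_norm; apply: bmB; [exact: bY|exact: bm_cst].
rewrite -exp_indic//.
apply: (@le_trans _ _ (\int[Pj j]_w (((eps / 2) ^+ 2)^-1 * D w ^+ 2))).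
  apply: exp_atom_le => //; [exact: bm_indic|by apply: bmZ; exact: bmX|].
  move=> w jw; rewrite indicE; case: (boolP (w \in _)) => [/set_mem /= hw|_]; last first.
    by rewrite mulr_ge0 ?sqr_ge0// invr_ge0 ltW.
  rewrite ler_pdivlMl// mulr1 -[leRHS]ger0_norm ?sqr_ge0// normrX ler_pXn2r ?nnegrE ?(ltW e2)//.
  move: hw; rewrite YD// => hw; have := ler_normD (D w) ((freq j r - pi_ r) * mu).
  rewrite (normrM (_ - _) mu); move: fr hw; lra.
rewrite expZ; last exact: bmX.
rewrite ler_pdivrMl//.
have lim' : forall j : {ffun 'I_n -> 'I_K},
    balanced del1 j -> P (label_atom J j) != 0%E ->
    \int[Pj j]_w (n%:R^-1 * \sum_i g (tnth (X n w) i) * (j i == r)%:R) ^+ 2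
      <= eta / 2 * (eps / 2) ^+ 2 + C ^+ 2 / n%:R by near: n.
apply: (le_trans (lim' j bal1 Pj0)).
have hn : C ^+ 2 / n%:R <= eta / 2 * (eps / 2) ^+ 2.
  rewrite ler_pdivrMr// mulrC -ler_pdivrMr//.
  by near: n; exact: nbhs_infty_ger.
move: hn; lra.
Unshelve. all: by end_near. Qed.


Let Pr1 d' (T : measurableType d') (p : probability T R) (A : set T) :
  measurable A -> Pr p A = 1 -> p A = 1%E.
Proof.
by move=> mA pA; rewrite -[LHS]fineK ?[fine _]pA//; exact: fin_num_measure.
Qed.

Let label_tent N (a : {ffun 'I_l -> 'I_N.+1} * 'I_K) (x : V * nat) : R :=
  tent a.1 x.1 * (minn x.2 K.-1 == a.2)%:R.

Let measurable_label0 : measurable_fun setT (fun w => nat_of_ord (J0 w)).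
Proof.
move=> _ A _; rewrite setTI.
rewrite (_ : _ @^-1` A = \big[setU/set0]_(r : 'I_K | `[< A r >]) [set w | J0 w = r]).
  by apply: bigsetU_measurable => r _; exact: (measurable_atom0 typical).
rewrite -bigcup_seq_cond; apply/seteqP; split => w /=.
  by move=> h; exists (J0 w) => //=; rewrite mem_index_enum asboolT.
by move=> [r /andP[_ /asboolP Ar]] /= ->.
Qed.

Let bm_label_tent N a : bm (@label_tent N a).
Proof.
apply: bmM; first by apply: (bm_comp (bm_tent a.1) measurable_fst).
apply: (bm_comp (f := fun t : nat => (minn t K.-1 == a.2)%:R : R) _ measurable_snd).
by split => //; exists 1 => t; case: (_ == _); rewrite ?normr1 ?normr0.
Qed.

Let label_tent_sum N x : \sum_a @label_tent N a x = 1.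
Proof.
rewrite -(pair_bigA _ (fun b s => tent b x.1 * (minn x.2 K.-1 == nat_of_ord s)%:R))/=.
rewrite -[RHS](tent_sum N x.1); apply: eq_bigr => b _; rewrite -mulr_sumr.
have lt : (minn x.2 K.-1 < K)%N by rewrite gtn_min orbC prednK// leqnn.
rewrite (bigD1 (Ordinal lt))//= eqxx big1 ?addr0 ?mulr1// => s sne.
by case: eqP => // e; case/eqP: sne; apply: val_inj; rewrite /= e.
Qed.

Let label_min (s : 'I_K) : minn s K.-1 = s.
Proof. by apply/minn_idPl; rewrite -ltnS prednK. Qed.

Let dist_total (x y : V) : dist1 x y = \sum_(k < l) `|tnth x k - tnth y k|.
Proof. by []. Qed.

Lemma dclip_tri (x y z : V) : dclip x y <= dclip x z + dclip y z.
Proof.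
rewrite /dclip -big_split/=; apply: ler_sum => k _.
by rewrite [`|clip1 (tnth y k) - _|]distrC; exact: ler_distD.
Qed.

Lemma dclip_le2 (x y : V) : dclip x y <= 2 * l%:R.
Proof.
rewrite mulrC -(sum_ord_const l); apply: ler_sum => k _.
apply: (le_trans (ler_normB _ _)).
have := clip1_le (tnth x k); have := clip1_le (tnth y k); lra.
Qed.

Let cost (Gam : probability ((V * nat) * (V * nat))%type R) : R :=
  \int[Gam]_x dist1 x.1.1 x.2.1.

Notation coupling n j Gam := (@is_coupling R K l dO Omega P J X d0 Omega0 P0 R0 J0 n j Gam).

(** The grid coupling: nearby points of the cube with equal labels are matched
   as much as the masses of the cells allow. *)
Lemma coupling_cost_bound n (j : {ffun 'I_n -> 'I_K}) N : (0 < n)%N -> (0 < N)%N ->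
  P (label_atom J j) != 0%E ->
  exists2 Gam, coupling n j Gam &
    cost Gam <= 2 * (l%:R * (2 / N%:R)) + 2 * l%:R *
      \sum_(b : {ffun 'I_l -> 'I_N.+1}) \sum_s
        `|n%:R^-1 * \sum_i (j i == s)%:R * \int[Pj j]_w tent b (tnth (X n w) i) -
          pi_ s * \int[P0r s]_w tent b (R0 w)|.
Proof.
case: n j => // n j _ N0 Pj0.
have mXj i : measurable_fun setT (fun w => (tnth (X n.+1 w) i, nat_of_ord (j i))).
  by apply: measurable_fun_pair => //; exact: mX.
have mRJ : measurable_fun setT (fun w => (R0 w, nat_of_ord (J0 w))).
  exact: measurable_fun_pair.
have [Pi PiE] := choice (fun i => @law_exists R _ (V * nat)%type _ _ (Pj j) _ (mXj i)).
have [al alE] := mixture_exists Pi.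
have [be beE] := @law_exists R _ (V * nat)%type _ _ P0 _ mRJ.
have alEX f : bm f -> \int[al]_x f x = n.+1%:R^-1 *
    \sum_i \int[Pj j]_w f (tnth (X n.+1 w) i, nat_of_ord (j i)).
  by move=> bf; rewrite alE//; congr (_ * _); apply: eq_bigr => i _; rewrite PiE.
have lb0 a x : 0 <= @label_tent N a x by rewrite mulr_ge0// tent_ge0.
have [Gam [G1 G2 Gcost]] := coupling_exists al be (@bm_label_tent N) lb0 (@label_tent_sum N).
have nR : 0 < n.+1%:R :> R by rewrite ltr0n.
exists Gam.
  move=> A r mA; pose A' := [set z : V * nat | A z.1 /\ z.2 = r].
  have mA' : measurable A'.
    rewrite (_ : A' = A `*` [set nat_of_ord r]); first exact: measurableX.
    by apply/seteqP; split => -[z1 z2] [].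
  split.
    rewrite (G1 _ mA') -exp_indic// (alEX _ (bm_indic mA')); congr (_ * _).
    apply: eq_bigr => i _.
    have mC : measurable [set w | A' (tnth (X n.+1 w) i, nat_of_ord (j i))].
      by rewrite -[X in measurable X]setTI; exact: mXj.
    rewrite (_ : (fun w => \1_A' _) = \1_[set w | A' (tnth (X n.+1 w) i, nat_of_ord (j i))])//.
    rewrite exp_indic// /label_law (condpE (measurable_label_atom model j))//.
    rewrite /condPr; congr (Pr P _ / _); apply/seteqP; split => w /= [[h1 h2] jw]; split => //; split => //.
      by apply: val_inj; rewrite /= -h2 -jw /labels ffunE.
    by rewrite /= -h2 -jw /labels ffunE.
  rewrite (G2 _ mA') -exp_indic// (beE _ (bm_indic mA')).
  have mC : measurable [set w | A' (R0 w, nat_of_ord (J0 w))].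
    by rewrite -[X in measurable X]setTI; exact: mRJ.
  rewrite (_ : (fun w => \1_A' _) = \1_[set w | A' (R0 w, nat_of_ord (J0 w))])// exp_indic//.
  congr (Pr P0 _); apply/seteqP; split => w /= [h1 h2]; split => //; last by rewrite /= h2.
  exact: val_inj.
have mcube : measurable [set z : V * nat | cube z.1].
  rewrite (_ : [set z | _] = cube `*` setT); first by apply: measurableX => //; exact: measurable_cube.
  by apply/seteqP; split => -[z1 z2] //= [].
have mt k : measurable_fun setT (fun x : (V * nat) * (V * nat) => tnth x.1.1 k).
  by apply: (measurableT_comp (measurable_tnth k)); exact: (measurableT_comp measurable_fst measurable_fst).
have mt2 k : measurable_fun setT (fun x : (V * nat) * (V * nat) => tnth x.2.1 k).
  by apply: (measurableT_comp (measurable_tnth k)); exact: (measurableT_comp measurable_fst measurable_snd).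
have mc1 : measurable [set x : (V * nat) * (V * nat) | cube x.1.1].
  have m1 := @measurable_fst _ _ (V * nat)%type (V * nat)%type.
  by rewrite -[X in measurable X]setTI; apply: (m1 measurableT _ mcube).
have mc2 : measurable [set x : (V * nat) * (V * nat) | cube x.2.1].
  have m2 := @measurable_snd _ _ (V * nat)%type (V * nat)%type.
  by rewrite -[X in measurable X]setTI; apply: (m2 measurableT _ mcube).
have bD : bm (fun x : (V * nat) * (V * nat) => dclip x.1.1 x.2.1).
  apply: bm_dclip; [exact: (measurableT_comp measurable_fst measurable_fst)|
    exact: (measurableT_comp measurable_fst measurable_snd)].
have costE : cost Gam = \int[Gam]_x dclip x.1.1 x.2.1.
  transitivity (\int[Gam]_x \sum_(k < l) `|clip1 (tnth x.1.1 k) - tnth x.2.1 k|).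
    apply: (exp_as (A := [set x | cube x.1.1])) => //.
    - apply: Pr1 => //; rewrite (G1 _ mcube) -exp_indic// (alEX _ (bm_indic mcube)).
      rewrite (eq_bigr (fun=> 1)); first by rewrite sumr_const card_ord mulVf// gt_eqF.
      move=> i _; rewrite -[RHS](exp_cst (Pj j)); apply: eq_Rintegral => w _.
      by rewrite indicE mem_set//; exact: cX.
    - by apply: measurable_sum => k; apply: measurableT_comp => //; exact: measurable_funB.
    - apply: measurable_sum => k; apply: measurableT_comp => //; apply: measurable_funB => //.
      by apply: bm_measurable; exact: bm_clip1.
    - by move=> x cx; apply: eq_bigr => k _; rewrite clip1_id.
  apply: (exp_as (A := [set x | cube x.2.1])) => //.
  - apply: Pr1 => //; rewrite (G2 _ mcube) -exp_indic// (beE _ (bm_indic mcube)).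
    rewrite -[RHS](exp_cst P0); apply: eq_Rintegral => w _.
    by rewrite indicE mem_set//; exact: cR0.
  - apply: measurable_sum => k; apply: measurableT_comp => //; apply: measurable_funB => //.
    by apply: bm_measurable; exact: bm_clip1.
  - by case: bD.
  - by move=> x cx; apply: eq_bigr => k _; rewrite (clip1_id (cx k)).
rewrite costE; apply: (le_trans (Gcost _ (2 * (l%:R * (2 / N%:R))) (2 * l%:R) bD _ _ _ _)).
- by rewrite !mulr_ge0.
- by rewrite mulr_ge0.
- by move=> x; exact: dclip_le2.
- move=> a x p1 p2.
  have b1 : tent a.1 x.1.1 != 0 by apply: contra p1 => /eqP z; rewrite /label_tent z mul0r.
  have b2 : tent a.1 x.2.1 != 0 by apply: contra p2 => /eqP z; rewrite /label_tent z mul0r.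
  apply: (le_trans (dclip_tri _ _ (grid_point a.1))); rewrite mulr_natl mulr2n.
  by apply: lerD; exact: tent_supp.
rewrite lerD2l ler_wpM2l ?mulr_ge0//.
rewrite (pair_bigA _ (fun b s => `|n.+1%:R^-1 * \sum_i (j i == s)%:R * \int[Pj j]_w tent b (tnth (X n.+1 w) i) -
          pi_ s * \int[P0r s]_w tent b (R0 w)|))/=.
rewrite le_eqVlt; apply/orP; left; apply/eqP; apply: eq_bigr => -[b s] _ /=.
congr (`|_ - _|).
  rewrite (alEX _ (bm_label_tent (b, s))); congr (_ * _); apply: eq_bigr => i _.
  rewrite -expZ; last exact: (bm_comp (bm_tent b) (mX i)).
  by apply: eq_Rintegral => w _; rewrite /label_tent /= label_min mulrC.
rewrite (beE _ (bm_label_tent (b, s))) -(exp_community s (bm_comp (bm_tent b) mR0)).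
by apply: eq_Rintegral => w _; rewrite /label_tent /= label_min.
Qed.

Lemma coupling_cost_near eta : 0 < eta ->
  exists2 del, 0 < del & \forall n \near \oo, forall j : {ffun 'I_n -> 'I_K},
    balanced del j -> P (label_atom J j) != 0%E ->
    exists2 Gam, coupling n j Gam & cost Gam <= eta.
Proof.
move=> eta0; have eta2 : 0 < eta / 2 by rewrite divr_gt0.
have [|y y0 hy] := exists_small (A := l%:R * 4 : R) _ eta2; first by rewrite mulr_ge0.
pose N := (Num.truncn y^-1).+1.
have NR : 0 < N%:R :> R by rewrite ltr0n.
have hN : 2 * (l%:R * (2 / N%:R)) <= eta / 2.
  rewrite (_ : 2 * _ = l%:R * 4 / N%:R); last by ring.
  apply: hy; rewrite -[y]invrK lef_pV2 ?posrE ?invr_gt0//; apply: ltW; exact: truncnS_gt.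
pose I := ({ffun 'I_l -> 'I_N.+1} * 'I_K)%type.
have [|x x0 hx] := exists_small (A := 2 * l%:R * (#|{: I}|%:R * 2)) _ eta2.
  by rewrite !mulr_ge0.
have [del1 del10 lim] := vertex_limit model typical
  pi_gt0 c0 dpos cd1 H0 kappa0 G_support theta0 nu_cube theta_cvgy K0 stationary 1 x0 (ler0n R N).
exists (Num.min del1 x); first by rewrite lt_min del10.
near=> n => j bal Pj0.
have lim' : forall j : {ffun 'I_n -> 'I_K},
    balanced del1 j -> P (label_atom J j) != 0%E ->
    forall (v : 'I_1 -> 'I_n) (f : 'I_1 -> V -> R),
    injective v -> (forall b, bm (f b)) -> (forall b y, `|f b y| <= 1) ->
    (forall b x y, `|f b x - f b y| <= N%:R * dclip x y) ->
    `|\int[Pj j]_w \prod_b f b (tnth (X n w) (v b)) -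
      \prod_b \int[P0r (j (v b))]_w f b (R0 w)| <= x by near: n.
have n0 : (0 < n)%N by near: n; exact: nbhs_infty_gt.
have nR : 0 < n%:R :> R by rewrite ltr0n.
have bal1 : balanced del1 j.
  move=> s; have [b1 b2] := bal s; split => [|t].
    by apply: (le_trans b1); rewrite ge_min lexx.
  by apply: (le_trans (b2 t)); rewrite ge_min lexx.
have fr s : `|freq j s - pi_ s| <= x.
  by have [b1 _] := bal s; apply: (le_trans b1); rewrite ge_min lexx orbT.
have [Gam cG costG] := coupling_cost_bound (N := N) n0 isT Pj0.
exists Gam => //; apply: (le_trans costG); rewrite [leRHS]splitr; apply: lerD => //.
have one (b : {ffun 'I_l -> 'I_N.+1}) (s : 'I_K) :
  `|n%:R^-1 * \sum_i (j i == s)%:R * \int[Pj j]_w tent b (tnth (X n w) i) -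
          pi_ s * \int[P0r s]_w tent b (R0 w)| <= x * 2.
  set mu := \int[P0r s]_w tent b (R0 w).
  have mu1 : `|mu| <= 1.
    apply: exp_abs_cst; first exact: (bm_comp (bm_tent b) mR0).
    by move=> w; rewrite ger0_norm ?tent_ge0// tent_le1.
  have one i : `|(j i == s)%:R * (\int[Pj j]_w tent b (tnth (X n w) i) - mu)| <= x.
    have [jis|_] := eqVneq (j i) s; last by rewrite mul0r normr0 ltW.
    rewrite mul1r; have := lim' j bal1 Pj0 (fun _ => i) (fun _ => tent b).
    rewrite big_ord1 jis; under eq_Rintegral do rewrite big_ord1; apply.
    - by move=> a1 a2 _; rewrite [a1]ord1 [a2]ord1.
    - by move=> _; exact: bm_tent.
    - by move=> _ z; rewrite ger0_norm ?tent_ge0// tent_le1.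
    - by move=> _ z z'; exact: tent_lip.
  rewrite (_ : _ - _ = n%:R^-1 * \sum_i (j i == s)%:R * (\int[Pj j]_w tent b (tnth (X n w) i) - mu) +
      (freq j s - pi_ s) * mu); last first.
    under [in RHS]eq_bigr do rewrite mulrBr.
    rewrite sumrB -mulr_suml /freq; ring.
  apply: (le_trans (ler_normD _ _)); rewrite mulr_natr mulr2n; apply: lerD.
    rewrite normrM ger0_norm ?invr_ge0// ler_pdivrMl//.
    apply: (le_trans (ler_norm_sum _ _ _)); rewrite -(sum_ord_const n).
    by apply: ler_sum => i _; exact: one.
  by rewrite normrM; apply: le_trans (fr s); rewrite ler_piMr.
apply: le_trans (hx x (lexx _)).
rewrite -[leRHS]mulrA ler_wpM2l ?mulr_ge0//.
apply: (@le_trans _ _ (\sum_(b : {ffun 'I_l -> 'I_N.+1}) \sum_(s < K) x * 2)).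
  by apply: ler_sum => b _; apply: ler_sum => s _; exact: one.
rewrite pair_bigA/= sumr_const -[leLHS]mulr_natl.
by rewrite [x * 2]mulrC mulrA.
Unshelve. all: by end_near. Qed.

Theorem optimal_couplings : exists Gam : forall n, {ffun 'I_n -> 'I_K} ->
     probability ((V * nat) * (V * nat))%type R,
     (forall n j, (0 < n)%N -> P (label_atom J j) != 0%E -> coupling n j (Gam n j)) /\
     cvg_in_prob P
       (fun n w => \int[Gam n (labels J n w)]_x dist1 x.1.1 x.2.1) 0.
Proof.
have cost0 Gam : 0 <= cost Gam.
  by apply: exp_ge0 => x; apply: sumr_ge0.
have ex n (j : {ffun 'I_n -> 'I_K}) : exists Gam : probability ((V * nat) * (V * nat))%type R,
    (0 < n)%N -> P (label_atom J j) != 0%E ->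
    coupling n j Gam /\ forall Gam', coupling n j Gam' -> cost Gam <= cost Gam' + n.+1%:R^-1.
  have [[n0 Pj0]|nh] := pselect ((0 < n)%N /\ P (label_atom J j) != 0%E); last first.
    pose z : V * nat := ([tuple 0 | _ < l], 0%N).
    by exists (dirac (z, z)) => n0 Pj0; case: nh.
  have [Gam0 cGam0 _] := coupling_cost_bound (N := 1) n0 isT Pj0.
  pose S := [set cost Gam | Gam in [set Gam | coupling n j Gam]].
  have hS : has_inf S.
    split; first by exists (cost Gam0), Gam0.
    by exists 0 => _ [Gam _ <-].
  have [|_ [Gam cGam <-] lt] := inf_adherent (eps := n.+1%:R^-1) _ hS.
    by rewrite invr_gt0.
  exists Gam => _ _; split => // Gam' cGam'; apply: ltW; apply: (lt_le_trans lt).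
  by rewrite lerD2r; apply: ge_inf; [case: hS|exists Gam'].
pose Gam n j := sval (cid (ex n j)).
have GamP n j : (0 < n)%N -> P (label_atom J j) != 0%E ->
    coupling n j (Gam n j) /\ forall Gam', coupling n j Gam' ->
      cost (Gam n j) <= cost Gam' + n.+1%:R^-1.
  exact: (svalP (cid (ex n j))).
exists Gam; split; first by move=> n j n0 Pj0; have [] := GamP n j n0 Pj0.
move=> eps eps0; have eps4 : 0 < eps / 4 by rewrite divr_gt0.
have [del del0 near_cost] := coupling_cost_near eps4.
apply: (label_event_small (phi := fun n j => eps <= `|\int[Gam n j]_x dist1 x.1.1 x.2.1 - 0|)).
exists del => //; near=> n => j bal Pj0.
have n0 : (0 < n)%N by near: n; exact: nbhs_infty_gt.
have nc : forall j : {ffun 'I_n -> 'I_K},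
    balanced del j -> P (label_atom J j) != 0%E ->
    exists2 Gam, coupling n j Gam & cost Gam <= eps / 4 by near: n.
have [Gam' cGam' costG] := nc j bal Pj0.
have [_ /(_ _ cGam') h] := GamP n j n0 Pj0.
have hn : n.+1%:R^-1 < eps / 4 by near: n; exact: (near_infty_natSinv_lt (PosNum eps4)).
apply/negP; rewrite -ltNge subr0 ger0_norm; last exact: cost0.
apply: (le_lt_trans h); apply: (le_lt_trans (lerD costG (ltW hn))); lra.
Unshelve. all: by end_near. Qed.

End Limits.

Theorem theorem3p3 (R : realType) (K l : nat)
  (c d H : R) (kappa : 'I_K -> 'I_K -> R) (pi_ : 'I_K -> R) (theta : nat -> R)
  (F : 'I_K -> probability (l.-tuple R) R)
  (G : 'I_K -> 'I_K -> probability R R)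
  (nu : 'I_K -> R.-pker (l.-tuple R) ~> (l.-tuple R))
  (K_gt0 : (0 < K)%N) (l_gt0 : (0 < l)%N)
  (c01 : 0 <= c <= 1) (d01 : 0 <= d <= 1) (cd01 : 0 < c + d <= 1)
  (d_gt0 : 0 < d) (H_gt0 : 0 < H)
  (kappa_ge0 : forall r s, 0 <= kappa r s)
  (F_cube : forall r, F r cube = 1%E)
  (G_support : forall r s, G r s `[0, H]%classic = 1%E)
  (nu_cube : forall r q, cube q -> nu r q cube = 1%E)
  (theta_gt0 : forall n, 0 < theta n)
  (theta_limsup :
     (limn_esup (fun n =>
        (\big[Num.max/0]_r \big[Num.max/0]_s
           (kappa r s * theta n / n%:R))%:E) <= 1)%E)
  (theta_cvgy : theta @ \oo --> +oo)
  (pi_gt0 : forall r, 0 < pi_ r) (pi_sum1 : \sum_r pi_ r = 1)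
  (* the random graphs and the stationary opinions *)
  (dO : measure_display) (Omega : measurableType dO) (P : probability Omega R)
  (J : forall n, 'I_n -> Omega -> 'I_K)
  (E : forall n, 'I_n -> 'I_n -> {RV P >-> bool})
  (Q : forall n, 'I_n -> {RV P >-> l.-tuple R})
  (B : forall n, 'I_n -> 'I_n -> {RV P >-> R})
  (X : forall n, {RV P >-> n.-tuple (l.-tuple R)})
  (model : network_model kappa theta F G H J E Q B)
  (label_freq : forall r : 'I_K,
     cvg_in_prob P (fun n w => (\sum_(i < n) (J n i w == r)%:R) / n%:R) (pi_ r))
  (stationary : stationary_opinions nu c d J E Q B X)
  (* the limiting variables *)
  (d0 : measure_display) (Omega0 : measurableType d0)
  (P0 : probability Omega0 R)
  (J0 : Omega0 -> 'I_K) (Q0 : {RV P0 >-> l.-tuple R})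
  (Z0 : nat -> {RV P0 >-> l.-tuple R})
  (typical : typical_vertex pi_ F nu J0 Q0 Z0) :
  let R0 := mean_field_opinion kappa pi_ G c d J0 Q0 Z0 in
  (exists Gam : forall n, {ffun 'I_n -> 'I_K} ->
       probability ((l.-tuple R * nat) * (l.-tuple R * nat))%type R,
     (forall n j, (0 < n)%N -> P (label_atom J j) != 0%E ->
        is_coupling J X P0 R0 J0 j (Gam n j)) /\
     cvg_in_prob P
       (fun n w => \int[Gam n (labels J n w)]_x dist1 x.1.1 x.2.1) 0) /\
  (forall f (r : 'I_K), bounded_continuous f ->
     cvg_in_prob P
       (fun n w => n%:R^-1 *
          \sum_(i < n) f (tnth (X n w) i) * (J n i w == r)%:R)
       (\int[P0]_w (f (R0 w) * (J0 w == r)%:R))) /\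
  (forall (m : nat) (r : 'I_m -> 'I_K) (f : 'I_m -> l.-tuple R -> R),
     (0 < m)%N -> (forall a, bounded_continuous (f a)) ->
     forall eps, 0 < eps ->
     (fun n => P [set w | exists i : 'I_m -> 'I_n,
        [/\ injective i, forall a, J n (i a) w = r a &
            eps <= `| condE P (label_atom J (labels J n w))
                        (fun w' => \prod_(a < m) f a (tnth (X n w') (i a)))
                    - \prod_(a < m) condE P0 [set w' | J0 w' = r a]
                                      (fun w' => f a (R0 w')) |]])
       @ \oo --> 0%E).
Proof.
move=> R0.
have [c0 c1] := andP c01; have [d0' d1] := andP d01; have [cd0 cd1] := andP cd01.
split; last split.
- exact: (optimal_couplings model typical K_gt0 pi_gt0 c0 d_gt0 cd1 H_gt0 kappa_ge0 G_support
    nu_cube theta_gt0 theta_limsup theta_cvgy label_freq stationary).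
- move=> f r; exact: (community_averages model typical K_gt0 l_gt0 pi_gt0 c0 d_gt0 cd1 H_gt0 kappa_ge0
    G_support nu_cube theta_gt0 theta_limsup theta_cvgy label_freq stationary).
- move=> m r f _ cf eps eps0.
  exact: (vertices_asymptotically_independent model typical K_gt0 l_gt0 pi_gt0 c0 d_gt0 cd1 H_gt0
    kappa_ge0 G_support nu_cube theta_gt0 theta_limsup theta_cvgy label_freq stationary).
Qed.
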